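(* Let $G$ be a connected reductive complex algebraic group with maximal torus $T$, with simple Lie algebra $\mathfrak{g}$. Fix a choice of positive roots, with half sum $\delta$. Let $\lambda\in X^*(T)$ be a dominant weight such that the irreducible representation $\pi=\pi_\lambda$ of $G$ with highest weight $\lambda$ is orthogonal, and put $$j(\pi)=-\mathrm{ord}_2\left(\frac{\deg\pi_\lambda\,\langle\lambda+2\delta,\lambda\rangle}{4\dim\mathfrak{g}}\right).$$ Then $\pi_\lambda$ is spinorial if and only if $$2^{-j(\pi)}\cdot q_2\in\mathrm{Sym}^2_{\mathbb{Z}}X^*(T).$$
   Context: Representations are finite-dimensional, complex and algebraic; $\deg\pi$ is the dimension of $\pi$. A representation $(\pi,V)$ is orthogonal if $V$ has a $G$-invariant nondegenerate symmetric bilinear form; since $G$ is connected, then $\pi:G\to SO(V)$, and $\pi$ is called spinorial if it lifts to the double cover $\mathrm{Spin}(V)\to SO(V)$. $\mathfrak{t}$ is the Lie algebra of $T$; $X^*(T)$ (the algebraic characters of $T$) is embedded in $\mathfrak{t}^*$ by differentiation, so $\mathrm{Sym}^2_{\mathbb{Z}}X^*(T)\subset\mathrm{Sym}^2_{\mathbb{C}}(\mathfrak{t}^* )$. $K$ is the Killing form on $\mathfrak{t}$, and $q_2\in\mathrm{Sym}^2_{\mathbb{C}}(\mathfrak{t}^* )$ is $q_2(\nu)=K(\nu,\nu)$, i.e. $q_2=\sum_\alpha\alpha^2$ over all roots $\alpha$. In the formula for $j(\pi)$, the pairing $\langle\cdot,\cdot\rangle$ on $\mathfrak{t}^*$ is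 the inverse form $K^\vee$ of $K$, defined by $K^\vee(\sigma(\nu),\sigma(\nu'))=K(\nu,\nu')$, where $\sigma:\mathfrak{t}\to\mathfrak{t}^*$ is the isomorphism with $\sigma(\nu)(\nu')=K(\nu,\nu')$; so $\langle\lambda+2\delta,\lambda\rangle=|\lambda+\delta|^2-|\delta|^2$, with $|\mu|^2=K^\vee(\mu,\mu)$. This number is rational, and $\mathrm{ord}_2$ is the $2$-adic valuation on $\mathbb{Q}$. *)

(* Defs.v *)
(* MathComp world; the complex numbers are R[i] for R : realType. *)
From mathcomp Require Import all_boot all_order all_algebra all_field.
From mathcomp Require Import classical_sets reals complex mpoly.

Set Implicit Arguments.
Unset Strict Implicit.
Unset Printing Implicit Defensive.

Import Order.TTheory GRing.Theory Num.Theory.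
Local Open Scope ring_scope.
Local Open Scope classical_set_scope.

(* An affine algebraic group over C is a Zariski closed subgroup of some GL_n.
   Subsets of GL_n are classical sets of n x n matrices, and polynomials in
   the matrix entries are n-by-n-variate mpoly's through mxvec. *)

Section AlgebraicGroups.
Variable R : realType.
Local Notation C := (R[i]).

Definition mxeval n (p : {mpoly C[n * n]}) (g : 'M[C]_n) : C :=
  p.@[fun k => mxvec g ord0 k].

(* the differential of p at the identity matrix, in the direction X *)
Definition mxdiff1 n (p : {mpoly C[n * n]}) (X : 'M[C]_n) : C :=
  \sum_(k < n * n) mxeval p^`M(k) 1%:M * mxvec X ord0 k.

Definition GL n : set 'M[C]_n := [set g | g \in unitmx].

Definition zariski_closed n (S : set 'M[C]_n) : Prop :=
  exists I : set {mpoly C[n * n]},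
    S = [set g | GL g /\ forall p, I p -> mxeval p g = 0].

Definition zariski_connected n (S : set 'M[C]_n) : Prop :=
  forall A B : set 'M[C]_n, zariski_closed A -> zariski_closed B ->
    S `<=` A `|` B -> S `&` A `&` B = set0 -> S `<=` A \/ S `<=` B.

Definition algebraic_group n (G : set 'M[C]_n) : Prop :=
  [/\ zariski_closed G, G 1%:M, forall g h, G g -> G h -> G (g *m h)
    & forall g, G g -> G (invmx g)].

Definition regular n (G : set 'M[C]_n) (f : 'M[C]_n -> C) : Prop :=
  exists (p : {mpoly C[n * n]}) (k : nat),
    forall g, G g -> f g = mxeval p g / \det g ^+ k.

(* Only the restriction of f to G is meaningful. *)
Definition algebraic_morphism n m (G : set 'M[C]_n) (H : set 'M[C]_m)
    (f : 'M[C]_n -> 'M[C]_m) : Prop :=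
  [/\ forall g, G g -> H (f g),
      forall g h, G g -> G h -> f (g *m h) = f g *m f h
    & forall i j, regular G (fun g => f g i j)].

Definition unipotent n (U : set 'M[C]_n) : Prop :=
  forall u, U u -> exists k, (u - 1%:M) ^+ k = 0.

Definition normal_in n (G U : set 'M[C]_n) : Prop :=
  U `<=` G /\ forall g u, G g -> U u -> U (g *m u *m invmx g).

(* algebraic, with trivial unipotent radical *)
Definition reductive n (G : set 'M[C]_n) : Prop :=
  algebraic_group G /\
  forall U : set 'M[C]_n, algebraic_group U -> zariski_connected U ->
    unipotent U -> normal_in G U -> U = [set 1%:M].

Definition diag_group r : set 'M[C]_r := [set d | GL d /\ is_diag_mx d].

Definition torus n (T : set 'M[C]_n) : Prop :=
  algebraic_group T /\
  exists r (f : 'M[C]_r -> 'M[C]_n) (h : 'M[C]_n -> 'M[C]_r),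
    [/\ algebraic_morphism (@diag_group r) T f,
        algebraic_morphism T (@diag_group r) h,
        forall d, diag_group d -> h (f d) = d
      & forall x, T x -> f (h x) = x].

Definition maximal_torus n (G T : set 'M[C]_n) : Prop :=
  [/\ torus T, T `<=` G
    & forall T' : set 'M[C]_n, torus T' -> T' `<=` G -> T `<=` T' -> T' = T].

(* The Lie algebra is the Zariski tangent space at the identity. *)
Definition is_lie_algebra n (G : set 'M[C]_n) (g : {vspace 'M[C]_n}) : Prop :=
  forall X, X \in g <->
    forall p, (forall x, G x -> mxeval p x = 0) -> mxdiff1 p X = 0.

Definition bracket n (X Y : 'M[C]_n) : 'M[C]_n := X *m Y - Y *m X.

Definition simple_lie_algebra n (g : {vspace 'M[C]_n}) : Prop :=
  (exists X Y, [/\ X \in g, Y \in g & bracket X Y != 0]) /\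
  forall a : {vspace 'M[C]_n}, (a <= g)%VS ->
    (forall X Y, X \in g -> Y \in a -> bracket X Y \in a) ->
    a = 0%VS \/ a = g.

(* trace of ad X \o ad Y on g, for X and Y in g *)
Definition killing n (g : {vspace 'M[C]_n}) (X Y : 'M[C]_n) : C :=
  \sum_(i < \dim g)
    coord (vbasis g) i (bracket X (bracket Y (vbasis g)`_i)).

End AlgebraicGroups.

Section Weights.
Variables (R : realType) (n : nat).
Local Notation C := (R[i]).

Definition dual (t : {vspace 'M[C]_n}) := 'Hom(subvs_of t, C^o).

(* chi is an algebraic character of T, with differential mu.  If chi = p/det^k
   on T then p(1) = 1, and the differential of p/det^k at 1 is dp - k tr;
   its restriction to t depends only on the restriction of p/det^k to T. *)
Definition char_diff (T : set 'M[C]_n) (t : {vspace 'M[C]_n})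
    (chi : 'M[C]_n -> C) (mu : dual t) : Prop :=
  [/\ forall x, T x -> chi x != 0,
      forall x y, T x -> T y -> chi (x *m y) = chi x * chi y
    & exists (p : {mpoly C[n * n]}) (k : nat),
        (forall x, T x -> chi x = mxeval p x / \det x ^+ k) /\
        forall nu : subvs_of t,
          mu nu = mxdiff1 p (vsval nu) - k%:R * \tr (vsval nu)].

(* X^*(T), embedded in the dual of t by differentiation *)
Definition char_lattice (T : set 'M[C]_n) (t : {vspace 'M[C]_n}) :
    set (dual t) :=
  [set mu | exists chi, char_diff T chi mu].

(* The complex symmetric square of t^* is identified with the quadratic
   functions on t; as the integral symmetric square is generated by products
   and X^*(T) is closed under opposite, its elements are finite sums of
   products. *)
Definition in_sym2_lattice (T : set 'M[C]_n) (t : {vspace 'M[C]_n})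
    (q : subvs_of t -> C) : Prop :=
  exists s : seq (dual t * dual t),
    (forall ab, ab \in s -> char_lattice T ab.1 /\ char_lattice T ab.2) /\
    forall nu, q nu = \sum_(ab <- s) (ab.1 nu : C) * (ab.2 nu : C).

Definition is_root (g t : {vspace 'M[C]_n}) (a : dual t) : Prop :=
  a != 0 /\
  exists X, [/\ X \in g, X != 0
    & forall nu : subvs_of t, bracket (vsval nu) X = (a nu : C) *: X].

Definition positive_system (g t : {vspace 'M[C]_n}) (P : seq (dual t)) :
    Prop :=
  [/\ uniq P,
      forall a, a \in P -> is_root g a,
      forall a, is_root g a -> (a \in P) (+) (- a \in P)
    & forall a b, a \in P -> b \in P -> is_root g (a + b) -> a + b \in P].

Definition half_sum (t : {vspace 'M[C]_n}) (P : seq (dual t)) : dual t :=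
  2^-1 *: \sum_(a <- P) a.

(* the isomorphism from t to its dual given by the Killing form of g *)
Definition killing_iso (g t : {vspace 'M[C]_n}) :
    'Hom(subvs_of t, dual t) :=
  linfun (fun nu : subvs_of t =>
    linfun (fun nu' : subvs_of t => killing g (vsval nu) (vsval nu') : C^o)
    : dual t).

Definition killing_dual (g t : {vspace 'M[C]_n}) (a b : dual t) : C :=
  killing g (vsval ((killing_iso g t)^-1%VF a))
            (vsval ((killing_iso g t)^-1%VF b)).

Definition killing_quadratic (g t : {vspace 'M[C]_n}) (nu : subvs_of t) : C :=
  killing g (vsval nu) (vsval nu).

Definition dominant (g t : {vspace 'M[C]_n}) (P : seq (dual t))
    (la : dual t) : Prop :=
  forall a, a \in P ->
    0 <= 2 * killing_dual g la a / killing_dual g a a.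

End Weights.

Section Representations.
Variables (R : realType) (n m : nat).
Local Notation C := (R[i]).

Definition representation (G : set 'M[C]_n) (pi : 'M[C]_n -> 'M[C]_m) : Prop :=
  algebraic_morphism G (@GL R m) pi.

Definition irreducible (G : set 'M[C]_n) (pi : 'M[C]_n -> 'M[C]_m) : Prop :=
  (0 < m)%N /\
  forall U : {vspace 'cV[C]_m},
    (forall x v, G x -> v \in U -> pi x *m v \in U) ->
    U = 0%VS \/ U = fullv.

Definition is_weight (T : set 'M[C]_n) (t : {vspace 'M[C]_n})
    (pi : 'M[C]_n -> 'M[C]_m) (mu : dual t) : Prop :=
  exists chi, char_diff T chi mu /\
  exists v : 'cV[C]_m, v != 0 /\ forall x, T x -> pi x *m v = chi x *: v.

Definition highest_weight (T : set 'M[C]_n) (t : {vspace 'M[C]_n})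
    (P : seq (dual t)) (pi : 'M[C]_n -> 'M[C]_m) (la : dual t) : Prop :=
  is_weight T pi la /\
  forall mu, is_weight T pi mu ->
    exists c : dual t -> nat, la - mu = \sum_(a <- P) a *+ c a.

(* B is the Gram matrix of the bilinear form on C^m *)
Definition invariant_form (G : set 'M[C]_n) (pi : 'M[C]_n -> 'M[C]_m)
    (B : 'M[C]_m) : Prop :=
  [/\ B^T = B, B \in unitmx
    & forall x, G x -> (pi x)^T *m B *m pi x = B].

End Representations.

Section Spin.
Variables (R : realType) (m : nat).
Local Notation C := (R[i]).

Definition quad (B : 'M[C]_m) (v : 'cV[C]_m) : C :=
  (v^T *m B *m v) ord0 ord0.

(* universal property of the Clifford algebra, with v * v = B(v, v) *)
Definition is_clifford_algebra (B : 'M[C]_m) (A : falgType C)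
    (iota : {linear 'cV[C]_m -> A}) : Prop :=
  (forall v, iota v * iota v = (quad B v)%:A) /\
  forall (A' : algType C) (f : {linear 'cV[C]_m -> A'}),
    (forall v, f v * f v = (quad B v)%:A) ->
    exists F : {lrmorphism A -> A'},
      (forall v, F (iota v) = f v) /\
      forall F' : {lrmorphism A -> A'},
        (forall v, F' (iota v) = f v) -> F' =1 F.

(* products of an even number of unit vectors *)
Definition spin_group (B : 'M[C]_m) (A : falgType C)
    (iota : {linear 'cV[C]_m -> A}) : set A :=
  [set x | exists s : seq 'cV[C]_m,
     [/\ ~~ odd (size s), forall v, v \in s -> quad B v = 1
       & x = \prod_(v <- s) iota v]].

(* The double cover Spin(V) -> SO(V) sends x to its conjugation action on V;
   the lift rho is a morphism of algebraic groups. *)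
Definition spinorial n (G : set 'M[C]_n) (pi : 'M[C]_n -> 'M[C]_m)
    (B : 'M[C]_m) : Prop :=
  exists (A : falgType C) (iota : {linear 'cV[C]_m -> A}),
    is_clifford_algebra B iota /\
    exists rho : 'M[C]_n -> A,
      [/\ forall x, G x -> spin_group B iota (rho x),
          forall x y, G x -> G y -> rho (x *m y) = rho x * rho y,
          forall i, regular G (fun x => coord (vbasis {:A}) i (rho x))
        & forall x v, G x ->
            rho x * iota v * (rho x)^-1 = iota (pi x *m v)].

End Spin.

Section TwoAdic.
Variable R : realType.
Local Notation C := (R[i]).

Definition ord2_rat (q : rat) : int :=
  (logn 2 `|numq q|)%:Z - (logn 2 `|denq q|)%:Z.

(* the 2-adic valuation of a rational complex number; the value is 0 at 0
   and outside of Q *)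
Definition ord2 (z : C) : int := ord2_rat (xget 0 [set q : rat | ratr q = z]).

Definition spin_exponent n (g t : {vspace 'M[C]_n}) (P : seq (dual t))
    (m : nat) (la : dual t) : int :=
  - ord2 (m%:R * killing_dual g (la + 2 *: half_sum P) la
          / (4 * (\dim g)%:R)).

End TwoAdic.

(* Main.v *)
Require Import Defs.
From HB Require Import structures.
From mathcomp Require Import all_boot all_order all_algebra all_field.
From mathcomp Require Import boolp classical_sets reals complex mpoly.
From mathcomp Require Import ring lra zify.

Set Implicit Arguments.
Unset Strict Implicit.
Unset Printing Implicit Defensive.

Import Order.TTheory GRing.Theory Num.Theory.
Local Open Scope ring_scope.

(* Let c be the constant with tr (dpi X dpi Y) = c K(X, Y) on g.  The Casimir
   element acts on pi by the scalar <la + 2 delta, la>, so that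
   deg pi * <la + 2 delta, la> = c * dim g, and the number under ord_2 is c / 4.
   On the other hand pi lifts to the spin group iff the half sum of its weights
   that are positive on a generic cocharacter is a character of T.  Pairing with
   a cocharacter v and using s^2 = s mod 2, this says that the number
   tr (dpi(v)^2) / 4 = (c / 4) K(v, v) is an integer for all v.  As c K(v, v) is
   always an integer, only the power of 2 in c / 4 matters; and a quadratic form
   that is integral on the cocharacters is an element of Sym^2 X^*(T).

   The lift is constructed algebraically.  Let E be, in the Clifford algebra,
   the projector on the lowest weight line of the spin module.  A sum over the
   monomials e_s of the Clifford algebra, of the form
   R(x) = sum_s theta_x(e_s E) e_s^-1, where theta_x is the automorphism induced
   by pi(x), is polynomial in x and equal to f(x) S for S above pi(x), where f(x)
   is up to a constant the matrix coefficient of S^-1 at the lowest weight vector.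
   If the weight of this line is a character, its opposite is the weight of
   a quotient a / b of products of principal minors of x, which coincides with f
   on the big cell; then b R is divisible by a and the quotient is the lift.
   All divisions and identities on G are obtained from uniqueness theorems for
   differential equations along g, which in turn rest on Cartier's theorem
   (algebraic groups are reduced) in the form: a function all of whose jets along
   g vanish at 1 vanishes on the connected group G. *)

(** * Polynomial maps and their derivatives *)

(** A perfect Lie algebra forces G into SL_n, so regular functions, inverses and representations
    become polynomial in the matrix entries; this is why the proof works with polynomial maps on all
    matrices and with identities that hold on G. The non-degeneracy of the Killing form does not
    come from Cartan's criterion. The weights of ad are integral, so the form is positive on real
    combinations of cocharacters, and its radical, an ideal, could be all of g only if t were 0.
    Engel's theorem excludes this, because an element commuting with t is an element of t plus a
    nilpotent one. That fact is where the maximality of T enters, through a Jordan decomposition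
    inside g. For the lift, the obstacle is a sign: an element S of the spin group above pi(x) is
    determined only up to sign. An expression quadratic in S is well defined; dividing it by a
    matrix coefficient of S^-1 fixes the sign, and this coefficient is single-valued exactly when
    its weight is a character. *)

Section PolynomialMaps.
Variable C : numClosedFieldType.

Lemma poly_eq0_nz (p : {poly C}) : (forall x, x != 0 -> p.[x] = 0) -> p = 0.
Proof.
move=> p0; apply/eqP/negPn/negP => nzp.
have u : uniq [seq i.+1%:R : C | i <- iota 0 (size p)].
  by rewrite map_inj_uniq ?iota_uniq // => i j /eqP; rewrite eqr_nat => /eqP [].
have /(max_poly_roots nzp)/(_ u) : all (root p) [seq i.+1%:R : C | i <- iota 0 (size p)].
  by apply/allP => x /mapP [i _ ->]; apply/eqP/p0; rewrite pnatr_eq0.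
by rewrite size_map size_iota ltnn.
Qed.

Lemma poly_eq_nz (p q : {poly C}) : (forall x, x != 0 -> p.[x] = q.[x]) -> p = q.
Proof.
move=> pq; apply/eqP; rewrite -subr_eq0; apply/eqP/poly_eq0_nz => x x0.
by rewrite hornerD hornerN pq // subrr.
Qed.

(** Only nonzero arguments are tested, so that coefficients can also be compared in identities that
    hold on the multiplicative group alone. *)
Lemma vect_poly_eq0 (W : vectType C) d (c : nat -> W) :
  (forall e : C, e != 0 -> \sum_(k < d) e ^+ k *: c k = 0) ->
  forall k, (k < d)%N -> c k = 0.
Proof.
move=> H k kd; rewrite (coord_vbasis (memvf (c k))); apply: big1 => i _.
suff -> : coord (vbasis {:W}) i (c k) = 0 by rewrite scale0r.
have : \poly_(k < d) coord (vbasis {:W}) i (c k) = 0.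
  apply: poly_eq0_nz => e /H /(congr1 (coord (vbasis {:W}) i)).
  rewrite linear_sum linear0 horner_poly => E; rewrite -[RHS]E.
  by apply: eq_bigr => j _; rewrite linearZ /= mulrC.
by move/(congr1 (fun p : {poly C} => p`_k)); rewrite coef_poly kd coef0.
Qed.

Lemma sum_widen (W : vectType C) D D' (e : C) (F : nat -> W) : (D <= D')%N ->
  \sum_(k < D') e ^+ k *: (if (k < D)%N then F k else 0)
    = \sum_(k < D) e ^+ k *: F k.
Proof.
move=> leD; rewrite (big_ord_widen D' (fun k => e ^+ k *: F k) leD) [RHS]big_mkcond /=.
by apply: eq_bigr => k _; case: ifP => //; rewrite scaler0.
Qed.

Section Definitions.
Variables (n : nat) (W : vectType C).

(** A predicate on functions with values in any [vectType]: it serves scalars, matrices and the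
    Clifford algebra alike, and most properties follow by induction on it. *)
Inductive polymap : ('M[C]_n -> W) -> Prop :=
| PolyCst w : polymap (fun _ => w)
| PolyEnt i j f : polymap f -> polymap (fun x => x i j *: f x)
| PolyAdd f g : polymap f -> polymap g -> polymap (fun x => f x + g x).

(** A polynomial expansion on the line through [x] with direction [v]; the length [d.+2] keeps the
    index 1 of the linear coefficient in range. *)
Definition taylor1 (f : 'M[C]_n -> W) x v w := exists d (c : nat -> W),
  (forall e : C, f (x + e *: v) = \sum_(k < d.+2) e ^+ k *: c k) /\ c 1%N = w.

Definition der f x v : W := xget 0 (taylor1 f x v : set W).

(** [DX X] differentiates along the left-invariant field of [X], and [LX X] along the
    right-invariant one. They agree at the identity. *)
Definition DX X f : 'M[C]_n -> W := fun x => der f x (x *m X).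
Definition LX X f : 'M[C]_n -> W := fun x => der f x (X *m x).

End Definitions.

Section Calculus.
Variable n : nat.
Implicit Types (W : vectType C) (x v X : 'M[C]_n).

Lemma polymap_ext W (f g : 'M[C]_n -> W) : f =1 g -> polymap f -> polymap g.
Proof. by move=> /funext ->. Qed.

Lemma der_ext W (f g : 'M[C]_n -> W) x v : f =1 g -> der f x v = der g x v.
Proof. by move=> /funext ->. Qed.

Lemma derE W (f : 'M[C]_n -> W) x v w : taylor1 f x v w -> der f x v = w.
Proof.
move=> tw; rewrite /der; case: xgetP => [w' _ tw'|]; last by move/(_ w).
case: tw tw' => d [c [Hc <-]] [d' [c' [Hc' <-]]].
pose b k := (if (k < d'.+2)%N then c' k else 0) - (if (k < d.+2)%N then c k else 0).
suff /(_ 1%N) : forall k, (k < (d + d').+2)%N -> b k = 0.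
  by rewrite /b /= => /(_ isT)/eqP; rewrite subr_eq0 => /eqP.
apply: vect_poly_eq0 => e _.
under eq_bigr do rewrite /b scalerBr.
rewrite sumrB !sum_widen ?ltnS ?leq_addl ?leq_addr //.
by rewrite -Hc -Hc' subrr.
Qed.

Lemma taylor1_cst W (w : W) x v : taylor1 (fun _ => w) x v 0.
Proof.
exists 0%N, (fun k => if k == 0%N then w else 0); split=> // e.
by rewrite big_ord_recl big_ord1 /= expr0 scale1r scaler0 addr0.
Qed.

Lemma taylor1_add W (f g : 'M[C]_n -> W) x v a b :
  taylor1 f x v a -> taylor1 g x v b -> taylor1 (fun x => f x + g x) x v (a + b).
Proof.
move=> [d [c [Hc <-]]] [d' [c' [Hc' <-]]].
exists (d + d')%N, (fun k => (if (k < d.+2)%N then c k else 0) + (if (k < d'.+2)%N then c' k else 0)).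
split=> // e; rewrite Hc Hc'; under [RHS]eq_bigr do rewrite scalerDr.
by rewrite big_split /= !sum_widen ?ltnS ?leq_addl ?leq_addr.
Qed.

Lemma taylor1_ent W (f : 'M[C]_n -> W) i j x v a : taylor1 f x v a ->
  taylor1 (fun x => x i j *: f x) x v (v i j *: f x + x i j *: a).
Proof.
move=> [d [c [Hc <-]]].
have fx : f x = c 0%N.
  have := Hc 0; rewrite scale0r addr0 => ->; rewrite big_ord_recl /= scale1r.
  by rewrite big1 ?addr0 // => k _; rewrite expr0n scale0r.
exists d.+1, (fun k => (if (k < d.+2)%N then x i j *: c k else 0) +
  if k is k'.+1 then v i j *: c k' else 0); split; last by rewrite /= fx addrC.
move=> e; rewrite !mxE Hc; under [RHS]eq_bigr do rewrite scalerDr.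
rewrite big_split /= scalerDl; congr (_ + _).
  rewrite [RHS]big_ord_recr /= ltnn scaler0 addr0 scaler_sumr.
  by apply: eq_bigr => k _; rewrite ltn_ord !scalerA mulrC.
rewrite [RHS]big_ord_recl /= scaler0 add0r scaler_sumr; apply: eq_bigr => k _.
by rewrite /bump /= add1n exprS !scalerA; congr (_ *: _); ring.
Qed.

Lemma polymap_taylor1 W (f : 'M[C]_n -> W) x v :
  polymap f -> exists w, taylor1 f x v w.
Proof.
elim=> [w|i j g _ [w Hw]|g h _ [a Ha] _ [b Hb]].
- by exists 0; apply: taylor1_cst.
- by eexists; apply: taylor1_ent Hw.
- by eexists; apply: taylor1_add Ha Hb.
Qed.

Lemma derP W (f : 'M[C]_n -> W) x v : polymap f -> taylor1 f x v (der f x v).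
Proof. by move/(polymap_taylor1 x v) => [w Hw]; rewrite (derE Hw). Qed.

Lemma der_cst W (w : W) x v : der (fun _ => w) x v = 0.
Proof. exact/derE/taylor1_cst. Qed.

Lemma der_add W (f g : 'M[C]_n -> W) x v : polymap f -> polymap g ->
  der (fun x => f x + g x) x v = der f x v + der g x v.
Proof. by move=> pf pg; apply/derE/taylor1_add; apply: derP. Qed.

Lemma der_ent W (f : 'M[C]_n -> W) i j x v : polymap f ->
  der (fun x => x i j *: f x) x v = v i j *: f x + x i j *: der f x v.
Proof. by move=> pf; apply/derE/taylor1_ent/derP. Qed.

Lemma der_poly (f : 'M[C]_n -> C^o) x v (p : {poly C}) :
  (forall e : C, f (x + e *: v) = p.[e]) -> der f x v = p`_1.
Proof.
move=> Hp; apply: derE; exists (size p), (fun k => p`_k); split=> // e.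
rewrite Hp (@horner_coef_wide _ (size p).+2) ?leqW //.
by apply: eq_bigr => k _; rewrite mulrC.
Qed.

Lemma linear_hyp0 W W' (L : W -> W') : linear L -> L 0 = 0.
Proof. by move=> linL; have := linL (-1) 0 0; rewrite scaler0 addr0 scaleN1r addNr. Qed.

Lemma linear_hypD W W' (L : W -> W') : linear L -> forall u w, L (u + w) = L u + L w.
Proof. by move=> linL u w; have := linL 1 u w; rewrite !scale1r. Qed.

Lemma linear_hypZ W W' (L : W -> W') : linear L -> forall a u, L (a *: u) = a *: L u.
Proof. by move=> linL a u; rewrite -[a *: u]addr0 linL linear_hyp0 // addr0. Qed.

Lemma polymap_linear W W' (L : W -> W') (f : 'M[C]_n -> W) : linear L ->
  polymap f -> polymap (fun x => L (f x)).
Proof.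
move=> linL; elim=> [w|i j g _ H|g h _ Hg _ Hh]; first exact: PolyCst.
- by apply: polymap_ext (PolyEnt i j H) => x; rewrite linear_hypZ.
- by apply: polymap_ext (PolyAdd Hg Hh) => x; rewrite linear_hypD.
Qed.

Lemma der_linear W W' (L : W -> W') (f : 'M[C]_n -> W) x v : linear L ->
  polymap f -> der (fun x => L (f x)) x v = L (der f x v).
Proof.
move=> linL pf; elim: pf x v => [w|i j g pg H|g h pg Hg ph Hh] x v.
- by rewrite !der_cst linear_hyp0.
- rewrite (der_ext _ _ (fun y => linear_hypZ linL (y i j) (g y))).
  by rewrite !der_ent ?H ?(linear_hypD linL) ?(linear_hypZ linL) //; apply: polymap_linear.
- rewrite (der_ext _ _ (fun y => linear_hypD linL (g y) (h y))).
  by rewrite !der_add ?Hg ?Hh ?(linear_hypD linL) //; apply: polymap_linear.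
Qed.

Lemma polymap_bilin W1 W2 W3 (b : W1 -> W2 -> W3) (f : 'M[C]_n -> W1) g :
  (forall w, linear (b w)) -> (forall w, linear (b^~ w)) ->
  polymap f -> polymap g -> polymap (fun x => b (f x) (g x)).
Proof.
move=> bl br pf pg; elim: pf => [w|i j h _ H|h k _ Hh _ Hk].
- exact: polymap_linear.
- by apply: polymap_ext (PolyEnt i j H) => x; rewrite (linear_hypZ (br _)).
- by apply: polymap_ext (PolyAdd Hh Hk) => x; rewrite (linear_hypD (br _)).
Qed.

Lemma der_bilin W1 W2 W3 (b : W1 -> W2 -> W3) (f : 'M[C]_n -> W1) g x v :
  (forall w, linear (b w)) -> (forall w, linear (b^~ w)) ->
  polymap f -> polymap g ->
  der (fun x => b (f x) (g x)) x v = b (der f x v) (g x) + b (f x) (der g x v).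
Proof.
move=> bl br pf pg; elim: pf => [w|i j h ph H|h k ph Hh pk Hk].
- by rewrite (der_linear _ _ (bl w)) // der_cst (linear_hyp0 (br _)) add0r.
- rewrite (der_ext _ _ (fun y => linear_hypZ (br (g y)) (y i j) (h y))).
  rewrite !der_ent ?H ?(linear_hypD (br _)) ?(linear_hypZ (br _)) ?scalerDr ?addrA //.
  exact: polymap_bilin.
- rewrite (der_ext _ _ (fun y => linear_hypD (br (g y)) (h y) (k y))).
  rewrite !der_add ?Hh ?Hk ?(linear_hypD (br _)) //; try exact: polymap_bilin.
  by rewrite addrACA.
Qed.

Lemma scale_linear_r W (a : C) : linear (fun w : W => a *: w).
Proof. by move=> b u v; rewrite scalerDr !scalerA mulrC. Qed.

Lemma scale_linear_l W (w : W) : linear (fun a : C^o => (a : C) *: w).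
Proof. by move=> b u v; rewrite scalerDl -scalerA. Qed.

Lemma polymap_scale W (f : 'M[C]_n -> C^o) (g : 'M[C]_n -> W) :
  polymap f -> polymap g -> polymap (fun x => (f x : C) *: g x).
Proof.
apply: (@polymap_bilin C^o W W (fun a w => (a : C) *: w)); first exact: scale_linear_r.
exact: scale_linear_l.
Qed.

Lemma der_scale W (f : 'M[C]_n -> C^o) (g : 'M[C]_n -> W) x v :
  polymap f -> polymap g ->
  der (fun x => (f x : C) *: g x) x v = (der f x v : C) *: g x + (f x : C) *: der g x v.
Proof.
apply: (@der_bilin C^o W W (fun a w => (a : C) *: w)); first exact: scale_linear_r.
exact: scale_linear_l.
Qed.

Lemma polymap_mul (f g : 'M[C]_n -> C^o) :
  polymap f -> polymap g -> polymap (fun x => f x * g x : C^o).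
Proof. exact: polymap_scale. Qed.

Lemma der_mul (f g : 'M[C]_n -> C^o) x v : polymap f -> polymap g ->
  der (fun x => f x * g x : C^o) x v = der f x v * g x + f x * der g x v.
Proof. exact: der_scale. Qed.

Lemma polymap_mulmx m p q (f : 'M[C]_n -> 'M[C]_(m, p)) (g : 'M[C]_n -> 'M[C]_(p, q)) :
  polymap f -> polymap g -> polymap (fun x => f x *m g x).
Proof.
apply: (@polymap_bilin _ _ _ mulmx) => w a u v.
  by rewrite mulmxDr scalemxAr.
by rewrite mulmxDl scalemxAl.
Qed.

Lemma der_mulmx m p q (f : 'M[C]_n -> 'M[C]_(m, p)) (g : 'M[C]_n -> 'M[C]_(p, q)) x v :
  polymap f -> polymap g ->
  der (fun x => f x *m g x) x v = der f x v *m g x + f x *m der g x v.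
Proof.
apply: (@der_bilin _ _ _ mulmx) => w a u v'.
  by rewrite mulmxDr scalemxAr.
by rewrite mulmxDl scalemxAl.
Qed.

Lemma polymap_mulA (A : falgType C) (f g : 'M[C]_n -> A) :
  polymap f -> polymap g -> polymap (fun x => f x * g x).
Proof.
apply: (@polymap_bilin A A A *%R) => w a u v; first by rewrite mulrDr scalerAr.
by rewrite mulrDl scalerAl.
Qed.

Lemma der_mulA (A : falgType C) (f g : 'M[C]_n -> A) x v : polymap f -> polymap g ->
  der (fun x => f x * g x) x v = der f x v * g x + f x * der g x v.
Proof.
apply: (@der_bilin A A A *%R) => w a u v'; first by rewrite mulrDr scalerAr.
by rewrite mulrDl scalerAl.
Qed.

Lemma polymap_opp W (f : 'M[C]_n -> W) : polymap f -> polymap (fun x => - f x).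
Proof. by apply: (polymap_linear (L := -%R)) => a u v; rewrite opprD scalerN. Qed.

Lemma der_opp W (f : 'M[C]_n -> W) x v : polymap f -> der (fun x => - f x) x v = - der f x v.
Proof. by apply: (der_linear _ _ (L := -%R)) => a u w; rewrite opprD scalerN. Qed.

Lemma polymap_sub W (f g : 'M[C]_n -> W) :
  polymap f -> polymap g -> polymap (fun x => f x - g x).
Proof. by move=> pf pg; apply: PolyAdd => //; apply: polymap_opp. Qed.

Lemma der_sub W (f g : 'M[C]_n -> W) x v : polymap f -> polymap g ->
  der (fun x => f x - g x) x v = der f x v - der g x v.
Proof. by move=> pf pg; rewrite der_add ?der_opp //; apply: polymap_opp. Qed.

Lemma polymap_scalec W a (f : 'M[C]_n -> W) : polymap f -> polymap (fun x => a *: f x).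
Proof. by apply: (polymap_linear (L := *:%R a)) => b u v; rewrite scalerDr !scalerA mulrC. Qed.

Lemma der_scalec W a (f : 'M[C]_n -> W) x v : polymap f ->
  der (fun x => a *: f x) x v = a *: der f x v.
Proof. by apply: (der_linear _ _ (L := *:%R a)) => b u w; rewrite scalerDr !scalerA mulrC. Qed.

Lemma polymap_sum W (I : Type) (r : seq I) (F : I -> 'M[C]_n -> W) :
  (forall i, polymap (F i)) -> polymap (fun x => \sum_(i <- r) F i x).
Proof.
move=> pF; elim: r => [|i r IH].
  by apply: polymap_ext (PolyCst _ 0) => x; rewrite big_nil.
by apply: polymap_ext (PolyAdd (pF i) IH) => x; rewrite big_cons.
Qed.

Lemma der_sum W (I : Type) (r : seq I) (F : I -> 'M[C]_n -> W) x v :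
  (forall i, polymap (F i)) ->
  der (fun x => \sum_(i <- r) F i x) x v = \sum_(i <- r) der (F i) x v.
Proof.
move=> pF; elim: r => [|i r IH].
  rewrite big_nil (@der_ext _ _ (fun _ => 0)) ?der_cst // => y.
  by rewrite big_nil.
rewrite big_cons -IH -der_add //; last exact: polymap_sum.
by apply: der_ext => y; rewrite big_cons.
Qed.

Lemma scaler1_regular (a : C) : a *: (1 : C^o) = a.
Proof. exact: mulr1. Qed.

Lemma polymap_entry i j : polymap (fun x : 'M[C]_n => x i j : C^o).
Proof.
by apply: polymap_ext (PolyEnt i j (PolyCst n (1 : C^o))) => x; rewrite scaler1_regular.
Qed.

Lemma der_entry i j x v : der (fun x : 'M[C]_n => x i j : C^o) x v = v i j.
Proof.
rewrite (@der_ext _ _ (fun x : 'M[C]_n => x i j *: (1 : C^o))); last first.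
  by move=> y; rewrite scaler1_regular.
by rewrite der_ent ?der_cst ?scaler0 ?addr0 ?scaler1_regular //; apply: PolyCst.
Qed.

Lemma polymap_of_linear W (L : 'M[C]_n -> W) : linear L -> polymap L.
Proof.
move=> linL; suff : polymap (fun x : 'M[C]_n => \sum_i \sum_j x i j *: L (delta_mx i j)).
  apply: polymap_ext => x; rewrite [in RHS](matrix_sum_delta x).
  have LS (I : finType) (F : I -> 'M[C]_n) : L (\sum_i F i) = \sum_i L (F i).
    by apply: (big_morph L (linear_hypD linL) (linear_hyp0 linL)).
  by rewrite LS; apply: eq_bigr => i _; rewrite LS; apply: eq_bigr => j _; rewrite linear_hypZ.
by apply: polymap_sum => i; apply: polymap_sum => j; apply/PolyEnt/PolyCst.
Qed.

Lemma der_of_linear W (L : 'M[C]_n -> W) x v : linear L -> der L x v = L v.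
Proof.
move=> linL; apply: derE; exists 0%N, (fun k => if k == 0%N then L x else L v).
by split=> // e; rewrite big_ord_recl big_ord1 /= expr0 scale1r expr1 addrC linL addrC.
Qed.

Lemma polymap_id : polymap (fun x : 'M[C]_n => x).
Proof. exact: polymap_of_linear. Qed.

Lemma der_id x v : der (fun x : 'M[C]_n => x) x v = v.
Proof. exact: der_of_linear. Qed.

Lemma der_lin_dir W (f : 'M[C]_n -> W) x : polymap f -> linear (der f x).
Proof.
elim=> [w|i j g pg H|g h pg Hg ph Hh] a u v.
- by rewrite !der_cst scaler0 addr0.
- rewrite !der_ent // H !mxE !scalerDl !scalerDr !scalerA -!addrA; congr (_ + _).
  by rewrite addrCA [x i j * a]mulrC.
- by rewrite !der_add // Hg Hh scalerDr addrACA.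
Qed.

Lemma der_dirD W (f : 'M[C]_n -> W) x u v : polymap f -> der f x (u + v) = der f x u + der f x v.
Proof. by move=> pf; apply/linear_hypD/der_lin_dir. Qed.

Lemma der_dirZ W (f : 'M[C]_n -> W) x a v : polymap f -> der f x (a *: v) = a *: der f x v.
Proof. by move=> pf; apply/linear_hypZ/der_lin_dir. Qed.

Lemma der_dir0 W (f : 'M[C]_n -> W) x : polymap f -> der f x 0 = 0.
Proof. by move=> pf; apply/linear_hyp0/der_lin_dir. Qed.

Lemma der_dir_sum W (f : 'M[C]_n -> W) x (I : Type) (r : seq I) (F : I -> 'M[C]_n) :
  polymap f -> der f x (\sum_(i <- r) F i) = \sum_(i <- r) der f x (F i).
Proof.
by move=> pf; apply: (big_morph (der f x) (fun u v => der_dirD x u v pf) (der_dir0 x pf)).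
Qed.

Lemma polymap_der_field W (f : 'M[C]_n -> W) (L : 'M[C]_n -> 'M[C]_n) :
  linear L -> polymap f -> polymap (fun x => der f x (L x)).
Proof.
move=> linL; elim=> [w|i j g pg H|g h pg Hg ph Hh].
- by apply: polymap_ext (PolyCst _ 0) => x; rewrite der_cst.
- apply: (@polymap_ext _ (fun x => (L x) i j *: g x + x i j *: der g x (L x))).
    by move=> x; rewrite der_ent.
  apply: PolyAdd; last exact: PolyEnt.
  apply: (@polymap_scale _ (fun x => (L x) i j : C^o)) => //.
  by apply: polymap_of_linear => a u v; rewrite linL !mxE.
- by apply: polymap_ext (PolyAdd Hg Hh) => x; rewrite der_add.
Qed.

Lemma polymap_DX W X (f : 'M[C]_n -> W) : polymap f -> polymap (DX X f).
Proof. by apply: polymap_der_field => a u v; rewrite mulmxDl scalemxAl. Qed.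

Lemma polymap_LX W X (f : 'M[C]_n -> W) : polymap f -> polymap (LX X f).
Proof. by apply: polymap_der_field => a u v; rewrite mulmxDr scalemxAr. Qed.

Lemma der_entM W (f : 'M[C]_n -> W) i j (L : 'M[C]_n -> 'M[C]_n) x v : linear L ->
  polymap f -> der (fun x => (L x) i j *: f x) x v = (L v) i j *: f x + (L x) i j *: der f x v.
Proof.
move=> linL pf; have linE : linear (fun x : 'M[C]_n => (L x) i j : C^o).
  by move=> a u w; rewrite linL !mxE.
rewrite (@der_scale _ (fun x => (L x) i j : C^o)) ?(der_of_linear _ _ linE) //.
exact: polymap_of_linear.
Qed.

(** Both sides equal the second derivative of [f] at [x] in the directions [L x] and [M x], plus the
    same two first order terms: this is the symmetry of second derivatives, written for linear
    vector fields. *)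
Lemma der_field_comm W (f : 'M[C]_n -> W) (L M : 'M[C]_n -> 'M[C]_n) x :
  linear L -> linear M -> polymap f ->
  der (fun x => der f x (L x)) x (M x) + der f x (M (L x))
  = der (fun x => der f x (M x)) x (L x) + der f x (L (M x)).
Proof.
move=> linL linM; elim=> [w|i j g pg H|g h pg Hg ph Hh].
- by rewrite !der_cst !(@der_ext _ _ (fun => 0)) ?der_cst // => y; rewrite der_cst.
- have E (K : 'M[C]_n -> 'M[C]_n) v : linear K ->
      der (fun x => der (fun y => y i j *: g y) x (K x)) x v =
      (K v) i j *: g x + (K x) i j *: der g x v +
      (v i j *: der g x (K x) + x i j *: der (fun x => der g x (K x)) x v).
    move=> linK; rewrite (@der_ext _ _ (fun x => (K x) i j *: g x + x i j *: der g x (K x))).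
      rewrite der_add ?der_entM ?der_ent //; first exact: polymap_der_field.
        apply: (@polymap_scale _ (fun x => (K x) i j : C^o)) => //.
        by apply: polymap_of_linear => a u v'; rewrite linK !mxE.
      exact/PolyEnt/polymap_der_field.
    by move=> y; rewrite der_ent.
  rewrite !E // !der_ent //.
  rewrite [LHS](AC (2*2*2) ((1*2*3*5)*(4*6))) [RHS](AC (2*2*2) ((5*3*2*1)*(4*6))) /=.
  by rewrite -!scalerDr H.
- have E (K : 'M[C]_n -> 'M[C]_n) v : linear K ->
      der (fun x => der (fun y => g y + h y) x (K x)) x v =
      der (fun x => der g x (K x)) x v + der (fun x => der h x (K x)) x v.
    move=> linK; rewrite -der_add; try exact: polymap_der_field.
    by apply: der_ext => y; rewrite der_add.
  by rewrite !E // !der_add // addrACA Hg Hh addrACA.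
Qed.

Lemma DX_comm W X Y (f : 'M[C]_n -> W) x : polymap f ->
  DX X (DX Y f) x = DX Y (DX X f) x + der f x (x *m (X *m Y - Y *m X)).
Proof.
have lin (Z : 'M[C]_n) : linear (mulmx^~ Z : 'M[C]_n -> 'M[C]_n).
  by move=> a u v; rewrite mulmxDl scalemxAl.
move=> pf; have := der_field_comm x (lin Y) (lin X) pf; rewrite /DX => E.
rewrite mulmxBr der_dirD // -scaleN1r der_dirZ // scaleN1r !mulmxA addrA.
by apply/eqP; rewrite eq_sym subr_eq E.
Qed.

Lemma DX_LX W X Y (f : 'M[C]_n -> W) x : polymap f -> DX X (LX Y f) x = LX Y (DX X f) x.
Proof.
have lin (Z : 'M[C]_n) : linear (mulmx^~ Z : 'M[C]_n -> 'M[C]_n).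
  by move=> a u v; rewrite mulmxDl scalemxAl.
have lin' (Z : 'M[C]_n) : linear (mulmx Z : 'M[C]_n -> 'M[C]_n).
  by move=> a u v; rewrite mulmxDr scalemxAr.
move=> pf; have := der_field_comm x (lin' Y) (lin X) pf; rewrite /DX /LX mulmxA.
by move/addIr.
Qed.

End Calculus.

Section Composition.
Variables n k : nat.

Lemma polymap_comp (W : vectType C) (F : 'M[C]_k -> 'M[C]_n) (f : 'M[C]_n -> W) :
  polymap F -> polymap f -> polymap (fun x => f (F x)).
Proof.
move=> pF; elim=> [w|i j g _ H|g h _ Hg _ Hh]; [exact: PolyCst| |exact: PolyAdd].
apply: (@polymap_bilin _ C^o W W (fun a w => (a : C) *: w) (fun x => F x i j)) => //;
  [exact: scale_linear_r|exact: scale_linear_l|].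
by apply: (polymap_linear (L := fun y : 'M[C]_n => y i j : C^o)) => // a u v; rewrite !mxE.
Qed.

Lemma der_comp (W : vectType C) (F : 'M[C]_k -> 'M[C]_n) (f : 'M[C]_n -> W) x v :
  polymap F -> polymap f -> der (fun x => f (F x)) x v = der f (F x) (der F x v).
Proof.
move=> pF; have lin i j : linear (fun y : 'M[C]_n => y i j : C^o) by move=> a u w; rewrite !mxE.
elim=> [w|i j g pg H|g h pg Hg ph Hh]; first by rewrite !der_cst.
  rewrite der_ent // (@der_scale _ _ (fun x => F x i j : C^o)); last exact: polymap_comp.
    by rewrite H (der_linear _ _ (lin i j)).
  exact: (polymap_linear (lin i j)).
by rewrite !der_add ?Hg ?Hh //; apply: polymap_comp.
Qed.

End Composition.

Section MPoly.
Variable n : nat.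

Lemma polymap_meval (p : {mpoly C[n * n]}) :
  polymap (fun g : 'M[C]_n => p.@[fun k => mxvec g ord0 k] : C^o).
Proof.
elim/mpolyind: p => [|c m p _ _ IH].
  by apply: polymap_ext (PolyCst _ (0 : C^o)) => x; rewrite meval0.
pose ev (p : {mpoly C[n * n]}) (g : 'M[C]_n) : C^o := p.@[fun k => mxvec g ord0 k].
apply: (@polymap_ext _ _ (fun g : 'M[C]_n => c *: ev 'X_[m] g + ev p g)) => [x|].
  by rewrite /ev mevalD mevalZ.
apply: PolyAdd => //; apply: (@polymap_scalec _ C^o).
have pent k : polymap (fun g : 'M[C]_n => mxvec g ord0 k : C^o).
  by apply: polymap_of_linear => a u v; rewrite linearP !mxE.
suff H : forall s : seq 'I_(n * n),
    polymap (fun g : 'M[C]_n => \prod_(k <- s) mxvec g ord0 k ^+ m k : C^o).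
  by apply: polymap_ext (H (index_enum _)) => x; rewrite /ev mevalX.
elim=> [|k s IHs].
  by apply: polymap_ext (PolyCst _ (1 : C^o)) => x; rewrite big_nil.
apply: (@polymap_ext _ _ (fun g : 'M[C]_n => mxvec g ord0 k ^+ m k *
  \prod_(k <- s) mxvec g ord0 k ^+ m k : C^o)) => [x|]; first by rewrite big_cons.
apply: polymap_mul => //; elim: (m k) => [|j IHj].
  by apply: polymap_ext (PolyCst _ (1 : C^o)) => x; rewrite expr0.
by apply: polymap_ext (polymap_mul (pent k) IHj) => x; rewrite exprS.
Qed.

Lemma meval_polymap (f : 'M[C]_n -> C^o) : polymap f ->
  exists p : {mpoly C[n * n]}, forall g, f g = p.@[fun k => mxvec g ord0 k].
Proof.
elim=> [w|i j g _ [p Hp]|g h _ [p Hp] _ [q Hq]].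
- by exists w%:MP => x; rewrite mevalC.
- by exists ('X_(mxvec_index i j) * p) => x; rewrite mevalM mevalXU mxvecE Hp.
- by exists (p + q) => x; rewrite mevalD Hp Hq.
Qed.

Lemma der_meval (p : {mpoly C[n * n]}) (x v : 'M[C]_n) :
  der (fun g : 'M[C]_n => p.@[fun k => mxvec g ord0 k] : C^o) x v =
  \sum_k (p^`M(k)).@[fun k => mxvec x ord0 k] * mxvec v ord0 k.
Proof.
pose ev (p : {mpoly C[n * n]}) (g : 'M[C]_n) : C^o := p.@[fun k => mxvec g ord0 k].
pose P p := der (ev p) x v = \sum_k ev p^`M(k) x * mxvec v ord0 k.
have Hprod p1 p2 : P p1 -> P p2 -> P (p1 * p2).
  rewrite /P => H1 H2; rewrite (@der_ext _ _ _ (fun g => ev p1 g * ev p2 g)); last first.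
    by move=> y; rewrite /ev mevalM.
  rewrite der_mul; try exact: polymap_meval.
  rewrite H1 H2 mulr_suml mulr_sumr -big_split /=; apply: eq_bigr => k _.
  rewrite /ev mderivM mevalD !mevalM; ring.
have Hone : P 1.
  rewrite /P (@der_ext _ _ _ (fun=> 1)) ?der_cst; last by move=> y; rewrite /ev meval1.
  by rewrite big1 // => k _; rewrite -mpolyC1 mderivC /ev meval0 mul0r.
have Hvar i : P 'X_i.
  have lin : linear (fun g : 'M[C]_n => mxvec g ord0 i : C^o).
    by move=> a u w; rewrite linearP !mxE.
  rewrite /P (@der_ext _ _ _ (fun g : 'M[C]_n => mxvec g ord0 i : C^o)); last first.
    by move=> y; rewrite /ev mevalXU.
  rewrite (der_of_linear _ _ lin) (bigD1 i) //= big1 => [|k ki].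
    rewrite addr0 mderivX /ev mevalZ mnm1E eqxx (_ : (U_(i) - U_(i) = 0)%MM); last first.
      by apply/mnmP => j; rewrite mnmBE subnn mnm0E.
    by rewrite mpolyX0 meval1 mulr1 mul1r.
  by rewrite mderivX mnm1E eq_sym (negbTE ki) scale0r /ev meval0 mul0r.
rewrite -/(ev p) -/(P p).
elim/mpolyind: p => [|c m p _ _ IH].
  rewrite /P (@der_ext _ _ _ (fun=> 0)) ?der_cst; last by move=> y; rewrite /ev meval0.
  by rewrite big1 // => k _; rewrite mderiv0 /ev meval0 mul0r.
have HX : P 'X_[m].
  rewrite mpolyXE_id; apply: (big_ind P) => // i _.
  by elim: (m i) => [|j IHj]; rewrite ?expr0 // exprS; apply: Hprod.
rewrite /P (@der_ext _ _ _ (fun g => c *: ev 'X_[m] g + ev p g)); last first.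
  by move=> y; rewrite /ev mevalD mevalZ.
rewrite der_add ?der_scalec; try exact: polymap_meval; last first.
  exact/polymap_scalec/polymap_meval.
rewrite HX IH scaler_sumr -big_split /=; apply: eq_bigr => k _.
by rewrite /ev mderivD mderivZ mevalD mevalZ mulrDl -mulrA.
Qed.

End MPoly.
End PolynomialMaps.

(** * Hilbert's basis theorem *)

Section HilbertBasis.

Lemma nondecreasing_subsequence (f : nat -> nat) : exists phi : nat -> nat,
  {homo phi : i j / (i < j)%N} /\ {homo (fun i => f (phi i)) : i j / (i <= j)%N}.
Proof.
have H i : exists j, (i <= j)%N /\ forall k, (i <= k)%N -> (f j <= f k)%N.
  have ex : exists v, `[< exists2 j, (i <= j)%N & f j = v >] by exists (f i); apply/asboolP; exists i.
  case: (ex_minnP ex) => v /asboolP [j ij fj] minv; exists j; split=> // k ik.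
  by rewrite fj; apply: minv; apply/asboolP; exists k.
have [m Hm] := choice H.
(* Each index minimises [f] beyond the preceding one, so the chosen values can only grow. *)
pose phi i := iter i (fun j => m j.+1) (m 0%N); exists phi.
have phiS i : phi i.+1 = m (phi i).+1 by [].
have incr i : (phi i < phi i.+1)%N by rewrite phiS; case: (Hm (phi i).+1).
have homo_phi : {homo phi : i j / (i < j)%N} by apply: homo_ltn => // x y z; apply: ltn_trans.
split=> // i j ij.
have le_phi : (phi i <= phi j)%N.
  by move: ij; rewrite leq_eqVlt => /orP [/eqP -> //|/homo_phi/ltnW].
change (f (phi i) <= f (phi j))%N.
case: i le_phi {ij} => [|i] le_phi; first by case: (Hm 0%N) => _; apply.
rewrite [phi i.+1]phiS in le_phi *.
by case: (Hm (phi i).+1) => le_i; apply; exact: leq_trans le_i le_phi.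
Qed.

Lemma nondecreasing_subsequences (fs : seq (nat -> nat)) : exists phi : nat -> nat,
  {homo phi : i j / (i < j)%N} /\
  forall k, (k < size fs)%N ->
    {homo (fun i => nth (fun=> 0%N) fs k (phi i)) : i j / (i <= j)%N}.
Proof.
elim: fs => [|f fs [phi [phi_lt Hphi]]]; first by exists id; split=> // i j.
have [psi [psi_lt Hpsi]] := nondecreasing_subsequence (fun i => f (phi i)).
exists (phi \o psi); split=> [i j ij|]; first by apply: phi_lt; apply: psi_lt.
case=> [|k] lt_k i j ij /=; first exact: (Hpsi i j ij).
apply: (Hphi k lt_k); move: ij; rewrite leq_eqVlt => /orP [/eqP -> //|/psi_lt/ltnW //].
Qed.

Lemma dickson n (u : nat -> 'X_{1..n}) : exists i j, (i < j)%N /\ (u i <= u j)%MM.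
Proof.
have [phi [phi_lt Hphi]] := nondecreasing_subsequences [seq (fun i => u i k) | k <- enum 'I_n].
exists (phi 0%N), (phi 1%N); split; first exact: phi_lt.
apply/mnm_lepP => k; have kn : (k < size [seq (fun i => u i k) | k <- enum 'I_n])%N.
  by rewrite size_map size_enum_ord.
have := Hphi k kn 0%N 1%N isT.
by rewrite (nth_map k) ?size_enum_ord // nth_ord_enum.
Qed.

Variables (F : fieldType) (n : nat).
Implicit Types (p q : {mpoly F[n]}) (s : seq {mpoly F[n]}).

Definition in_ideal s p := exists c : nat -> {mpoly F[n]}, p = \sum_(i < size s) c i * s`_i.

Lemma in_idealD s p q : in_ideal s p -> in_ideal s q -> in_ideal s (p + q).
Proof.
move=> [c ->] [d ->]; exists (fun i => c i + d i); rewrite -big_split /=.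
by apply: eq_bigr => i _; rewrite mulrDl.
Qed.

Lemma in_idealM s p q : in_ideal s p -> in_ideal s (q * p).
Proof.
move=> [c ->]; exists (fun i => q * c i); rewrite mulr_sumr.
by apply: eq_bigr => i _; rewrite mulrA.
Qed.

Lemma in_ideal_mem s p : p \in s -> in_ideal s p.
Proof.
move=> ps; exists (fun i => (i == index p s)%:R).
have lt_i : (index p s < size s)%N by rewrite index_mem.
rewrite (bigD1 (Ordinal lt_i)) //= eqxx mul1r nth_index // big1 ?addr0 // => i.
by rewrite -val_eqE /= => /negbTE ->; rewrite mul0r.
Qed.

Lemma mlead_sub_lt p q : p != q -> mlead p = mlead q -> mleadc p = mleadc q ->
  (mlead (p - q) < mlead p)%O.
Proof.
move=> pq lpq cpq; rewrite lt_neqAle; apply/andP; split; last first.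
  by apply: le_trans (mleadB_le p q) _; rewrite -lpq joinxx.
apply/negP => /eqP E; move: (mleadc_eq0 (p - q)).
by rewrite E mcoeffB {2}lpq -cpq subrr eqxx subr_eq0 (negbTE pq).
Qed.

(** If no finite family generates, one keeps adding an element of [I] outside the ideal generated so
    far, of least leading monomial. By Dickson's lemma the leading monomial of some added p divides
    that of a later q; subtracting a multiple of p from q yields an element that is still outside
    and has a smaller leading monomial, against the choice of q. *)
Theorem hilbert_basis (I : {mpoly F[n]} -> Prop) :
  I 0 -> (forall p q, I p -> I q -> I (p + q)) -> (forall p q, I p -> I (q * p)) ->
  exists s, (forall p, p \in s -> I p) /\ forall p, I p -> in_ideal s p.
Proof.
move=> I0 ID IM; apply: contrapT => /forallNP noFG.
have step s : exists p, (forall q, q \in s -> I q) ->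
    [/\ I p, ~ in_ideal s p &
      forall q, I q -> ~ in_ideal s q -> (mlead p <= mlead q)%O].
  have [Is|nIs] := pselect (forall q, q \in s -> I q); last by exists 0 => /nIs.
  have /existsNP [p0 /not_implyP [Ip0 np0]] : ~ forall p, I p -> in_ideal s p.
    by move=> H; apply: (noFG s).
  pose B m := exists p, [/\ I p, ~ in_ideal s p & mlead p = m].
  have [m [p [Ip np <-]] minp] : exists2 m, B m & forall q, I q -> ~ in_ideal s q -> (m <= mlead q)%O.
    have : B (mlead p0) by exists p0.
    elim/(well_founded_ind (@ltom_wf n)): (mlead p0) => m IH Bm.
    have [[q [Iq nq lt_q]]|no] := pselect (exists q, [/\ I q, ~ in_ideal s q & (mlead q < m)%O]).
      by apply: (IH _ lt_q); exists q.
    exists m => // q Iq nq; rewrite leNgt; apply/negP => lt_q.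
    by apply: no; exists q.
  by exists p => _; split.
have [nxt Hnxt] := choice step.
pose S := fix S k := if k is k'.+1 then rcons (S k') (nxt (S k')) else [::].
have IS k q : q \in S k -> I q.
  elim: k q => [|k IH] q //=; rewrite mem_rcons inE => /orP [/eqP ->|/IH //].
  by case: (Hnxt _ IH).
have SS i j : (i < j)%N -> nxt (S i) \in S j.
  elim: j => [|j IH] //=; rewrite ltnS leq_eqVlt => /orP [/eqP ->|/IH ij].
    by rewrite mem_rcons mem_head.
  by rewrite mem_rcons inE ij orbT.
have [i [j [ij]]] := dickson (fun k => mlead (nxt (S k))).
have [Ii ni mini] := Hnxt _ (IS i); have [Ij nj minj] := Hnxt _ (IS j).
set p := nxt (S i) in Ii ni mini *; set q := nxt (S j) in Ij nj minj * => le_pq.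
have nz r k : ~ in_ideal (S k) r -> r != 0.
  move=> nr; apply/eqP => r0; apply: nr; exists (fun=> 0).
  by rewrite r0 big1 // => a _; rewrite mul0r.
have p0 := nz _ _ ni; have q0 := nz _ _ nj.
have cp0 : mleadc p != 0 by rewrite mleadc_eq0.
have cq0 : mleadc q != 0 by rewrite mleadc_eq0.
pose t := ((mleadc q / mleadc p) *: 'X_[(mlead q - mlead p)%MM]) : {mpoly F[n]}.
have ab0 : mleadc q / mleadc p != 0 by rewrite mulf_neq0 ?invr_eq0.
have lt : mlead t = (mlead q - mlead p)%MM by rewrite mleadZ // mleadXm.
have t0 : t != 0 by rewrite -mleadc_eq0 mleadcZE mleadXm mcoeffX eqxx mulr1.
have ltp : mlead (t * p) = mlead q by rewrite mleadM // lt submK.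
have ctp : mleadc (t * p) = mleadc q.
  by rewrite ltp -[X in _@_X](submK le_pq) -lt mleadcM lt mcoeffZ mcoeffX eqxx mulr1 divfK.
have Itp : I (t * p) by apply: IM.
have itp : in_ideal (S j) (t * p) by apply/in_idealM/in_ideal_mem/SS.
have nqt : ~ in_ideal (S j) (q - t * p).
  by move=> H; apply: nj; rewrite -[q](subrK (t * p)); apply: in_idealD.
have neq : q != t * p by apply/eqP => E; apply: nj; rewrite E.
have := mlead_sub_lt neq (esym ltp) (esym ctp).
rewrite ltNge minj //; apply: ID => //; rewrite -mulN1r; exact: IM.
Qed.

(** A finite generating set of the ideal spanned by all [P i] involves only the indices below some
    [N]. *)
Corollary ideal_chain (P : nat -> {mpoly F[n]}) :
  exists N (c : nat -> {mpoly F[n]}), P N = \sum_(i < N) c i * P i.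
Proof.
pose I p := exists N (c : nat -> {mpoly F[n]}), p = \sum_(i < N) c i * P i.
have wid N N' (c : nat -> {mpoly F[n]}) : (N <= N')%N ->
    \sum_(i < N) c i * P i = \sum_(i < N') (if (i < N)%N then c i else 0) * P i.
  move=> le; rewrite (big_ord_widen N' (fun i => c i * P i) le) big_mkcond /=.
  by apply: eq_bigr => i _; case: ifP => //; rewrite mul0r.
have [||p q|s [sI Is]] := @hilbert_basis I.
- by exists 0%N, (fun=> 0); rewrite big_ord0.
- move=> p q [N [c ->]] [N' [c' ->]]; rewrite (wid _ (N + N')%N) ?leq_addr //.
  rewrite (wid N' (N + N')%N) ?leq_addl // -big_split /=; exists (N + N')%N.
  exists (fun i => (if (i < N)%N then c i else 0) + (if (i < N')%N then c' i else 0)).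
  by apply: eq_bigr => i _; rewrite mulrDl.
- move=> [N [c ->]]; exists N, (fun i => q * c i); rewrite mulr_sumr.
  by apply: eq_bigr => i _; rewrite mulrA.
have [N HN] : exists N, forall p, p \in s -> exists c : nat -> {mpoly F[n]}, p = \sum_(i < N) c i * P i.
  elim: s sI {Is} => [|p s IH] sI; first by exists 0%N.
  have [|N HN] := IH; first by move=> q qs; apply: sI; rewrite inE qs orbT.
  have [N' [c Hc]] := sI p (mem_head _ _).
  exists (N + N')%N => q; rewrite inE => /orP [/eqP ->|/HN [d ->]].
    by exists (fun i => if (i < N')%N then c i else 0); rewrite Hc (wid N' (N + N')%N) ?leq_addl.
  by exists (fun i => if (i < N)%N then d i else 0); rewrite (wid N (N + N')%N) ?leq_addr.
have [d Hd] : in_ideal s (P N).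
  apply: Is; exists N.+1, (fun i => (i == N)%:R); rewrite big_ord_recr /= eqxx mul1r.
  by rewrite big1 ?add0r // => i _; rewrite ltn_eqF ?mul0r.
have : exists e : nat -> nat -> {mpoly F[n]}, forall k, (k < size s)%N -> s`_k = \sum_(i < N) e k i * P i.
  suff /choice [e He] : forall k, exists c : nat -> {mpoly F[n]},
      (k < size s)%N -> s`_k = \sum_(i < N) c i * P i by exists e.
  move=> k; have [ks|] := boolP (k < size s)%N; last by exists (fun=> 0).
  by have [c Hc] := HN _ (mem_nth 0 ks); exists c.
move=> [e He]; exists N, (fun i => \sum_(k < size s) d k * e k i); rewrite Hd.
under eq_bigr => k _ do rewrite He // mulr_sumr.
rewrite exchange_big /=; apply: eq_bigr => i _; rewrite mulr_suml.
by apply: eq_bigr => k _; rewrite mulrA.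
Qed.

End HilbertBasis.

(** * Jets along the Lie algebra of an algebraic group *)

Section Closed.
Variable C : numClosedFieldType.

(** The subspace is one of maximal dimension inside [P]: a vector of [P] outside it would enlarge
    it. This turns spaces described by arbitrary conditions into objects of type [vspace]. *)
Lemma pred_vspace (W : vectType C) (P : W -> Prop) :
  P 0 -> (forall a u v, P u -> P v -> P (a *: u + v)) ->
  exists U : {vspace W}, forall v, v \in U <-> P v.
Proof.
move=> P0 PL; pose B k := `[< exists U : {vspace W}, (forall v, v \in U -> P v) /\ \dim U = k >].
have exB : exists k, B k.
  by exists 0%N; apply/asboolP; exists 0%VS; split=> [v|]; rewrite ?dimv0 // memv0 => /eqP ->.
have bdB k : B k -> (k <= \dim {:W})%N by move=> /asboolP [U [_ <-]]; apply/dimvS/subvf.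
case: (ex_maxnP exB bdB) => k /asboolP [U [UP dimU]] maxU.
exists U => v; split; first exact: UP.
move=> Pv; apply/negPn/negP => vU.
have /maxU : B (\dim (U + <[v]>)).
  apply/asboolP; exists (U + <[v]>)%VS; split=> // w /memv_addP [u uU [z /vlineP [c ->] ->]].
  by rewrite addrC; apply: PL => //; apply: UP.
rewrite leqNgt -dimU => /negP; apply.
rewrite ltnNge; apply/negP => le; case/negP: vU.
have /eqP -> : U == (U + <[v]>)%VS by rewrite eqEdim addvSl le.
by apply: (subvP (addvSr U _)); rewrite memv_line.
Qed.

Variable n : nat.
Implicit Types (x X Y : 'M[C]_n) (f : 'M[C]_n -> C^o).

Definition poly_closed (S : set 'M[C]_n) := exists I : ('M[C]_n -> C^o) -> Prop,
  (forall f, I f -> polymap f) /\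
  forall x, S x <-> x \in unitmx /\ forall f, I f -> f x = 0.

(** [bipoly k Q] means that Q(x, Y) is polynomial in x and homogeneous of degree k in Y.
    Substituting x - 1 for Y gives the k-th power of the maximal ideal at the identity, and Q(1, Y)
    is a leading form. *)
Inductive bipoly : nat -> ('M[C]_n -> 'M[C]_n -> C^o) -> Prop :=
| BipBase f : polymap f -> bipoly 0 (fun x _ => f x)
| BipEnt k i j Q : bipoly k Q -> bipoly k.+1 (fun x Y => Y i j * Q x Y)
| BipAdd k Q Q' : bipoly k Q -> bipoly k Q' -> bipoly k (fun x Y => Q x Y + Q' x Y)
| BipZero k : bipoly k (fun _ _ => 0).

Lemma bipoly_ext k Q Q' : (forall x Y, Q x Y = Q' x Y) -> bipoly k Q -> bipoly k Q'.
Proof.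
by move=> QQ; have -> : Q' = Q by apply/funext => x; apply/funext => Y; rewrite QQ.
Qed.

Lemma bipoly_mulx k f Q : polymap f -> bipoly k Q -> bipoly k (fun x Y => f x * Q x Y).
Proof.
move=> pf; elim=> {k Q} [g pg|k i j Q _ IH|k Q Q' _ H _ H'|k].
- exact/BipBase/polymap_mul.
- by apply: bipoly_ext (BipEnt i j IH) => x Y; rewrite mulrCA.
- by apply: bipoly_ext (BipAdd H H') => x Y; rewrite mulrDr.
- by apply: bipoly_ext (BipZero k) => x Y; rewrite mulr0.
Qed.

Lemma bipoly_mul k l Q Q' : bipoly k Q -> bipoly l Q' -> bipoly (k + l) (fun x Y => Q x Y * Q' x Y).
Proof.
move=> bQ bQ'; elim: bQ => {k Q} [g pg|k i j Q _ IH|k Q Q2 _ H _ H'|k].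
- exact: bipoly_mulx.
- by apply: bipoly_ext (BipEnt i j IH) => x Y; rewrite mulrA.
- by apply: bipoly_ext (BipAdd H H') => x Y; rewrite mulrDl.
- by apply: bipoly_ext (BipZero (k + l)) => x Y; rewrite mul0r.
Qed.

Lemma bipoly_sum k (I : Type) (r : seq I) Q :
  (forall i, bipoly k (Q i)) -> bipoly k (fun x Y => \sum_(i <- r) Q i x Y).
Proof.
move=> bQ; elim: r => [|i r IH].
  by apply: bipoly_ext (BipZero k) => x Y; rewrite big_nil.
by apply: bipoly_ext (BipAdd (bQ i) IH) => x Y; rewrite big_cons.
Qed.

Lemma bipoly_subst k Q (L : 'M[C]_n -> 'M[C]_n) : linear L -> bipoly k Q ->
  bipoly k (fun _ Y => Q 1%:M (L Y)).
Proof.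
move=> linL; elim=> {k Q} [f pf|k i j Q bQ IH|k Q Q' _ H _ H'|k].
- exact/BipBase/PolyCst.
- have bL : bipoly 1 (fun _ Y => (L Y) i j).
    pose c a b : C := (L (delta_mx a b)) i j.
    have bc a b : bipoly 1 (fun _ Y => Y a b * c a b) by apply/BipEnt/BipBase/PolyCst.
    apply: bipoly_ext (bipoly_sum (index_enum _) (fun a => bipoly_sum (index_enum _) (bc a))) => x Y.
    rewrite [in RHS](matrix_sum_delta Y).
    have LS (I : finType) (F : I -> 'M[C]_n) : L (\sum_i F i) = \sum_i L (F i).
      by apply: (big_morph L (linear_hypD linL) (linear_hyp0 linL)).
    rewrite LS summxE; apply: eq_bigr => a _; rewrite LS summxE; apply: eq_bigr => b _.
    by rewrite (linear_hypZ linL) !mxE.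
  exact: (bipoly_mul bL IH).
- exact: BipAdd.
- exact: BipZero.
Qed.

Lemma bipoly_homog k Q : bipoly k Q -> forall x Y (s : C), Q x (s *: Y) = s ^+ k * Q x Y.
Proof.
elim=> {k Q} [f pf|k i j Q bQ IH|k Q Q' _ H _ H'|k] x Y s; rewrite ?mul1r ?mulr0 //.
- by rewrite mxE IH exprS; ring.
- by rewrite H H' mulrDr.
Qed.

Lemma bipoly_diag k Q : bipoly k Q -> polymap (fun x => Q x (x - 1%:M)).
Proof.
elim=> {k Q} [f pf|k i j Q bQ IH|k Q Q' _ H _ H'|k] //; last exact: PolyCst.
  apply: (@polymap_mul _ _ (fun x => (x - 1%:M) i j)) => //.
  apply: (@polymap_ext _ _ _ (fun x : 'M[C]_n => x i j - 1%:M i j : C^o)) => [x|]; first by rewrite !mxE.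
  by apply: polymap_sub; [exact: polymap_entry|exact: PolyCst].
exact: PolyAdd.
Qed.

Lemma bipoly_form k Q x : bipoly k Q -> polymap (Q x).
Proof.
elim=> {k Q} [f pf|k i j Q bQ IH|k Q Q' _ H _ H'|k]; try exact: PolyCst; last exact: PolyAdd.
by apply: polymap_mul => //; apply: polymap_entry.
Qed.

Lemma polymap_taylor0 f : polymap f -> exists2 Q, bipoly 1 Q &
  forall x, f x = f 1%:M + Q x (x - 1%:M).
Proof.
elim=> [w|i j g pg [Q bQ HQ]|g h pg [Q bQ HQ] ph [Q' bQ' HQ']].
- by exists (fun _ _ => 0) => [|x]; [exact: BipZero|rewrite addr0].
- exists (fun x Y => Y i j * g x + (1%:M : 'M[C]_n) i j * Q x Y).
    by apply: BipAdd; [exact/BipEnt/BipBase|apply: bipoly_mulx => //; exact: PolyCst].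
  move=> x; have -> : Q x (x - 1%:M) = g x - g 1%:M by rewrite (HQ x); ring.
  by rewrite !mxE /GRing.scale /=; ring.
- exists (fun x Y => Q x Y + Q' x Y) => [|x]; first exact: BipAdd.
  by rewrite HQ HQ' addrACA.
Qed.

Lemma polymap_taylor2 f : polymap f -> exists2 Q, bipoly 2 Q &
  forall x, f x = f 1%:M + der f 1%:M (x - 1%:M) + Q x (x - 1%:M).
Proof.
elim=> [w|i j g pg [Q bQ HQ]|g h pg [Q bQ HQ] ph [Q' bQ' HQ']].
- by exists (fun _ _ => 0) => [|x]; [exact: BipZero|rewrite der_cst !addr0].
- have [Q1 bQ1 HQ1] := polymap_taylor0 pg.
  exists (fun x Y => Y i j * Q1 x Y + (1%:M : 'M[C]_n) i j * Q x Y).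
    by apply: BipAdd; [exact/BipEnt|apply: bipoly_mulx => //; exact: PolyCst].
  move=> x; rewrite der_ent // /GRing.scale /=.
  have -> : Q1 x (x - 1%:M) = g x - g 1%:M by rewrite (HQ1 x); ring.
  have -> : Q x (x - 1%:M) = g x - g 1%:M - der g 1%:M (x - 1%:M) by rewrite (HQ x); ring.
  by rewrite !mxE; ring.
- exists (fun x Y => Q x Y + Q' x Y) => [|x]; first exact: BipAdd.
  by rewrite HQ HQ' der_add //; ring.
Qed.

(** Replacing the coefficients by their values at the identity costs one more factor x - 1. *)
Lemma bipoly_lead k Q : bipoly k Q -> exists2 Q', bipoly k.+1 Q' &
  forall x, Q x (x - 1%:M) = Q 1%:M (x - 1%:M) + Q' x (x - 1%:M).
Proof.
elim=> {k Q} [f pf|k i j Q bQ [Q' bQ' H]|k Q Q' _ [R bR H] _ [R' bR' H']|k].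
- exact: polymap_taylor0.
- exists (fun x Y => Y i j * Q' x Y) => [|x]; first exact: BipEnt.
  by rewrite H mulrDr.
- exists (fun x Y => R x Y + R' x Y) => [|x]; first exact: BipAdd.
  by rewrite H H' addrACA.
- by exists (fun _ _ => 0) => [|x]; [exact: BipZero|rewrite addr0].
Qed.

(** A derivation lowers the order at the identity by at most one, and acts on the leading form as
    the directional derivative along [X], because the field x X takes the value X at 1. *)
Lemma DX_bipoly k Q X : bipoly k Q -> exists2 Q', bipoly k.-1 Q' &
  (forall x, DX X (fun x => Q x (x - 1%:M)) x = Q' x (x - 1%:M)) /\
  ((0 < k)%N -> forall Y, Q' 1%:M Y = der (Q 1%:M) Y X).
Proof.
elim=> {k Q} [f pf|k i j Q bQ [Q' bQ' [H H2]]|k Q Q' bQ [R bR [H H2]] bQ' [R' bR' [H' H2']]|k].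
- by exists (fun x _ => DX X f x); first exact/BipBase/polymap_DX.
- have lin1 : linear (fun x => (x *m X) i j : C^o) by move=> a u v; rewrite mulmxDl -scalemxAl !mxE.
  have pE : polymap (fun x => (x *m X) i j : C^o) by apply: polymap_of_linear.
  have pv : polymap (fun x => (x - 1%:M) i j : C^o).
    apply: (@polymap_ext _ _ _ (fun x : 'M[C]_n => x i j - 1%:M i j : C^o)) => [x|]; first by rewrite !mxE.
    by apply: polymap_sub; [exact: polymap_entry|exact: PolyCst].
  have E x : DX X (fun x => (x - 1%:M) i j * Q x (x - 1%:M) : C^o) x =
      (x *m X) i j * Q x (x - 1%:M) + (x - 1%:M) i j * DX X (fun x => Q x (x - 1%:M)) x.
    rewrite /DX der_mul //; last exact: bipoly_diag bQ.
    congr (_ * _ + _); rewrite (@der_ext _ _ _ _ (fun y : 'M[C]_n => y i j - 1%:M i j : C^o)); last first.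
      by move=> y; rewrite !mxE.
    by rewrite der_sub ?der_cst ?subr0 ?der_entry //; [exact: polymap_entry|exact: PolyCst].
  case: k bQ H H2 bQ' => [|k] bQ H H2 bQ'.
    exists (fun x Y => (x *m X) i j * Q x Y + (x - 1%:M) i j * Q' x Y).
      by apply: BipAdd; apply: bipoly_mulx.
    split=> [x|_ Y]; first by rewrite E H.
    rewrite subrr [X in X * Q' _ _]mxE mul0r addr0 mul1mx der_mul ?der_entry //; last exact: bipoly_form bQ.
      have -> : Q 1%:M = fun=> Q 1%:M 0.
        by apply/funext => Z; have := bipoly_homog bQ 1%:M Z 0; rewrite scale0r mul1r.
      by rewrite der_cst mulr0 addr0.
    exact: polymap_entry.
  exists (fun x Y => (x *m X) i j * Q x Y + Y i j * Q' x Y).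
    by apply: BipAdd; [apply: bipoly_mulx|apply: BipEnt].
  split=> [x|_ Y]; first by rewrite E H.
  rewrite der_mul ?der_entry ?mul1mx ?H2 //; [exact: polymap_entry|exact: bipoly_form bQ].
- exists (fun x Y => R x Y + R' x Y); first exact: BipAdd.
  split=> [x|k0 Y].
    by rewrite /DX der_add -?H -?H' //; [exact: bipoly_diag bQ|exact: bipoly_diag bQ'].
  by rewrite der_add ?H2 ?H2' //; [exact: bipoly_form bQ|exact: bipoly_form bQ'].
- exists (fun _ _ => 0); first exact: BipZero.
  by split=> [x|_ Y]; rewrite /DX der_cst.
Qed.

Lemma iter_der_homog (F : 'M[C]_n -> C^o) k X : polymap F ->
  (forall s : C, F (s *: X) = s ^+ k * F X) ->
  iter k (fun h Y => der h Y X) F 0 = k`!%:R * F X.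
Proof.
move=> pF hF; pose D j := iter j (fun h Y => der h Y X) F.
have pD j : polymap (D j).
  elim: j => [|j IH] //=; move: IH; elim=> [w|a b g pg H|g h pg Hg ph Hh].
  - by apply: polymap_ext (PolyCst _ (0 : C^o)) => Y; rewrite der_cst.
  - apply: polymap_ext (PolyAdd (polymap_scalec (X a b) pg) (PolyEnt a b H)) => Y.
    by rewrite der_ent.
  - by apply: polymap_ext (PolyAdd Hg Hh) => Y; rewrite der_add.
have E j : (j <= k)%N -> forall s : C, D j (s *: X) = (k ^_ j)%:R * (s ^+ (k - j) * F X).
  elim: j => [|j IH] jk s; first by rewrite /D /= hF ffactn0 mul1r subn0.
  rewrite /D iterS -/(D j).
  pose p := ((k ^_ j)%:R * F X) *: ('X + s%:P) ^+ (k - j) : {poly C}.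
  rewrite (@der_poly _ _ _ _ _ p) => [|e]; last first.
    rewrite -scalerDl IH; last exact: ltnW.
    by rewrite /p hornerZ horner_exp hornerD hornerX hornerC; rewrite [s + e]addrC; ring.
  have -> : p`_1 = (p^`()).[0] by rewrite horner_coef0 coef_deriv.
  rewrite derivZ deriv_exp derivD derivX derivC addr0 mul1r hornerZ hornerMn horner_exp.
  rewrite hornerD hornerX hornerC add0r ffactnSr natrM -mulr_natr.
  by rewrite (_ : (k - j).-1 = k - j.+1)%N ?subnS //; ring.
have := E k (leqnn k) 0; rewrite scale0r subnn mul1r ffactnn.
by rewrite /D.
Qed.

(** The k-th derivative along [X] at the identity reads off the leading form at [X]; the factorial
    comes from Euler's identity for forms. *)
Lemma iter_DX_bipoly k Q X : bipoly k Q ->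
  iter k (DX X) (fun x => Q x (x - 1%:M)) 1%:M = k`!%:R * Q 1%:M X.
Proof.
move=> bQ; rewrite -iter_der_homog; last first.
- by move=> s; apply: bipoly_homog.
- exact: bipoly_form bQ.
have H0 : forall k F Q, bipoly k Q -> Q 1%:M = F ->
    iter k (DX X) (fun x => Q x (x - 1%:M)) 1%:M = iter k (fun h Y => der h Y X) F 0.
  elim=> [|l IH] F Q0 bQ0 <-; first by rewrite /= subrr.
  have [Q' bQ' [H H2]] := DX_bipoly X bQ0.
  rewrite !iterSr (funext H); apply: IH => //.
  by apply/funext => Y; apply: H2.
exact: H0.
Qed.

End Closed.

Lemma meval_sum (C : comNzRingType) n (v : 'I_n -> C) I (r : seq I) (F : I -> {mpoly C[n]}) :
  (\sum_(i <- r) F i).@[v] = \sum_(i <- r) (F i).@[v].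
Proof. exact: (big_morph _ (mevalD v) (meval0 v)). Qed.

(** * Krull's intersection theorem at the identity *)

Section Krull.
Variables (C : numClosedFieldType) (n : nat).
Implicit Types (x X Y : 'M[C]_n) (f : 'M[C]_n -> C^o).

Let N := (n * n)%N.

Definition pair_coord x Y : 'I_(N + N) -> C := fun k => row_mx (mxvec x) (mxvec Y) ord0 k.

Lemma bipoly_meval k Q : bipoly k Q ->
  exists q : {mpoly C[N + N]}, forall x Y, Q x Y = q.@[pair_coord x Y].
Proof.
elim=> {k Q} [f pf|k i j Q bQ [q Hq]|k Q Q' _ [q Hq] _ [q' Hq']|k].
- elim: pf => [w|i j g _ [q Hq]|g h _ [q Hq] _ [q' Hq']].
  + by exists w%:MP => x Y; rewrite mevalC.
  + exists ('X_(lshift N (mxvec_index i j)) * q) => x Y.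
    by rewrite mevalM mevalXU /pair_coord row_mxEl mxvecE -Hq.
  + by exists (q + q') => x Y; rewrite mevalD -Hq // -Hq'.
- exists ('X_(rshift N (mxvec_index i j)) * q) => x Y.
  by rewrite mevalM mevalXU /pair_coord row_mxEr mxvecE -Hq.
- by exists (q + q') => x Y; rewrite mevalD Hq Hq'.
- by exists 0 => x Y; rewrite meval0.
Qed.

(* [s |-> A(x, s (x - 1))] is a polynomial in [s]; its coefficients of positive degree vanish at 1. *)
Lemma meval_scaled (A : {mpoly C[N + N]}) : exists P : 'M[C]_n -> {poly C},
  [/\ forall x (s : C), A.@[pair_coord x (s *: (x - 1%:M))] = (P x).[s],
      forall k, polymap (fun x => (P x)`_k : C^o)
    & forall k, (0 < k)%N -> (P 1%:M)`_k = 0].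
Proof.
pose H (A : {mpoly C[N + N]}) := exists P : 'M[C]_n -> {poly C},
  [/\ forall x (s : C), A.@[pair_coord x (s *: (x - 1%:M))] = (P x).[s],
      forall k, polymap (fun x => (P x)`_k : C^o)
    & forall k, (0 < k)%N -> (P 1%:M)`_k = 0].
have Hmul A1 A2 : H A1 -> H A2 -> H (A1 * A2).
  move=> [P [P1 P2 P3]] [P' [P1' P2' P3']]; exists (fun x => P x * P' x); split.
  - by move=> x s; rewrite mevalM hornerM P1 P1'.
  - move=> k; apply: (@polymap_ext _ _ _ (fun x => \sum_(i < k.+1) (P x)`_i * (P' x)`_(k - i) : C^o)).
      by move=> x; rewrite coefM.
    by apply: polymap_sum => i; apply: polymap_mul.
  - move=> k k0; rewrite coefM big1 // => i _.
    have [i0|i0] := posnP i; last by rewrite P3 ?mul0r.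
    by rewrite i0 subn0 P3' ?mulr0.
have Hadd A1 A2 : H A1 -> H A2 -> H (A1 + A2).
  move=> [P [P1 P2 P3]] [P' [P1' P2' P3']]; exists (fun x => P x + P' x); split.
  - by move=> x s; rewrite mevalD hornerD P1 P1'.
  - by move=> k; apply: polymap_ext (PolyAdd (P2 k) (P2' k)) => x; rewrite coefD.
  - by move=> k k0; rewrite coefD P3 ?P3' ?addr0.
have Hcst c : H c%:MP.
  exists (fun=> c%:P); split=> [x s|k|k k0]; first by rewrite mevalC hornerC.
    exact: PolyCst.
  by rewrite coefC gtn_eqF.
have Hvar i : H 'X_i.
  have pm k : polymap (fun x => mxvec x ord0 k : C^o).
    by apply: polymap_of_linear => a u v; rewrite linearP !mxE.
  case: (split_ordP i) => k ->.
    exists (fun x => (mxvec x ord0 k)%:P); split=> [x s|l|l l0].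
    - by rewrite mevalXU /pair_coord row_mxEl hornerC.
    - case: l => [|l]; first by apply: polymap_ext (pm k) => x; rewrite coefC.
      by apply: polymap_ext (PolyCst _ (0 : C^o)) => x; rewrite coefC.
    - by rewrite coefC gtn_eqF.
  exists (fun x => (mxvec (x - 1%:M) ord0 k) *: 'X); split=> [x s|l|l l0].
  - by rewrite mevalXU /pair_coord row_mxEr hornerZ hornerX linearZ mxE mulrC.
  - apply: polymap_ext (polymap_mul (PolyCst n ((l == 1%N)%:R : C^o))
      (polymap_sub (pm k) (PolyCst n (mxvec 1%:M ord0 k : C^o)))) => x.
    by rewrite coefZ coefX linearB !mxE mulrC.
  - by rewrite subrr linear0 mxE scale0r coef0.
rewrite -/(H A); elim/mpolyind: A => [|c m p _ _ IH]; first exact: (Hcst 0).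
apply: Hadd => //; rewrite -mul_mpolyC; apply: (Hmul); first exact: Hcst.
rewrite mpolyXE_id; apply: (big_ind H) => [||i _]; [by rewrite -mpolyC1|exact: Hmul|].
by elim: (m i) => [|j IHj]; rewrite ?expr0 -?mpolyC1 ?exprS //; apply: Hmul.
Qed.

(* Perles' argument: the ideal generated by the [Q k] in [C[x, Y]] is finitely
   generated, so [p = P N] is a combination of the previous [P i = p] with
   coefficients vanishing at 1. *)
Lemma krull_intersection (G : set 'M[C]_n) f :
  (forall k, exists2 Q, bipoly k Q & forall x, G x -> f x = Q x (x - 1%:M)) ->
  exists2 a : 'M[C]_n -> C^o, polymap a /\ a 1%:M = 0 & forall x, G x -> (1 - a x) * f x = 0.
Proof.
move=> H; have /choice [q Hq] : forall k, exists q : {mpoly C[N + N]},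
    exists2 Q, bipoly k Q & (forall x Y, Q x Y = q.@[pair_coord x Y]) /\
    forall x, G x -> f x = Q x (x - 1%:M).
  move=> k; have [Q bQ HQ] := H k; have [q Hq] := bipoly_meval bQ.
  by exists q, Q.
have [M [c Hc]] := ideal_chain q.
have /choice [P HP] : forall i, exists P : 'M[C]_n -> {poly C},
  [/\ forall x (s : C), (c i).@[pair_coord x (s *: (x - 1%:M))] = (P x).[s],
      forall k, polymap (fun x => (P x)`_k : C^o)
    & forall k, (0 < k)%N -> (P 1%:M)`_k = 0] by move=> i; apply: meval_scaled.
exists (fun x => \sum_(i < M) (P i x)`_(M - i)).
  split; first by apply: polymap_sum => i; case: (HP i).
  by rewrite big1 // => i _; case: (HP i) => _ _ -> //; rewrite subn_gt0.
move=> x Gx; have fq k (s : C) : (q k).@[pair_coord x (s *: (x - 1%:M))] = s ^+ k * f x.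
  have [Q bQ [qQ fQ]] := Hq k.
  by rewrite -qQ (bipoly_homog bQ) -fQ.
(* The relation between the generators is evaluated at (x, s (x - 1)), where [q i] takes the value
   s^i f(x); the coefficient of s^M is then compared. *)
have E : f x *: 'X^M = \sum_(i < M) f x *: (P i x * 'X^i).
  apply: poly_eq_nz => s _; rewrite hornerZ hornerXn mulrC -fq Hc meval_sum.
  rewrite horner_sum; apply: eq_bigr => i _; rewrite mevalM fq hornerZ hornerM hornerXn.
  by case: (HP i) => -> _ _; ring.
have := congr1 (fun p : {poly C} => p`_M) E.
rewrite coefZ coefXn eqxx mulr1 coef_sum => E2.
rewrite mulrBl mul1r {1}E2 mulr_suml -sumrB big1 // => i _.
by rewrite coefZ coefMXn ltnNge ltnW //= mulrC subrr.
Qed.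

End Krull.

(** * Functions with vanishing jets on a connected group *)

Section GroupJets.
Variables (C : numClosedFieldType) (n : nat) (G : set 'M[C]_n) (g : {vspace 'M[C]_n}).
Hypothesis G_closed : poly_closed G.
Hypothesis G_1 : G 1%:M.
Hypothesis G_M : forall x y, G x -> G y -> G (x *m y).
Hypothesis G_V : forall x, G x -> G (invmx x).
Hypothesis G_connected : forall A B : set 'M[C]_n, poly_closed A -> poly_closed B ->
  (forall x, G x -> A x \/ B x) -> (forall x, G x -> A x -> B x -> False) ->
  (forall x, G x -> A x) \/ (forall x, G x -> B x).
Hypothesis G_lie : forall X, X \in g <->
  forall f : 'M[C]_n -> C^o, polymap f -> (forall x, G x -> f x = 0) -> der f 1%:M X = 0.

Let G_unit x : G x -> x \in unitmx.
Proof. by move=> Gx; have [I [_ H]] := G_closed; have [/(_ Gx) []] := H x. Qed.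

Section Invariant.
Variable W : vectType C.
Implicit Types (f h : 'M[C]_n -> W).

Lemma lie_der0 f X : polymap f -> (forall x, G x -> f x = 0) -> X \in g -> der f 1%:M X = 0.
Proof.
move=> pf f0 /G_lie gX; rewrite (coord_vbasis (memvf (der f _ _))) big1 // => i _.
have lin : linear (coord (vbasis {:W}) i : W -> C^o) by move=> a u v; rewrite linearP.
rewrite -(der_linear _ _ lin pf) gX ?scale0r // => [|x Gx]; first exact: polymap_linear.
by rewrite f0 // linear0.
Qed.

Lemma DX_mull x y X f : polymap f -> DX X (fun z => f (y *m z)) x = DX X f (y *m x).
Proof.
have lin : linear (mulmx y : 'M[C]_n -> 'M[C]_n) by move=> a u v; rewrite mulmxDr scalemxAr.
move=> pf; rewrite /DX (@der_comp _ _ _ _ (mulmx y)) //; last exact: polymap_of_linear.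
by rewrite (der_of_linear _ _ lin) mulmxA.
Qed.

Lemma polymap_mull y f : polymap f -> polymap (fun z => f (y *m z)).
Proof.
have lin : linear (mulmx y : 'M[C]_n -> 'M[C]_n) by move=> a u v; rewrite mulmxDr scalemxAr.
by apply: polymap_comp; apply: polymap_of_linear.
Qed.

Lemma LX_mulr x y X f : polymap f -> LX X (fun z => f (z *m y)) x = LX X f (x *m y).
Proof.
have lin : linear (mulmx^~ y : 'M[C]_n -> 'M[C]_n) by move=> a u v; rewrite mulmxDl scalemxAl.
move=> pf; rewrite /LX (@der_comp _ _ _ _ (mulmx^~ y)) //; last exact: polymap_of_linear.
by rewrite (der_of_linear _ _ lin) mulmxA.
Qed.

Lemma polymap_mulr y f : polymap f -> polymap (fun z => f (z *m y)).
Proof.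
have lin : linear (mulmx^~ y : 'M[C]_n -> 'M[C]_n) by move=> a u v; rewrite mulmxDl scalemxAl.
by apply: polymap_comp; apply: polymap_of_linear.
Qed.

Lemma DX_vanish f X : polymap f -> (forall x, G x -> f x = 0) -> X \in g ->
  forall x, G x -> DX X f x = 0.
Proof.
move=> pf f0 gX x Gx; rewrite -[x]mulmx1 -DX_mull // /DX mul1mx.
by apply: lie_der0 => //; [apply: polymap_mull|move=> y Gy; apply/f0/G_M].
Qed.

Lemma LX_vanish f X : polymap f -> (forall x, G x -> f x = 0) -> X \in g ->
  forall x, G x -> LX X f x = 0.
Proof.
move=> pf f0 gX x Gx; rewrite -[x]mul1mx -LX_mulr // /LX mulmx1.
by apply: lie_der0 => //; [apply: polymap_mulr|move=> y Gy; apply/f0/G_M].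
Qed.

Lemma DX_eq f h X : polymap f -> polymap h -> (forall x, G x -> f x = h x) -> X \in g ->
  forall x, G x -> DX X f x = DX X h x.
Proof.
move=> pf ph fh gX x Gx; apply/eqP; rewrite -subr_eq0 /DX -der_sub //; apply/eqP.
apply: (@DX_vanish (fun x => f x - h x)) => //; first exact: polymap_sub.
by move=> y Gy; rewrite fh // subrr.
Qed.

Lemma LX_eq f h X : polymap f -> polymap h -> (forall x, G x -> f x = h x) -> X \in g ->
  forall x, G x -> LX X f x = LX X h x.
Proof.
move=> pf ph fh gX x Gx; apply/eqP; rewrite -subr_eq0 /LX -der_sub //; apply/eqP.
apply: (@LX_vanish (fun x => f x - h x)) => //; first exact: polymap_sub.
by move=> y Gy; rewrite fh // subrr.
Qed.

Definition DW (w : seq 'M[C]_n) f := foldr (@DX C n W) f w.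

Definition jet0 f := forall w, {subset w <= g} -> DW w f 1%:M = 0.

Lemma polymap_DW w f : polymap f -> polymap (DW w f).
Proof. by move=> pf; elim: w => //= X w; apply: polymap_DX. Qed.

Lemma DW_add w f h : polymap f -> polymap h ->
  DW w (fun x => f x + h x) = fun x => DW w f x + DW w h x.
Proof.
move=> pf ph; elim: w => //= X w ->; apply/funext => x.
by rewrite /DX der_add //; apply: polymap_DW.
Qed.

Lemma jet0_DX X f : X \in g -> jet0 f -> jet0 (DX X f).
Proof.
move=> gX jf w wg; have := jf (rcons w X); rewrite /DW foldr_rcons; apply=> Y.
by rewrite mem_rcons inE => /orP [/eqP ->|/wg].
Qed.

Lemma jet0_eq f h : polymap f -> polymap h -> (forall x, G x -> f x = h x) -> jet0 f -> jet0 h.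
Proof.
move=> pf ph fh jf w wg; rewrite -(jf w wg).
suff H : forall w, {subset w <= g} -> forall x, G x -> DW w h x = DW w f x by apply: H.
elim=> [|X v IH] vg x Gx /=; first by rewrite fh.
apply: DX_eq => //; try exact: polymap_DW; last by apply/vg/mem_head.
by apply: IH => Y Yv; apply: vg; rewrite inE Yv orbT.
Qed.

End Invariant.

Implicit Types (f h : 'M[C]_n -> C^o).

(** By the Leibniz rule, the functions with zero jets form an ideal, to which Hilbert's theorem can
    be applied. *)
Lemma jet0_mul f h : polymap f -> polymap h -> jet0 f -> jet0 (fun x => h x * f x : C^o).
Proof.
move=> pf ph jf w; elim/last_ind: w f h pf ph jf => [|w X IH] f h pf ph jf wg.
  by rewrite /= (_ : f 1%:M = 0) ?mulr0 //; apply: (jf [::]).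
have gX : X \in g by apply: wg; rewrite mem_rcons mem_head.
rewrite /DW foldr_rcons -/(DW _ _).
have -> : DX X (fun x => h x * f x : C^o) = fun x => DX X h x * f x + h x * DX X f x.
  by apply/funext => x; rewrite /DX der_mul.
rewrite (DW_add w (f := fun x => DX X h x * f x)); last 2 first.
- exact/polymap_mul/pf/polymap_DX.
- exact/polymap_mul/polymap_DX.
have wg' : {subset w <= g} by move=> Y Yw; apply: wg; rewrite mem_rcons inE Yw orbT.
rewrite !IH ?addr0 //; try exact: polymap_DX.
exact: jet0_DX.
Qed.

(** Duality in finite dimension: the differentials at 1 of functions vanishing on [G] form a space
    whose annihilator is [g], hence this space is the whole annihilator of [g]. In the proof, the
    columns of [cokermx] give the vectors of that annihilator. *)
Lemma tangent_functional (th : 'M[C]_n -> C^o) : linear th -> (forall X, X \in g -> th X = 0) ->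
  exists f, [/\ polymap f, forall x, G x -> f x = 0 & forall v, der f 1%:M v = th v].
Proof.
move=> lin_th th0; pose rv (L : 'M[C]_n -> C^o) := \row_k (L (vec_mx (delta_mx 0 k)) : C).
have rvE L v : linear L -> L v = (rv L *m (mxvec v)^T) 0 0.
  move=> linL; rewrite -{1}[v]mxvecK {1}[mxvec v]row_sum_delta linear_sum /=.
  rewrite (big_morph L (linear_hypD linL) (linear_hyp0 linL)) mxE; apply: eq_bigr => k _.
  by rewrite linearZ /= (linear_hypZ linL) !mxE mulrC.
pose D d := exists f, [/\ polymap f, forall x, G x -> f x = 0 & rv (der f 1%:M) = d].
have [||U HU] := @pred_vspace C ('rV[C]_(n * n)) D.
- exists (fun=> 0); split=> //; first exact: PolyCst.
  by apply/rowP => k; rewrite !mxE der_cst.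
- move=> a u v [f [pf f0 <-]] [h [ph h0 <-]]; exists (fun x => a *: f x + h x); split.
  + by apply: PolyAdd => //; apply: polymap_scalec.
  + by move=> x Gx; rewrite f0 // h0 // scaler0 addr0.
  + by apply/rowP => k; rewrite !mxE der_add ?der_scalec //; apply: polymap_scalec.
have [f [pf f0 Ef]] : D (rv th); last first.
  exists f; split=> // v.
  have := rvE _ v (der_lin_dir 1%:M pf); rewrite Ef => ->.
  by rewrite (rvE _ _ lin_th).
apply/HU; pose M := \matrix_(i < \dim U) (vbasis U)`_i.
suff : (rv th <= M)%MS.
  case/submxP => c ->; rewrite mulmx_sum_row memv_suml // => i _.
  by rewrite memvZ // rowK vbasis_mem // mem_nth // size_tuple.
rewrite submxE; apply/eqP/matrixP => i k; rewrite (ord1 i) !mxE.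
pose X := vec_mx (col k (cokermx M))^T : 'M[C]_n.
have gX : X \in g.
  apply/G_lie => f pf f0; have : rv (der f 1%:M) \in U by apply/HU; exists f.
  move/coord_vbasis; rewrite (rvE _ _ (der_lin_dir 1%:M pf)) => ->.
  rewrite vec_mxK trmxK; have -> : \sum_(i0 < \dim U) coord (vbasis U) i0 (rv (der f 1%:M)) *: (vbasis U)`_i0
      = (\row_i coord (vbasis U) i (rv (der f 1%:M))) *m M.
    by rewrite mulmx_sum_row; apply: eq_bigr => j _; rewrite rowK mxE.
  by rewrite -mulmxA colE [M *m _]mulmxA mulmx_coker mul0mx mulmx0 mxE.
have := th0 X gX; rewrite rvE // vec_mxK trmxK => E; rewrite -[RHS]E mxE.
by apply: eq_bigr => j _; rewrite !mxE.
Qed.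

(** Induction on the order at 1. If f has order k on [G], its leading form vanishes on [g], by
    taking k derivatives along X in [g]. By [tangent_functional], x - 1 agrees on [G] with its
    projection to [g] up to second order, so a leading form that vanishes on [g] contributes only to
    order k + 1. *)
Lemma cartier f : polymap f -> jet0 f -> forall k,
  exists2 Q, bipoly k Q & forall x, G x -> f x = Q x (x - 1%:M).
Proof.
move=> pf jf; pose pr : 'M[C]_n -> 'M[C]_n := projv g.
have lin_pr : linear pr by move=> a u v; rewrite /pr linearP.
have /choice [R HR] : forall ij : 'I_n * 'I_n, exists R, bipoly 2 R /\
    forall x, G x -> (x - 1%:M) ij.1 ij.2 = (pr (x - 1%:M)) ij.1 ij.2 + R x (x - 1%:M).
  move=> [i j] /=; have [||h [ph h0 dh]] := @tangent_functional (fun v => (v - pr v) i j).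
  - by move=> a u v; rewrite lin_pr !mxE /GRing.scale /=; ring.
  - by move=> X gX; rewrite /pr projv_id // subrr mxE.
  have [Q bQ HQ] := polymap_taylor2 ph; exists (fun x Y => - 1 * Q x Y); split.
    by apply: bipoly_mulx => //; apply: PolyCst.
  move=> x Gx; have := HQ x; rewrite h0 // h0 // dh add0r mulN1r => /esym/eqP.
  by rewrite addr_eq0 => /eqP <-; rewrite !mxE; ring.
have proj k Q : bipoly k Q -> exists2 Q', bipoly k.+1 Q' & forall x, G x ->
    Q 1%:M (x - 1%:M) = Q 1%:M (pr (x - 1%:M)) + Q' x (x - 1%:M).
  elim=> {k Q} [h ph|k i j Q bQ [Q' bQ' H]|k Q Q' _ [S bS H] _ [S' bS' H']|k].
  - by exists (fun _ _ => 0) => [|x Gx]; [exact: BipZero|rewrite addr0].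
  - have [bR ER] := HR (i, j); exists (fun x Y => R (i, j) x Y * Q 1%:M (pr Y) + Y i j * Q' x Y).
      by apply: BipAdd; [exact: (bipoly_mul bR (bipoly_subst lin_pr bQ))|exact: BipEnt].
    by move=> x Gx; rewrite H // mulrDr {1}(ER x Gx) /=; ring.
  - exists (fun x Y => S x Y + S' x Y) => [|x Gx]; first exact: BipAdd.
    by rewrite H // H' //; ring.
  - by exists (fun _ _ => 0) => [|x Gx]; [exact: BipZero|rewrite addr0].
elim=> [|k [Q bQ HQ]]; first by exists (fun x _ => f x); first exact: BipBase.
have jQ : jet0 (fun x => Q x (x - 1%:M)) by apply: jet0_eq jf => //; apply: bipoly_diag bQ.
have Q0 X : X \in g -> Q 1%:M X = 0.
  move=> gX; have kX : {subset nseq k X <= g} by move=> Y /nseqP [->].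
  have DWn h : DW (nseq k X) h = iter k (DX X) h by elim: (k) => //= l ->.
  have /eqP := jQ _ kX; rewrite DWn (iter_DX_bipoly _ bQ) mulf_eq0 pnatr_eq0.
  by rewrite -[_ == 0%N]negbK -lt0n fact_gt0 /= => /eqP.
have [Q1 bQ1 HQ1] := bipoly_lead bQ; have [Q2 bQ2 HQ2] := proj _ _ bQ.
exists (fun x Y => Q2 x Y + Q1 x Y) => [|x Gx]; first exact: BipAdd.
by rewrite HQ // HQ1 HQ2 // Q0 ?memv_proj // add0r.
Qed.

(** The jet-zero functions vanish wherever a single function [a], with a(1) = 0, differs from 1.
    Translating this neighbourhood of the identity shows that their common zeros in [G] form a set
    that is both open and closed. *)
Theorem jet0_vanish f : polymap f -> jet0 f -> forall x, G x -> f x = 0.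
Proof.
move=> pf jf.
pose ev (p : {mpoly C[n * n]}) : 'M[C]_n -> C^o := fun x => p.@[fun k => mxvec x ord0 k].
have pev p : polymap (ev p) by apply: polymap_meval.
have [|p q Jp Jq|p q Jp|s [sJ Js]] := @hilbert_basis C (n * n) (fun p => jet0 (ev p)).
- move=> w wg; have -> : ev 0 = fun=> 0 by apply/funext => x; rewrite /ev meval0.
  have -> : DW w (fun=> 0 : C^o) = fun=> 0 :> C^o; last by [].
  by elim: w {wg} => //= X w ->; apply/funext => x; rewrite /DX der_cst.
- have -> : ev (p + q) = fun x => ev p x + ev q x by apply/funext => x; rewrite /ev mevalD.
  by move=> w wg; rewrite DW_add // Jp // Jq // addr0.
- have -> : ev (q * p) = fun x => ev q x * ev p x by apply/funext => x; rewrite /ev mevalM.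
  exact: jet0_mul.
(* One multiplier serves all generators of the ideal: 1 - a and 1 - b are multiplied together. *)
have [a [pa a1] Ha] : exists2 a : 'M[C]_n -> C^o, polymap a /\ a 1%:M = 0 &
    forall x, G x -> forall p, p \in s -> (1 - a x) * ev p x = 0.
  elim: s sJ {Js} => [|p s IH] sJ; first by exists (fun=> 0); [split=> //; exact: PolyCst|].
  have [|a [pa a1] Ha] := IH; first by move=> q qs; apply: sJ; rewrite inE qs orbT.
  have [b [pb b1] Hb] := krull_intersection (cartier (pev p) (sJ _ (mem_head _ _))).
  exists (fun x => 1 - (1 - a x) * (1 - b x)).
    split; last by rewrite a1 b1 !subr0 mulr1 subrr.
    by do ![apply: polymap_sub; first exact: PolyCst | apply: polymap_mul | done].
  move=> x Gx q; rewrite opprB addrC subrK inE => /orP [/eqP ->|/(Ha x Gx) E].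
    by rewrite -mulrA Hb // mulr0.
  by rewrite mulrAC E mul0r.
pose A x := G x /\ forall h, polymap h -> jet0 h -> h x = 0.
have A1 : A 1%:M by split=> // h ph jh; exact: (jh [::]).
have AM x y : A x -> A y -> A (x *m y).
  move=> [Gx Hx] [Gy Hy]; split=> [|h ph jh]; first exact: G_M.
  apply: (Hy (fun z => h (x *m z))) => [|w wg]; first exact: polymap_mull.
  have -> : DW w (fun z => h (x *m z)) = fun z => DW w h (x *m z).
    elim: w {wg} => //= X w ->; apply/funext => z.
    by rewrite (@DX_mull _ _ _ _ (DW w h)) //; apply: polymap_DW.
  rewrite mulmx1; apply: Hx => [|v vg]; first exact: polymap_DW.
  rewrite /DW -foldr_cat; apply: jh => Y; rewrite mem_cat => /orP []; [exact: vg|exact: wg].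
have Anbhd x : G x -> a x != 1 -> A x.
  move=> Gx ax; split=> // h ph jh; have [p Hp] := meval_polymap ph.
  have [|c Ec] := Js p; first by rewrite (_ : ev p = h) //; apply/funext => y; rewrite Hp.
  rewrite Hp Ec meval_sum big1 // => i _; rewrite mevalM.
  have /eqP := Ha x Gx s`_i (mem_nth _ (ltn_ord i)).
  rewrite mulf_eq0 subr_eq0 eq_sym (negbTE ax) /= => /eqP E.
  by rewrite (_ : (s`_i).@[_] = 0) ?mulr0.
case: G_closed => I [pI GI].
(* [B] is the complement of [A] in [G], written as a closed set: if a(y^-1 x) differs from 1 for
   some y in [A], then y^-1 x is in [A], and so is x. *)
pose B x := G x /\ forall y, A y -> a (invmx y *m x) = 1.
have [||x Gx|x Gx [_ Ax] [_ Bx]|AG|BG] := @G_connected A B.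
- exists (fun h => I h \/ polymap h /\ jet0 h); split=> [h [/pI //|[] //]|x]; split.
  + by move=> [/GI [xu HI] HJ]; split=> // h [/HI|[ph jh]] //; apply: HJ.
  + move=> [xu H]; split; first by apply/GI; split=> // h Ih; apply: H; left.
    by move=> h ph jh; apply: H; right.
- exists (fun h => I h \/ exists2 y, A y & h = fun x => a (invmx y *m x) - 1).
  split=> [h [/pI //|[y _ ->]]|x].
    by apply: polymap_sub; [apply: polymap_mull|apply: PolyCst].
  split.
  + move=> [/GI [xu HI] HJ]; split=> // h [/HI|[y Ay ->]] //.
    by rewrite HJ // subrr.
  + move=> [xu H]; split; first by apply/GI; split=> // h Ih; apply: H; left.
    move=> y Ay; apply/eqP; rewrite -subr_eq0; apply/eqP.
    by apply: (H (fun x => a (invmx y *m x) - 1)); right; exists y.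
- have [Ax|nAx] := pselect (A x); [by left|right; split=> // y Ay].
  apply/eqP/negPn/negP => ne; apply: nAx.
  have Gy : G y by case: Ay.
  rewrite -[x](mulKVmx (G_unit Gy)); apply: AM => //; apply: Anbhd => //.
  by apply: G_M => //; apply: G_V.
- have Axx : A x by [].
  by have /eqP := Bx x Axx; rewrite mulVmx ?G_unit // a1 eq_sym oner_eq0.
- by move=> x Gx; case: (AG x Gx) => _; apply.
- by have [_ /(_ _ A1)/eqP] := BG _ G_1; rewrite invmx1 mulmx1 a1 eq_sym oner_eq0.
Qed.

End GroupJets.

Section Det.
Variables (C : numClosedFieldType) (n : nat).

Lemma polymap_prod (I : Type) (r : seq I) (F : I -> 'M[C]_n -> C^o) :
  (forall i, polymap (F i)) -> polymap (fun x => \prod_(i <- r) (F i x : C) : C^o).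
Proof.
move=> pF; elim: r => [|i r IH].
  by apply: polymap_ext (PolyCst _ (1 : C^o)) => x; rewrite big_nil.
by apply: polymap_ext (polymap_mul (pF i) IH) => x; rewrite big_cons.
Qed.

Lemma polymap_mulc (c : C) (f : 'M[C]_n -> C^o) : polymap f -> polymap (fun x => c * (f x : C) : C^o).
Proof. exact: polymap_scalec. Qed.

Lemma polymap_mxentry (p q : nat) (F : 'M[C]_n -> 'M[C]_(p, q)) i j :
  polymap F -> polymap (fun x => F x i j : C^o).
Proof.
by apply: (polymap_linear (L := fun y : 'M[C]_(p, q) => y i j : C^o)) => a u v; rewrite !mxE.
Qed.

Lemma der_mxentry (p q : nat) (F : 'M[C]_n -> 'M[C]_(p, q)) i j x v :
  polymap F -> der (fun x => F x i j : C^o) x v = der F x v i j.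
Proof.
by apply: (der_linear _ _ (L := fun y : 'M[C]_(p, q) => y i j : C^o)) => a u w; rewrite !mxE.
Qed.

Lemma polymap_mx (p q : nat) (F : 'M[C]_n -> 'M[C]_(p, q)) :
  (forall i j, polymap (fun x => F x i j : C^o)) -> polymap F.
Proof.
move=> pF; suff : polymap (fun x => \sum_i \sum_j (F x i j : C) *: (delta_mx i j : 'M[C]_(p, q))).
  by apply: polymap_ext => x; rewrite -matrix_sum_delta.
apply: polymap_sum => i; apply: polymap_sum => j; apply: (polymap_scale (pF i j)).
exact: PolyCst.
Qed.

Lemma polymap_det k (F : 'M[C]_n -> 'M[C]_k) : polymap F -> polymap (fun x => \det (F x) : C^o).
Proof.
move=> pF; apply: polymap_sum => s; apply: polymap_mulc; by apply: polymap_prod => i; apply: polymap_mxentry.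
Qed.

Lemma polymap_adj (F : 'M[C]_n -> 'M[C]_n) : polymap F -> polymap (fun x => \adj (F x)).
Proof.
move=> pF; apply: polymap_mx => i j.
apply: (@polymap_ext _ _ _ (fun x => (-1) ^+ (j + i) * \det (row' j (col' i (F x))) : C^o)).
  by move=> x; rewrite mxE.
apply: polymap_mulc; apply: polymap_det; apply: (polymap_linear (L := fun y : 'M[C]_n => row' j (col' i y))) => //.
by move=> a u v; apply/matrixP => b d; rewrite !mxE.
Qed.

Lemma det_line k (A B : 'M[C]_k) : exists p : {poly C}, forall e, \det (A + e *: B) = p.[e].
Proof.
exists (\det (map_mx polyC A + 'X *: map_mx polyC B)) => e.
rewrite -[RHS]/(horner_eval e _) -det_map_mx; congr (\det _).
apply/matrixP => i j; rewrite !mxE /= /horner_eval.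
by rewrite hornerD hornerM hornerX !hornerC.
Qed.

Definition translation_family (K : finType) (f : K -> 'M[C]_n -> C^o) c :=
  [/\ forall i, polymap (f i), forall i k, polymap (c i k : 'M[C]_n -> C^o)
    & forall i x y, f i (x *m y) = \sum_k c i k y * f k x].

(** Local finiteness of the translation action: all translates of a polynomial map lie in one
    finite-dimensional space, with coefficients polynomial in the translating element. *)
Lemma translation_closed (a : 'M[C]_n -> C^o) : polymap a ->
  exists (K : finType) f c (v : K -> C), translation_family f c /\ forall x, a x = \sum_k v k * f k x.
Proof.
elim=> [w|i j a' pa' [K [f [c [v [[pf pc fc] av]]]]]
  |a1 a2 pa1 [K [f [c [v [[pf pc fc] av]]]]] pa2 [K' [f' [c' [v' [[pf' pc' fc'] av']]]]]].
- exists unit, (fun _ _ => 1), (fun _ _ _ => 1), (fun=> w); split; last first.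
    by move=> x; rewrite (big_pred1 tt) ?mulr1 // => -[].
  by split=> *; try exact: PolyCst; rewrite (big_pred1 tt) ?mulr1 // => -[].
- exists ('I_n * K)%type, (fun (lk : 'I_n * K) (x : 'M[C]_n) => x i lk.1 * f lk.2 x),
    (fun (lk bk : 'I_n * K) (y : 'M[C]_n) => y bk.1 lk.1 * c lk.2 bk.2 y),
    (fun lk : 'I_n * K => (lk.1 == j)%:R * v lk.2); split.
  + split=> [[l k]|[l k] [b k']|[l k] x y] /=; try by apply: polymap_mul => //; apply: polymap_entry.
    rewrite fc mxE mulr_suml -(pair_bigA _ (fun b k' => y b l * c k k' y * (x i b * f k' x))) /=.
    apply: eq_bigr => b _; rewrite mulr_sumr; apply: eq_bigr => k' _; ring.
  + move=> x; rewrite -(pair_bigA _ (fun l k => (l == j)%:R * v k * (x i l * f k x))) /=.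
    rewrite (bigD1 j) //= [X in _ + X]big1 ?addr0 => [|l /negbTE lj].
      rewrite av /GRing.scale /= mulr_sumr; by apply: eq_bigr => k _; rewrite eqxx mul1r mulrCA.
    by apply: big1 => k _; rewrite lj !mul0r.
- exists (K + K')%type, (fun k => match k with inl k => f k | inr k => f' k end),
    (fun i k => match i, k with inl i, inl k => c i k | inr i, inr k => c' i k | _, _ => fun=> 0 end),
    (fun k => match k with inl k => v k | inr k => v' k end); split.
  + split=> [[i|i]|[i|i] [k|k]|[i|i] x y] //; try exact: PolyCst.
    * by rewrite big_sumType /= fc [X in _ + X]big1 ?addr0 // => k _; rewrite mul0r.
    * by rewrite big_sumType /= fc' [X in X + _]big1 ?add0r // => k _; rewrite mul0r.
  + by move=> x; rewrite big_sumType /= av av'.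
Qed.

End Det.

(** * Uniqueness theorems for differential equations along the Lie algebra *)

Section Group.
Variables (C : numClosedFieldType) (n : nat).

Record algebraic_lie (G : set 'M[C]_n) (g : {vspace 'M[C]_n}) : Prop := AlgebraicLie {
  al_closed : poly_closed G;
  al_1 : G 1%:M;
  al_M : forall x y, G x -> G y -> G (x *m y);
  al_V : forall x, G x -> G (invmx x);
  al_connected : forall A B : set 'M[C]_n, poly_closed A -> poly_closed B ->
    (forall x, G x -> A x \/ B x) -> (forall x, G x -> A x -> B x -> False) ->
    (forall x, G x -> A x) \/ (forall x, G x -> B x);
  al_lie : forall X, X \in g <->
    forall f : 'M[C]_n -> C^o, polymap f -> (forall x, G x -> f x = 0) -> der f 1%:M X = 0 }.

Variables (G : set 'M[C]_n) (g : {vspace 'M[C]_n}).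
Hypothesis AG : algebraic_lie G g.

Let G_1 := al_1 AG.
Let G_M := al_M AG.
Let G_lie := al_lie AG.

Lemma al_unit x : G x -> x \in unitmx.
Proof. by move=> Gx; have [I [_ H]] := al_closed AG; have [/(_ Gx) []] := H x. Qed.

Definition bra (X Y : 'M[C]_n) := X *m Y - Y *m X.

Lemma lie_bra X Y : X \in g -> Y \in g -> bra X Y \in g.
Proof.
move=> gX gY; apply/G_lie => f pf f0.
have := @DX_comm _ _ _ X Y f 1%:M pf; rewrite mul1mx -/(bra X Y).
have DX0 Z : Z \in g -> forall x, G x -> DX Z f x = 0 by move=> gZ; apply: (DX_vanish G_M G_lie).
rewrite !(DX_vanish G_M G_lie) ?add0r => //; try exact: polymap_DX; by move=> // x; apply: DX0.
Qed.

Section Uniqueness.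
Variable W : vectType C.
Implicit Types f h : 'M[C]_n -> W.

Lemma jet0_vanish_vect f : polymap f -> jet0 g f -> forall x, G x -> f x = 0.
Proof.
move=> pf jf x Gx; rewrite (coord_vbasis (memvf (f x))) big1 // => i _.
have lin : linear (coord (vbasis {:W}) i : W -> C^o) by move=> a u v; rewrite linearP.
case: AG => A1 A2 A3 A4 A5 A6.
rewrite (jet0_vanish A1 A2 A3 A4 A5 A6 (polymap_linear lin pf)) ?scale0r // => w wg.
have -> : DW w (fun x => coord (vbasis {:W}) i (f x) : C^o)
    = fun x => coord (vbasis {:W}) i (DW w f x).
  elim: w {wg} => //= X w ->; apply/funext => y.
  by rewrite /DX (der_linear _ _ lin) //; apply: polymap_DW.
by rewrite jf // linear0.
Qed.

(** The class [Z] plays the role of a homogeneous linear system with zero initial value: since it is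
    stable under the derivations, its members have zero jets. *)
Lemma ode_vanish (Z : ('M[C]_n -> W) -> Prop) :
  (forall f, Z f -> polymap f /\ f 1%:M = 0) ->
  (forall f X, Z f -> X \in g -> exists2 h, Z h & forall x, G x -> DX X f x = h x) ->
  forall f, Z f -> forall x, G x -> f x = 0.
Proof.
move=> Z1 ZD f Zf; have [pf _] := Z1 _ Zf; apply: (jet0_vanish_vect pf) => w wg.
suff [h Zh Eh] : exists2 h, Z h & forall x, G x -> DW w f x = h x.
  by rewrite Eh //; case: (Z1 _ Zh).
elim: w wg => [|X w IH] wg; first by exists f.
have [|h Zh Eh] := IH; first by move=> Y Yw; apply: wg; rewrite inE Yw orbT.
have gX : X \in g by apply/wg/mem_head.
have [h' Zh' Eh'] := ZD h X Zh gX; exists h' => // x Gx /=.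
rewrite -Eh' //; apply: (DX_eq G_M G_lie) => //; first exact: polymap_DW.
by case: (Z1 _ Zh).
Qed.

(** The functions obtained from [Z] by sums and by derivations along [nm] only, up to equality on
    [G]. The point is that derivations along all of [g] do not leave this class. *)
Inductive ordered_word (nm : 'M[C]_n -> Prop) (Z : ('M[C]_n -> W) -> Prop) :
  ('M[C]_n -> W) -> Prop :=
| OrdBase f : Z f -> ordered_word nm Z f
| OrdEq f h : ordered_word nm Z f -> polymap h -> (forall x, G x -> f x = h x) ->
    ordered_word nm Z h
| OrdAdd f h : ordered_word nm Z f -> ordered_word nm Z h -> ordered_word nm Z (fun x => f x + h x)
| OrdDX Y f : nm Y -> ordered_word nm Z f -> ordered_word nm Z (DX Y f).

(* The words in the derivations [DX] are reordered so that those of [nm] come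
   first; at the identity the latter agree with the commuting derivations [LX]. *)
Lemma ode_vanish2 (b nm : 'M[C]_n -> Prop) (Z : ('M[C]_n -> W) -> Prop) :
  (forall X, b X -> X \in g) -> (forall Y, nm Y -> Y \in g) ->
  (forall X, X \in g -> exists B Y, [/\ b B, nm Y & X = B + Y]) ->
  (forall f, Z f -> polymap f /\ f 1%:M = 0) ->
  (forall f X, Z f -> b X -> exists2 h, Z h & forall x, G x -> DX X f x = h x) ->
  (forall f Y, Z f -> nm Y -> exists2 h, Z h & forall x, G x -> LX Y f x = h x) ->
  forall f, Z f -> forall x, G x -> f x = 0.
Proof.
move=> bg ng g_dec Z1 ZD ZL.
have pO f : ordered_word nm Z f -> polymap f.
  elim=> // [h /Z1 [] //|h k _ ph _ pk|Y h _ _]; [exact: PolyAdd|exact: polymap_DX].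
have OB f : ordered_word nm Z f -> forall X, b X -> ordered_word nm Z (DX X f).
  elim=> {f} [f Zf X bX|f h Of IH ph fh X bX|f h Of IH Oh IH' X bX|Y f nY Of IH X bX].
  - have [h Zh Eh] := ZD f X Zf bX.
    apply: (OrdEq (OrdBase nm Zh)) => [|x Gx]; last by rewrite Eh.
    by apply/polymap_DX/(pO _)/OrdBase.
  - apply: (OrdEq (IH X bX)) => [|x Gx]; first exact: polymap_DX.
    by apply: (DX_eq G_M G_lie) => //; [exact: pO|exact: bg].
  - apply: (OrdEq (OrdAdd (IH X bX) (IH' X bX))) => [|x Gx].
      by apply/polymap_DX/pO; apply: OrdAdd.
    by rewrite /DX der_add //; apply: pO.
  - have [B [Y' [bB nY' E]]] := g_dec _ (lie_bra (bg _ bX) (ng _ nY)).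
    apply: (OrdEq (OrdAdd (OrdDX nY (IH X bX)) (OrdAdd (IH B bB) (OrdDX nY' Of)))).
      exact/polymap_DX/polymap_DX/pO.
    move=> x Gx; rewrite (@DX_comm _ _ _ X Y) -/(bra X Y); last exact: pO.
    by rewrite E mulmxDr der_dirD //; apply: pO.
have OD f X : ordered_word nm Z f -> X \in g -> ordered_word nm Z (DX X f).
  move=> Of /g_dec [B [Y [bB nY ->]]].
  apply: (OrdEq (OrdAdd (OB _ Of B bB) (OrdDX nY Of))); first exact/polymap_DX/pO.
  by move=> x Gx; rewrite /DX mulmxDr der_dirD //; apply: pO.
pose LW w f := foldr (@LX C n W) f w.
have pLW w f : polymap f -> polymap (LW w f) by move=> pf; elim: w => //= Y w; apply: polymap_LX.
have LWeq w f h : polymap f -> polymap h -> (forall Y, Y \in w -> nm Y) ->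
    (forall x, G x -> f x = h x) -> forall x, G x -> LW w f x = LW w h x.
  move=> pf ph; elim: w => [|Y w IH] nw fh x Gx //=; first exact: fh.
  apply: (LX_eq G_M G_lie) => //; try exact: pLW; last by apply/ng/nw/mem_head.
  by apply: IH => // Y' Y'w; apply: nw; rewrite inE Y'w orbT.
have O1 f : ordered_word nm Z f -> forall w, (forall Y, Y \in w -> nm Y) -> LW w f 1%:M = 0.
  elim=> {f} [f Zf w nw|f h Of IH ph fh w nw|f h Of IH Oh IH' w nw|Y f nY Of IH w nw].
  - suff [h Zh ->] : exists2 h, Z h & LW w f 1%:M = h 1%:M by case: (Z1 _ Zh).
    suff [h Zh Eh] : exists2 h, Z h & forall x, G x -> LW w f x = h x by exists h; rewrite ?Eh.
    elim: w nw => [|Y w IH] nw; first by exists f.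
    have [|h Zh Eh] := IH; first by move=> Y' Y'w; apply: nw; rewrite inE Y'w orbT.
    have nY : nm Y by apply/nw/mem_head.
    have [h' Zh' Eh'] := ZL h Y Zh nY; exists h' => // x Gx /=; rewrite -Eh' //.
    have [pf _] := Z1 _ Zf; have [ph _] := Z1 _ Zh.
    by apply: (LX_eq G_M G_lie) => //; [exact: pLW|exact: ng].
  - by rewrite -(LWeq w f h) // ?IH //; apply: pO.
  - have -> : LW w (fun x => f x + h x) = fun x => LW w f x + LW w h x.
      elim: w {nw} => //= Y w ->; apply/funext => x; rewrite /LX der_add //.
        exact/pLW/pO.
      exact/pLW/pO.
    by rewrite IH ?IH' ?addr0.
  - have -> : LW w (DX Y f) = DX Y (LW w f).
      elim: w {nw} => //= Y' w ->; apply/funext => x; rewrite DX_LX //.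
      exact/pLW/pO.
    rewrite /DX mul1mx -[Y in der _ _ Y]mulmx1 -/(LX Y _ _).
    by apply: (IH (Y :: w)) => Y'; rewrite inE => /orP [/eqP ->|/nw].
move=> f Zf; have [pf _] := Z1 _ Zf; apply: (jet0_vanish_vect pf) => w wg.
apply: (O1 _ _ [::]) => //.
elim: w wg => [|X w IH] wg /=; first exact: OrdBase.
apply: OD; last by apply/wg/mem_head.
by apply: IH => Y Yw; apply: wg; rewrite inE Yw orbT.
Qed.

End Uniqueness.

Section Perfect.
Hypothesis g_perfect : forall U : {vspace 'M[C]_n},
  (forall X Y, X \in g -> Y \in g -> bra X Y \in U) -> (g <= U)%VS.

(** The eigenvalue of a bracket is the commutator of two scalars, hence 0; as brackets span [g], all
    derivatives of [f] vanish on [G]. *)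
Lemma character_trivial (f : 'M[C]_n -> C^o) : polymap f ->
  (forall X, X \in g -> exists c : C, forall x, G x -> DX X f x = c * f x) ->
  forall x, G x -> f x = f 1%:M.
Proof.
move=> pf H; pose P X := X \in g /\ forall x, G x -> DX X f x = 0.
have [||U HU] := @pred_vspace C _ P.
- by split=> [|x Gx]; rewrite ?mem0v // /DX mulmx0 der_dir0.
- move=> a X Y [gX HX] [gY HY]; split=> [|x Gx]; first by rewrite memvD ?memvZ.
  rewrite /DX mulmxDr -scalemxAr der_dirD // der_dirZ // -/(DX X f x) HX // scaler0 add0r; exact: HY.
have gU : (g <= U)%VS.
  apply: g_perfect => X Y gX gY; apply/HU; split=> [|x Gx]; first exact: lie_bra.
  have [c Hc] := H X gX; have [d Hd] := H Y gY.
  have E Z Z' (a b : C) : Z \in g -> Z' \in g -> (forall x, G x -> DX Z f x = a * f x) ->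
      (forall x, G x -> DX Z' f x = b * f x) -> DX Z (DX Z' f) x = a * b * f x.
    move=> gZ gZ' Ha Hb; rewrite (DX_eq G_M G_lie (h := fun x => b *: f x)) //.
    + by rewrite /DX der_scalec // -/(DX Z f x) Ha // /GRing.scale /=; ring.
    + exact: polymap_DX.
    + exact: polymap_scalec.
  have := DX_comm X Y x pf; rewrite (E X Y c d) // (E Y X d c) // [d * c]mulrC => /eqP.
  by rewrite -subr_eq0 opprD addNKr oppr_eq0 => /eqP.
move=> x Gx; apply/eqP; rewrite -subr_eq0; apply/eqP.
pose Z (h : 'M[C]_n -> C^o) := polymap h /\ h 1%:M = 0 /\ forall X, X \in g -> forall x, G x -> DX X h x = 0.
pose fh y : C^o := f y - f 1%:M; suff : fh x = 0 by [].
apply: (@ode_vanish C^o (fun h => Z h \/ h = fun=> 0)) => //.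
- by move=> h [[ph [h1 _]]|->]; split=> //; apply: PolyCst.
- move=> h X [[ph [_ h0]]|->] gX; exists (fun=> 0); [by right|exact: h0|by right|].
  by move=> y _; rewrite /DX der_cst.
left; split; first by apply: polymap_sub => //; apply: PolyCst.
split=> [|X gX y Gy]; first exact: subrr.
rewrite /DX /fh der_sub ?der_cst ?subr0 //; last exact: PolyCst.
by have /(subvP gU)/HU [_] := gX; apply.
Qed.

(** The determinant is an eigenfunction of each [DX X]. This is what removes the denominators of
    regular functions and makes the inverse the polynomial map [\adj]. *)
Lemma al_det x : G x -> \det x = 1.
Proof.
move=> Gx; rewrite -(det1 C n).
apply: (@character_trivial (fun x => \det x)) => //; first exact/polymap_det/polymap_id.
move=> X gX; have [p Hp] := det_line 1%:M X; exists p`_1 => y _.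
rewrite /DX (@der_poly _ _ _ _ _ (\det y *: p)) => [|e]; first by rewrite coefZ mulrC.
by rewrite hornerZ -Hp -det_mulmx mulmxDr mulmx1 -scalemxAr.
Qed.

Lemma al_inv x : G x -> invmx x = \adj x.
Proof. by move=> Gx; rewrite /invmx al_unit // al_det // invr1 scale1r. Qed.

(* The right translates of [a] by [G] stay in the [g]-stable ideal [D], and the
   Hopf identity [a (x x^-1) = a 1] writes 1 as a combination of them. *)
Lemma stable_ideal_unit (D : ('M[C]_n -> C^o) -> Prop) a :
  (forall f, D f -> polymap f) -> D (fun=> 0) ->
  (forall f h, D f -> D h -> D (fun x => f x + h x)) ->
  (forall f h, polymap h -> D f -> D (fun x => h x * f x)) ->
  (forall f X, X \in g -> D f -> D (DX X f)) ->
  D a -> a 1%:M = 1 ->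
  exists2 q, D q & forall x, G x -> q x = 1.
Proof.
move=> Dp D0 DD DM DDX Da a1.
have DS (I : Type) (r : seq I) F : (forall i, D (F i)) -> D (fun x => \sum_(i <- r) F i x).
  move=> DF; elim: r => [|i r IH].
    by rewrite (_ : (fun x => _) = fun=> 0) //; apply/funext => x; rewrite big_nil.
  rewrite (_ : (fun x => _) = fun x => F i x + \sum_(i <- r) F i x); first exact: DD.
  by apply/funext => x; rewrite big_cons.
have [K [f [c [v [[pf pc fc] av]]]]] := translation_closed (Dp _ Da).
pose comb (u : {ffun K -> C^o}) x : C^o := \sum_k u k * f k x.
have [||V HV] := @pred_vspace C {ffun K -> C^o} (fun u => D (comb u)).
- by rewrite (_ : comb 0 = fun=> 0) //; apply/funext => x; rewrite /comb big1 // => k _; rewrite ffunE mul0r.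
- move=> b u u' Du Du'; rewrite (_ : comb _ = fun x => b * comb u x + comb u' x).
    by apply: DD => //; apply: (DM _ (fun=> b)) => //; apply: PolyCst.
  apply/funext => x; rewrite /comb mulr_sumr -big_split; apply: eq_bigr => k _ /=.
  by rewrite !ffunE /GRing.scale /=; ring.
pose vv (y : 'M[C]_n) : {ffun K -> C^o} := [ffun k => \sum_i v i * c i k y].
have pvv : polymap vv.
  pose dl k : {ffun K -> C^o} := [ffun l => (l == k)%:R].
  apply: (@polymap_ext _ _ _ (fun y => \sum_k (\sum_i v i * c i k y) *: dl k)).
    move=> y; apply/ffunP => k; rewrite sum_ffunE [RHS]ffunE (bigD1 k) //= [X in _ + X]big1 ?addr0.
      by rewrite !ffunE eqxx; apply: mulr1.
    by move=> l lk; rewrite !ffunE eq_sym (negbTE lk); apply: mulr0.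
  apply: polymap_sum => k; apply: (@polymap_scale _ _ _ (fun y => \sum_i v i * c i k y)).
    by apply: polymap_sum => i; apply: (@polymap_mul _ _ (fun=> v i)) => //; apply: PolyCst.
  exact: PolyCst.
have a_vv x y : a (x *m y) = comb (vv y) x.
  rewrite av /comb; under eq_bigr do rewrite fc mulr_sumr.
  rewrite exchange_big /=; apply: eq_bigr => k _; rewrite ffunE mulr_suml.
  by apply: eq_bigr => i _; rewrite mulrA.
have comb_lin x : linear (fun u => comb u x).
  move=> b u u'; rewrite /comb scaler_sumr -big_split; apply: eq_bigr => k _ /=.
  by rewrite !ffunE /GRing.scale /=; ring.
(* Modulo [V] the map [vv] has zero jets: its derivatives at 1 are coefficient vectors of the
   functions [DW w a], which belong to the stable ideal [D]. *)
have VG y : G y -> vv y \in V.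
  move=> Gy; pose L (u : {ffun K -> C^o}) := u - projv V u.
  have linL : linear L by move=> b u u'; rewrite /L linearP opprD scalerBr addrACA.
  have : L (vv y) = 0.
    apply: (@jet0_vanish_vect _ (fun y => L (vv y))) => // [|w wg]; first exact: polymap_linear.
    have -> : DW w (fun y => L (vv y)) = fun y => L (DW w vv y).
      elim: w {wg} => //= X w ->; apply/funext => z; rewrite /DX (der_linear _ _ linL) //.
      exact: polymap_DW.
    rewrite /L projv_id ?subrr //; apply/HV.
    have E x z : DW w a (x *m z) = comb (DW w vv z) x.
      elim: w {wg} z => [|X w IH] z; first exact: a_vv.
      rewrite /= -DX_mull; last by apply/polymap_DW/Dp.
      rewrite (_ : (fun z => _) = fun z => comb (DW w vv z) x); last exact/funext.
      by rewrite /DX (der_linear _ _ (comb_lin x)) //; apply: polymap_DW.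
    rewrite (_ : comb _ = DW w a); last by apply/funext => x; rewrite -E mulmx1.
    elim: w wg {E} => //= X w IH wg; apply: DDX; first by apply/wg/mem_head.
    by apply: IH => Y Yw; apply: wg; rewrite inE Yw orbT.
  by move/eqP; rewrite subr_eq0 => /eqP ->; apply: memv_proj.
pose t i (y : 'M[C]_n) : C^o := coord (vbasis V) i (vv y).
(* This is a(x x^-1) with the translate of [a] by x^-1 expanded in a basis of [V]. *)
pose q x : C^o := \sum_i t i (\adj x) * comb (vbasis V)`_i x.
exists q => [|x Gx].
  apply: DS => i; apply: DM; last by apply/HV/vbasis_mem/mem_nth; rewrite size_tuple.
  apply: (@polymap_comp _ _ _ _ (fun x : 'M[C]_n => \adj x)); first exact/polymap_adj/polymap_id.
  apply: (polymap_linear (L := coord (vbasis V) i : {ffun K -> C^o} -> C^o)) => // b u u'.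
  by rewrite linearP.
rewrite -a1 -(mulmxV (al_unit Gx)) a_vv (coord_vbasis (VG _ (al_V AG Gx))).
rewrite (big_morph _ (linear_hypD (comb_lin x)) (linear_hyp0 (comb_lin x))).
by apply: eq_bigr => i _; rewrite (linear_hypZ (comb_lin x)) al_inv.
Qed.

End Perfect.
End Group.

(** * Tori *)

Section Laurent.
Variable C : numClosedFieldType.

(* [f] is a Laurent polynomial function on C^* with derivative [d] at 1. *)
Definition lder (f : C -> C) d := exists (p : {poly C}) (k : nat),
  (forall y, y != 0 -> f y = p.[y] / y ^+ k) /\ d = p^`().[1] - k%:R * p.[1].

Definition laurent f := exists d, lder f d.

Lemma lder_ext f h d : (forall y, y != 0 -> f y = h y) -> lder f d -> lder h d.
Proof. by move=> fh [p [k [Hp ->]]]; exists p, k; split=> // y y0; rewrite -fh ?Hp. Qed.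

Lemma lder_uniq f h d d' : lder f d -> lder h d' -> (forall y, y != 0 -> f y = h y) -> d = d'.
Proof.
move=> [p [k [Hp ->]]] [q [l [Hq ->]]] fh.
have E : p * 'X^l = q * 'X^k.
  apply: poly_eq_nz => y y0; rewrite !hornerM !hornerXn.
  have /eqP := fh y y0; rewrite Hp // Hq // eqr_div ?expf_neq0 // => /eqP.
  by [].
have E1 := congr1 (fun p : {poly C} => p.[1]) E.
have := congr1 (fun p : {poly C} => p^`().[1]) E.
move: E1; rewrite !derivM !derivXn !hornerE !hornerMn !hornerXn /= !expr1n !mulr1 => E1.
rewrite E1 => /eqP; rewrite -subr_eq0 => /eqP E2.
by apply/eqP; rewrite -subr_eq0 -E2; apply/eqP; ring.
Qed.

Lemma lder_cst a : lder (fun=> a) 0.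
Proof.
exists a%:P, 0%N; split=> [y _|]; first by rewrite hornerC divr1.
by rewrite derivC horner0 mul0r subrr.
Qed.

Lemma lder_add f h d e : lder f d -> lder h e -> lder (fun y => f y + h y) (d + e).
Proof.
move=> [p [k [Hp ->]]] [q [l [Hq ->]]]; exists (p * 'X^l + q * 'X^k), (k + l)%N; split.
  move=> y y0; rewrite Hp // Hq // hornerD !hornerM !hornerXn exprD.
  by field; rewrite !expf_neq0.
rewrite derivD !derivM !derivXn !hornerE !hornerMn !hornerXn /= !expr1n natrD.
ring.
Qed.

Lemma lder_mul f h d e : lder f d -> lder h e ->
  lder (fun y => f y * h y) (d * h 1 + f 1 * e).
Proof.
move=> [p [k [Hp ->]]] [q [l [Hq ->]]]; exists (p * q), (k + l)%N; split.
  by move=> y y0; rewrite Hp // Hq // hornerM exprD mulrACA invfM.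
rewrite Hp ?oner_eq0 // Hq ?oner_eq0 // !expr1n !divr1 derivM hornerD !hornerM natrD; ring.
Qed.

Lemma lder_exprz (a : int) : lder (fun y => y ^ a) a%:~R.
Proof.
case: a => m; last first.
  exists 1%:P, m.+1; split=> [y _|]; first by rewrite hornerC mul1r.
  by rewrite derivC horner0 hornerC mulr1 NegzE add0r mulrNz.
exists 'X^m, 0%N; split=> [y _|]; first by rewrite hornerXn divr1.
by rewrite derivXn hornerMn hornerXn expr1n mul0r subr0.
Qed.

Lemma lder_sum (I : Type) (r : seq I) F D : (forall i, lder (F i) (D i)) ->
  lder (fun y => \sum_(i <- r) F i y) (\sum_(i <- r) D i).
Proof.
move=> H; elim: r => [|i r IH].
  rewrite big_nil; apply: lder_ext (lder_cst 0) => y _; by rewrite big_nil.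
rewrite big_cons; apply: lder_ext (lder_add (H i) IH) => y _; by rewrite big_cons.
Qed.

Lemma lder_mulc a f d : lder f d -> lder (fun y => a * f y) (a * d).
Proof. by move=> Hf; have := lder_mul (lder_cst a) Hf; rewrite mul0r add0r. Qed.

Lemma lder_polymap n (F : 'M[C]_n -> C^o) (M : C -> 'M[C]_n) (D : 'M[C]_n) :
  polymap F -> (forall i j, lder (fun y => M y i j) (D i j)) ->
  lder (fun y => F (M y)) (der F (M 1) D).
Proof.
move=> pF HM; elim: pF => [w|i j f pf IH|f h pf IH ph IH'].
- by rewrite der_cst; apply: lder_cst.
- by rewrite der_ent //; apply: lder_mul.
- by rewrite der_add //; apply: lder_add.
Qed.

Lemma polymap_line n (F : 'M[C]_n -> C^o) x v : polymap F ->
  exists p : {poly C}, forall e, F (x + e *: v) = p.[e].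
Proof.
elim=> [w|i j f pf [p Hp]|f h pf [p Hp] ph [q Hq]].
- by exists w%:P => e; rewrite hornerC.
- by exists (((x i j)%:P + 'X * (v i j)%:P) * p) => e; rewrite !hornerE -Hp !mxE.
- by exists (p + q) => e; rewrite hornerD -Hp -Hq.
Qed.

Lemma laurent_monomial_mem (I : finType) (a : int) (b : I -> int) (c : I -> C) :
  (forall y, y != 0 -> y ^ a = \sum_i c i * y ^ b i) -> exists i, b i = a.
Proof.
move=> H; apply: contrapT => nb.
pose K := (`|a|%N + \sum_i `|b i|%N)%N.
have shift (d : int) : (`|d| <= K)%N -> exists m : nat, d + K%:Z = m%:Z.
  by move=> dK; exists `|(d + K%:Z)%R|%N; lia.
have [m Hm] : exists m : nat, a + K%:Z = m%:Z by apply: shift; rewrite leq_addr.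
have /choice [k Hk] : forall i, exists m : nat, b i + K%:Z = m%:Z.
  move=> i; apply: shift; rewrite /K (bigD1 i) //=; lia.
have E : 'X^m = \sum_i c i *: 'X^(k i) :> {poly C}.
  apply: poly_eq_nz => y y0; rewrite hornerXn horner_sum exprnP -Hm expfzDr // H //.
  rewrite mulr_suml; apply: eq_bigr => i _.
  by rewrite hornerZ hornerXn -mulrA -expfzDr // Hk exprnP.
have := congr1 (fun p : {poly C} => p`_m) E.
rewrite coefXn eqxx coef_sum big1 => [/eqP|i _]; first by rewrite oner_eq0.
rewrite coefZ coefXn; case: eqP => [mk|]; last by rewrite mulr0.
by case: nb; exists i; have := Hk i; rewrite -mk -Hm => /addIr.
Qed.

Section OneParameter.
Variables (N : nat) (R : C -> 'M[C]_N).
Hypothesis R_laurent : forall i j, laurent (fun y => R y i j).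
Hypothesis R_mul : forall x y, x != 0 -> y != 0 -> R (x * y) = R x *m R y.
Hypothesis R_1 : R 1 = 1%:M.

(** Comparing the coefficients of x and y in R(x y) = R(x) R(y) shows that the coefficient matrices
    of [R] are orthogonal idempotents. The exponent [K] clears the denominators of all entries. *)
Lemma one_parameter_idempotents : exists K L (E : nat -> 'M[C]_N),
  [/\ forall y, y != 0 -> y ^+ K *: R y = \sum_(l < L) y ^+ l *: E l,
      forall l l', (l < L)%N -> (l' < L)%N -> E l *m E l' = if l == l' then E l else 0
    & \sum_(l < L) E l = 1%:M].
Proof.
have /choice [p Hp] : forall ij : 'I_N * 'I_N, exists p : {poly C}, exists k : nat,
    forall y, y != 0 -> R y ij.1 ij.2 = p.[y] / y ^+ k.
  by move=> [i j]; have [d [p [k [Hp _]]]] := R_laurent i j; exists p, k.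
have [k Hk] := choice Hp.
pose K := (\sum_ij k ij)%N; pose P ij := p ij * 'X^(K - k ij).
pose L := (\sum_ij size (P ij))%N; pose E l := \matrix_(i, j) (P (i, j))`_l.
have HE y : y != 0 -> y ^+ K *: R y = \sum_(l < L) y ^+ l *: E l.
  move=> y0; apply/matrixP => i j; rewrite mxE summxE (Hk (i, j)) //=.
  have lekK : (k (i, j) <= K)%N by rewrite /K (bigD1 (i, j)) //= leq_addr.
  transitivity (P (i, j)).[y].
    rewrite /P hornerM hornerXn -{1}(subnK lekK) exprD; field; exact: expf_neq0.
  have leL : (size (P (i, j)) <= L)%N by rewrite /L (bigD1 (i, j)) //= leq_addr.
  rewrite (horner_coef_wide _ leL).
  by apply: eq_bigr => l _; rewrite !mxE mulrC.
have H1 x y : x != 0 -> y != 0 ->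
    \sum_(l < L) x ^+ l *: (y ^+ l *: E l - E l *m \sum_(l' < L) y ^+ l' *: E l') = 0.
  move=> x0 y0; under eq_bigr => l _ do rewrite scalerBr scalerA -exprMn scalemxAl.
  rewrite sumrB -mulmx_suml -!HE ?mulf_neq0 // R_mul // -scalemxAl -scalemxAr scalerA -exprMn.
  by rewrite subrr.
have H2 y l : y != 0 -> (l < L)%N -> y ^+ l *: E l = E l *m \sum_(l' < L) y ^+ l' *: E l'.
  move=> y0 lL; apply/eqP; rewrite -subr_eq0; apply/eqP.
  by apply: (vect_poly_eq0 (c := fun l => y ^+ l *: E l - E l *m _) _ lL) => x x0; apply: H1.
exists K, L, E; split=> // [l l' lL l'L|].
  have H3 y : y != 0 -> \sum_(m < L) y ^+ m *: ((if m == l :> nat then E l else 0) - E l *m E m) = 0.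
    move=> y0; under eq_bigr do rewrite scalerBr scalemxAr.
    rewrite sumrB -mulmx_sumr -H2 // (bigD1 (Ordinal lL)) //= eqxx big1 ?addr0 ?subrr // => m.
    by rewrite -val_eqE /= => /negbTE ->; rewrite scaler0.
  have /eqP := vect_poly_eq0 (c := fun m => (if m == l then E l else 0) - E l *m E m) H3 l'L.
  by rewrite subr_eq0 eq_sym eq_sym [l' == l]eq_sym => /eqP.
have := HE 1 (oner_neq0 _); rewrite expr1n scale1r R_1 => ->.
by apply: eq_bigr => l _; rewrite expr1n scale1r.
Qed.

End OneParameter.

Section Weights.
Variable r : nat.

Definition nzv (z : 'I_r -> C) := forall j, z j != 0.
Definition evec (j : 'I_r) (y : C) : 'I_r -> C := fun k => if k == j then y else 1.
Definition mono (w : 'I_r -> int) (z : 'I_r -> C) := \prod_j z j ^ w j.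

Lemma nzv_evec j y : y != 0 -> nzv (evec j y).
Proof. by move=> y0 k; rewrite /evec; case: ifP; rewrite ?oner_eq0. Qed.

Lemma nzv1 : nzv (fun=> 1). Proof. by move=> j; apply: oner_neq0. Qed.

Lemma nzvM z z' : nzv z -> nzv z' -> nzv (fun j => z j * z' j).
Proof. by move=> Hz Hz' j; rewrite mulf_neq0. Qed.

Lemma mono_evec w j y : mono w (evec j y) = y ^ w j.
Proof.
rewrite /mono (bigD1 j) //= big1 ?mulr1 => [|k /negbTE kj]; first by rewrite /evec eqxx.
by rewrite /evec kj exp1rz.
Qed.

Lemma mono_neq0 w z : nzv z -> mono w z != 0.
Proof. by move=> Hz; apply/prodf_neq0 => j _; rewrite expfz_neq0. Qed.

Lemma monoM w z z' : mono w (fun j => z j * z' j) = mono w z * mono w z'.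
Proof. by rewrite /mono -big_split; apply: eq_bigr => j _; rewrite /= expfzMl. Qed.

Lemma monoD w w' z : nzv z -> mono (fun j => w j + w' j) z = mono w z * mono w' z.
Proof. by move=> Hz; rewrite /mono -big_split; apply: eq_bigr => j _; rewrite /= expfzDr. Qed.

Section Simultaneous.
Variables (N : nat) (R : ('I_r -> C) -> 'M[C]_N).
Hypothesis R_laurent : forall k i j, laurent (fun y => R (evec k y) i j).
Hypothesis R_mul : forall z z', nzv z -> nzv z' -> R (fun j => z j * z' j) = R z *m R z'.
Hypothesis R_1 : R (fun=> 1) = 1%:M.

(** The idempotents of the coordinate one-parameter groups commute with each other, hence have a
    common eigenbasis. A basis vector lies in the image of exactly one idempotent per coordinate,
    whose index, shifted by [K], is its exponent. *)
Theorem simultaneous_weights : exists (Q : 'M[C]_N) (w : 'I_N -> 'I_r -> int),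
  Q \in unitmx /\ forall z, nzv z -> R z *m Q = Q *m diag_mx (\row_i mono (w i) z).
Proof.
case: N R R_laurent R_mul R_1 => [|m] R' Rl Rm R1.
  by exists 1%:M, (fun _ _ => 0); split; [exact: unitmx1|move=> z _; apply/matrixP => -[]].
have /choice [KLE HKLE] : forall k, exists KLE : nat * nat * (nat -> 'M[C]_m.+1),
  [/\ forall y, y != 0 -> y ^+ KLE.1.1 *: R' (evec k y) = \sum_(l < KLE.1.2) y ^+ l *: KLE.2 l,
      forall l l', (l < KLE.1.2)%N -> (l' < KLE.1.2)%N ->
        KLE.2 l *m KLE.2 l' = if l == l' then KLE.2 l else 0
    & \sum_(l < KLE.1.2) KLE.2 l = 1%:M].
  move=> k; have [||K [L [E H]]] := @one_parameter_idempotents m.+1 (fun y => R' (evec k y)) (Rl k).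
  - move=> x y x0 y0; rewrite -Rm; try exact: nzv_evec.
    by congr R'; apply/funext => j; rewrite /evec; case: ifP; rewrite ?mulr1.
  - by rewrite -R1; congr R'; apply/funext => j; rewrite /evec if_same.
  by exists (K, L, E).
pose K k := (KLE k).1.1; pose L k := (KLE k).1.2; pose E k := (KLE k).2.
have HE k y : y != 0 -> y ^+ K k *: R' (evec k y) = \sum_(l < L k) y ^+ l *: E k l.
  by case: (HKLE k) => H _ _; apply: H.
have EE k l l' : (l < L k)%N -> (l' < L k)%N -> E k l *m E k l' = if l == l' then E k l else 0.
  by case: (HKLE k) => _ H _; apply: H.
have E1 k : \sum_(l < L k) E k l = 1%:M by case: (HKLE k).
have Rcomm z z' : nzv z -> nzv z' -> R' z *m R' z' = R' z' *m R' z.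
  by move=> Hz Hz'; rewrite -!Rm //; congr R'; apply/funext => j; rewrite mulrC.
have Ecomm k k' l l' : (l < L k)%N -> (l' < L k')%N -> E k l *m E k' l' = E k' l' *m E k l.
  move=> lL l'L; apply/eqP; rewrite -subr_eq0; apply/eqP.
  apply: (vect_poly_eq0 (c := fun l' => E k l *m E k' l' - E k' l' *m E k l) _ l'L) => y' y'0.
  under eq_bigr => m' _ do rewrite scalerBr [_ *: (E k l *m _)]scalemxAr [_ *: (_ *m E k l)]scalemxAl.
  rewrite sumrB -mulmx_sumr -mulmx_suml -HE // -scalemxAr -scalemxAl -scalerBr.
  suff -> : E k l *m R' (evec k' y') - R' (evec k' y') *m E k l = 0 by rewrite scaler0.
  apply: (vect_poly_eq0 (c := fun l => E k l *m R' (evec k' y') - R' (evec k' y') *m E k l) _ lL) => y y0.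
  under eq_bigr => m' _ do rewrite scalerBr [_ *: (E k _ *m _)]scalemxAl [_ *: (_ *m E k _)]scalemxAr.
  rewrite sumrB -mulmx_suml -mulmx_sumr -HE // -scalemxAl -scalemxAr Rcomm ?subrr //; exact: nzv_evec.
(* One operator per coordinate, with distinct eigenvalues on the images of the idempotents, so that
   finitely many commuting matrices are to be diagonalised. *)
pose M k := \sum_(l < L k) l%:R *: E k l.
have EM k l : (l < L k)%N -> E k l *m M k = l%:R *: E k l.
  move=> lL; rewrite /M mulmx_sumr (bigD1 (Ordinal lL)) //= -scalemxAr EE // eqxx.
  rewrite big1 ?addr0 // => l' ne; rewrite -scalemxAr EE ?ltn_ord // eq_sym.
  by move: ne; rewrite -val_eqE /= => /negbTE ->; rewrite scaler0.
have ME k l : (l < L k)%N -> M k *m E k l = l%:R *: E k l.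
  move=> lL; rewrite -EM // /M mulmx_sumr mulmx_suml; apply: eq_bigr => l' _.
  by rewrite -scalemxAl -scalemxAr Ecomm.
have Mdiag k : diagonalizable (M k).
  apply/diagonalizableP; exists [seq l%:R | l <- iota 0 (L k)].
    by rewrite map_inj_uniq ?iota_uniq // => i j /eqP; rewrite eqr_nat => /eqP.
  apply: mxminpoly_min; rewrite rmorph_prod /=.
  have H s : (forall l, l \in s -> (l < L k)%N) -> forall l, (l < L k)%N ->
      (\prod_(x <- [seq l%:R | l <- s]) horner_mx (M k) ('X - x%:P)) *m E k l
      = (\prod_(x <- s) (l%:R - x%:R)) *: E k l.
    elim: s => [|x s IH] sL l lL; first by rewrite !big_nil mul1mx scale1r.
    rewrite map_cons !big_cons -mulmxE -mulmxA IH // => [|x' x's]; last by rewrite sL // inE x's orbT.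
    rewrite -scalemxAr rmorphB /= horner_mx_X horner_mx_C mulmxBl ME // mul_scalar_mx.
    by rewrite -scalerBl scalerA mulrC.
  rewrite -[LHS]mulmx1 -(E1 k) mulmx_sumr big1 // => l _.
  rewrite H // => [|l']; last by rewrite mem_iota.
  have lk : (l : nat) \in iota 0 (L k) by rewrite mem_iota /= add0n.
  by rewrite (big_rem _ lk) /= subrr mul0r scale0r.
have [P Pu HP] : codiagonalizable [seq M k | k <- enum 'I_r].
  apply/codiagonalizableP; split=> [_ _ /mapP [k _ ->] /mapP [k' _ ->]|_ /mapP [k _ ->]] //.
  rewrite /comm_mx /M mulmx_suml [RHS]mulmx_sumr; apply: eq_bigr => l _.
  rewrite mulmx_sumr [RHS]mulmx_suml; apply: eq_bigr => l' _.
  by rewrite -!scalemxAl -!scalemxAr Ecomm ?ltn_ord // !scalerA mulrC.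
pose Q := invmx P; have Qu : Q \in unitmx by rewrite unitmx_inv.
have /choice [d Hd] : forall k, exists d : 'rV[C]_m.+1, M k *m Q = Q *m diag_mx d.
  move=> k; have kM : M k \in [seq M k | k <- enum 'I_r] by apply: map_f; rewrite mem_enum.
  have /diagonalizable_forPex [D /(simmxLR Pu) EMk] := allP HP _ kM; exists D.
  by rewrite EMk mxpoly.conjVmx // -!mulmxA mulmxV // mulmx1.
have col_nz i : col i Q != 0.
  apply/eqP => c0; have := mulVmx Qu => /matrixP /(_ i i); rewrite !mxE eqxx.
  rewrite big1 => [/eqP|j _]; first by rewrite eq_sym oner_eq0.
  by move: c0 => /matrixP /(_ j ord0); rewrite !mxE => ->; rewrite mulr0.
have Mcol k i : M k *m col i Q = d k 0 i *: col i Q.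
  by rewrite [in LHS]colE mulmxA Hd -colE; apply/matrixP => a b; rewrite mxE mul_mx_diag !mxE mulrC.
have /choice [l Hl] : forall ki : 'I_r * 'I_m.+1, exists l : nat,
    forall l', (l' < L ki.1)%N -> E ki.1 l' *m col ki.2 Q = if l' == l then col ki.2 Q else 0.
  move=> [k i] /=.
  have Ed l : (l < L k)%N -> (d k 0 i - l%:R) *: (E k l *m col i Q) = 0.
    move=> lL; rewrite scalerBl scalemxAr -Mcol mulmxA EM //.
    by rewrite -scalemxAl subrr.
  have [[l [lL El]]|no] := pselect (exists l, (l < L k)%N /\ E k l *m col i Q != 0); last first.
    have : col i Q = 0; last by move/eqP: (col_nz i).
    rewrite -[LHS]mul1mx -(E1 k) mulmx_suml big1 // => l _; apply/eqP/negPn/negP => nz.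
    by apply: no; exists l.
  have dl : d k 0 i = l%:R.
    have /eqP := Ed l lL; rewrite scaler_eq0 (negbTE El) orbF subr_eq0 => /eqP //.
  have E0 l' : (l' < L k)%N -> l' != l -> E k l' *m col i Q = 0.
    move=> l'L ne; have /eqP := Ed l' l'L; rewrite scaler_eq0 dl subr_eq0 eqr_nat eq_sym (negbTE ne) /=.
    by move/eqP.
  exists l => l' l'L; case: eqP => [->|/eqP ne]; last exact: E0.
  rewrite -{2}[col i Q]mul1mx -(E1 k) mulmx_suml (bigD1 (Ordinal lL)) //= big1 ?addr0 // => l'' ne.
  by apply: E0 => //; move: ne; rewrite -val_eqE.
have Hlt ki : (l ki < L ki.1)%N.
  case: ki => k i /=; rewrite ltnNge; apply/negP => le; case/eqP: (col_nz i).
  rewrite -[LHS]mul1mx -(E1 k) mulmx_suml big1 // => l' _; rewrite (Hl (k, i)) //=.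
  by rewrite ltn_eqF // (leq_trans (ltn_ord l')).
exists Q, (fun i k => (l (k, i))%:Z - (K k)%:Z); split=> // z nz.
have Rcol k y i : y != 0 -> R' (evec k y) *m col i Q = y ^ ((l (k, i))%:Z - (K k)%:Z) *: col i Q.
  move=> y0; have yK : y ^+ K k != 0 by rewrite expf_neq0.
  apply: (scalerI yK); rewrite scalemxAl HE // scalerA mulmx_suml.
  rewrite (bigD1 (Ordinal (Hlt (k, i)))) //= -scalemxAl (Hl (k, i)) ?(Hlt (k, i)) //= eqxx.
  rewrite big1 ?addr0 => [|l' ne].
    by congr (_ *: _); rewrite expfzDr // mulrCA -exprnP -exprnN divff ?mulr1.
  rewrite -scalemxAl (Hl (k, i)) //=; move: ne; rewrite -val_eqE /= => /negbTE ->.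
  by rewrite scaler0.
have Rz i : R' z *m col i Q = mono (fun k => (l (k, i))%:Z - (K k)%:Z) z *: col i Q.
  pose zs (s : seq 'I_r) : 'I_r -> C := fun j => if j \in s then z j else 1.
  have nzs s : nzv (zs s) by move=> j; rewrite /zs; case: ifP; rewrite ?oner_eq0.
  have H s : uniq s -> R' (zs s) *m col i Q =
      (\prod_(j <- s) z j ^ ((l (j, i))%:Z - (K j)%:Z)) *: col i Q.
    elim: s => [_|j s IH /andP [js us]].
      rewrite big_nil scale1r (_ : zs [::] = fun=> 1) ?R1 ?mul1mx //.
    rewrite big_cons (_ : zs (j :: s) = fun k => evec j (z j) k * zs s k).
      rewrite Rm //; last exact: nzv_evec.
      by rewrite -mulmxA IH // -scalemxAr Rcol // scalerA mulrC.
    apply/funext => k; rewrite /zs /evec inE; case: eqP => [->|_]; last by rewrite mul1r.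
    by rewrite (negbTE js) mulr1.
  rewrite -[z in R' z](_ : zs (enum 'I_r) = z) ?H ?enum_uniq //.
    by rewrite big_enum.
  by apply/funext => k; rewrite /zs mem_enum.
apply/matrixP => a b; have := congr1 (fun A : 'cV_m.+1 => A a ord0) (Rz b).
by rewrite /= [in LHS]colE mulmxA -colE mxE mul_mx_diag !mxE => ->; rewrite mulrC.
Qed.

End Simultaneous.
End Weights.
End Laurent.

Section GenericVector.
Variable C : numClosedFieldType.

Lemma poly_nat_nonroot (p : {poly C}) : p != 0 -> exists m : nat, p.[m%:R] != 0.
Proof.
move=> nzp; apply: contrapT => no; have no' m : p.[m%:R] = 0.
  by apply/eqP/negPn/negP => nz; apply: no; exists m.
have u : uniq [seq i%:R : C | i <- iota 0 (size p)].
  by rewrite map_inj_uniq ?iota_uniq // => i j /eqP; rewrite eqr_nat => /eqP.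
have /(max_poly_roots nzp)/(_ u) : all (root p) [seq i%:R : C | i <- iota 0 (size p)].
  by apply/allP => x /mapP [i _ ->]; apply/eqP/no'.
by rewrite size_map size_iota ltnn.
Qed.

Definition dot r (u nu : 'I_r -> int) : int := \sum_l u l * nu l.

(** For the vector of powers of an integer m, the pairing with [u i] is the value at m of the
    polynomial with coefficients [u i]; m is chosen outside the roots of all the nonzero ones. *)
Lemma generic_vector r (I : finType) (u : I -> 'I_r -> int) :
  exists nu : 'I_r -> int, forall i, (exists l, u i l != 0) -> dot (u i) nu != 0.
Proof.
pose P i : {poly C} := \sum_l (u i l)%:~R *: 'X^l.
pose Q : {poly C} := \prod_(i | [exists l, u i l != 0]) P i.
have Pcoef i (l : 'I_r) : (P i)`_l = (u i l)%:~R.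
  rewrite coef_sum (bigD1 l) //= coefZ coefXn eqxx mulr1 big1 ?addr0 // => k kl.
  by rewrite coefZ coefXn eq_sym; move: kl; rewrite -val_eqE /= => /negbTE ->; rewrite mulr0.
have nzQ : Q != 0.
  apply/prodf_neq0 => i /existsP [l nz]; apply/eqP => P0; have := Pcoef i l.
  by rewrite P0 coef0 => /esym/eqP; rewrite intr_eq0 (negbTE nz).
have [m] := poly_nat_nonroot nzQ; rewrite horner_prod => /prodf_neq0 H.
exists (fun l => (m ^ l)%N%:Z) => i /existsP/H; apply: contra_neq.
rewrite /dot => /(congr1 (fun z : int => z%:~R : C)); rewrite rmorph_sum /= => E.
rewrite horner_sum -[RHS]E; apply: eq_bigr => l _.
by rewrite hornerZ hornerXn rmorphM /= -pmulrn natrX.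
Qed.

End GenericVector.

(** * Charts of a torus, its Lie algebra and its characters *)

Section Chart.
Variables (C : numClosedFieldType) (n : nat).

(** The coordinates and their inverses are restrictions of polynomial maps [p] and [pv] on all
    matrices, so that every character of the torus is the restriction of a polynomial map. *)
Record torus_chart (T : set 'M[C]_n) r (tor : ('I_r -> C) -> 'M[C]_n)
    (p pv : 'I_r -> 'M[C]_n -> C^o) : Prop := TorusChart {
  tc_in : forall z, nzv z -> T (tor z);
  tc_sur : forall x, T x -> exists2 z, nzv z & x = tor z;
  tc_mul : forall z z', nzv z -> nzv z' -> tor (fun j => z j * z' j) = tor z *m tor z';
  tc_one : tor (fun=> 1) = 1%:M;
  tc_laurent : forall k i j, laurent (fun y => tor (evec k y) i j);
  tc_poly : forall j, polymap (p j);
  tc_polyV : forall j, polymap (pv j);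
  tc_p : forall j z, nzv z -> p j (tor z) = z j;
  tc_pV : forall j z, nzv z -> pv j (tor z) = (z j)^-1 }.

Variables (T : set 'M[C]_n) (r : nat) (tor : ('I_r -> C) -> 'M[C]_n).
Variables (p pv : 'I_r -> 'M[C]_n -> C^o) (t : {vspace 'M[C]_n}).
Hypothesis TC : torus_chart T tor p pv.
Hypothesis t_lie : forall X, X \in t <->
  forall f : 'M[C]_n -> C^o, polymap f -> (forall x, T x -> f x = 0) -> der f 1%:M X = 0.

Variable H : 'I_r -> 'M[C]_n.
Hypothesis H_lder : forall j a b, lder (fun y => tor (evec j y) a b) (H j a b).

Let tor_evec1 j : tor (evec j 1) = 1%:M.
Proof. by rewrite -(tc_one TC); congr tor; apply/funext => k; rewrite /evec if_same. Qed.

Lemma lder_tor (F : 'M[C]_n -> C^o) j : polymap F ->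
  lder (fun y => F (tor (evec j y))) (der F 1%:M (H j)).
Proof. by move=> pF; rewrite -(tor_evec1 j); apply: lder_polymap. Qed.

Lemma der_tor_mono (F : 'M[C]_n -> C^o) w : polymap F ->
  (forall z, nzv z -> F (tor z) = mono w z) -> forall j, der F 1%:M (H j) = (w j)%:~R.
Proof.
move=> pF HF j; apply: lder_uniq (lder_tor j pF) (lder_exprz C (w j)) _ => y y0.
by rewrite HF ?mono_evec //; apply: nzv_evec.
Qed.

Section Representation.
Variables (N : nat) (F : 'M[C]_n -> 'M[C]_N).
Hypothesis F_poly : polymap F.

Lemma chart_weights : F 1%:M = 1%:M ->
  (forall x y, T x -> T y -> F (x *m y) = F x *m F y) ->
  exists (Q : 'M[C]_N) (w : 'I_N -> 'I_r -> int), Q \in unitmx /\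
    forall z, nzv z -> F (tor z) *m Q = Q *m diag_mx (\row_i mono (w i) z).
Proof.
move=> F1 FM; apply: (@simultaneous_weights _ _ _ (fun z => F (tor z))) => [k i j|z z' nz nz'|].
- by eexists; apply: (lder_tor k (polymap_mxentry i j F_poly)).
- by rewrite (tc_mul TC) // FM //; apply: (tc_in TC).
- by rewrite (tc_one TC).
Qed.

Lemma der_tor_weights (Q : 'M[C]_N) w :
  (forall z, nzv z -> F (tor z) *m Q = Q *m diag_mx (\row_i mono (w i) z)) ->
  forall j, der F 1%:M (H j) *m Q = Q *m diag_mx (\row_i (w i j)%:~R).
Proof.
move=> HF j; apply/matrixP => a b; rewrite mul_mx_diag !mxE.
have L1 : lder (fun y => (F (tor (evec j y)) *m Q) a b) (\sum_k der F 1%:M (H j) a k * Q k b).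
  apply: (@lder_ext _ (fun y => \sum_k F (tor (evec j y)) a k * Q k b)) => [y _|].
    by rewrite mxE.
  apply: lder_sum => k; rewrite mulrC; apply: (@lder_ext _ (fun y => Q k b * F (tor (evec j y)) a k)).
    by move=> y _; rewrite mulrC.
  by apply: lder_mulc; rewrite -der_mxentry //; apply: lder_tor; apply: polymap_mxentry.
apply: lder_uniq L1 (lder_mulc (Q a b) (lder_exprz C (w b j))) _ => y y0.
by rewrite HF ?mul_mx_diag ?mxE ?mono_evec //; apply: nzv_evec.
Qed.

End Representation.

(** The integral power of [f] at points where [h] is its inverse, kept polynomial for negative
    exponents. *)
Definition pw (f h : 'M[C]_n -> C^o) (a : int) : 'M[C]_n -> C^o :=
  fun x => if a is Posz k then f x ^+ k else h x ^+ `|a|.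

Definition cmap (w : 'I_r -> int) : 'M[C]_n -> C^o := fun x => \prod_j pw (p j) (pv j) (w j) x.

Lemma polymap_expn (f : 'M[C]_n -> C^o) k : polymap f -> polymap (fun x => f x ^+ k : C^o).
Proof.
move=> pf; elim: k => [|k IH]; first by apply: polymap_ext (PolyCst _ (1 : C^o)) => x.
by apply: polymap_ext (polymap_mul pf IH) => x; rewrite exprS.
Qed.

Lemma polymap_pw f h a : polymap f -> polymap h -> polymap (pw f h a).
Proof. by case: a => k pf ph; apply: polymap_expn. Qed.

Lemma polymap_cmap w : polymap (cmap w).
Proof. by apply: polymap_prod => j; apply: polymap_pw; [apply: (tc_poly TC)|apply: (tc_polyV TC)]. Qed.

Lemma cmap_tor w z : nzv z -> cmap w (tor z) = mono w z.
Proof.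
move=> nz; apply: eq_bigr => j _; rewrite /pw; case: (w j) => k.
  by rewrite (tc_p TC).
by rewrite (tc_pV TC) // NegzE abszN absz_nat exprVn -exprnN.
Qed.

Lemma character_mono (F : 'M[C]_n -> C^o) : polymap F ->
  (forall x, T x -> F x != 0) -> (forall x y, T x -> T y -> F (x *m y) = F x * F y) ->
  exists w, forall z, nzv z -> F (tor z) = mono w z.
Proof.
move=> pF F0 FM; have T1 : T 1%:M by rewrite -(tc_one TC); apply: (tc_in TC); apply: nzv1.
have F1 : F 1%:M = 1.
  by have /eqP := FM _ _ T1 T1; rewrite mulmx1 eq_sym -subr_eq0 -{3}[F _]mulr1 -mulrBr mulf_eq0
     (negbTE (F0 _ T1)) subr_eq0 => /eqP.
have [|||Q [w [Qu Hw]]] := @chart_weights 1 (fun x => (F x)%:M).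
- apply: polymap_mx => i j; apply: polymap_ext (polymap_mulc ((i == j)%:R) pF) => x.
  by rewrite mxE mulr_natl.
- by rewrite F1.
- by move=> x y Tx Ty; rewrite FM // scalar_mxM.
exists (w ord0) => z nz; have := Hw z nz; rewrite mul_scalar_mx => /matrixP /(_ ord0 ord0).
rewrite mul_mx_diag !mxE mulrC => E; apply: (mulfI _ E).
by move: Qu; rewrite unitmxE unitfE det_mx11.
Qed.

Lemma vanish_cmap_pV j X : X \in t -> der (pv j) 1%:M X = - der (p j) 1%:M X.
Proof.
have [pp ppV] := (tc_poly TC j, tc_polyV TC j).
have p1 : p j 1%:M = 1 by rewrite -(tc_one TC) (tc_p TC) //; apply: nzv1.
have pv1 : pv j 1%:M = 1 by rewrite -(tc_one TC) (tc_pV TC) ?invr1 //; apply: nzv1.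
move/t_lie => /(_ (fun x => p j x * pv j x - 1)) E; apply/eqP; rewrite -addr_eq0 addrC -[_ + _]subr0.
move: E; rewrite der_sub ?der_cst; last exact: PolyCst; last exact: polymap_mul.
rewrite der_mul // p1 pv1 mulr1 mul1r => -> //.
  by apply: polymap_sub; [exact: polymap_mul|exact: PolyCst].
by move=> x /(tc_sur TC) [z nz ->]; rewrite (tc_p TC) // (tc_pV TC) // divff ?subrr.
Qed.

Lemma der_expn1 (f : 'M[C]_n -> C^o) k X : polymap f -> f 1%:M = 1 ->
  der (fun x => f x ^+ k : C^o) 1%:M X = k%:R * der f 1%:M X.
Proof.
move=> pf f1; elim: k => [|k IH].
  by rewrite mul0r -(der_cst (1 : C^o) 1%:M X); apply: der_ext => y; rewrite expr0.
rewrite (@der_ext _ _ _ _ (fun x => f x * f x ^+ k : C^o)); last by move=> y; rewrite exprS.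
rewrite der_mul ?IH //; last exact: polymap_expn.
by rewrite f1 expr1n mulr1 mul1r -natr1; ring.
Qed.

Lemma der_cmap w X : X \in t -> der (cmap w) 1%:M X = \sum_j (w j)%:~R * der (p j) 1%:M X.
Proof.
move=> tX; rewrite /cmap; have p1 j : p j 1%:M = 1.
  by rewrite -(tc_one TC) (tc_p TC) //; apply: nzv1.
have pv1 j : pv j 1%:M = 1 by rewrite -(tc_one TC) (tc_pV TC) ?invr1 //; apply: nzv1.
have pw1 j : pw (p j) (pv j) (w j) 1%:M = 1.
  by rewrite /pw; case: (w j) => k; rewrite ?p1 ?pv1 expr1n.
have ppw j : polymap (pw (p j) (pv j) (w j)).
  by apply: polymap_pw; [apply: (tc_poly TC)|apply: (tc_polyV TC)].
have dpw j : der (pw (p j) (pv j) (w j)) 1%:M X = (w j)%:~R * der (p j) 1%:M X.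
  rewrite /pw; case: (w j) => k; first by rewrite der_expn1 //; apply: (tc_poly TC).
  rewrite der_expn1 //; last exact: (tc_polyV TC).
  by rewrite vanish_cmap_pV // NegzE abszN absz_nat mulrNz mulrN mulNr.
elim: (index_enum _) => [|j s IH].
  rewrite big_nil (@der_ext _ _ _ _ (fun=> 1)) ?der_cst // => y.
  by rewrite big_nil.
rewrite big_cons -IH -dpw.
rewrite (@der_ext _ _ _ _ (fun x => pw (p j) (pv j) (w j) x * \prod_(j <- s) pw (p j) (pv j) (w j) x)).
  rewrite der_mul //; last exact: polymap_prod.
  by rewrite pw1 mul1r [X in _ * X]big1 ?mulr1.
by move=> y; rewrite big_cons.
Qed.

Lemma tor_H_t j : H j \in t.
Proof.
apply/t_lie => f pf f0; apply: lder_uniq (lder_tor j pf) (lder_cst 0) _ => y y0.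
by apply/f0/(tc_in TC)/nzv_evec.
Qed.

Lemma der_p_H i j : der (p i) 1%:M (H j) = (i == j)%:R.
Proof.
rewrite (@der_tor_mono (p i) (fun k => (k == i)%:R)); last 1 first.
- move=> z nz; rewrite (tc_p TC) // /mono (bigD1 i) //= eqxx expr1z.
  by rewrite big1 ?mulr1 // => k /negbTE ->; rewrite expr0z.
- by rewrite eq_sym; case: (i == j).
- exact: (tc_poly TC).
Qed.

(** In a basis that diagonalises the torus, the off-diagonal entries vanish on T and the diagonal
    ones coincide there with monomials in the coordinates; differentiating these identities
    determines [X] from the differentials of the coordinates. *)
Lemma t_coord X : X \in t -> X = \sum_j der (p j) 1%:M X *: H j.
Proof.
move=> tX; have [|Q [w [Qu Hw]]] := chart_weights (@polymap_id C n) (erefl _); first by [].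
have HQ j := der_tor_weights (@polymap_id C n) Hw j.
have conj_poly i k : polymap (fun x => (invmx Q *m x *m Q) i k : C^o).
  apply: polymap_mxentry; apply: polymap_mulmx; last exact: PolyCst.
  by apply: polymap_mulmx; [exact: PolyCst|exact: polymap_id].
have conj_der i k : der (fun x => (invmx Q *m x *m Q) i k : C^o) 1%:M X = (invmx Q *m X *m Q) i k.
  by apply: der_of_linear => a u v; rewrite mulmxDr mulmxDl -scalemxAr -scalemxAl !mxE.
have conj_tor z : nzv z -> invmx Q *m tor z *m Q = diag_mx (\row_i mono (w i) z).
  by move=> nz; rewrite -mulmxA Hw // mulKmx.
suff E : invmx Q *m X *m Q = diag_mx (\row_i \sum_j (w i j)%:~R * der (p j) 1%:M X).
  have EX : X = Q *m (invmx Q *m X *m Q) *m invmx Q by rewrite !mulmxA mulmxV // mul1mx mulmxK.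
  rewrite [LHS]EX {}E; apply: (can_inj (mulmxK Qu)); rewrite mulmxKV // mulmx_suml.
  under eq_bigr do rewrite -scalemxAl -[H _](@der_id C n 1%:M) HQ.
  apply/matrixP => a b; rewrite mul_mx_diag !mxE summxE mulr_sumr; apply: eq_bigr => j _.
  by rewrite mul_mx_diag !mxE; ring.
apply/matrixP => i k; rewrite -conj_der; have [<-|ne] := eqVneq i k.
  rewrite !mxE eqxx mulr1n -der_cmap //.
  suff : der (fun x => (invmx Q *m x *m Q) i i - cmap (w i) x : C^o) 1%:M X = 0.
    by rewrite der_sub // => [/eqP|]; [rewrite subr_eq0 => /eqP|exact: polymap_cmap].
  have /t_lie := tX; apply; first by apply: polymap_sub => //; apply: polymap_cmap.
  by move=> x /(tc_sur TC) [z nz ->]; rewrite conj_tor // cmap_tor // !mxE eqxx mulr1n subrr.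
rewrite !mxE (negbTE ne) mulr0n; have /t_lie := tX; apply => // x /(tc_sur TC) [z nz ->].
by rewrite conj_tor // !mxE (negbTE ne).
Qed.

(* The weights of the faithful representation [x] generate the characters. *)
Lemma weights_generate (Q : 'M[C]_n) (w : 'I_n -> 'I_r -> int) : Q \in unitmx ->
  (forall z, nzv z -> tor z *m Q = Q *m diag_mx (\row_i mono (w i) z)) ->
  forall j, exists m : 'I_n -> nat, forall l, \sum_i (m i)%:Z * w i l = (l == j)%:R.
Proof.
move=> Qu Hw j.
have expand (F : 'M[C]_n -> C^o) : polymap F -> exists (I : finType) (c : I -> C) (m : I -> 'I_n -> nat),
    forall z, nzv z -> F (tor z) = \sum_i c i * mono (fun l => \sum_k (m i k)%:Z * w k l) z.
  elim=> [a|a b f pf [I [c [m Hf]]]|f h pf [I [c [m Hf]]] ph [I' [c' [m' Hh]]]].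
  - exists unit, (fun=> a), (fun _ _ => 0%N) => z nz; rewrite (big_pred1 tt) => [|[] //].
    by rewrite /mono big1 ?mulr1 // => l _; rewrite big1 ?expr0z // => k _; rewrite mul0r.
  - exists ('I_n * I)%type, (fun ki => Q a ki.1 * invmx Q ki.1 b * c ki.2),
      (fun ki k => ((k == ki.1) + m ki.2 k)%N) => z nz.
    rewrite -(pair_bigA _ (fun k i => Q a k * invmx Q k b * c i *
      mono (fun l => \sum_k' ((k' == k) + m i k')%:Z * w k' l) z)) /=.
    have -> : tor z a b = \sum_k Q a k * invmx Q k b * mono (w k) z.
      have -> : tor z = Q *m diag_mx (\row_i mono (w i) z) *m invmx Q by rewrite -Hw // mulmxK.
      by rewrite mxE; apply: eq_bigr => k _; rewrite mul_mx_diag !mxE mulrAC.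
    rewrite Hf // /GRing.scale /= mulr_suml; apply: eq_bigr => k _; rewrite mulr_sumr.
    apply: eq_bigr => i _.
    rewrite (_ : mono (fun l => \sum_k' ((k' == k) + m i k')%:Z * w k' l) z
      = mono (w k) z * mono (fun l => \sum_k' (m i k')%:Z * w k' l) z); first by ring.
    rewrite -monoD //; congr mono; apply/funext => l.
    under eq_bigr do rewrite PoszD mulrDl.
    rewrite big_split /= (bigD1 k) //= eqxx mul1r big1 ?addr0 // => k' /negbTE ->.
    by rewrite mul0r.
  - exists (I + I')%type, (fun i => match i with inl i => c i | inr i => c' i end),
      (fun i => match i with inl i => m i | inr i => m' i end) => z nz.
    by rewrite big_sumType /= Hf // Hh.
have [I [c [m Hm]]] := expand _ (tc_poly TC j).
pose e l : int := (l == j)%:R.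
pose u i l := \sum_k (m i k)%:Z * w k l.
(* Along a generic one-parameter subgroup distinct monomials have distinct exponents, so
   independence of the powers of one variable is enough. *)
have [nu Hnu] := @generic_vector C r I (fun i l => u i l - e l).
have mono_pow (y : C) (v : 'I_r -> int) : y != 0 -> mono v (fun l => y ^ nu l) = y ^ dot v nu.
  move=> y0; rewrite /mono /dot; under eq_bigr do rewrite exprz_exp mulrC.
  by elim: (index_enum _) => [|l s IH]; rewrite ?big_nil ?expr0z // !big_cons IH expfzDr.
have [i Ei] : exists i, dot (u i) nu = dot e nu.
  apply: (@laurent_monomial_mem C I _ _ c) => y y0.
  have nz : nzv (fun l => y ^ nu l) by move=> l; rewrite expfz_neq0.
  rewrite -mono_pow //; have := Hm _ nz; rewrite (tc_p TC) // => E.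
  transitivity (y ^ nu j).
    rewrite /mono (bigD1 j) //= /e eqxx expr1z big1 ?mulr1 // => l /negbTE ->.
    by rewrite expr0z.
  by rewrite E; apply: eq_bigr => i _; rewrite mono_pow.
exists (m i) => l; apply/eqP/negPn/negP => ne; have : dot (fun l => u i l - e l) nu != 0.
  by apply: Hnu; exists l; rewrite subr_eq0.
rewrite /dot; under eq_bigr do rewrite mulrBl.
by rewrite sumrB -/(dot (u i) nu) -/(dot e nu) Ei subrr eqxx.
Qed.

End Chart.

(** * The image of a diagonal monomial map is a closed torus *)

Section MonomialTorus.
Variables (C : numClosedFieldType) (n : nat).

Lemma prod_exprz (I : Type) (s : seq I) (F : I -> C) (a : int) :
  (\prod_(i <- s) F i) ^ a = \prod_(i <- s) F i ^ a.
Proof. by apply: (big_morph (fun x => x ^ a)) => [x y|]; rewrite ?expfzMl ?exp1rz. Qed.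

Lemma exprz_sum (I : Type) (s : seq I) (y : C) (a : I -> int) : y != 0 ->
  y ^ (\sum_(i <- s) a i) = \prod_(i <- s) y ^ a i.
Proof. by move=> y0; apply: (big_morph (fun a => y ^ a)) => [b c|]; rewrite ?expfzDr ?expr0z. Qed.

Lemma prod_prod_exprz (I J : finType) (v : J -> C) (A : I -> J -> int) (B : I -> int) :
  (forall k, v k != 0) ->
  \prod_l (\prod_k v k ^ A l k) ^ B l = \prod_k v k ^ (\sum_l B l * A l k).
Proof.
move=> v0; under eq_bigr do rewrite prod_exprz.
rewrite exchange_big /=; apply: eq_bigr => k _; rewrite exprz_sum //.
by apply: eq_bigr => l _; rewrite exprz_exp mulrC.
Qed.

Lemma exists_rootz (u : C) (d : int) : u != 0 -> d != 0 -> exists2 v, v != 0 & v ^ d = u.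
Proof.
move=> u0; have root0 m : (m.+1).-root u != 0 by rewrite rootC_eq0.
case: d => [[|m]|m] // _.
  by exists (m.+1.-root u); rewrite // -exprnP rootCK.
by exists (m.+1.-root u)^-1; rewrite ?invr_eq0 // NegzE exprz_inv opprK -exprnP rootCK.
Qed.

Variables (Q : 'M[C]_n) (q : nat) (W : 'I_n -> 'I_q -> int).
Hypothesis Qu : Q \in unitmx.

Let dg (c : 'I_n -> C) := Q *m diag_mx (\row_i c i) *m invmx Q.
Hypothesis det1W : forall z, nzv z -> \det (dg (fun i => mono (W i) z)) = 1.

Let conj_dg c : invmx Q *m dg c *m Q = diag_mx (\row_i c i).
Proof. by rewrite /dg -!mulmxA mulVmx // mulmx1 mulKmx. Qed.

Let det_dg c : \det (dg c) = \prod_i c i.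
Proof.
rewrite !det_mulmx det_diag mulrAC -det_mulmx mulmxV // det1 mul1r.
by apply: eq_bigr => i _; rewrite mxE.
Qed.

Let dgM c c' : dg c *m dg c' = dg (fun i => c i * c' i).
Proof.
rewrite /dg -!mulmxA mulKmx // [diag_mx _ *m (_ *m _)]mulmxA; congr (_ *m (_ *m _)).
by rewrite mulmx_diag; congr diag_mx; apply/rowP => i; rewrite !mxE.
Qed.

Let dg1 : dg (fun=> 1) = 1%:M.
Proof.
rewrite /dg (_ : \row_i 1 = const_mx 1); last by apply/rowP => i; rewrite !mxE.
by rewrite diag_const_mx mulmx1 mulmxV.
Qed.

Let chi i (x : 'M[C]_n) : C^o := (invmx Q *m x *m Q) i i.
Let chiV i (x : 'M[C]_n) : C^o := (invmx Q *m \adj x *m Q) i i.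
Let pmono (e : 'I_n -> int) (x : 'M[C]_n) : C^o := \prod_i pw (chi i) (chiV i) (e i) x.

Let poly_chi i : polymap (chi i).
Proof.
apply: polymap_mxentry; apply: polymap_mulmx; last exact: PolyCst.
by apply: polymap_mulmx; [exact: PolyCst|exact: polymap_id].
Qed.

Let poly_pmono e : polymap (pmono e).
Proof.
apply: polymap_prod => i; apply: polymap_pw => //.
apply: polymap_mxentry; apply: polymap_mulmx; last exact: PolyCst.
by apply: polymap_mulmx; [exact: PolyCst|exact/polymap_adj/polymap_id].
Qed.

Let pmono_dg e c : (forall i, c i != 0) -> \prod_i c i = 1 -> pmono e (dg c) = \prod_i c i ^ e i.
Proof.
move=> c0 c1; apply: eq_bigr => i _; rewrite /pw.
have chiE : chi i (dg c) = c i by rewrite /chi conj_dg !mxE eqxx.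
have adjE : \adj (dg c) = dg (fun i => (c i)^-1).
  rewrite -[LHS]mulmx1 -dg1 (_ : (fun=> 1) = (fun i => c i * (c i)^-1)); last first.
    by apply/funext => k; rewrite divff.
  by rewrite -dgM mulmxA mul_adj_mx det_dg c1 mul1mx.
have chiVE : chiV i (dg c) = (c i)^-1 by rewrite /chiV adjE conj_dg !mxE eqxx.
case: (e i) => k; rewrite ?chiE // chiVE NegzE abszN absz_nat.
by rewrite exprVn -exprnN.
Qed.

(** By the Smith form L D R of the exponents, the map is, up to invertible monomial changes of
    variables on both sides, a list of power maps. Since C has roots, the image is parametrised by
    the columns of L at the nonzero elementary divisors, and the inverse of L gives both its
    coordinates and its equations. *)
Lemma monomial_torus : exists (T : set 'M[C]_n) (r : nat) (tor : ('I_r -> C) -> 'M[C]_n) p pv,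
  [/\ torus_chart T tor p pv, poly_closed T,
      forall z, nzv z -> T (dg (fun i => mono (W i) z))
    & forall x, T x -> exists2 z, nzv z & x = dg (fun i => mono (W i) z)].
Proof.
have [L uL [R uR [d _ EW]]] := int_Smith_normal_form (\matrix_(i, j) W i j).
pose D : 'M[int]_(n, q) := \matrix_(i, j) (d`_i *+ (i == j :> nat)).
pose e (k : 'I_n) (j : 'I_q) : int := (D *m R) k j.
have WE i j : W i j = \sum_k L i k * e k j.
  by have /matrixP /(_ i j) := EW; rewrite mxE -mulmxA => ->; rewrite mxE.
(* The indices of the nonzero elementary divisors; their number is the dimension of the image. *)
pose S := [set k : 'I_n | (k < q)%N && (d`_k != 0)].
have eS (k : 'I_n) (kq : (k < q)%N) j : e k j = d`_k * R (Ordinal kq) j.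
  rewrite /e mxE (bigD1 (Ordinal kq)) //= !mxE eqxx mulr1n big1 ?addr0 // => k' ne.
  by rewrite mxE (_ : (k == k' :> nat) = false) ?mulr0n ?mul0r // eq_sym; apply: negbTE.
have e0 k j : k \notin S -> e k j = 0.
  rewrite inE negb_and => /orP [kq|]; last first.
    rewrite negbK => /eqP dk; rewrite /e mxE big1 // => k' _; rewrite mxE dk.
    by rewrite mul0rn mul0r.
  rewrite /e mxE big1 // => k' _; rewrite mxE (_ : (k == k' :> nat) = false) ?mulr0n ?mul0r //.
  by apply/eqP => E; move: kq; rewrite E ltn_ord.
pose ek (j : 'I_#|S|) : 'I_n := enum_val j.
have ekS j : ek j \in S by apply: enum_valP.
have prod_S (F : 'I_n -> C) : (forall k, k \notin S -> F k = 1) -> \prod_k F k = \prod_j F (ek j).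
  move=> F1; rewrite (bigID (mem S)) /= [X in _ * X]big1 ?mulr1; last by move=> k /F1.
  by rewrite big_enum_val.
pose Li := invmx L; have LiL : Li *m L = 1%:M by apply: mulVmx.
have LLi : L *m Li = 1%:M by apply: mulmxV.
pose tc (u : 'I_#|S| -> C) i := \prod_j u j ^ L i (ek j).
have tc0 u : nzv u -> forall i, tc u i != 0.
  by move=> nu i; apply/prodf_neq0 => j _; rewrite expfz_neq0.
have mono_W z i : nzv z -> mono (W i) z = tc (fun j => mono (e (ek j)) z) i.
  move=> nz; rewrite /tc -(prod_S (fun k => mono (e k) z ^ L i k)) => [|k kS]; last first.
    by rewrite /mono big1 ?exp1rz // => j _; rewrite e0.
  by rewrite /mono prod_prod_exprz //; apply: eq_bigr => j _; rewrite WE.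
have tc_inv u j : nzv u -> \prod_i tc u i ^ Li (ek j) i = u j.
  move=> nu; rewrite prod_prod_exprz // (bigD1 j) //= [X in _ * X]big1 ?mulr1 => [|l ne].
    have /matrixP /(_ (ek j) (ek j)) := LiL; rewrite !mxE eqxx => ->; exact: expr1z.
  have /matrixP /(_ (ek j) (ek l)) := LiL; rewrite !mxE => ->.
  by rewrite (inj_eq enum_val_inj) eq_sym (negbTE ne) expr0z.
have tc_inv0 u k : nzv u -> k \notin S -> \prod_i tc u i ^ Li k i = 1.
  move=> nu kS; rewrite prod_prod_exprz //; apply: big1 => l _.
  have /matrixP /(_ k (ek l)) := LiL; rewrite !mxE => ->.
  by rewrite (_ : (k == ek l) = false) ?expr0z //; apply: contraNF kS => /eqP ->.
have surj u : nzv u -> exists2 z : 'I_q -> C, nzv z & forall i, tc u i = mono (W i) z.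
  move=> nu.
  have /choice [v Hv] : forall k' : 'I_q, exists v : C, v != 0 /\
      forall j, ek j = k' :> nat -> v ^ d`_(ek j) = u j.
    move=> k'; have [[j Ej]|no] := pselect (exists j, ek j = k' :> nat); last first.
      by exists 1; split=> [|j Ej]; [exact: oner_neq0|case: no; exists j].
    have := ekS j; rewrite inE => /andP [_ /(exists_rootz (nu j)) [v v0 vE]].
    exists v; split=> // j' Ej'; suff -> : j' = j by [].
    by apply: enum_val_inj; apply: val_inj; rewrite /= -/(ek _) -/(ek j) Ej Ej'.
  have v0 k : v k != 0 by case: (Hv k).
  exists (fun l => \prod_k v k ^ (invmx R) l k).
    by move=> l; apply/prodf_neq0 => k _; rewrite expfz_neq0.
  set z := fun l => _; have nz : nzv z by move=> l; apply/prodf_neq0 => k _; rewrite expfz_neq0.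
  have mono_R k : mono (fun l => R k l) z = v k.
    rewrite /mono /z prod_prod_exprz // (bigD1 k) //= [X in _ * X]big1 ?mulr1 => [|k' ne].
      have /matrixP /(_ k k) := mulmxV uR; rewrite !mxE eqxx => ->; exact: expr1z.
    have /matrixP /(_ k k') := mulmxV uR; rewrite !mxE => ->.
    by rewrite eq_sym (negbTE ne) expr0z.
  move=> i; rewrite mono_W //; apply: eq_bigr => j _; congr (_ ^ _).
  have := ekS j; rewrite inE => /andP [kq _]; case: (Hv (Ordinal kq)) => _ /(_ j erefl) <-.
  rewrite -mono_R /mono prod_exprz; apply: eq_bigr => l _.
  by rewrite exprz_exp (eS _ kq) mulrC.
have prod_tc u : nzv u -> \prod_i tc u i = 1.
  move=> nu; have [z nz E] := surj u nu.
  by rewrite (eq_bigr (fun i => mono (W i) z)) => [|i _]; [rewrite -det_dg det1W|exact: E].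
pose T : set 'M[C]_n := fun x => exists2 u, nzv u & x = dg (tc u).
have dg_ext c c' : (forall i, c i = c' i) -> dg c = dg c' by move=> cc'; congr dg; apply/funext.
exists T, #|S|, (fun u => dg (tc u)), (fun j => pmono (fun i => Li (ek j) i)),
  (fun j => pmono (fun i => - Li (ek j) i)); split.
- split=> //.
  + by move=> u nu; exists u.
  + move=> u u' nu nu'; rewrite dgM; apply: dg_ext => i; rewrite /tc -big_split.
    by apply: eq_bigr => j _; rewrite expfzMl.
  + by rewrite -dg1; apply: dg_ext => i; rewrite /tc big1 // => j _; rewrite exp1rz.
  + move=> k a b; eexists; apply: (@lder_ext _ (fun y => \sum_i (Q a i * invmx Q i b) * y ^ L i (ek k))).
      move=> y y0; rewrite mxE; apply: eq_bigr => i _; rewrite mul_mx_diag !mxE mulrAC.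
      by congr (_ * _ * _); rewrite -(mono_evec (fun j => L i (ek j))).
    by apply: lder_sum => i; apply/lder_mulc/lder_exprz.
  + by move=> j u nu; rewrite pmono_dg ?tc_inv ?prod_tc //; apply: tc0.
  + move=> j u nu; rewrite pmono_dg ?prod_tc //; last exact: tc0.
    rewrite -[X in X^-1](tc_inv u j nu) -prodfV; apply: eq_bigr => i _.
    by rewrite invr_expz.
- exists (fun f => [\/ f = (fun x => \det x - 1 : C^o),
     exists i k, i != k /\ f = (fun x => (invmx Q *m x *m Q) i k)
   | exists2 k, k \notin S & f = (fun x => pmono (fun i => Li k i) x - 1)]); split.
    move=> f [->|[i [k [_ ->]]]|[k _ ->]].
    + by apply: polymap_sub; [exact/polymap_det/polymap_id|exact: PolyCst].
    + apply: polymap_mxentry; apply: polymap_mulmx; last exact: PolyCst.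
      by apply: polymap_mulmx; [exact: PolyCst|exact: polymap_id].
    + by apply: polymap_sub => //; apply: PolyCst.
  move=> x; split.
    move=> [u nu ->]; split.
      by rewrite unitmxE det_dg prod_tc // unitr1.
    move=> f [->|[i [k [ne ->]]]|[k kS ->]].
    + by rewrite det_dg prod_tc // subrr.
    + by rewrite conj_dg !mxE (negbTE ne).
    + by rewrite pmono_dg ?tc_inv0 ?prod_tc ?subrr //; apply: tc0.
  move=> [xu Hx]; pose c i : C := chi i x.
  have Ex : x = dg c.
    have E : invmx Q *m x *m Q = diag_mx (\row_i c i).
      apply/matrixP => i k; rewrite [RHS]mxE [X in X *+ _]mxE; case: eqVneq => [<-|ne].
        by rewrite mulr1n.
      by rewrite mulr0n; apply: (Hx (fun x => (invmx Q *m x *m Q) i k)); apply: Or32; exists i, k.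
    by rewrite /dg -E !mulmxA mulmxV // mul1mx mulmxK.
  have det1x : \prod_i c i = 1.
    rewrite -det_dg -Ex; apply/eqP; rewrite -subr_eq0; apply/eqP.
    by apply: (Hx (fun x => \det x - 1 : C^o)); apply: Or31.
  have c0 i : c i != 0.
    by have := oner_neq0 C; rewrite -det1x => /prodf_neq0; apply.
  pose y k := \prod_i c i ^ Li k i.
  have y0 k : y k != 0 by apply/prodf_neq0 => i _; rewrite expfz_neq0.
  have y1 k : k \notin S -> y k = 1.
    move=> kS; apply/eqP; rewrite -subr_eq0 /y -pmono_dg // -Ex; apply/eqP.
    by apply: (Hx (fun x => pmono (fun i => Li k i) x - 1)); apply: Or33; exists k.
  exists (fun j => y (ek j)) => [j //|]; rewrite [LHS]Ex; apply: dg_ext => i.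
  rewrite /tc -(prod_S (fun k => y k ^ L i k)) => [|k /y1 ->]; last exact: exp1rz.
  rewrite /y prod_prod_exprz // (bigD1 i) //= [X in _ * X]big1 ?mulr1 => [|i' ne].
    have /matrixP /(_ i i) := LLi; rewrite !mxE eqxx => ->; by rewrite expr1z.
  have /matrixP /(_ i i') := LLi; rewrite !mxE => ->.
  by rewrite eq_sym (negbTE ne) expr0z.
- move=> z nz; exists (fun j => mono (e (ek j)) z) => [j|]; first exact: mono_neq0.
  by apply: dg_ext => i; apply: mono_W.
- by move=> x [u nu ->]; have [z nz E] := surj u nu; exists z => //; apply: dg_ext.
Qed.

End MonomialTorus.

(** * Replicas and the Jordan decomposition *)

Section Spectral.
Variable C : numClosedFieldType.

(** A family [b] of minimal length is independent over the integers: a relation with a nonzero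
    coefficient at j0 would, after dividing the other generators by this coefficient, express all
    [c i] integrally through one generator less. *)
Lemma integral_coordinates q (c : 'I_q -> C) : exists s (b : 'I_s -> C) (m : 'I_q -> 'I_s -> int),
  (forall i, c i = \sum_j (m i j)%:~R * b j) /\
  forall v : 'I_s -> int, \sum_j (v j)%:~R * b j = 0 -> forall j, v j = 0.
Proof.
pose B s := `[< exists (b : 'I_s -> C) (m : 'I_q -> 'I_s -> int),
  forall i, c i = \sum_j (m i j)%:~R * b j >].
have exB : exists s, B s.
  exists q; apply/asboolP; exists c, (fun i j => (i == j)%:R) => i.
  rewrite (bigD1 i) //= eqxx mul1r big1 ?addr0 // => j ne.
  by rewrite eq_sym (negbTE ne) mul0r.
case: (ex_minnP exB) => s /asboolP [b [m Hc]] mins; exists s, b, m; split=> // v Hv j0.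
apply/eqP/negPn/negP => nz; case: s => [|s] in b m Hc mins v Hv j0 nz *; first by case: j0 nz.
suff /mins : B s by rewrite ltnn.
have nz' : (v j0)%:~R != 0 :> C by rewrite intr_eq0.
apply/asboolP; exists (fun j => b (lift j0 j) / (v j0)%:~R),
  (fun i j => m i (lift j0 j) * v j0 - m i j0 * v (lift j0 j)) => i.
have Eb : b j0 = - \sum_j (v (lift j0 j))%:~R * (b (lift j0 j) / (v j0)%:~R).
  apply: (mulfI nz'); rewrite mulrN mulr_sumr.
  have := Hv; rewrite (bigD1_ord j0) //= => /eqP; rewrite addr_eq0 => /eqP ->.
  by congr (- _); apply: eq_bigr => j _; field.
rewrite Hc (bigD1_ord j0) //= Eb mulrN mulr_sumr -sumrN -big_split /=.
by apply: eq_bigr => j _; rewrite rmorphB !rmorphM /=; field.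
Qed.

(** The projectors on the generalised eigenspaces are polynomials in [X], hence commute with
    everything that commutes with [X]. *)
Lemma spectral_idempotents n (X : 'M[C]_n) : exists q (c : 'I_q -> C) (pi : 'I_q -> 'M[C]_n),
  [/\ injective c, \sum_i pi i = 1%:M, forall i j, pi i *m pi j = if i == j then pi i else 0,
      forall A, A *m X = X *m A -> forall i, A *m pi i = pi i *m A
    & forall i, exists k, iter k (mulmx (X - (c i)%:M)) (pi i) = 0].
Proof.
case: n X => [|n] X.
  by exists 0%N, (fun=> 0), (fun=> 0); split=> [[]//|||A _ []//|[]//]; [apply/matrixP => -[]|case].
have [rs Ers] := closed_field_poly_normal (char_poly X).
rewrite (monicP (char_poly_monic X)) scale1r in Ers.
pose cs := undup rs; pose N := size rs.
pose P := \prod_(c <- cs) ('X - c%:P) : {poly C}.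
pose Pc c := \prod_(d <- rem c cs) ('X - d%:P) : {poly C}.
have PE c : c \in cs -> P = ('X - c%:P) * Pc c by move=> cc; rewrite /P (big_rem c).
have Pc_nz c : c \in cs -> (Pc c).[c] != 0.
  move=> cc; rewrite horner_prod prodf_seq_neq0; apply/allP => d /=.
  rewrite (mem_rem_uniq _ (undup_uniq rs)) inE => /andP [dc _].
  by rewrite hornerXsubC subr_eq0 eq_sym dc.
pose l c := (Pc c).[c]^-1 *: Pc c.
(* As l is 1 at c and 0 at the other eigenvalues, e is divisible by l^N while 1 - e is divisible by
   the N-th power of 'X - c; these congruences make its value at [X] a projector. *)
pose e c := 1 - (1 - l c ^+ N) ^+ N.
have le c : l c ^+ N %| e c.
  by rewrite /e -{1}(expr1n _ N) subrXX opprB addrC subrK dvdp_mulr.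
have lc_eq c : c \in cs -> l c %= Pc c by move=> cc; rewrite eqp_scale // invr_eq0 Pc_nz.
have X1e c : c \in cs -> ('X - c%:P) ^+ N %| 1 - e c.
  move=> cc; rewrite /e subKr dvdp_exp2r // dvdp_XsubCl.
  by rewrite /root !hornerE /= mulVf ?Pc_nz // expr1n subrr.
have XPN : horner_mx X (P ^+ N) = 0.
  have : char_poly X %| P ^+ N.
    have H s : {subset s <= cs} -> \prod_(z <- s) ('X - z%:P) %| P ^+ size s.
      elim: s => [_|z s IH zs]; first by rewrite big_nil dvd1p.
      rewrite big_cons exprS dvdp_mul //; last by apply: IH => y ys; rewrite zs // inE ys orbT.
      by rewrite (PE z) ?zs ?mem_head // dvdp_mulr.
    by rewrite Ers; apply: H => z; rewrite mem_undup.
  by move=> /dvdpP [u ->]; rewrite rmorphM /= Cayley_Hamilton mulr0.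
have hM p p' : horner_mx X (p * p') = horner_mx X p *m horner_mx X p' by rewrite rmorphM.
have dvd0 p : P ^+ N %| p -> horner_mx X p = 0.
  by move=> /dvdpP [u ->]; rewrite rmorphM /= XPN mulr0.
pose pi c := horner_mx X (e c).
have pi_orth c d : c \in cs -> d \in cs -> c != d -> pi c *m pi d = 0.
  move=> cc dc ne; rewrite /pi -hM dvd0 //.
  apply: dvdp_trans (dvdp_mul (le c) (le d)); rewrite -exprMn dvdp_exp2r //.
  rewrite (PE c) // mulrC dvdp_mul ?(eqp_dvdr _ (lc_eq _ dc)) ?(eqp_dvdr _ (lc_eq _ cc)) //.
  have cd : c \in rem d cs by rewrite (mem_rem_uniq _ (undup_uniq rs)) inE ne.
  by rewrite /Pc (big_rem c) //= dvdp_mulr.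
have pi_idem c : c \in cs -> pi c *m pi c = pi c.
  move=> cc; apply/eqP; rewrite -subr_eq0 -{3}[pi c]mulmx1 -mulmxBr -oppr_eq0 -mulmxN opprB.
  have -> : 1%:M - pi c = horner_mx X (1 - e c) by rewrite rmorphB /= [horner_mx X 1]rmorph1.
  apply/eqP; rewrite /pi -hM dvd0 //.
  rewrite mulrC; apply: dvdp_trans (dvdp_mul (X1e c cc) (le c)); rewrite -exprMn dvdp_exp2r //.
  by rewrite (PE c) // dvdp_mul // (eqp_dvdr _ (lc_eq _ cc)).
have prod_1pi s : uniq s -> {subset s <= cs} ->
    horner_mx X (\prod_(c <- s) (1 - e c)) = 1 - \sum_(c <- s) pi c.
  elim: s => [_ _|c s IH /andP [cs' us] sub]; first by rewrite !big_nil subr0 rmorph1.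
  have sub' : {subset s <= cs} by move=> d ds; rewrite sub // inE ds orbT.
  rewrite !big_cons rmorphM /= IH // rmorphB rmorph1 /= mulrBr mulr1 mulrBl mul1r.
  rewrite [X in _ - _ - (_ - X)](_ : _ = 0) ?subr0 ?opprD ?addrA //.
  rewrite mulr_sumr big_seq big1 // => d ds; apply: pi_orth; [exact/sub/mem_head|exact: sub'|].
  by apply: contraNneq cs' => ->.
have sum_pi : \sum_(c <- cs) pi c = 1.
  apply/eqP; rewrite eq_sym -subr_eq0 -prod_1pi ?undup_uniq // dvd0 //.
  have H s : {subset s <= cs} -> (\prod_(c <- s) ('X - c%:P)) ^+ N %| \prod_(c <- s) (1 - e c).
    elim: s => [_|z s IH zs]; first by rewrite !big_nil expr1n.
    rewrite !big_cons exprMn dvdp_mul ?X1e ?zs ?mem_head //.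
    by apply: IH => y ys; rewrite zs // inE ys orbT.
  exact: H.
exists (size cs), (fun i => cs`_i), (fun i => pi cs`_i); split.
- by move=> i j /eqP; rewrite nth_uniq ?undup_uniq // => /eqP /val_inj.
- by rewrite -[1%:M]sum_pi (big_nth 0) big_mkord.
- move=> i j; case: eqVneq => [<-|ne]; first by rewrite pi_idem // mem_nth.
  by rewrite pi_orth ?mem_nth // nth_uniq ?undup_uniq.
- by move=> A AX i; apply: comm_mx_horner.
- move=> i; exists N; have iterE k (A : 'M[C]_n.+1) :
      iter k (mulmx (X - (cs`_i)%:M)) A = (X - (cs`_i)%:M) ^+ k *m A.
    by elim: k => [|k IH]; rewrite ?mul1mx //= IH exprS -mulmxA.
  have EX : X - (cs`_i)%:M = horner_mx X ('X - (cs`_i)%:P).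
    by rewrite rmorphB /= horner_mx_X horner_mx_C.
  rewrite iterE EX -rmorphXn /= /pi -hM dvd0 //.
  apply: dvdp_trans (dvdp_mul (dvdpp _) (le _)); rewrite -exprMn dvdp_exp2r //.
  by rewrite (PE cs`_i) ?mem_nth // dvdp_mul // (eqp_dvdr _ (lc_eq _ _)) ?mem_nth.
Qed.

End Spectral.

Section GeneralizedEigenfunctions.
Variables (C : numClosedFieldType) (n : nat) (X : 'M[C]_n).
Implicit Types f h : 'M[C]_n -> C^o.

Definition DXs (c : C) f : 'M[C]_n -> C^o := fun x => DX X f x - c * f x.

Definition sing f := forall k, iter k (DX X) f 1%:M = 0.

Lemma polymap_DXs c f : polymap f -> polymap (DXs c f).
Proof. by move=> pf; apply: polymap_sub; [exact: polymap_DX|exact: polymap_mulc]. Qed.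

Lemma polymap_iterDXs k c f : polymap f -> polymap (iter k (DXs c) f).
Proof. by move=> pf; elim: k => //= k; apply: polymap_DXs. Qed.

Lemma DX_lin (a b : C) f h : polymap f -> polymap h ->
  DX X (fun x => a * f x + b * h x : C^o) = fun x => a * DX X f x + b * DX X h x.
Proof.
move=> pf ph; apply/funext => x; rewrite /DX der_add; try exact: polymap_mulc.
by rewrite !(der_scalec (W := C^o)).
Qed.

Lemma DXs_lin c (a b : C) f h : polymap f -> polymap h ->
  DXs c (fun x => a * f x + b * h x : C^o) = fun x => a * DXs c f x + b * DXs c h x.
Proof. by move=> pf ph; apply/funext => x; rewrite /DXs DX_lin //; ring. Qed.

Lemma iterDXs_lin k c (a b : C) f h : polymap f -> polymap h ->
  iter k (DXs c) (fun x => a * f x + b * h x : C^o)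
  = fun x => a * iter k (DXs c) f x + b * iter k (DXs c) h x.
Proof.
move=> pf ph; elim: k => //= k ->; apply: DXs_lin; exact: polymap_iterDXs.
Qed.

Lemma DXs_comm c d f : polymap f -> DXs c (DXs d f) = DXs d (DXs c f).
Proof.
move=> pf; have E a b : DXs a (DXs b f) = fun x => DX X (DX X f) x - (a + b) * DX X f x + a * b * f x.
  apply/funext => x; rewrite /DXs.
  have -> : (fun x => DX X f x - b * f x : C^o) = fun x => 1 * DX X f x + (- b) * f x.
    by apply/funext => y; ring.
  by rewrite DX_lin //; [ring|exact: polymap_DX].
by rewrite !E; apply/funext => x; ring.
Qed.

Lemma sing_lin (a b : C) f h : polymap f -> polymap h -> sing f -> sing h ->
  sing (fun x => a * f x + b * h x : C^o).
Proof.
move=> pf ph Sf Sh k; have -> : iter k (DX X) (fun x => a * f x + b * h x : C^o)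
    = fun x => a * iter k (DX X) f x + b * iter k (DX X) h x.
  elim: k => //= k ->; apply: DX_lin.
    by elim: k => //= k; apply: polymap_DX.
  by elim: k => //= k; apply: polymap_DX.
by rewrite Sf Sh !mulr0 addr0.
Qed.

Lemma sing_DX f : sing f -> sing (DX X f).
Proof. by move=> Sf k; rewrite -iterSr; apply: Sf. Qed.

Lemma sing_DXs c f : polymap f -> sing f -> sing (DXs c f).
Proof.
move=> pf Sf; have -> : DXs c f = fun x => 1 * DX X f x + (- c) * f x.
  by apply/funext => x; rewrite /DXs; ring.
by apply: sing_lin => //; [exact: polymap_DX|exact: sing_DX].
Qed.

Lemma iterDXs_comm k c d f : polymap f -> iter k (DXs c) (DXs d f) = DXs d (iter k (DXs c) f).
Proof. by move=> pf; elim: k => //= k ->; rewrite DXs_comm //; apply: polymap_iterDXs. Qed.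

Lemma iterDXs_comm2 k l c d f : polymap f ->
  iter k (DXs c) (iter l (DXs d) f) = iter l (DXs d) (iter k (DXs c) f).
Proof.
by move=> pf; elim: l => //= l IH; rewrite iterDXs_comm ?IH //; apply: polymap_iterDXs.
Qed.

(** The operators [DXs c] and [DXs d] differ by the scalar d - c, so that [f] is a combination of
    their values at [f], for which the total exponent is smaller. *)
Lemma sing_coprime c d k l f : c != d -> polymap f ->
  sing (iter k (DXs c) f) -> sing (iter l (DXs d) f) -> sing f.
Proof.
move=> cd; have [m] := ubnP (k + l)%N; elim: m k l f => // m IH [|k] [|l] f //= lt pf Sc Sd.
have Pc : sing (DXs c f).
  apply: (IH k l.+1 _ _ (polymap_DXs c pf)); first by lia.
    by rewrite -iterSr; exact: Sc.
  by rewrite iterDXs_comm //; apply: sing_DXs => //; apply: (polymap_iterDXs l.+1).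
have Pd : sing (DXs d f).
  apply: (IH k.+1 l _ _ (polymap_DXs d pf)); first by lia.
    by rewrite iterDXs_comm //; apply: sing_DXs => //; apply: (polymap_iterDXs k.+1).
  by rewrite -iterSr; exact: Sd.
have -> : f = fun x => (d - c)^-1 * DXs c f x + (- (d - c)^-1) * DXs d f x.
  apply/funext => x; rewrite /DXs; have nz : d - c != 0 by rewrite subr_eq0 eq_sym.
  by field.
by apply: sing_lin => //; apply: polymap_DXs.
Qed.

Lemma iterDXs0 k c : iter k (DXs c) (fun=> 0) = fun=> 0.
Proof.
elim: k => //= k ->; apply/funext => x.
by rewrite /DXs /DX der_cst mulr0 subr0.
Qed.

Lemma iterDXs_sum k c (I : Type) (s : seq I) (F : I -> 'M[C]_n -> C^o) :
  (forall i, polymap (F i)) -> iter k (DXs c) (fun x => \sum_(i <- s) F i x : C^o)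
  = fun x => \sum_(i <- s) iter k (DXs c) (F i) x.
Proof.
move=> pF; elim: s => [|i s IH].
  rewrite (_ : (fun x => _) = fun=> 0) ?iterDXs0; apply/funext => x; by rewrite big_nil.
rewrite (_ : (fun x => \sum_(j <- i :: s) F j x : C^o) =
  fun x => 1 * F i x + 1 * \sum_(j <- s) F j x); last by apply/funext => x; rewrite big_cons !mul1r.
rewrite iterDXs_lin //; last exact: polymap_sum.
by rewrite IH; apply/funext => x; rewrite big_cons !mul1r.
Qed.

(** If a sum of generalised eigenfunctions for distinct eigenvalues has zero derivatives at 1 along
    [X], so does each term: applying a power of one operator reduces to a shorter sum, and
    [sing_coprime] undoes it. *)
Lemma sing_components (K : eqType) (s : seq K) (c : K -> C) (F : K -> 'M[C]_n -> C^o) :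
  uniq s -> {in s &, injective c} -> (forall v, polymap (F v)) ->
  (forall v, v \in s -> exists k, sing (iter k (DXs (c v)) (F v))) ->
  sing (fun x => \sum_(v <- s) F v x : C^o) -> forall v, v \in s -> sing (F v).
Proof.
have sing_sum (r : seq K) (H : K -> 'M[C]_n -> C^o) : (forall v, polymap (H v)) ->
    (forall v, v \in r -> sing (H v)) -> sing (fun x => \sum_(v <- r) H v x : C^o).
  move=> pH; elim: r => [_ k|v r IH Hr].
    rewrite (_ : (fun x => _) = fun=> 0); last by apply/funext => x; rewrite big_nil.
    have -> : iter k (DX X) (fun=> 0 : C^o) = fun=> 0 by elim: k => //= k ->; apply/funext => x; rewrite /DX der_cst.
    by [].
  rewrite (_ : (fun x => _) = fun x => 1 * H v x + 1 * \sum_(w <- r) H w x).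
    apply: sing_lin => //; [exact: polymap_sum|exact/Hr/mem_head|].
    by apply: IH => w wr; apply: Hr; rewrite inE wr orbT.
  by apply/funext => x; rewrite big_cons !mul1r.
elim: s F => [|v s IH] F //= /andP [vs us] cinj pF HF S.
have [k Sv] := HF v (mem_head _ _).
have cinj' : {in s &, injective c} by move=> a b as' bs; apply: cinj; rewrite inE ?as' ?bs orbT.
have Ss w : w \in s -> sing (F w).
  move=> ws; have ws' : w \in v :: s by rewrite inE ws orbT.
  have [l Sw] := HF w ws'.
  apply: (sing_coprime (c := c v) (d := c w) (k := k)) Sw => //.
    apply: contraNneq vs => /(cinj _ _ (mem_head _ _) ws') -> //.
  apply: (IH (fun w => iter k (DXs (c v)) (F w))) => // [u|u us'|]; first exact: polymap_iterDXs.
    have [l' Su] : exists l, sing (iter l (DXs (c u)) (F u)) by apply: HF; rewrite inE us' orbT.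
    exists l'; rewrite iterDXs_comm2 //; elim: k {Sv} => //= k; apply: sing_DXs.
    exact/polymap_iterDXs/polymap_iterDXs.
  rewrite -iterDXs_sum //.
  have -> : (fun x => \sum_(i <- s) F i x : C^o) =
      fun x => 1 * \sum_(i <- v :: s) F i x + (- 1) * F v x.
    by apply/funext => x; rewrite big_cons; ring.
  rewrite iterDXs_lin //; last exact: polymap_sum.
  apply: sing_lin => //; try exact: polymap_iterDXs.
    exact/polymap_iterDXs/polymap_sum.
  elim: k {Sv} => //= k; apply: sing_DXs; exact/polymap_iterDXs/polymap_sum.
move=> w; rewrite inE => /orP [/eqP ->|/Ss //].
have -> : F v = fun x => 1 * \sum_(i <- v :: s) F i x + (- 1) * \sum_(i <- s) F i x.
  by apply/funext => x; rewrite big_cons; ring.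
by apply: sing_lin; [exact: polymap_sum|exact: polymap_sum|exact: S|exact: sing_sum].
Qed.

Lemma gen_eigen_mul k l c d f h : polymap f -> polymap h ->
  iter k (DXs c) f = (fun=> 0) -> iter l (DXs d) h = (fun=> 0) ->
  exists m, iter m (DXs (c + d)) (fun x => f x * h x : C^o) = fun=> 0.
Proof.
have [m] := ubnP (k + l)%N; elim: m k l f h => // m IH [|k] [|l] f h lt pf ph; try by
  [move=> /= -> _; exists 0%N; apply/funext => x; rewrite /= mul0r
  |move=> /= _ ->; exists 0%N; apply/funext => x; rewrite /= mulr0].
move=> Ef Eh.
have [m1 E1] : exists m, iter m (DXs (c + d)) (fun x => DXs c f x * h x : C^o) = fun=> 0.
  apply: (IH k l.+1) => //; [exact: polymap_DXs|by rewrite -iterSr].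
have [m2 E2] : exists m, iter m (DXs (c + d)) (fun x => f x * DXs d h x : C^o) = fun=> 0.
  apply: (IH k.+1 l) => //; [by move: lt; rewrite addnS ltnS|exact: polymap_DXs|by rewrite -iterSr].
exists (m1 + m2).+1; rewrite iterSr.
have -> : DXs (c + d) (fun x => f x * h x : C^o) =
    fun x => 1 * (DXs c f x * h x) + 1 * (f x * DXs d h x).
  by apply/funext => x; rewrite /DXs /DX der_mul //; ring.
rewrite iterDXs_lin; [|by apply: polymap_mul => //; apply: polymap_DXs..].
rewrite {1}addnC !iterD E1 E2 !iterDXs0; by apply/funext => x; ring.
Qed.

End GeneralizedEigenfunctions.

Section Replica.
Variables (C : numClosedFieldType) (n : nat) (G : set 'M[C]_n) (g : {vspace 'M[C]_n}).
Hypothesis AG : algebraic_lie G g.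
Hypothesis G_det : forall x, G x -> \det x = 1.

Variables (X : 'M[C]_n) (q s : nat) (c : 'I_q -> C) (pi : 'I_q -> 'M[C]_n).
Variables (b : 'I_s -> C) (m : 'I_q -> 'I_s -> int).
Hypothesis gX : X \in g.
Hypothesis pi_sum : \sum_i pi i = 1%:M.
Hypothesis pi_orth : forall i j, pi i *m pi j = if i == j then pi i else 0.
Hypothesis pi_comm : forall A, A *m X = X *m A -> forall i, A *m pi i = pi i *m A.
Hypothesis pi_nil : forall i, exists k, iter k (mulmx (X - (c i)%:M)) (pi i) = 0.
Hypothesis c_b : forall i, c i = \sum_j (m i j)%:~R * b j.
Hypothesis b_free : forall v : 'I_s -> int, \sum_j (v j)%:~R * b j = 0 -> forall j, v j = 0.

(** The torus generated by the semisimple part of [X]: its cocharacters are the integral operators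
    that multiply the independent numbers [b j] in the eigenvalues. *)
Definition replica (z : 'I_s -> C) := \sum_i mono (m i) z *: pi i.

Lemma replica_pi z i : replica z *m pi i = mono (m i) z *: pi i.
Proof.
rewrite /replica mulmx_suml (bigD1 i) //= -scalemxAl pi_orth eqxx big1 ?addr0 // => j /negbTE ne.
by rewrite -scalemxAl pi_orth ne scaler0.
Qed.

Lemma replicaM z z' : replica (fun j => z j * z' j) = replica z *m replica z'.
Proof.
rewrite {3}/replica mulmx_sumr; apply: eq_bigr => i _.
by rewrite -scalemxAr replica_pi scalerA monoM mulrC.
Qed.

Lemma replica1 : replica (fun=> 1) = 1%:M.
Proof.
rewrite -pi_sum; apply: eq_bigr => i _; rewrite /mono big1 ?scale1r // => j _.
by rewrite exp1rz.
Qed.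

(** Each polynomial map splits into pieces that are at once generalised eigenfunctions of [DX X] and
    eigenfunctions of right translation by replicas, with the same integral label [u i]. *)
Lemma replica_expand (f : 'M[C]_n -> C^o) : polymap f ->
  exists (I : finType) (u : I -> 'I_s -> int) (F : I -> 'M[C]_n -> C^o),
  [/\ forall i, polymap (F i), forall x, f x = \sum_i F i x,
      forall i, exists k, iter k (DXs X (\sum_j (u i j)%:~R * b j)) (F i) = fun=> 0
    & forall i x z, nzv z -> F i (x *m replica z) = mono (u i) z * F i x].
Proof.
elim=> [w|a d f' pf [I [u [F [pF Ef eF rF]]]]|f1 f2 _ [I [u [F [pF Ef eF rF]]]] _
  [I' [u' [F' [pF' Ef' eF' rF']]]]].
- exists unit, (fun _ _ => 0), (fun _ _ => w); split=> [_|x|_|_ x z nz].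
  + exact: PolyCst.
  + by rewrite (big_pred1 tt) // => -[].
  + exists 1%N => /=; apply/funext => x; rewrite /DXs /DX der_cst big1 ?mul0r ?subr0 // => j _.
    by rewrite mul0r.
  + by rewrite /mono big1 ?mul1r // => j _; rewrite expr0z.
- have lin (A : 'M[C]_n) : linear (fun x : 'M[C]_n => (x *m A) a d : C^o).
    by move=> e x y; rewrite mulmxDl -scalemxAl !mxE.
  exists ('I_q * I)%type, (fun ik j => m ik.1 j + u ik.2 j),
    (fun ik x => (x *m pi ik.1) a d * F ik.2 x); split.
  + by move=> [i k] /=; apply: polymap_mul => //; apply: polymap_of_linear.
  + move=> x; rewrite -(pair_bigA _ (fun i k => (x *m pi i) a d * F k x)) /=.
    under eq_bigr do rewrite -mulr_sumr -Ef.
    by rewrite -mulr_suml -summxE -mulmx_sumr pi_sum mulmx1.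
  + move=> [i k] /=; have [l El] := eF k; have [l' El'] := pi_nil i.
    have -> : \sum_j (m i j + u k j)%:~R * b j = c i + \sum_j (u k j)%:~R * b j.
      by rewrite c_b -big_split; apply: eq_bigr => j _; rewrite rmorphD mulrDl.
    apply: (gen_eigen_mul (k := l') (l := l)) => //; first exact: polymap_of_linear.
    have H A l0 : iter l0 (DXs X (c i)) (fun x => (x *m A) a d : C^o) =
        fun x => (x *m iter l0 (mulmx (X - (c i)%:M)) A) a d.
      elim: l0 => //= l0 ->; apply/funext => x; rewrite /DXs /DX (der_of_linear _ _ (lin _)).
      rewrite mulmxBl mul_scalar_mx mulmxBr -scalemxAr !mulmxA.
      rewrite [RHS]mxE; congr (_ + _); rewrite [RHS]mxE; congr (- _).
      by rewrite [RHS]mxE.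
    by rewrite H El'; apply/funext => x; rewrite mulmx0 mxE.
  + move=> [i k] x z nz /=; rewrite rF // monoD // -mulmxA replica_pi -scalemxAr mxE; ring.
- exists (I + I')%type, (fun i => match i with inl i => u i | inr i => u' i end),
    (fun i => match i with inl i => F i | inr i => F' i end); split.
  + by case.
  + by move=> x; rewrite big_sumType /= Ef Ef'.
  + by case.
  + by case.
Qed.

(** All derivatives of [f] along [X] vanish at 1. As the [b j] are independent over the integers,
    different labels give different eigenvalues, so each piece vanishes at 1, and a replica only
    multiplies the pieces by scalars. *)
Lemma replica_vanish (f : 'M[C]_n -> C^o) z : polymap f -> (forall x, G x -> f x = 0) -> nzv z ->
  f (replica z) = 0.
Proof.
move=> pf f0 nz; have [I [u [F [pF Ef eF rF]]]] := replica_expand pf.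
pose lab i : {ffun 'I_s -> int} := [ffun j => u i j].
pose us := undup [seq lab i | i <- enum I].
pose FF v x : C^o := \sum_i (if lab i == v then F i x else 0).
have pFi v i : polymap (fun x => if lab i == v then F i x else 0 : C^o).
  by case: (lab i == v) => //; apply: PolyCst.
have pFF v : polymap (FF v) by apply: polymap_sum.
have EFF x : f x = \sum_(v <- us) FF v x.
  rewrite Ef exchange_big /=; apply: eq_bigr => i _.
  have li : lab i \in us by rewrite mem_undup map_f // mem_enum.
  rewrite (bigD1_seq (lab i)) ?undup_uniq //= eqxx big1 ?addr0 // => v.
  by rewrite eq_sym => /negbTE ->.
have FF1 v : v \in us -> FF v 1%:M = 0.
  move=> vus; suff S : sing X (FF v) by apply: (S 0%N).
  apply: (sing_components (s := us) (c := fun v : {ffun 'I_s -> int} => \sum_j (v j)%:~R * b j)) => //.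
  - exact: undup_uniq.
  - move=> v1 v2 _ _ E; apply/ffunP => j; apply/eqP; rewrite -subr_eq0; apply/eqP.
    apply: (b_free (v := fun j => v1 j - v2 j)).
    by under eq_bigr do rewrite rmorphB mulrBl; rewrite sumrB E subrr.
  - move=> w wus; have [k Hk] := choice eF; exists (\sum_i k i)%N => l.
    rewrite /FF iterDXs_sum //.
    rewrite (_ : (fun x => _) = fun=> 0 : C^o).
      have -> : iter l (DX X) (fun=> 0 : C^o) = fun=> 0.
        by elim: l => //= l ->; apply/funext => x; rewrite /DX der_cst.
      by [].
    apply/funext => x; apply: big1 => i _; case: eqP => [Ei|_]; last by rewrite iterDXs0.
    have -> : \sum_j (w j)%:~R * b j = \sum_j (u i j)%:~R * b j.
      by apply: eq_bigr => j _; rewrite -Ei ffunE.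
    rewrite (bigD1 i) //= addnC iterD.
    by rewrite (_ : iter (k i) _ _ = fun=> 0) ?iterDXs0 //; apply: Hk.
  - have -> : (fun x => \sum_(v <- us) FF v x : C^o) = f by apply/funext => x; rewrite EFF.
    move=> k; suff H : forall x, G x -> iter k (DX X) f x = 0 by apply/H/(al_1 AG).
    elim: k => [|k IH] //= x Gx; apply: (DX_vanish (al_M AG) (al_lie AG)) => //.
    by elim: (k) => //= l; apply: polymap_DX.
rewrite EFF big_seq big1 // => v vus; rewrite -[replica z]mul1mx.
have -> : FF v (1%:M *m replica z) = mono v z * FF v 1%:M.
  rewrite /FF mulr_sumr; apply: eq_bigr => i _; case: eqP => [<-|_]; last by rewrite mulr0.
  by rewrite rF //; congr (mono _ _ * _); apply/funext => j; rewrite ffunE.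
by rewrite FF1 // mulr0.
Qed.

Lemma replica_in z : nzv z -> G (replica z).
Proof.
move=> nz; have [I [pI GI]] := al_closed AG; apply/GI; split.
  have : replica z *m replica (fun j => (z j)^-1) = 1%:M.
    by rewrite -replicaM -replica1; congr replica; apply/funext => j; rewrite divff.
  by move/mulmx1_unit => [].
by move=> f If; apply: replica_vanish => // [|x /GI [_]]; [exact: pI|apply].
Qed.

Section Maximal.
Variables (T : set 'M[C]_n) (r : nat) (tor : ('I_r -> C) -> 'M[C]_n).
Variables (p pv : 'I_r -> 'M[C]_n -> C^o) (t : {vspace 'M[C]_n}).
Hypothesis TC : torus_chart T tor p pv.
Hypothesis t_lie : forall X, X \in t <->
  forall f : 'M[C]_n -> C^o, polymap f -> (forall x, T x -> f x = 0) -> der f 1%:M X = 0.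
Hypothesis TG : forall x, T x -> G x.
Hypothesis T_max : forall (T' : set 'M[C]_n) r' (tor' : ('I_r' -> C) -> 'M[C]_n) p' pv',
  torus_chart T' tor' p' pv' -> poly_closed T' -> (forall x, T' x -> G x) ->
  (forall x, T x -> T' x) -> forall x, T' x -> T x.
Hypothesis X_comm : forall Y, Y \in t -> X *m Y = Y *m X.

Lemma tor_comm z : nzv z -> tor z *m X = X *m tor z.
Proof.
move=> nz; have /choice [H HH] : forall j, exists Hj : 'M[C]_n, forall a d, lder (fun y => tor (evec j y) a d) (Hj a d).
  move=> j; have /choice [h Hh] : forall ad : 'I_n * 'I_n, exists d,
      lder (fun y => tor (evec j y) ad.1 ad.2) d by move=> [a d]; apply: (tc_laurent TC).
  by exists (\matrix_(a, d) h (a, d)) => a d; rewrite mxE; apply: (Hh (a, d)).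
have [|Q [w [Qu Hw]]] := chart_weights TC HH (@polymap_id C n) (erefl _); first by [].
have HQ j : H j *m Q = Q *m diag_mx (\row_i (w i j)%:~R).
  by rewrite -[H j](@der_id C n 1%:M); apply: (der_tor_weights TC HH (@polymap_id C n) Hw).
pose X' := invmx Q *m X *m Q.
have X'E j : diag_mx (\row_i (w i j)%:~R) *m X' = X' *m diag_mx (\row_i (w i j)%:~R).
  have HD : invmx Q *m H j = diag_mx (\row_i (w i j)%:~R) *m invmx Q.
    by apply: (can_inj (mulmxK Qu)); rewrite mulmxKV // -mulmxA HQ mulKmx.
  rewrite /X' !mulmxA -HD -!mulmxA -HQ; congr (_ *m _); rewrite !mulmxA.
  by rewrite X_comm //; apply: (tor_H_t TC t_lie HH).
have EX : X = Q *m X' *m invmx Q by rewrite /X' !mulmxA mulmxV // mul1mx mulmxK.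
move: X' X'E EX => X' X'E EX.
have E : diag_mx (\row_i mono (w i) z) *m X' = X' *m diag_mx (\row_i mono (w i) z).
  apply/matrixP => i k; rewrite mul_diag_mx mul_mx_diag !mxE.
  have [X0|X0] := eqVneq (X' i k) 0; first by rewrite X0 mul0r mulr0.
  suff -> : w i = w k by rewrite mulrC.
  apply/funext => j; have /matrixP /(_ i k) := X'E j; rewrite mul_diag_mx mul_mx_diag !mxE.
  by rewrite mulrC => /(mulfI X0)/intr_inj.
have Et : tor z = Q *m diag_mx (\row_i mono (w i) z) *m invmx Q by rewrite -Hw // mulmxK.
rewrite EX Et -!mulmxA !mulKmx //; rewrite [diag_mx _ *m (_ *m _)]mulmxA E.
by rewrite -!mulmxA.
Qed.

(** The product of T with the replicas is again a torus in G, so it is T by maximality; the given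
    matrix is the derivative of a one-parameter group of replicas. *)
Lemma replica_in_t j : \sum_i (m i j)%:~R *: pi i \in t.
Proof.
pose zl (z : 'I_(r + s) -> C) := fun j => z (lshift s j).
pose zr (z : 'I_(r + s) -> C) := fun j => z (rshift r j).
pose R z := tor (zl z) *m replica (zr z).
have nzl z : nzv z -> nzv (zl z) by move=> nz k; apply: nz.
have nzr z : nzv z -> nzv (zr z) by move=> nz k; apply: nz.
have torR z z' : nzv z -> replica z' *m tor z = tor z *m replica z'.
  move=> nz; rewrite /replica mulmx_suml mulmx_sumr; apply: eq_bigr => i _.
  by rewrite -scalemxAl -scalemxAr (pi_comm (tor_comm nz)).
have RM z z' : nzv z -> nzv z' -> R (fun j => z j * z' j) = R z *m R z'.
  move=> nz nz'; rewrite /R (tc_mul TC (nzl z nz) (nzl z' nz')) replicaM.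
  by rewrite -!mulmxA; congr (_ *m _); rewrite !mulmxA torR //; apply: nzl.
have R1 : R (fun=> 1) = 1%:M by rewrite /R (tc_one TC) replica1 mulmx1.
have zl_l k y : zl (evec (lshift s k) y) = evec k y.
  by apply/funext => i; rewrite /zl /evec (inj_eq (@lshift_inj _ _)).
have zr_l k y : zr (evec (lshift s k) y) = fun=> 1.
  by apply/funext => i; rewrite /zr /evec eq_rlshift.
have zl_r k y : zl (evec (rshift r k) y) = fun=> 1.
  by apply/funext => i; rewrite /zl /evec eq_lrshift.
have zr_r k y : zr (evec (rshift r k) y) = evec k y.
  by apply/funext => i; rewrite /zr /evec (inj_eq (@rshift_inj _ _)).
have Rr k y : R (evec (rshift r k) y) = replica (evec k y).
  by rewrite /R zl_r zr_r (tc_one TC) mul1mx.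
have lder_rep k a d : lder (fun y => replica (evec k y) a d) ((\sum_i (m i k)%:~R *: pi i) a d).
  rewrite summxE; apply: (@lder_ext _ (fun y => \sum_i pi i a d * y ^ m i k)) => [y _|].
    by rewrite summxE; apply: eq_bigr => i _; rewrite mxE mono_evec mulrC.
  by apply: lder_sum => i; rewrite mxE mulrC; apply/lder_mulc/lder_exprz.
have [k a d|Q [W [Qu HW]]] := simultaneous_weights _ RM R1.
  case: (split_ordP k) => l ->.
    have [e He] := tc_laurent TC l a d; exists e; apply: lder_ext He => y _.
    by rewrite /R zl_l zr_l replica1 mulmx1.
  eexists; apply: (@lder_ext _ (fun y => replica (evec l y) a d)) (lder_rep l a d) => y _.
  by rewrite Rr.
have ER z : nzv z -> Q *m diag_mx (\row_i mono (W i) z) *m invmx Q = R z.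
  by move=> nz; rewrite -HW // mulmxK.
have GR z : nzv z -> G (R z).
  move=> nz; apply: (al_M AG); first by apply/TG/(tc_in TC)/nzl.
  exact/replica_in/nzr.
have [z nz|T' [r' [tor' [p' [pv' [TC' T'c T'in T'sur]]]]]] := @monomial_torus C n Q _ W Qu.
  by rewrite ER // G_det //; apply: GR.
have T'T : forall x, T' x -> T x.
  apply: (T_max TC') => // [x /T'sur [z nz ->]|x /(tc_sur TC) [z nz ->]].
    by rewrite ER //; apply: GR.
  pose z1 (k : 'I_(r + s)) := match split k with inl i => z i | inr _ => 1 end.
  have nz1 : nzv z1 by move=> k; rewrite /z1; case: (split k) => i; rewrite ?oner_eq0.
  have zl1 : zl z1 = z by apply/funext => i; rewrite /zl /z1 (unsplitK (inl i)).
  have zr1 : zr z1 = fun=> 1 by apply/funext => i; rewrite /zr /z1 (unsplitK (inr i)).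
  have -> : tor z = R z1 by rewrite /R zl1 zr1 replica1 mulmx1.
  by rewrite -ER //; apply: T'in.
apply/t_lie => f pf f0.
have e1 : evec j 1 = (fun=> 1) :> ('I_s -> C) by apply/funext => k; rewrite /evec if_same.
have L := lder_polymap (M := fun y => replica (evec j y)) pf (lder_rep j).
rewrite e1 replica1 in L; apply: lder_uniq L (lder_cst 0) _ => y y0.
apply/f0/T'T; rewrite -Rr -ER; last exact: nzv_evec.
by apply/T'in/nzv_evec.
Qed.

End Maximal.
End Replica.

Section Jordan.
Variables (C : numClosedFieldType) (n : nat) (G : set 'M[C]_n) (g : {vspace 'M[C]_n}).
Hypothesis AG : algebraic_lie G g.
Hypothesis G_det : forall x, G x -> \det x = 1.
Variables (T : set 'M[C]_n) (r : nat) (tor : ('I_r -> C) -> 'M[C]_n).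
Variables (p pv : 'I_r -> 'M[C]_n -> C^o) (t : {vspace 'M[C]_n}).
Hypothesis TC : torus_chart T tor p pv.
Hypothesis t_lie : forall X, X \in t <->
  forall f : 'M[C]_n -> C^o, polymap f -> (forall x, T x -> f x = 0) -> der f 1%:M X = 0.
Hypothesis TG : forall x, T x -> G x.
Hypothesis T_max : forall (T' : set 'M[C]_n) r' (tor' : ('I_r' -> C) -> 'M[C]_n) p' pv',
  torus_chart T' tor' p' pv' -> poly_closed T' -> (forall x, T' x -> G x) ->
  (forall x, T x -> T' x) -> forall x, T' x -> T x.

Definition nilpotent (N : 'M[C]_n) := exists k, iter k (mulmx N) 1%:M = 0.

(** The semisimple part is a combination, with coefficients [b j], of the derivatives of the
    replicas. *)
Theorem centralizer_jordan X : X \in g -> (forall Y, Y \in t -> X *m Y = Y *m X) ->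
  exists2 S, S \in t & nilpotent (X - S).
Proof.
move=> gX Xt; have [q [c [pi [cinj psum porth pcomm pnil]]]] := spectral_idempotents X.
have [s [b [m [cb bfree]]]] := integral_coordinates c.
pose S := \sum_i c i *: pi i; exists S.
  have -> : S = \sum_j b j *: (\sum_i (m i j)%:~R *: pi i).
    under [RHS]eq_bigr do rewrite scaler_sumr.
    rewrite exchange_big /=; apply: eq_bigr => i _; rewrite cb scaler_suml.
    by apply: eq_bigr => j _; rewrite scalerA mulrC.
  apply: memv_suml => j _; apply: memvZ.
  exact: (replica_in_t AG G_det gX psum porth pcomm pnil cb bfree TC t_lie TG T_max Xt).
have [k Hk] := choice pnil; exists (\sum_i k i)%N.
have Spi i : S *m pi i = c i *: pi i.
  rewrite /S mulmx_suml (bigD1 i) //= -scalemxAl porth eqxx big1 ?addr0 // => j /negbTE ne.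
  by rewrite -scalemxAl porth ne scaler0.
have it_pi i l A : iter l (mulmx A) (pi i) = iter l (mulmx A) 1%:M *m pi i.
  by elim: l => [|l IH] /=; rewrite ?mul1mx // IH mulmxA.
have it0 l A : iter l (mulmx A) 0 = 0 :> 'M[C]_n by elim: l => //= l ->; rewrite mulmx0.
have E i l : iter l (mulmx (X - S)) (pi i) = iter l (mulmx (X - (c i)%:M)) (pi i).
  have Xpi : X *m pi i = pi i *m X by apply: pcomm.
  have H l' : pi i *m iter l' (mulmx (X - (c i)%:M)) (pi i) = iter l' (mulmx (X - (c i)%:M)) (pi i).
    elim: l' => [|l' IH] /=; first by rewrite porth eqxx.
    rewrite mulmxA mulmxBr -Xpi mul_mx_scalar -mul_scalar_mx -mulmxBl -mulmxA IH.
    by [].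
  elim: l => //= l ->; rewrite -H !mulmxA; congr (_ *m _).
  by rewrite !mulmxBl Spi mul_scalar_mx.
rewrite -[LHS]mulmx1 -[Y in _ *m Y]psum mulmx_sumr big1 // => i _; rewrite -it_pi E (bigD1 i) //=.
by rewrite addnC iterD Hk it0.
Qed.

End Jordan.

(** * Root decomposition of a simple Lie algebra *)

Section Nilpotent.
Variables (C : numClosedFieldType).

Lemma iter_mulmx n k (A B : 'M[C]_n) : iter k (mulmx A) B = iter k (mulmx A) 1%:M *m B.
Proof. by elim: k => [|k IH] /=; rewrite ?mul1mx // IH mulmxA. Qed.

Lemma iter_mulmx0 n k (A : 'M[C]_n) : iter k (mulmx A) 0 = 0 :> 'M[C]_n.
Proof. by rewrite iter_mulmx mulmx0. Qed.

Lemma nilpotent_mul n (A B : 'M[C]_n) : nilpotent A -> A *m B = B *m A -> nilpotent (A *m B).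
Proof.
move=> [k Ak] AB; exists k.
have BA l : B *m iter l (mulmx A) 1%:M = iter l (mulmx A) 1%:M *m B.
  by elim: l => [|l IH] /=; rewrite ?mulmx1 ?mul1mx // mulmxA -AB -!mulmxA IH.
suff -> : iter k (mulmx (A *m B)) 1%:M = iter k (mulmx A) 1%:M *m iter k (mulmx B) 1%:M.
  by rewrite Ak mul0mx.
elim: (k) => [|l IH] /=; first by rewrite mulmx1.
by rewrite IH !mulmxA -(mulmxA A B) BA !mulmxA.
Qed.

Lemma nilpotent_trace n (A : 'M[C]_n) : nilpotent A -> \tr A = 0.
Proof.
move=> [k Ak]; case: n A Ak => [|n] A Ak; first by rewrite /mxtrace big_ord0.
have [s Es] := closed_field_poly_normal (char_poly A).
rewrite (eqP (char_poly_monic A)) scale1r in Es.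
have s0 z : z \in s -> z = 0.
  move=> zs; have : root (char_poly A) z by rewrite Es root_prod_XsubC.
  rewrite -eigenvalue_root_char => /eigenvalueP [v vA v0].
  have vk l : v *m iter l (mulmx A) 1%:M = z ^+ l *: v.
    elim: l => [|l IH] /=; first by rewrite mulmx1 scale1r.
    by rewrite mulmxA vA -scalemxAl IH scalerA exprS.
  have := vk k; rewrite Ak mulmx0 => /esym/eqP; rewrite scaler_eq0 (negbTE v0) orbF.
  by rewrite expf_eq0 => /andP[_ /eqP].
have ss : size s = n.+1.
  by have := size_char_poly A; rewrite Es size_prod_XsubC => -[].
have := @char_poly_trace C n.+1 A isT; rewrite Es.
rewrite (eq_big_seq (fun=> 'X)) => [|z /s0 ->]; last by rewrite polyC0 subr0.
rewrite big_const_seq count_predT iter_mulr_1 ss coefXn /= ltn_eqF //.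
by move=> /eqP; rewrite eq_sym oppr_eq0 => /eqP.
Qed.

(** A repeated bracket expands into terms A^a Z A^b; with 2k brackets one of the two powers is at
    least the k-th. *)
Lemma nilpotent_ad n (A : 'M[C]_n) : nilpotent A -> exists k, forall Z, iter k (bra A) Z = 0.
Proof.
move=> [k Ak]; exists (k + k)%N => Z.
pose pA a := iter a (mulmx A) 1%:M.
have pA_comm a : pA a *m A = A *m pA a.
  elim: a => [|a IH]; rewrite /pA /= ?mulmx1 ?mul1mx // -/(pA a) -mulmxA IH.
  by [].
have pA0 a : (k <= a)%N -> pA a = 0.
  by move=> ka; rewrite -(subnK ka) /pA iterD Ak iter_mulmx0.
have lin a : linear (iter a (bra A)).
  move=> c u v; elim: a => //= a ->.
  by rewrite /bra mulmxDr mulmxDl -scalemxAr -scalemxAl scalerBr opprD addrACA.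
have H N a b : (k + k <= N + a + b)%N -> iter N (bra A) (pA a *m Z *m pA b) = 0.
  elim: N a b => [|N IH] a b kab.
    have [/pA0 -> /=|ak] := leqP k a; first by rewrite !mul0mx.
    by rewrite /= (pA0 b) ?mulmx0 //; lia.
  rewrite iterSr; have -> : bra A (pA a *m Z *m pA b) = pA a.+1 *m Z *m pA b - pA a *m Z *m pA b.+1.
    rewrite /bra {2 3}/pA /= -/(pA a) -/(pA b) -[pA a *m Z *m pA b *m A]mulmxA.
    by rewrite (pA_comm b) !mulmxA.
  have linB u v : iter N (bra A) (u - v) = iter N (bra A) u - iter N (bra A) v.
    by rewrite -scaleN1r addrC lin scaleN1r addrC.
  by rewrite linB !IH ?subr0 //; lia.
have := H (k + k)%N 0%N 0%N; rewrite /pA /= mul1mx mulmx1; apply; lia.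
Qed.

End Nilpotent.

(** * Engel's theorem *)

Section Engel.
Variables (C : numClosedFieldType) (n : nat).
Local Notation M := 'M[C]_n.
Implicit Types (L U h : {vspace 'M[C]_n}).

Definition subalgebra L := forall X Y : M, X \in L -> Y \in L -> bra X Y \in L.
Definition stable_under L U := forall X Y : M, X \in L -> Y \in U -> bra X Y \in U.

Lemma bra_jacobi (X Y Z : M) : bra X (bra Y Z) = bra Y (bra X Z) + bra (bra X Y) Z.
Proof.
rewrite /bra !mulmxBr !mulmxBl !mulmxA; move: (X *m Y *m Z) (X *m Z *m Y) (Y *m Z *m X)
  (Z *m Y *m X) (Y *m X *m Z) (Z *m X *m Y) => a b c d e f.
by rewrite !opprB; apply/matrixP => i j; rewrite !mxE; ring.
Qed.

Lemma bra_linr (X : M) : linear (bra X).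
Proof. by move=> c u v; rewrite /bra mulmxDr mulmxDl -scalemxAr -scalemxAl scalerBr opprD addrACA. Qed.

Lemma bra_linl (X : M) : linear (fun Y => bra Y X).
Proof. by move=> c u v; rewrite /bra mulmxDr mulmxDl -scalemxAr -scalemxAl scalerBr opprD addrACA. Qed.

Lemma braDr (X Y Z : M) : bra X (Y + Z) = bra X Y + bra X Z.
Proof. exact: linear_hypD (bra_linr X) _ _. Qed.

Lemma braZr (X Y : M) c : bra X (c *: Y) = c *: bra X Y.
Proof. exact: linear_hypZ (bra_linr X) _ _. Qed.

Lemma braDl (X Y Z : M) : bra (Y + Z) X = bra Y X + bra Z X.
Proof. exact: linear_hypD (bra_linl X) _ _. Qed.

Lemma braZl (X Y : M) c : bra (c *: Y) X = c *: bra Y X.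
Proof. exact: linear_hypZ (bra_linl X) _ _. Qed.

Lemma bra_sumr (I : Type) (s : seq I) X (F : I -> M) : bra X (\sum_(i <- s) F i) = \sum_(i <- s) bra X (F i).
Proof. by rewrite /bra mulmx_sumr mulmx_suml -sumrB. Qed.

Lemma bra_anti (X Y : M) : bra X Y = - bra Y X. Proof. by rewrite /bra opprB. Qed.

Lemma braxx (X : M) : bra X X = 0. Proof. exact: subrr. Qed.

(** A pair of stable subspaces stands for the quotient module U / U0, which avoids forming
    quotients. The induction passes through a maximal proper subalgebra, which turns out to have
    codimension one. *)
Lemma engel L : (forall X, X \in L -> exists k, forall Z : M, iter k (bra X) Z = 0) -> subalgebra L ->
  forall U0 U, (U0 <= U)%VS -> U0 != U -> stable_under L U0 -> stable_under L U ->
  exists u, [/\ u \in U, u \notin U0 & forall X, X \in L -> bra X u \in U0].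
Proof.
have [k] := ubnP (\dim L); elim: k L => // k IH L dL nilL subL U0 U U0U nU sU0 sU.
have [u0 u0U u0U0] : exists2 u, u \in U & u \notin U0.
  have : ~~ (U <= U0)%VS by apply: contra nU => UU0; apply/eqP/subv_anti; rewrite U0U.
  by move/subvPn.
have [L0|L0] := eqVneq L 0%VS.
  by exists u0; split=> // X; rewrite L0 memv0 => /eqP ->; rewrite /bra mul0mx mulmx0 subrr mem0v.
have [h [hL hnL hsub hmax]] : exists h, [/\ (h <= L)%VS, h != L, subalgebra h &
    forall h', (h' <= L)%VS -> subalgebra h' -> (\dim h < \dim h')%N -> h' = L].
  pose Q d := `[< exists h, [/\ (h <= L)%VS, h != L, subalgebra h & \dim h = d] >].
  have Q0 : exists d, Q d.
    exists 0%N; apply/asboolP; exists 0%VS; split; rewrite ?sub0v ?dimv0 // 1?eq_sym //.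
    by move=> X Y; rewrite !memv0 => /eqP -> _; rewrite /bra mul0mx mulmx0 subrr.
  have Qb d : Q d -> (d <= \dim L)%N by move=> /asboolP [h [/dimvS]] /[swap] _ /[swap] _ + <-.
  case: (ex_maxnP Q0 Qb) => d /asboolP [h [hL hnL hsub hd]] dmax; exists h; split=> // h' h'L sh' dh.
  apply/eqP; apply/negPn/negP => nh'; have : (\dim h' <= d)%N by apply/dmax/asboolP; exists h'.
  by rewrite leqNgt -hd dh.
have hLm X : X \in h -> X \in L by move/subvP: hL; apply.
have dhL : (\dim h < \dim L)%N.
  by rewrite ltn_neqAle dimvS // andbT; apply: contra hnL => dd; rewrite eqEdim hL (eqP dd) leqnn.
have nilh X : X \in h -> exists k, forall Z : M, iter k (bra X) Z = 0 by move/hLm; apply: nilL.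
have sULh V : stable_under L V -> stable_under h V by move=> sV X Y /hLm Xh; apply: sV.
(* The induction hypothesis for [h] acting on L / h gives an element that normalises [h]. *)
have [x [xL xh hx]] : exists x, [/\ x \in L, x \notin h & forall X, X \in h -> bra X x \in h].
  by apply: (IH h); rewrite ?(leq_trans dhL) //; move=> X Y /hLm Xh; apply: subL.
have EL : (h + <[x]>)%VS = L.
  apply: hmax.
  - by rewrite subv_add hL -memvE.
  - move=> X Y /memv_addP [X1 X1h [_ /vlineP [a ->] ->]] /memv_addP [Y1 Y1h [_ /vlineP [c ->] ->]].
    apply: (subvP (addvSl _ _)).
    have -> : bra (X1 + a *: x) (Y1 + c *: x) = bra X1 Y1 + c *: bra X1 x - a *: bra Y1 x.
      rewrite braDl !braDr !braZl !braZr braxx !scaler0 addr0 (bra_anti x).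
      by rewrite scalerN.
    apply: memvB; last by apply/memvZ/hx.
    by apply: memvD; [apply: hsub|apply/memvZ/hx].
  - rewrite dimv_disjoint_sum; last first.
      apply/eqP; rewrite -subv0; apply/subvP => v /memv_capP [vh /vlineP [a Ev]].
      rewrite Ev in vh *; have [->|a0] := eqVneq a 0; first by rewrite scale0r mem0v.
      by case/negP: xh; rewrite -(scalerK a0 x) memvZ.
    rewrite dim_vline; case: eqP xh => [->|_ _]; first by rewrite mem0v.
    by rewrite addn1.
have [u1 [u1U u1U0 hu1]] : exists u, [/\ u \in U, u \notin U0 & forall X, X \in h -> bra X u \in U0].
  by apply: (IH h) => //; rewrite ?(leq_trans dhL) //; apply: sULh.
have [K xK] := nilL x xL.
(* The vectors annihilated by [h] modulo [U0] are stable under [x]; the last iterate outside [U0] is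
   annihilated by [x] as well. *)
have [N] : exists N, iter N (bra x) u1 \in U0 by exists K; rewrite xK mem0v.
have step u : u \in U /\ (forall X, X \in h -> bra X u \in U0) ->
    bra x u \in U /\ (forall X, X \in h -> bra X (bra x u) \in U0).
  move=> [uU hu]; split=> [|X Xh]; first exact: sU.
  rewrite bra_jacobi memvD //; first by apply: sU0 => //; apply: hu.
  by apply: hu; apply: hx.
elim: N u1 u1U u1U0 hu1 => [|N IHN] u uU uU0 hu; first by move=> /= uU0'; rewrite uU0' in uU0.
rewrite iterSr => xN; have [xu|xu] := boolP (bra x u \in U0).
  exists u; split=> // X; rewrite -EL => /memv_addP [X1 X1h [_ /vlineP [a ->] ->]].
  by rewrite addrC bra_linl memvD ?memvZ // hu.
have [] := step u (conj uU hu) => a b; exact: (IHN (bra x u)).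
Qed.

End Engel.

Section Sl2.
Variables (C : numClosedFieldType) (d : nat).

(** If B^k v is the last nonzero vector of its string, applying A to the next one gives (k + 1) c =
    ka (0 + 1 + ... + k), which is not negative. *)
Lemma sl2_highest_weight (A B H : 'M[C]_d) (ka c : C) (v : 'cV[C]_d) :
  A *m B - B *m A = H -> H *m B - B *m H = - ka *: B -> 0 < ka -> v != 0 ->
  A *m v = 0 -> H *m v = c *: v -> 0 <= c.
Proof.
move=> AB HB ka0 v0 Av Hv; pose u k := iter k (mulmx B) v.
have Hu k : H *m u k = (c - ka *+ k) *: u k.
  elim: k => [|k IH]; first by rewrite mulr0n subr0.
  rewrite /u /= -/(u k); have -> : H *m (B *m u k) = B *m (H *m u k) - ka *: (B *m u k).
    have HB' : H *m B = B *m H - ka *: B by rewrite -scaleNr -HB addrC subrK.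
    by rewrite mulmxA HB' mulmxBl -scalemxAl mulmxA.
  by rewrite IH -scalemxAr -scalerBl mulrS opprD addrA addrAC.
have Au k : A *m u k.+1 = (\sum_(i < k.+1) (c - ka *+ i)) *: u k.
  elim: k => [|k IH].
    rewrite big_ord1 mulr0n subr0 /u /= mulmxA -[A *m B](subrK (B *m A)) AB mulmxDl Hv.
    by rewrite -mulmxA Av mulmx0 addr0.
  rewrite big_ord_recr /= scalerDl -Hu.
  rewrite {1}/u /= -/(u k) -[B *m u k]/(u k.+1) mulmxA -[A *m B](subrK (B *m A)) AB mulmxDl addrC.
  by congr (_ + _); rewrite -mulmxA IH -scalemxAr.
(* Otherwise all numbers c - k ka would be roots of the characteristic polynomial of H. *)
have uex : exists k, u k = 0.
  have q0 : char_poly H \Po (c%:P - ka *: 'X) != 0.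
    have s2 : size (c%:P - ka *: 'X : {poly C}) = 2.
      rewrite addrC size_polyDl ?size_polyN ?size_scale ?gt_eqF ?size_polyX // size_polyC.
      by case: eqP.
    by rewrite comp_poly_eq0 ?s2 // monic_neq0 // char_poly_monic.
  have [k] := poly_nat_nonroot q0; rewrite horner_comp !hornerE => hk.
  exists k; apply/eqP; apply/negPn/negP => uk0; case/negP: hk.
  have : eigenvalue H^T (c - ka *+ k).
    apply/eigenvalueP; exists (u k)^T; last by rewrite -(inj_eq (@trmx_inj _ _ _)) trmxK trmx0.
    by rewrite -trmx_mul Hu linearZ.
  rewrite eigenvalue_root_char /root => /eqP ek; apply/eqP; rewrite -[RHS]ek; congr (_.[_]); last by rewrite mulr_natr.
  by rewrite /char_poly -det_tr; congr (\det _); apply/matrixP => i j; rewrite !mxE eq_sym.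
have [kk unz ukS] : exists2 k, u k != 0 & u k.+1 = 0.
  case: uex => l; elim: l => [E|l IH E]; first by move: v0; rewrite -[v]/(u 0%N) E eqxx.
  by have [/IH //|nz] := eqVneq (u l) 0; exists l.
have := Au kk; rewrite ukS mulmx0 => /esym/eqP; rewrite scaler_eq0 (negbTE unz) orbF.
rewrite sumrB sumr_const card_ord subr_eq0 => /eqP E.
have : 0 <= c *+ kk.+1 by rewrite E sumr_ge0 // => i _; rewrite mulrn_wge0 // ltW.
by rewrite pmulrn_lge0.
Qed.

End Sl2.

Section AdjointMatrix.
Variables (C : numClosedFieldType) (n : nat) (g : {vspace 'M[C]_n}).
Local Notation M := 'M[C]_n.
Local Notation d := (\dim g).

Definition cv (X : M) : 'cV[C]_d := \col_i coord (vbasis g) i X.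
Definition vc (c : 'cV[C]_d) : M := \sum_i c i 0 *: (vbasis g)`_i.
Definition adm (X : M) : 'M[C]_d := \matrix_(i, j) coord (vbasis g) i (bra X (vbasis g)`_j).
Definition kil (X Y : M) := \tr (adm X *m adm Y).

Lemma cvK X : X \in g -> vc (cv X) = X.
Proof. by move=> /coord_vbasis {2}->; apply: eq_bigr => i _; rewrite mxE. Qed.

Lemma vbasis_g (i : 'I_d) : (vbasis g)`_i \in g.
Proof. by apply: vbasis_mem; apply: mem_nth; rewrite size_tuple. Qed.

Lemma vc_mem c : vc c \in g.
Proof. by apply: memv_suml => i _; apply/memvZ/vbasis_g. Qed.

Lemma vcK c : cv (vc c) = c.
Proof.
apply/matrixP => i j; rewrite mxE /vc (ord1 j) coord_sum_free //.
exact: basis_free (vbasisP g).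
Qed.

Lemma cv_inj X Y : X \in g -> Y \in g -> cv X = cv Y -> X = Y.
Proof. by move=> /cvK EX /cvK EY E; rewrite -EX E. Qed.

Lemma cv_linear : linear cv.
Proof. by move=> a u v; apply/matrixP => i j; rewrite !mxE linearP. Qed.

Lemma vc_linear : linear vc.
Proof.
move=> a u v; rewrite /vc scaler_sumr -big_split; apply: eq_bigr => i _ /=.
by rewrite !mxE scalerDl scalerA.
Qed.

Lemma cv_sum (I : Type) (s : seq I) (F : I -> M) : cv (\sum_(i <- s) F i) = \sum_(i <- s) cv (F i).
Proof.
elim/big_rec2: _ => [|i u v _ <-]; first exact: linear_hyp0 cv_linear.
exact: linear_hypD cv_linear _ _.
Qed.

Lemma adm_act X Y : Y \in g -> adm X *m cv Y = cv (bra X Y).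
Proof.
move=> gY; rewrite [in RHS](coord_vbasis gY) bra_sumr cv_sum; apply/matrixP => i j.
rewrite mxE summxE; apply: eq_bigr => k _; rewrite !mxE braZr linearZ /= mulrC.
by [].
Qed.

Lemma adm_linear : linear adm.
Proof. by move=> a u v; apply/matrixP => i j; rewrite !mxE bra_linl linearP. Qed.

Lemma adm_sum (I : Type) (s : seq I) (F : I -> M) : adm (\sum_(i <- s) F i) = \sum_(i <- s) adm (F i).
Proof.
elim/big_rec2: _ => [|i u v _ <-]; first exact: linear_hyp0 adm_linear.
exact: linear_hypD adm_linear _ _.
Qed.

Lemma adm_ext (A B : 'M[C]_d) : (forall Y, Y \in g -> A *m cv Y = B *m cv Y) -> A = B.
Proof.
move=> E; apply/matrixP => i j; have := E _ (vc_mem (delta_mx j 0)); rewrite !vcK.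
by rewrite -!colE => /matrixP /(_ i 0); rewrite !mxE.
Qed.

Lemma kil_sym X Y : kil X Y = kil Y X. Proof. by rewrite /kil mxtrace_mulC. Qed.

Lemma kilDl X Y Z : kil (X + Y) Z = kil X Z + kil Y Z.
Proof. by rewrite /kil (linear_hypD adm_linear) mulmxDl mxtraceD. Qed.

Lemma kilZl a X Z : kil (a *: X) Z = a * kil X Z.
Proof. by rewrite /kil (linear_hypZ adm_linear) -scalemxAl mxtraceZ. Qed.

Lemma kilDr X Y Z : kil Z (X + Y) = kil Z X + kil Z Y.
Proof. by rewrite !(kil_sym Z) kilDl. Qed.

Lemma kilZr a X Z : kil Z (a *: X) = a * kil Z X.
Proof. by rewrite !(kil_sym Z) kilZl. Qed.

Lemma kil_suml (I : Type) (s : seq I) (F : I -> M) Z : kil (\sum_(i <- s) F i) Z = \sum_(i <- s) kil (F i) Z.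
Proof. by rewrite /kil adm_sum mulmx_suml raddf_sum. Qed.

Lemma kil_sumr (I : Type) (s : seq I) (F : I -> M) Z : kil Z (\sum_(i <- s) F i) = \sum_(i <- s) kil Z (F i).
Proof. by rewrite kil_sym kil_suml; apply: eq_bigr => i _; rewrite kil_sym. Qed.

Hypothesis g_sub : subalgebra g.

Lemma adm_bra X Y : X \in g -> Y \in g -> adm (bra X Y) = adm X *m adm Y - adm Y *m adm X.
Proof.
move=> gX gY; apply: adm_ext => Z gZ; rewrite adm_act // mulmxBl -!mulmxA !adm_act ?g_sub //.
rewrite (bra_jacobi X Y) (linear_hypD cv_linear (bra Y _)) [RHS]addrC addKr.
by [].
Qed.

Lemma kil_inv X Y Z : X \in g -> Y \in g -> Z \in g -> kil (bra X Y) Z = kil X (bra Y Z).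
Proof.
move=> gX gY gZ; rewrite /kil !adm_bra // mulmxBl mulmxBr !linearB /= !mulmxA.
by rewrite -[adm Y *m adm X *m adm Z]mulmxA [\tr (adm Y *m _)]mxtrace_mulC.
Qed.

Lemma nilpotent_adm N : N \in g -> nilpotent N -> nilpotent (adm N).
Proof.
move=> gN /nilpotent_ad [k Hk]; exists k; apply: adm_ext => Y gY; rewrite mul0mx.
have -> : iter k (mulmx (adm N)) 1%:M *m cv Y = cv (iter k (bra N) Y).
  suff [] : iter k (mulmx (adm N)) 1%:M *m cv Y = cv (iter k (bra N) Y) /\ iter k (bra N) Y \in g by [].
  elim: (k) => [|l [IH gl]] /=; first by rewrite mul1mx.
  by rewrite -mulmxA IH adm_act // g_sub.
by rewrite Hk (linear_hyp0 cv_linear).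
Qed.

End AdjointMatrix.

Section Weights.
Variables (C : numClosedFieldType) (r : nat).

Definition wt (u : 'I_r -> int) : 'cV[C]_r := \col_j (u j)%:~R.
Definition dotc (mu x : 'cV[C]_r) := \sum_j mu j 0 * x j 0.

Lemma dotcC x y : dotc x y = dotc y x. Proof. by apply: eq_bigr => j _; rewrite mulrC. Qed.

Lemma dotcDr x y z : dotc x (y + z) = dotc x y + dotc x z.
Proof. by rewrite -big_split; apply: eq_bigr => j _; rewrite mxE mulrDr. Qed.

Lemma dotcZr a x y : dotc x (a *: y) = a * dotc x y.
Proof. by rewrite mulr_sumr; apply: eq_bigr => j _; rewrite mxE mulrCA. Qed.

Lemma dotcDl x y z : dotc (y + z) x = dotc y x + dotc z x.
Proof. by rewrite !(dotcC _ x) dotcDr. Qed.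

Lemma dotcZl a x y : dotc (a *: y) x = a * dotc y x.
Proof. by rewrite !(dotcC _ x) dotcZr. Qed.

Lemma dotc_mx x y : dotc x y = (x^T *m y) 0 0.
Proof. by rewrite mxE; apply: eq_bigr => j _; rewrite mxE. Qed.

Lemma dotc_inj x : (forall y, dotc x y = 0) -> x = 0.
Proof.
move=> E; apply/matrixP => j k; rewrite (ord1 k) mxE; have := E (delta_mx j 0).
rewrite /dotc (bigD1 j) //= mxE !eqxx mulr1 big1 ?addr0 // => i /negbTE ij.
by rewrite mxE ij mulr0.
Qed.

End Weights.

Section Simple.
Variables (C : numClosedFieldType) (n : nat) (g : {vspace 'M[C]_n}).
Hypothesis g_sub : subalgebra g.
Hypothesis g_simple : forall a : {vspace 'M[C]_n}, (a <= g)%VS -> stable_under g a -> a = 0%VS \/ a = g.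
Hypothesis g_nab : exists X Y, [/\ X \in g, Y \in g & bra X Y != 0].

Lemma simple_perfect (U : {vspace 'M[C]_n}) : (forall X Y, X \in g -> Y \in g -> bra X Y \in U) -> (g <= U)%VS.
Proof.
move=> HU; have [|E|<-] := g_simple (capvSl g U); last exact: capvSr.
  by move=> X Y gX /memv_capP [gY _]; rewrite memv_cap g_sub // HU.
have [X [Y [gX gY /negP []]]] := g_nab.
by rewrite -memv0 -E memv_cap g_sub // HU.
Qed.

End Simple.

Section CartanData.
Variables (C : numClosedFieldType) (n : nat).

Definition hh r (H : 'I_r -> 'M[C]_n) (x : 'cV[C]_r) : 'M[C]_n := \sum_j x j 0 *: H j.

(** What the theory of tori supplies to the Lie algebra part: a basis [H] of t made of derivatives
    of cocharacters, integral weights [w] of the natural representation and [al] of ad, the latter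
    listed with multiplicity and including 0, and the Jordan decomposition of the centralizer of
    t. *)
Record cartan (g t : {vspace 'M[C]_n}) r (H : 'I_r -> 'M[C]_n) (Q : 'M[C]_n) (w : 'I_n -> 'I_r -> int)
    (A : 'M[C]_(\dim g)) (al : 'I_(\dim g) -> 'I_r -> int) : Prop := Cartan {
  ca_sub : subalgebra g;
  ca_simple : forall a : {vspace 'M[C]_n}, (a <= g)%VS -> stable_under g a -> a = 0%VS \/ a = g;
  ca_nab : exists X Y, [/\ X \in g, Y \in g & bra X Y != 0];
  ca_tg : (t <= g)%VS;
  ca_hht : forall x, hh H x \in t;
  ca_thh : forall X, X \in t -> exists x, X = hh H x;
  ca_inj : forall x, hh H x = 0 -> x = 0;
  ca_Qu : Q \in unitmx;
  ca_HQ : forall j, H j *m Q = Q *m diag_mx (\row_i (w i j)%:~R);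
  ca_Au : A \in unitmx;
  ca_HA : forall j, adm g (H j) *m A = A *m diag_mx (\row_i (al i j)%:~R);
  ca_jordan : forall X, X \in g -> (forall Y, Y \in t -> X *m Y = Y *m X) ->
    exists2 S, S \in t & nilpotent (X - S) }.

End CartanData.

(** * Killing form, Cartan subalgebra and roots *)

Section Structure.
Variables (C : numClosedFieldType) (n : nat) (g t : {vspace 'M[C]_n}) (r : nat) (H : 'I_r -> 'M[C]_n).
Local Notation M := 'M[C]_n.
Local Notation d := (\dim g).
Local Notation hh := (hh H).
Variables (Q : M) (w : 'I_n -> 'I_r -> int) (A : 'M[C]_d) (al : 'I_d -> 'I_r -> int).
Hypothesis CA : cartan t H Q w A al.
Let g_sub := ca_sub CA.
Let g_simple := ca_simple CA.
Let g_nab := ca_nab CA.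
Let t_g := ca_tg CA.
Let hh_t := ca_hht CA.
Let t_hh := ca_thh CA.
Let hh_inj := ca_inj CA.
Let Qu := ca_Qu CA.
Let HQ := ca_HQ CA.
Let Au := ca_Au CA.
Let HA := ca_HA CA.
Let jordan := ca_jordan CA.
Local Notation kil := (kil g).
Local Notation adm := (adm g).

Lemma simple_center X : X \in g -> (forall Y, Y \in g -> bra X Y = 0) -> X = 0.
Proof.
move=> gX X0; have [|a Y Z [gY Y0] [gZ Z0]|U HU] := @pred_vspace C _ (fun X => X \in g /\ forall Y, Y \in g -> bra X Y = 0).
- by split=> [|Y _]; rewrite ?mem0v // /bra mul0mx mulmx0 subrr.
- split=> [|W gW]; first by rewrite memvD ?memvZ.
  by rewrite braDl braZl Y0 // Z0 // scaler0 addr0.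
have [|Y Z gY /HU [gZ Z0]|E|E] := g_simple (a := U).
- by apply/subvP => Y /HU [].
- by rewrite bra_anti Z0 // oppr0 mem0v.
- by apply/eqP; rewrite -memv0 -E; apply/HU.
have [Z [Y [gZ gY /eqP[]]]] := g_nab.
by have := gZ; rewrite -E => /HU [_]; apply.
Qed.

Lemma hh_linear : linear hh.
Proof.
move=> a u v; rewrite /hh scaler_sumr -big_split; apply: eq_bigr => i _ /=.
by rewrite !mxE scalerDl scalerA.
Qed.

Lemma hh_delta j : hh (delta_mx j 0) = H j.
Proof.
rewrite /hh (bigD1 j) //= mxE !eqxx scale1r big1 ?addr0 // => i /negbTE ij.
by rewrite mxE ij scale0r.
Qed.

Lemma H_t j : H j \in t. Proof. by rewrite -hh_delta. Qed.

Lemma t_in_g X : X \in t -> X \in g. Proof. by move/subvP: t_g; apply. Qed.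
Hint Resolve t_in_g H_t hh_t : core.

Lemma hh_diag N (B : 'M[C]_N) (F : M -> 'M[C]_N) (u : 'I_N -> 'I_r -> int) : linear F ->
  (forall j, F (H j) *m B = B *m diag_mx (\row_i (u i j)%:~R)) ->
  forall x, F (hh x) *m B = B *m diag_mx (\row_i dotc (wt C (u i)) x).
Proof.
move=> linF FB x; have -> : F (hh x) = \sum_j x j 0 *: F (H j).
  rewrite /hh; elim/big_rec2: _ => [|j a b _ <-]; first exact: linear_hyp0 linF.
  by rewrite (linear_hypD linF) (linear_hypZ linF).
rewrite mulmx_suml; under eq_bigr do rewrite -scalemxAl FB scalemxAr.
rewrite -mulmx_sumr; congr (_ *m _); apply/matrixP => i j; rewrite summxE !mxE.
case: (i =P j) => [->|/eqP/negbTE ij]; last by rewrite mulr0n big1 // => k _; rewrite !mxE ij mulr0n mulr0.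
by rewrite !mulr1n; apply: eq_bigr => k _; rewrite !mxE eqxx mulr1n mulrC.
Qed.

Definition wsp (mu : 'cV[C]_r) X := X \in g /\ forall x, bra (hh x) X = dotc mu x *: X.

Definition ebas i := vc (col i A).

Lemma ebas_wsp i : wsp (wt C (al i)) (ebas i).
Proof.
have ge : ebas i \in g by apply: vc_mem.
split=> // x; apply: (@cv_inj _ _ g).
- by apply: g_sub => //; apply/t_in_g/hh_t.
- exact: memvZ.
rewrite (linear_hypZ (@cv_linear _ _ g)) -adm_act // vcK {1}colE mulmxA.
rewrite (hh_diag (@adm_linear _ _ g) HA) -mulmxA -colE; apply/matrixP => k l.
rewrite !mxE (bigD1 i) //= big1 ?addr0 => [|j /negbTE ji]; last by rewrite !mxE ji mulr0n mulr0.
by rewrite !mxE eqxx mulr1n mulrC.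
Qed.

Lemma ebas_span X : X \in g -> X = \sum_i (invmx A *m cv g X) i 0 *: ebas i.
Proof.
move=> gX; rewrite -{1}(cvK gX) -{1}[cv g X](mulKVmx Au); move: (invmx A *m _) => c.
have -> : A *m c = \sum_i c i 0 *: col i A.
  apply/matrixP => i j; rewrite mxE summxE; apply: eq_bigr => k _.
  by rewrite !mxE mulrC (ord1 j).
elim/big_rec2: _ => [|i u v _ <-]; first exact: linear_hyp0 (@vc_linear _ _ g).
by rewrite (linear_hypD (@vc_linear _ _ g)) (linear_hypZ (@vc_linear _ _ g)).
Qed.

Lemma kil_hh x y : kil (hh x) (hh y) = \sum_i dotc (wt C (al i)) x * dotc (wt C (al i)) y.
Proof.
rewrite /kil; have E z : adm (hh z) = A *m diag_mx (\row_i dotc (wt C (al i)) z) *m invmx A.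
  by rewrite -(hh_diag (@adm_linear _ _ g) HA) mulmxK.
rewrite !E !mulmxA mulmxKV // mxtrace_mulC !mulmxA mulVmx // mul1mx mulmx_diag mxtrace_diag.
by apply: eq_bigr => i _; rewrite !mxE.
Qed.

Lemma al_sep x : (forall i, dotc (wt C (al i)) x = 0) -> hh x = 0.
Proof.
move=> E; apply: simple_center => [|Y /ebas_span ->]; first by auto.
rewrite bra_sumr big1 // => i _; rewrite braZr (ebas_wsp i).2 E scale0r scaler0.
by [].
Qed.

Lemma real_wt (u : 'I_r -> int) (x : 'cV[C]_r) : (forall j, x j 0 \is Num.real) -> dotc (wt C u) x \is Num.real.
Proof. by move=> rx; apply: rpred_sum => j _; rewrite rpredM // mxE realz. Qed.

(** The weights of ad are integral, so the value is a sum of real squares; these are not all 0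
    because g has no centre. *)
Lemma kil_pos (x : 'cV[C]_r) : (forall j, x j 0 \is Num.real) -> hh x != 0 -> 0 < kil (hh x) (hh x).
Proof.
move=> rx hx; have pos i : 0 <= dotc (wt C (al i)) x * dotc (wt C (al i)) x.
  by rewrite -expr2 real_exprn_even_ge0 // real_wt.
rewrite kil_hh lt_def sumr_ge0 ?andbT //; apply: contra hx => /eqP.
move/psumr_eq0P => E; apply/eqP/al_sep => i; have /eqP := E (fun i _ => pos i) i isT.
by rewrite mulf_eq0 orbb => /eqP.
Qed.

(** If t were 0, every element of g would be nilpotent and Engel's theorem would give a nonzero
    central element. *)
Lemma t_nonzero : exists j : 'I_r, H j != 0.
Proof.
have [E|] := pselect (forall j, H j = 0); last by move/existsNP => [j /eqP]; exists j.
have t0 X : X \in t -> X = 0.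
  by move=> /t_hh [x ->]; apply: big1 => j _; rewrite E scaler0.
have nil X : X \in g -> exists k, forall Z : M, iter k (bra X) Z = 0.
  move=> gX; apply: nilpotent_ad; have [|S /t0 -> ] := jordan gX; last by rewrite subr0.
  by move=> Y /t0 ->; rewrite mulmx0 mul0mx.
have [|Y Z _|Y Z|u [gu /negP u0 gu0]] := engel nil g_sub (sub0v g).
- have [X [Y [gX gY]]] := g_nab; apply: contra => /eqP g0.
  by rewrite -g0 memv0 in gX; rewrite (eqP gX) /bra mul0mx mulmx0 subrr.
- by rewrite memv0 => /eqP ->; rewrite /bra mul0mx mulmx0 subrr mem0v.
- exact: g_sub.
exfalso; apply: u0; rewrite memv0; apply/eqP/simple_center => // Y gY.
by have := gu0 _ gY; rewrite bra_anti memv0 oppr_eq0 => /eqP.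
Qed.

Lemma real_delta j k : (delta_mx j 0 : 'cV[C]_r) k 0 \is Num.real.
Proof. by rewrite mxE realn. Qed.

(** The radical is an ideal, and it does not contain a nonzero [H j], on which the form is
    positive. *)
Lemma kil_radical X : X \in g -> (forall Y, Y \in g -> kil X Y = 0) -> X = 0.
Proof.
move=> gX X0; have [|a Y Z [gY Y0] [gZ Z0]|U HU] := @pred_vspace C _ (fun X => X \in g /\ forall Y, Y \in g -> kil X Y = 0).
- split=> [|Y _]; rewrite ?mem0v //.
  by rewrite /kil (linear_hyp0 (@adm_linear _ _ g)) mul0mx mxtrace0.
- split=> [|W gW]; first by rewrite memvD ?memvZ.
  by rewrite kilDl kilZl Y0 // Z0 // mulr0 addr0.
have [|Y Z gY /HU [gZ Z0]|E|E] := g_simple (a := U).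
- by apply/subvP => Y /HU [].
- apply/HU; split=> [|W gW]; first exact: g_sub.
  by rewrite bra_anti -scaleN1r kilZl kil_inv // Z0 ?mulr0 // g_sub.
- by apply/eqP; rewrite -memv0 -E; apply/HU.
have [j Hj] := t_nonzero; have gHj : H j \in g by auto.
have := gHj; rewrite -E => /HU [_ /(_ _ gHj)].
by move/eqP; rewrite -hh_delta gt_eqF // kil_pos ?hh_delta // => k; apply: real_delta.
Qed.

Lemma kil_wsp mu nu X Y : wsp mu X -> wsp nu Y -> mu + nu != 0 -> kil X Y = 0.
Proof.
move=> [gX HX] [gY HY] mn; apply/eqP; apply: contraNT mn => XY; apply/eqP/dotc_inj => x.
have := @kil_inv _ _ _ g_sub X (hh x) Y gX (t_in_g (hh_t x)) gY.
rewrite bra_anti HX HY -scaleNr kilZl kilZr dotcDl => /eqP.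
by rewrite -subr_eq0 -mulrBl mulf_eq0 (negbTE XY) orbF -opprD oppr_eq0 => /eqP.
Qed.

Lemma wsp_bra mu nu X Y : wsp mu X -> wsp nu Y -> wsp (mu + nu) (bra X Y).
Proof.
move=> [gX HX] [gY HY]; split=> [|x]; first exact: g_sub.
by rewrite bra_jacobi HX HY braZr braZl addrC dotcDl scalerDl.
Qed.

(** [F] is a function of the simultaneous eigenvalues of the [H j], and [X] preserves their
    eigenspaces. *)
Lemma tr_block (u : 'I_n -> C) (X : M) : (forall j, H j *m X = X *m H j) ->
  (forall i k, w i = w k -> u i = u k) ->
  let F := Q *m diag_mx (\row_i u i) *m invmx Q in F *m X = X *m F.
Proof.
move=> HX uw F; pose X' := invmx Q *m X *m Q.
have EX : X = Q *m X' *m invmx Q by rewrite /X' !mulmxA mulmxV // mul1mx mulmxK.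
have X'E j : diag_mx (\row_i (w i j)%:~R) *m X' = X' *m diag_mx (\row_i (w i j)%:~R).
  have HD : invmx Q *m H j = diag_mx (\row_i (w i j)%:~R) *m invmx Q.
    by apply: (can_inj (mulmxK Qu)); rewrite mulmxKV // -mulmxA HQ mulKmx.
  by rewrite /X' !mulmxA -HD -!mulmxA -HQ !mulmxA -[_ *m H j *m X]mulmxA HX !mulmxA.
move: X' EX X'E => X' EX X'E.
have E : diag_mx (\row_i u i) *m X' = X' *m diag_mx (\row_i u i).
  apply/matrixP => i k; rewrite mul_diag_mx mul_mx_diag !mxE.
  have [X0|X0] := eqVneq (X' i k) 0; first by rewrite X0 mul0r mulr0.
  rewrite (uw i k) 1?mulrC //; apply/funext => j.
  have /matrixP /(_ i k) := X'E j; rewrite mul_diag_mx mul_mx_diag !mxE.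
  by rewrite mulrC => /(mulfI X0)/intr_inj.
rewrite EX /F -!mulmxA !mulKmx //; rewrite [diag_mx _ *m (_ *m _)]mulmxA E.
by rewrite -!mulmxA.
Qed.

Lemma hh_Q x : hh x = Q *m diag_mx (\row_i dotc (wt C (w i)) x) *m invmx Q.
Proof. by rewrite -(@hh_diag _ Q id w _ HQ) ?mulmxK. Qed.

Lemma hh_comm x y : hh x *m hh y = hh y *m hh x.
Proof.
rewrite !hh_Q -!mulmxA !mulKmx //; congr (_ *m _); rewrite !mulmxA; congr (_ *m _).
exact: diag_mxC.
Qed.

Lemma commutes_H X : (forall x, bra (hh x) X = 0) -> forall j, H j *m X = X *m H j.
Proof. by move=> E j; apply/eqP; rewrite -subr_eq0 -(hh_delta j); apply/eqP/E. Qed.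

Lemma commutes_t X : (forall x, bra (hh x) X = 0) -> forall Y, Y \in t -> X *m Y = Y *m X.
Proof. by move=> E Y /t_hh [x ->]; apply/esym/eqP; rewrite -subr_eq0; apply/eqP/E. Qed.

Definition nil0 N := [/\ N \in g, forall x, bra (hh x) N = 0 & nilpotent N].

Lemma jordan0 X : X \in g -> (forall x, bra (hh x) X = 0) -> exists2 x, nil0 (X - hh x) & True.
Proof.
move=> gX X0; have [S /t_hh [x ->] nS] := jordan gX (commutes_t X0); exists x => //; split=> //.
  by apply: memvB => //; apply/t_in_g/hh_t.
move=> y; rewrite -scaleN1r braDr braZr X0 add0r.
by rewrite /bra hh_comm subrr scaler0.
Qed.

(** The semisimple part [hh x] of the sum lies in t. On each weight space the traces of the
    nilpotent matrices vanish, hence so does the trace of [hh x], which acts there as a scalar. *)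
Lemma nil0D N N' : nil0 N -> nil0 N' -> nil0 (N + N').
Proof.
move=> [gN cN nN] [gN' cN' nN'].
have gNN : N + N' \in g by apply: memvD.
have cNN x : bra (hh x) (N + N') = 0 by rewrite braDr cN cN' addr0.
have [x [g2 c2 n2] _] := jordan0 gNN cNN; suff E : hh x = 0 by rewrite E subr0 in n2.
suff E i : dotc (wt C (w i)) x = 0.
  rewrite hh_Q (_ : \row__ _ = 0) ?linear0 ?mulmx0 ?mul0mx //.
  by apply/matrixP => a b; rewrite !mxE E.
(* The resulting [F] projects onto the weight space of [w i]. *)
pose u k : C := (w k == w i)%:R.
have uw k l : w k = w l -> u k = u l by rewrite /u => ->.
pose F := Q *m diag_mx (\row_i u i) *m invmx Q.
have trF X : nilpotent X -> (forall x, bra (hh x) X = 0) -> \tr (F *m X) = 0.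
  move=> nX cX; have FX := tr_block (commutes_H cX) uw; rewrite -/F /= in FX.
  by rewrite FX; apply/nilpotent_trace/nilpotent_mul.
have : \tr (F *m hh x) = 0.
  have -> : hh x = N + N' - (N + N' - hh x) by rewrite opprB addrC subrK.
  by rewrite mulmxBr mulmxDr linearB linearD /= !trF // addr0 subr0.
rewrite hh_Q /F !mulmxA mulmxKV // mxtrace_mulC !mulmxA mulVmx // mul1mx mulmx_diag mxtrace_diag.
under eq_bigr => k _ do rewrite !mxE.
rewrite (eq_bigr (fun k => u k * dotc (wt C (w i)) x)) => [|k _]; last first.
  by rewrite /u; case: eqP => [->|_] //; rewrite !mul0r.
rewrite -mulr_suml => /eqP; rewrite mulf_eq0 => /orP[|/eqP //].
rewrite psumr_eq0 => [/allP/(_ i)|k _]; last exact: ler0n.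
by rewrite mem_index_enum /u eqxx oner_eq0 => /(_ isT).
Qed.

Lemma nil0_kil N N' : nil0 N -> nil0 N' -> kil N N' = 0.
Proof.
have E X : nil0 X -> kil X X = 0.
  move=> [gX _ nX]; apply/nilpotent_trace/nilpotent_mul => //.
  exact: nilpotent_adm.
move=> hN hN'; have := E _ (nil0D hN hN'); rewrite kilDl !kilDr !E // add0r addr0 kil_sym.
by move/eqP; rewrite -mulr2n mulrn_eq0 => /eqP.
Qed.

Lemma kil_hh_nil0 x N : nil0 N -> kil N (hh x) = 0.
Proof.
move=> [gN cN nN]; apply/nilpotent_trace/nilpotent_mul; first exact: nilpotent_adm.
apply/eqP; rewrite -subr_eq0 -adm_bra //; last by apply/t_in_g/hh_t.
by rewrite bra_anti cN oppr0 (linear_hyp0 (@adm_linear _ _ g)).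
Qed.

(** The nilpotent part of [X] is orthogonal to every weight vector: to those of nonzero weight
    because their weights do not cancel, and to those of weight 0 because they are again sums of
    elements of t and nilpotent ones. So it lies in the radical. *)
Theorem centralizer_t X : X \in g -> (forall x, bra (hh x) X = 0) -> X \in t.
Proof.
move=> gX cX; have [x hN _] := jordan0 gX cX; suff E : X - hh x = 0.
  by rewrite -(subrK (hh x) X) E add0r.
have [gN cN nN] := hN; apply: kil_radical => // Y gY; rewrite (ebas_span gY) kil_sumr big1 // => i _.
rewrite kilZr; have [ge We] := ebas_wsp i.
have wN : wsp 0 (X - hh x).
  by split=> // y; rewrite cN /dotc big1 ?scale0r // => j _; rewrite mxE mul0r.
have [a0|a0] := eqVneq (wt C (al i)) 0; last by rewrite (kil_wsp wN (ebas_wsp i)) ?mulr0 // add0r.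
have ce y : bra (hh y) (ebas i) = 0.
  by rewrite We a0 /dotc big1 ?scale0r // => j _; rewrite mxE mul0r.
have [y hN' _] := jordan0 ge ce.
rewrite -(subrK (hh y) (ebas i)) kilDr (nil0_kil hN hN') (kil_hh_nil0 _ hN).
by rewrite addr0 mulr0.
Qed.

Lemma wsp0 X : wsp 0 X -> X \in t.
Proof.
move=> [gX E]; apply: centralizer_t => // x.
by rewrite E /dotc big1 ?scale0r // => j _; rewrite mxE mul0r.
Qed.

Lemma kil_t_nondeg h : h \in t -> (forall x, kil h (hh x) = 0) -> h = 0.
Proof.
move=> th E; apply: kil_radical => [|Y /ebas_span ->]; first exact: t_in_g.
rewrite kil_sumr big1 // => i _; rewrite kilZr; have ei := ebas_wsp i.
have [a0|a0] := eqVneq (wt C (al i)) 0.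
  have : ebas i \in t by apply: wsp0; rewrite -a0.
  by move=> /t_hh [x ->]; rewrite E mulr0.
rewrite (@kil_wsp 0 _ h _ _ ei) ?add0r ?mulr0 //; have [x ->] := t_hh th.
split=> [|y]; first by apply/t_in_g/hh_t.
rewrite /dotc big1 ?scale0r; last by move=> j _; rewrite mxE mul0r.
by rewrite /bra hh_comm subrr.
Qed.

Lemma wsp_dual mu X : wsp mu X -> X != 0 -> exists2 Y, wsp (- mu) Y & kil X Y = 1.
Proof.
move=> wX X0; have [i ni] : exists i, kil X (ebas i) != 0.
  apply/existsP; apply: contraR X0; rewrite negb_exists => /forallP E; apply/eqP/kil_radical.
    by case: wX.
  move=> Y /ebas_span ->; rewrite kil_sumr big1 // => i _; rewrite kilZr.
  by have := E i; rewrite negbK => /eqP ->; rewrite mulr0.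
exists ((kil X (ebas i))^-1 *: ebas i); last by rewrite kilZr mulVf.
have Ei : - mu = wt C (al i).
  apply/esym/eqP; rewrite -addr_eq0 addrC; apply: contraNT ni => nz.
  by rewrite (kil_wsp wX (ebas_wsp i)).
rewrite Ei; have [ge We] := ebas_wsp i; split=> [|x]; first exact: memvZ.
by rewrite braZr We !scalerA mulrC.
Qed.

Lemma wsp_al mu X : wsp mu X -> X != 0 -> exists i, mu = wt C (al i).
Proof.
move=> wX X0; have [Y wY XY] := wsp_dual wX X0.
have [Z wZ YZ] : exists2 Z, wsp (- - mu) Z & kil Y Z = 1.
  apply: wsp_dual => //; apply: contra_eq_neq XY => ->.
  by rewrite /kil (linear_hyp0 (@adm_linear _ _ g)) mulmx0 mxtrace0 eq_sym oner_eq0.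
have [i ni] : exists i, kil Y (ebas i) != 0.
  apply/existsP; have := oner_neq0 C; rewrite -YZ; apply: contraR; rewrite negb_exists => /forallP E.
  rewrite (ebas_span wZ.1) kil_sumr big1 // => i _; rewrite kilZr.
  by have := E i; rewrite negbK => /eqP ->; rewrite mulr0.
exists i; apply/eqP; rewrite -subr_eq0 -oppr_eq0 opprB addrC; apply: contraNT ni => nz.
by rewrite (kil_wsp wY (ebas_wsp i)).
Qed.

Definition gram : 'M[C]_r := \matrix_(j, k) kil (H j) (H k).
Definition tv (mu : 'cV[C]_r) := hh (invmx gram *m mu).
(** The inverse Killing form on the dual of t, in the coordinates given by [H]; [tv mu] is the
    element of t that represents [mu]. *)
Definition form (mu nu : 'cV[C]_r) := dotc nu (invmx gram *m mu).

Lemma kil_gram x y : kil (hh x) (hh y) = dotc (gram *m x) y.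
Proof.
rewrite kil_sym kil_suml; apply: eq_bigr => k _; rewrite kilZl mulrC; congr (_ * _).
rewrite mxE kil_sumr; apply: eq_bigr => j _; rewrite kilZr mxE mulrC.
by [].
Qed.

Lemma gram_unit : gram \in unitmx.
Proof.
rewrite unitmxE unitfE; apply/negP => /det0P [v v0 vg]; case/negP: v0.
have gT : gram^T = gram by apply/matrixP => i j; rewrite !mxE kil_sym.
rewrite -(inj_eq (@trmx_inj _ _ _)) trmx0; apply/eqP/hh_inj/kil_t_nondeg => // x.
by rewrite kil_gram -gT -trmx_mul vg trmx0 /dotc big1 // => j _; rewrite mxE mul0r.
Qed.

Lemma kil_tv mu x : kil (tv mu) (hh x) = dotc mu x.
Proof. by rewrite kil_gram mulKVmx // gram_unit. Qed.

Lemma bra_tv mu nu X : wsp nu X -> bra (tv mu) X = form mu nu *: X.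
Proof. by move=> [_ ->]. Qed.

Lemma form_tv mu nu : kil (tv mu) (tv nu) = form nu mu.
Proof. by rewrite kil_tv. Qed.

Lemma form_sym mu nu : form mu nu = form nu mu.
Proof. by rewrite -!form_tv kil_sym. Qed.

Lemma formDl mu mu' nu : form (mu + mu') nu = form mu nu + form mu' nu.
Proof. by rewrite /form mulmxDr dotcDr. Qed.

Lemma formZl a mu nu : form (a *: mu) nu = a * form mu nu.
Proof. by rewrite /form -scalemxAr dotcZr. Qed.

Lemma formDr mu mu' nu : form nu (mu + mu') = form nu mu + form nu mu'.
Proof. by rewrite !(form_sym nu) formDl. Qed.

Lemma formZr a mu nu : form nu (a *: mu) = a * form nu mu.
Proof. by rewrite !(form_sym nu) formZl. Qed.

Lemma bra_wsp_opp mu X Y : wsp mu X -> wsp (- mu) Y -> bra X Y = kil X Y *: tv mu.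
Proof.
move=> wX wY; have tXY : bra X Y \in t by apply: wsp0; rewrite -(subrr mu); apply: wsp_bra.
apply/eqP; rewrite -subr_eq0; apply/eqP/kil_t_nondeg => [|x]; first by rewrite memvB ?memvZ // hh_t.
rewrite -scaleN1r kilDl !kilZl kil_tv; have [gX EX] := wX; have [gY EY] := wY.
have gx : hh x \in g by apply/t_in_g/hh_t.
rewrite kil_inv // bra_anti EY -scaleNr kilZr -scaleN1r dotcZl; ring.
Qed.

Lemma gram_rat : exists S0 : 'M[rat]_r, invmx gram = map_mx ratr S0.
Proof.
exists (invmx (\matrix_(j, k) (\sum_i al i j * al i k)%:~R)).
rewrite map_invmx; congr invmx; apply/matrixP => j k; rewrite mxE [in RHS]mxE [in RHS]mxE rmorph_int rmorph_sum /=.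
rewrite -2!hh_delta kil_hh; apply: eq_bigr => i _; rewrite rmorphM.
have E l : dotc (wt C (al i)) (delta_mx l 0) = (al i l)%:~R.
  rewrite /dotc (bigD1 l) //= big1 => [|m /negbTE ml]; first by rewrite !mxE !eqxx mulr1 addr0.
  by rewrite !mxE ml mulr0.
by rewrite !E.
Qed.

Lemma real_tv u j : (invmx gram *m wt C u) j 0 \is Num.real.
Proof.
have [S0 ->] := gram_rat; rewrite mxE; apply: rpred_sum => k _; rewrite !mxE rpredM ?realz //.
by rewrite /ratr rpredM ?rpredV ?realz.
Qed.

Lemma form_pos u : wt C u != 0 -> 0 < form (wt C u) (wt C u).
Proof.
move=> u0; rewrite -form_tv; apply: kil_pos; first exact: real_tv.
apply: contra u0 => /eqP /hh_inj E; apply/eqP.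
by rewrite -[wt C u](mulKVmx gram_unit) E mulmx0.
Qed.

(** A vector of weight mu orthogonal to the dual vector Y commutes with Y. If it were not 0, it
    would be a highest weight vector for the sl2-triple in which Y raises, with the negative weight
    -(mu, mu). *)
Lemma wsp_dim1 mu X X' : mu != 0 -> wsp mu X -> X != 0 -> wsp mu X' -> exists c, X' = c *: X.
Proof.
move=> mu0 wX X0 wX'; have [Y wY XY] := wsp_dual wX X0.
exists (kil X' Y); apply/eqP; rewrite -subr_eq0; apply/negPn/negP => nz.
pose E := X' - kil X' Y *: X.
have wE : wsp mu E.
  move: wX wX' => [gX HX] [gX' HX']; split=> [|x]; first by rewrite memvB ?memvZ.
  by rewrite /E -scaleN1r braDr !braZr HX HX' scalerDr !scalerA; congr (_ + _ *: _); ring.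
have kE : kil E Y = 0 by rewrite kilDl -scaleN1r !kilZl XY; ring.
have [i Ei] := wsp_al wX X0.
have f0 : 0 < form mu mu by rewrite Ei form_pos -?Ei.
have [gX HX] := wX; have [gY HY] := wY; have [gE HE] := wE.
have gtv : tv mu \in g by apply/t_in_g/hh_t.
have YX : bra Y X = - tv mu by rewrite bra_anti (bra_wsp_opp wX wY) XY scale1r.
suff : 0 <= - form mu mu by rewrite oppr_ge0 lt_geF.
apply: (@sl2_highest_weight _ d (adm Y) (adm X) (- adm (tv mu)) (form mu mu) (- form mu mu) (cv g E)) => //.
- by rewrite -adm_bra // YX -scaleN1r (linear_hypZ (@adm_linear _ _ g)) scaleN1r.
- rewrite mulNmx mulmxN -opprD -adm_bra // (bra_tv _ wX) (linear_hypZ (@adm_linear _ _ g)).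
  by rewrite scaleNr.
- apply: contra nz => /eqP; rewrite -(linear_hyp0 (@cv_linear _ _ g)) => /cv_inj E0.
  by apply/eqP/E0 => //; apply: mem0v.
- by rewrite adm_act // bra_anti (bra_wsp_opp wE wY) kE scale0r oppr0 (linear_hyp0 (@cv_linear _ _ g)).
- by rewrite mulNmx adm_act // (bra_tv _ wE) (linear_hypZ (@cv_linear _ _ g)) scaleNr.
Qed.

(** If the bracket were 0, then Y would be a highest weight vector of negative weight. *)
Lemma wsp_string be ga X Y : be != 0 -> wsp be X -> X != 0 -> wsp ga Y -> Y != 0 -> form be ga < 0 -> bra X Y != 0.
Proof.
move=> be0 wX X0 wY Y0 f0; apply/eqP => XY.
have [Z wZ XZ] := wsp_dual wX X0; have [i Ei] := wsp_al wX X0.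
have fp : 0 < form be be by rewrite Ei form_pos -?Ei.
have [gX HX] := wX; have [gY HY] := wY; have [gZ HZ] := wZ.
have gtv : tv be \in g by apply/t_in_g/hh_t.
suff : 0 <= form be ga by rewrite lt_geF.
apply: (@sl2_highest_weight _ d (adm X) (adm Z) (adm (tv be)) (form be be) (form be ga) (cv g Y)) => //.
- by rewrite -adm_bra // (bra_wsp_opp wX wZ) XZ scale1r.
- rewrite -adm_bra // (bra_tv _ wZ) (linear_hypZ (@adm_linear _ _ g)); congr (_ *: _).
  by rewrite /form -scaleN1r dotcZl mulN1r.
- by apply: contra Y0 => /eqP; rewrite -(linear_hyp0 (@cv_linear _ _ g)) => /cv_inj -> //; apply: mem0v.
- by rewrite adm_act // XY (linear_hyp0 (@cv_linear _ _ g)).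
- by rewrite adm_act // (bra_tv _ wY) (linear_hypZ (@cv_linear _ _ g)).
Qed.

Definition rootw mu := mu != 0 /\ exists2 X, wsp mu X & X != 0.

Lemma rootw_add be ga : rootw be -> rootw ga -> be + ga != 0 -> form be ga < 0 -> rootw (be + ga).
Proof.
move=> [b0 [X wX X0]] [g0 [Y wY Y0]] bg f0; split=> //.
by exists (bra X Y); [apply: wsp_bra|apply: wsp_string wX X0 wY Y0 f0].
Qed.

Lemma rootw_form_real be ga : rootw be -> rootw ga -> form be ga \is Num.real.
Proof.
move=> [_ [X wX X0]] [_ [Y wY Y0]]; have [i ->] := wsp_al wX X0; have [j ->] := wsp_al wY Y0.
by apply: real_wt; apply: real_tv.
Qed.

(** If b plus the other roots were 0, some a among them would have negative product with b; then b +
    a is again a positive root, and merging the two shortens the sum. This makes the order on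
    weights antisymmetric. *)
Lemma positive_sum (P : 'cV[C]_r -> Prop) : (forall a, P a -> rootw a) -> (forall a, P a -> ~ P (- a)) ->
  (forall a b, P a -> P b -> rootw (a + b) -> P (a + b)) ->
  forall s : seq 'cV[C]_r, (forall a, a \in s -> P a) -> s != [::] -> \sum_(a <- s) a != 0.
Proof.
move=> Pr Pn Pa s; have [k] := ubnP (size s); elim: k s => // k IH [|b s] //= ks Ps _.
rewrite big_cons; apply/negP => /eqP E; have Pb : P b by apply: Ps; rewrite mem_head.
have : form b b + \sum_(a <- s) form b a = 0.
  have -> : \sum_(a <- s) form b a = form b (\sum_(a <- s) a).
    elim/big_rec2: _ => [|a u v _ ->]; last by rewrite formDr.
    by rewrite -[0 in RHS](scale0r b) formZr mul0r.
  by rewrite -formDr E -[X in form _ X](scale0r b) formZr mul0r.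
have fb : 0 < form b b.
  have [b0 [X wX X0]] := Pr b Pb; have [i Ei] := wsp_al wX X0.
  by rewrite Ei form_pos -?Ei.
have [/hasP [a sa fa]|/hasPn nf] := boolP (has (fun a => form b a < 0) s); last first.
  move/eqP; rewrite gt_eqF //; apply: ltr_wpDr => //; rewrite big_seq; apply: sumr_ge0 => a sa.
  have := nf _ sa; rewrite -real_leNgt ?real0 //.
  by apply: rootw_form_real; apply: Pr => //; apply: Ps; rewrite inE sa orbT.
move=> _; have Pa' : P a by apply: Ps; rewrite inE sa orbT.
have ba : b + a != 0.
  by apply/negP; rewrite addrC addr_eq0 => /eqP Ea; apply: (Pn b Pb); rewrite -Ea.
have Pba : P (b + a) by apply: Pa => //; apply: rootw_add => //; apply: Pr.
have Es : \sum_(c <- s) c = a + \sum_(c <- rem a s) c by apply: big_rem.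
suff : \sum_(c <- b + a :: rem a s) c != 0 by rewrite big_cons -addrA -Es E eqxx.
apply: IH => //; first by rewrite /= size_rem //; case: (s) sa ks.
move=> c; rewrite inE => /orP[/eqP -> //|/mem_rem cs]; by apply: Ps; rewrite inE cs orbT.
Qed.

End Structure.

(** * The adjoint representation of the group *)

Section Adjoint.
Variables (C : numClosedFieldType) (n : nat) (G : set 'M[C]_n) (g : {vspace 'M[C]_n}).
Hypothesis AG : algebraic_lie G g.

Lemma Ad_stable x X : G x -> X \in g -> x *m X *m invmx x \in g.
Proof.
move=> Gx gX; apply/(al_lie AG) => f pf f0.
have lin : linear (fun y => x *m y *m invmx x).
  by move=> a u v; rewrite mulmxDr mulmxDl -scalemxAr -scalemxAl.
have := @lie_der0 _ _ _ _ (al_lie AG) _ (fun y => f (x *m y *m invmx x)) X.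
rewrite (der_comp _ _ (polymap_of_linear lin) pf) (der_of_linear _ _ lin) mulmx1 mulmxV ?(al_unit AG) //.
apply=> // [|y Gy]; first exact: polymap_comp (polymap_of_linear lin) pf.
by apply/f0/(al_M AG)/(al_V AG) => //; apply: (al_M AG).
Qed.

Hypothesis G_det : forall x, G x -> \det x = 1.

Lemma adj_mulr x : G x -> x *m \adj x = 1%:M.
Proof. by move=> /G_det Gx; rewrite mul_mx_adj Gx. Qed.

Lemma invmx_adj x : G x -> invmx x = \adj x.
Proof. by move=> Gx; rewrite -[\adj x](mulKmx (al_unit AG Gx)) adj_mulr ?mulmx1. Qed.

Lemma der_adj X : X \in g -> der (fun x : 'M[C]_n => \adj x) 1%:M X = - X.
Proof.
move=> gX; have pa := polymap_adj (@polymap_id C n).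
have pm : polymap (fun x : 'M[C]_n => x *m \adj x) by apply: polymap_mulmx => //; apply: polymap_id.
have := @lie_der0 _ _ _ _ (al_lie AG) _ (fun x => x *m \adj x - 1%:M) X.
rewrite der_sub //; last exact: PolyCst.
rewrite der_cst subr0 der_mulmx //; last exact: polymap_id.
have -> : \adj (1%:M : 'M[C]_n) = 1%:M by rewrite -(invmx_adj (al_1 AG)) invmx1.
rewrite der_id mulmx1 mul1mx => E; apply/eqP; rewrite -addr_eq0 addrC E //.
  by apply: polymap_sub => //; apply: PolyCst.
by move=> x Gx; rewrite adj_mulr // subrr.
Qed.

Local Notation d := (\dim g).

Definition Ad (x : 'M[C]_n) : 'M[C]_d := \matrix_(i, j) coord (vbasis g) i (x *m (vbasis g)`_j *m \adj x).

Lemma Ad_entry (i : 'I_d) : linear (fun y : 'M[C]_n => coord (vbasis g) i y : C^o).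
Proof. by move=> a u v; rewrite linearP. Qed.

Lemma conj_poly (Y : 'M[C]_n) : polymap (fun x => x *m Y *m \adj x).
Proof.
apply: polymap_mulmx; last by apply/polymap_adj/polymap_id.
by apply: polymap_of_linear => a u v; rewrite mulmxDl -scalemxAl.
Qed.

Lemma polymap_Ad : polymap Ad.
Proof.
apply: polymap_mx => i j; have := polymap_linear (Ad_entry i) (conj_poly (vbasis g)`_j).
by apply: polymap_ext => x; rewrite mxE.
Qed.

Lemma der_Ad X : X \in g -> der Ad 1%:M X = adm g X.
Proof.
move=> gX; apply/matrixP => i j; rewrite -der_mxentry; last exact: polymap_Ad.
rewrite (_ : (fun x => Ad x i j : C^o) = fun x => coord (vbasis g) i (x *m (vbasis g)`_j *m \adj x) : C^o).
  rewrite (der_linear _ _ (Ad_entry i) (conj_poly _)) mxE; congr (coord _ _ _).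
  have lin : linear (fun x : 'M[C]_n => x *m (vbasis g)`_j) by move=> a u v; rewrite mulmxDl -scalemxAl.
  rewrite der_mulmx; [|exact: polymap_of_linear|by apply/polymap_adj/polymap_id].
  rewrite (der_of_linear _ _ lin) der_adj // -(invmx_adj (al_1 AG)) invmx1 !mul1mx mulmx1.
  by rewrite mulmxN.
by apply/funext => x; rewrite mxE.
Qed.

Lemma Ad_act x Y : Y \in g -> Ad x *m cv g Y = cv g (x *m Y *m \adj x).
Proof.
move=> gY; rewrite [in RHS](coord_vbasis gY) mulmx_sumr mulmx_suml cv_sum; apply/matrixP => i j.
rewrite mxE summxE; apply: eq_bigr => k _; rewrite !mxE -scalemxAr -scalemxAl linearZ /= mulrC.
by [].
Qed.

Lemma Ad_M x y : G x -> G y -> Ad (x *m y) = Ad x *m Ad y.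
Proof.
move=> Gx Gy; apply: adm_ext => Y gY; have gy : y *m Y *m \adj y \in g by rewrite -invmx_adj // Ad_stable.
rewrite Ad_act // -[RHS]mulmxA !Ad_act //; congr cv; rewrite -!invmx_adj //; last exact: (al_M AG).
have -> : invmx (x *m y) = invmx y *m invmx x.
  have Gxy := al_M AG Gx Gy; rewrite -[RHS](mulKmx (al_unit AG Gxy)) -!mulmxA (mulmxA y).
  by rewrite mulmxV ?(al_unit AG) // mul1mx mulmxV ?(al_unit AG) // mulmx1.
by rewrite !mulmxA.
Qed.

Lemma Ad_1 : Ad 1%:M = 1%:M.
Proof.
apply: adm_ext => Y gY; rewrite Ad_act // -(invmx_adj (al_1 AG)).
by rewrite invmx1 mul1mx mulmx1 mul1mx.
Qed.

End Adjoint.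

(** * Cartan data of a maximal torus *)

Section Setup.
Variables (C : numClosedFieldType) (n : nat) (G : set 'M[C]_n) (g : {vspace 'M[C]_n}).
Hypothesis AG : algebraic_lie G g.
Hypothesis g_simple : forall a : {vspace 'M[C]_n}, (a <= g)%VS -> stable_under g a -> a = 0%VS \/ a = g.
Hypothesis g_nab : exists X Y, [/\ X \in g, Y \in g & bra X Y != 0].
Variables (T : set 'M[C]_n) (r : nat) (tor : ('I_r -> C) -> 'M[C]_n).
Variables (p pv : 'I_r -> 'M[C]_n -> C^o) (t : {vspace 'M[C]_n}).
Hypothesis TC : torus_chart T tor p pv.
Hypothesis t_lie : forall X, X \in t <->
  forall f : 'M[C]_n -> C^o, polymap f -> (forall x, T x -> f x = 0) -> der f 1%:M X = 0.
Hypothesis TG : forall x, T x -> G x.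
Hypothesis T_max : forall (T' : set 'M[C]_n) r' (tor' : ('I_r' -> C) -> 'M[C]_n) p' pv',
  torus_chart T' tor' p' pv' -> poly_closed T' -> (forall x, T' x -> G x) ->
  (forall x, T x -> T' x) -> forall x, T' x -> T x.

Lemma G_perfect (U : {vspace 'M[C]_n}) : (forall X Y, X \in g -> Y \in g -> bra X Y \in U) -> (g <= U)%VS.
Proof. by apply: simple_perfect => // X Y; apply: (lie_bra AG). Qed.

Theorem cartan_setup : exists (H : 'I_r -> 'M[C]_n) (Q : 'M[C]_n) w (A : 'M[C]_(\dim g)) al,
  [/\ forall j a b, lder (fun y => tor (evec j y) a b) (H j a b),
      forall z, nzv z -> tor z *m Q = Q *m diag_mx (\row_i mono (w i) z)
    & cartan t H Q w A al].
Proof.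
have Gd := al_det AG G_perfect.
have /choice [H HH] : forall j, exists Hj : 'M[C]_n, forall a d, lder (fun y => tor (evec j y) a d) (Hj a d).
  move=> j; have /choice [h Hh] : forall ad : 'I_n * 'I_n, exists d,
      lder (fun y => tor (evec j y) ad.1 ad.2) d by move=> [a d]; apply: (tc_laurent TC).
  by exists (\matrix_(a, d) h (a, d)) => a d; rewrite mxE; apply: (Hh (a, d)).
have [|Q [w [Qu Hw]]] := chart_weights TC HH (@polymap_id C n) (erefl _); first by [].
have HQ j : H j *m Q = Q *m diag_mx (\row_i (w i j)%:~R).
  by rewrite -[H j](@der_id C n 1%:M); apply: (der_tor_weights TC HH (@polymap_id C n) Hw).
have tg : (t <= g)%VS.
  apply/subvP => X /t_lie tX; apply/(al_lie AG) => f pf f0; apply: tX => // x Tx.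
  exact/f0/TG.
have Ht j : H j \in t := tor_H_t TC t_lie HH j.
have [|x y Tx Ty|A [al [Au HA]]] := chart_weights TC HH (polymap_Ad g).
- exact: Ad_1 AG Gd.
- by apply: (Ad_M AG Gd); apply: TG.
have HAd j : adm g (H j) *m A = A *m diag_mx (\row_i (al i j)%:~R).
  rewrite -(der_Ad AG Gd); last by move/subvP: tg; apply.
  exact: (der_tor_weights TC HH (polymap_Ad g) HA).
exists H, Q, w, A, al; split=> //; split=> //.
- by move=> X Y; apply: (lie_bra AG).
- by move=> x; apply: memv_suml => j _; apply: memvZ.
- move=> X tX; exists (\col_j der (p j) 1%:M X); rewrite {1}(t_coord TC t_lie HH tX).
  by apply: eq_bigr => j _; rewrite mxE.
- move=> x E; apply/matrixP => j k; rewrite (ord1 k) [RHS]mxE.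
  have := congr1 (der (p j) 1%:M) E; rewrite der_dir0; last exact: (tc_poly TC).
  rewrite /hh der_dir_sum; last exact: (tc_poly TC).
  rewrite (bigD1 j) //= big1 => [|l lj]; rewrite der_dirZ; try exact: (tc_poly TC).
    by rewrite (der_p_H TC HH) eqxx addr0 scaler1_regular.
  by rewrite (der_p_H TC HH) eq_sym (negbTE lj) scaler0.
- by move=> X gX XC; apply: (centralizer_jordan AG Gd TC t_lie TG T_max).
Qed.

End Setup.

(** * The differential of a representation *)

Section Representation.
Variables (C : numClosedFieldType) (n : nat) (G : set 'M[C]_n) (g : {vspace 'M[C]_n}).
Hypothesis AG : algebraic_lie G g.
Variables (m : nat) (Pi : 'M[C]_n -> 'M[C]_m).
Hypothesis Pi_poly : polymap Pi.
Hypothesis Pi_1 : Pi 1%:M = 1%:M.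
Hypothesis Pi_M : forall x y, G x -> G y -> Pi (x *m y) = Pi x *m Pi y.

Definition dPi X := der Pi 1%:M X.

Lemma dPi_linear : linear dPi. Proof. exact: der_lin_dir. Qed.

Lemma DX_Pi X x : X \in g -> G x -> DX X Pi x = Pi x *m dPi X.
Proof.
move=> gX Gx; have pl : polymap (fun y => Pi (x *m y)) by apply: polymap_mull.
have pr : polymap (fun y => Pi x *m Pi y).
  by apply: polymap_linear Pi_poly => a u v; rewrite mulmxDr -scalemxAr.
have := DX_eq (al_M AG) (al_lie AG) pl pr (fun y Gy => Pi_M Gx Gy) gX (al_1 AG).
rewrite DX_mull // mulmx1 => ->; rewrite /DX mul1mx.
by rewrite (der_linear _ _ _ Pi_poly) // => a u v; rewrite mulmxDr -scalemxAr.
Qed.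

Lemma dPi_bra X Y : X \in g -> Y \in g -> dPi (bra X Y) = dPi X *m dPi Y - dPi Y *m dPi X.
Proof.
have E U V : U \in g -> V \in g -> DX U (DX V Pi) 1%:M = dPi U *m dPi V.
  move=> gU gV; have lin : linear (fun A : 'M[C]_m => A *m dPi V).
    by move=> a u v; rewrite mulmxDl -scalemxAl.
  have pV : polymap (fun x => Pi x *m dPi V) := polymap_linear lin Pi_poly.
  rewrite (DX_eq (al_M AG) (al_lie AG) (polymap_DX V Pi_poly) pV (fun x Gx => DX_Pi gV Gx) gU (al_1 AG)).
  by rewrite /DX (der_linear _ _ lin) // mul1mx.
move=> gX gY; have := DX_comm X Y 1%:M Pi_poly; rewrite !E // mul1mx => ->.
by rewrite addrAC subrr add0r.
Qed.

(** The components outside U of x |-> Pi(x) u, for u in U, vanish at 1 and are permuted linearly by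
    the derivations, so uniqueness applies. Irreducibility of G thus passes to g. *)
Lemma stable_group (U : {vspace 'cV[C]_m}) : (forall X v, X \in g -> v \in U -> dPi X *m v \in U) ->
  forall x v, G x -> v \in U -> Pi x *m v \in U.
Proof.
move=> gU x v Gx vU; pose pr (u : 'cV[C]_m) := u - projv U u.
have prl : linear pr.
  by move=> a u1 u2; rewrite /pr linearP scalerBr opprD addrACA.
have pr0 u : pr u = 0 <-> u \in U.
  split=> [/eqP|uU]; last by rewrite /pr projv_id ?subrr.
  by rewrite subr_eq0 => /eqP ->; apply: memv_proj.
apply/pr0; pose Z (f : 'M[C]_n -> 'cV[C]_m) := exists2 u, u \in U & f = fun x => pr (Pi x *m u).
have lu u : linear (fun A : 'M[C]_m => pr (A *m u)).
  by move=> a A B; rewrite mulmxDl -scalemxAl prl.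
apply: (@ode_vanish _ _ _ _ AG _ Z _ _ (fun x => pr (Pi x *m v))) => //; last by exists v.
- move=> _ [u uU ->]; split; first exact: polymap_linear (lu u) Pi_poly.
  by rewrite Pi_1 mul1mx; apply/pr0.
move=> _ X [u uU ->] gX; exists (fun x => pr (Pi x *m (dPi X *m u))).
  by exists (dPi X *m u) => //; apply: gU.
move=> y Gy; rewrite /DX (der_linear _ _ (lu u) Pi_poly) -/(DX X Pi y) DX_Pi //.
by rewrite mulmxA.
Qed.

Lemma dPi_skew (B : 'M[C]_m) X : (forall x, G x -> (Pi x)^T *m B *m Pi x = B) -> X \in g ->
  (dPi X)^T *m B + B *m dPi X = 0.
Proof.
move=> PB gX; have linT : linear (fun A : 'M[C]_m => A^T *m B).
  by move=> a u v; rewrite linearP mulmxDl -scalemxAl.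
have pT := polymap_linear linT Pi_poly.
have := @lie_der0 _ _ _ _ (al_lie AG) _ (fun x => (Pi x)^T *m B *m Pi x - B) X.
rewrite der_sub ?der_cst ?subr0; [|exact: polymap_mulmx|exact: PolyCst].
rewrite der_mulmx // (der_linear _ _ linT Pi_poly) Pi_1 trmx1 mul1mx mulmx1; apply=> //.
- by apply: polymap_sub; [apply: polymap_mulmx|apply: PolyCst].
- by move=> x Gx; rewrite PB // subrr.
Qed.

(** * The Casimir element *)

Section Casimir.
Variables (t : {vspace 'M[C]_n}) (r : nat) (H : 'I_r -> 'M[C]_n).
Local Notation d := (\dim g).
Variables (Q : 'M[C]_n) (w : 'I_n -> 'I_r -> int) (A : 'M[C]_d) (al : 'I_d -> 'I_r -> int).
Hypothesis CA : cartan t H Q w A al.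
Local Notation hh := (hh H).
Local Notation kil := (kil g).
Local Notation wsp := (wsp g H).
Local Notation e := (ebas A).
Local Notation form := (form g H).

Let ge i : e i \in g. Proof. exact: vc_mem. Qed.

Lemma kil0l Y : kil 0 Y = 0. Proof. by rewrite -(scale0r (0 : 'M[C]_n)) kilZl mul0r. Qed.
Lemma kil0r Y : kil Y 0 = 0. Proof. by rewrite kil_sym kil0l. Qed.

Definition trf X Y := \tr (dPi X *m dPi Y).

Lemma trf_linl Y : linear (fun X => trf X Y : C^o).
Proof. by move=> a u v; rewrite /trf dPi_linear mulmxDl -scalemxAl linearP. Qed.

Lemma trf_linr Y : linear (fun X => trf Y X : C^o).
Proof. by move=> a u v; rewrite /trf dPi_linear mulmxDr -scalemxAr linearP. Qed.

Lemma trf_inv X Y Z : X \in g -> Y \in g -> Z \in g -> trf (bra X Y) Z = trf X (bra Y Z).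
Proof.
move=> gX gY gZ; rewrite /trf !dPi_bra // mulmxBl mulmxBr !linearB /= !mulmxA.
by rewrite -[dPi Y *m dPi X *m dPi Z]mulmxA [\tr (dPi Y *m _)]mxtrace_mulC.
Qed.

Definition egram : 'M[C]_d := \matrix_(i, j) kil (e i) (e j).

Lemma egram_unit : egram \in unitmx.
Proof.
rewrite unitmxE unitfE; apply/negP => /det0P [v v0 vg]; case/negP: v0.
have : \sum_i v 0 i *: e i = 0.
  apply: (kil_radical CA); first by apply: memv_suml => i _; apply/memvZ.
  move=> Y gY; rewrite (ebas_span CA gY) kil_sumr big1 // => j _; rewrite kilZr kil_suml.
  have /matrixP /(_ 0 j) := vg; rewrite mxE [RHS]mxE => E.
  under eq_bigr => i _ do rewrite kilZl.
  rewrite (_ : \sum_i _ = 0) ?mulr0 // -[RHS]E; apply: eq_bigr => i _.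
  by rewrite [egram i j]mxE.
have -> : \sum_i v 0 i *: e i = vc (A *m v^T).
  have -> : A *m v^T = \sum_i v 0 i *: col i A.
    by apply/matrixP => i j; rewrite mxE summxE; apply: eq_bigr => k _; rewrite !mxE mulrC (ord1 j).
  elim/big_rec2: _ => [|i a b _ ->]; first by rewrite (linear_hyp0 (@vc_linear _ _ g)).
  by rewrite (linear_hypD (@vc_linear _ _ g)) (linear_hypZ (@vc_linear _ _ g)).
move/(congr1 (cv g)); rewrite vcK (linear_hyp0 (@cv_linear _ _ g)) => /(congr1 (mulmx (invmx A))).
by rewrite mulKmx ?(ca_Au CA) // mulmx0 => /(congr1 trmx); rewrite trmxK trmx0 => ->.
Qed.

Definition edual i := \sum_j invmx egram i j *: e j.

Lemma kil_edual i j : kil (edual i) (e j) = (i == j)%:R.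
Proof.
rewrite kil_suml; have /matrixP /(_ i j) := mulVmx egram_unit; rewrite !mxE => <-.
by apply: eq_bigr => k _; rewrite kilZl [egram k j]mxE.
Qed.

Lemma edual_g i : edual i \in g. Proof. by apply: memv_suml => j _; apply/memvZ. Qed.
Hint Resolve edual_g ge : core.

Lemma expand_e X : X \in g -> X = \sum_i kil (edual i) X *: e i.
Proof.
move=> gX; have := ebas_span CA gX; move: (invmx A *m cv g X) => c EX.
rewrite {1}EX; apply: eq_bigr => i _; congr (_ *: _).
rewrite EX kil_sumr (bigD1 i) //= kilZr kil_edual eqxx mulr1 big1 ?addr0 // => j ji.
by rewrite kilZr kil_edual eq_sym (negbTE ji) mulr0.
Qed.

Lemma kil_ext X Y : X \in g -> Y \in g -> (forall i, kil X (e i) = kil Y (e i)) -> X = Y.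
Proof.
move=> gX gY E; apply/eqP; rewrite -subr_eq0; apply/eqP/(kil_radical CA); first exact: memvB.
move=> Z gZ; rewrite (ebas_span CA gZ) kil_sumr big1 // => i _; rewrite kilZr.
by rewrite -scaleN1r kilDl kilZl E mulN1r subrr mulr0.
Qed.

Lemma expand_edual X : X \in g -> X = \sum_i kil X (e i) *: edual i.
Proof.
move=> gX; apply: kil_ext => //; first by apply: memv_suml => i _; apply: memvZ.
move=> j; rewrite kil_suml (bigD1 j) //= kilZl kil_edual eqxx mulr1 big1 ?addr0 //.
by move=> i /negbTE ij; rewrite kilZl kil_edual ij mulr0.
Qed.

Lemma edual_wsp i : wsp (- wt C (al i)) (edual i).
Proof.
split=> // x; have gx : hh x \in g by apply: (t_in_g CA); apply: (ca_hht CA).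
apply: kil_ext => // [||j]; [exact: (ca_sub CA)|exact: memvZ|].
rewrite kilZl bra_anti -scaleN1r kilZl (kil_inv (ca_sub CA)) //.
rewrite ((ebas_wsp CA j).2 x) kilZr kil_edual -scaleN1r dotcZl.
by case: eqP => [->|_]; rewrite ?mulr0 // !mulr1.
Qed.

(** Schur's argument for invariant forms: for an eigenvalue c of one Gram matrix relative to the
    other, the form [trf] - c [kil] is degenerate, and its radical is a nonzero ideal of the simple
    algebra. *)
Lemma trf_kil : exists c, forall X Y, X \in g -> Y \in g -> trf X Y = c * kil X Y.
Proof.
pose GB : 'M[C]_d := \matrix_(i, j) trf (e i) (e j).
have d0 : (0 < d)%N.
  rewrite lt0n; apply/negP => /eqP dg; have [X [Y [gX gY]]] := ca_nab CA.
  have g0 : g = 0%VS by apply/eqP; rewrite -dimv_eq0 dg.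
  by rewrite g0 memv0 in gX; rewrite (eqP gX) /bra mul0mx mulmx0 subrr eqxx.
have [c /eigenvalueP [v vG v0]] : exists c, eigenvalue (GB *m invmx egram) c.
  by apply: eigenvalue_closed.
exists c.
have bil (b : 'M[C]_n -> 'M[C]_n -> C) Y u : linear (fun X => b X Y : C^o) -> b (\sum_(i < d) u i *: e i) Y = \sum_i u i * b (e i) Y.
  move=> lb; elim/big_rec2: _ => [|i x y _ <-]; first exact: linear_hyp0 lb.
  by rewrite (linear_hypD lb) (linear_hypZ lb).
pose X0 := \sum_i v 0 i *: e i.
have gX0 : X0 \in g by apply: memv_suml => i _; apply: memvZ.
have EX0 j : trf X0 (e j) = c * kil X0 (e j).
  have : v *m GB = c *: (v *m egram) by rewrite scalemxAl -vG mulmxA mulmxKV // egram_unit.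
  move/matrixP => /(_ 0 j); rewrite !mxE /X0 (bil trf) ?kil_suml; last exact: trf_linl.
  under eq_bigr => k _ do rewrite mxE.
  by under [in RHS]eq_bigr => k _ do rewrite [egram _ _]mxE -kilZl.
pose PP X := X \in g /\ forall Y, Y \in g -> trf X Y = c * kil X Y.
have [|a X Y [gX EX] [gY EY]|U HU] := @pred_vspace C _ PP.
- split=> [|Y _]; first exact: mem0v.
  by rewrite (linear_hyp0 (trf_linl Y)) kil0l mulr0.
- split=> [|Z gZ]; first by rewrite memvD ?memvZ.
  rewrite (linear_hypD (trf_linl Z)) (linear_hypZ (trf_linl Z)) EX // EY // kilDl kilZl.
  by rewrite /GRing.scale /=; ring.
have [|Y X gY /HU [gX EX]|E|E] := ca_simple CA (a := U).
- by apply/subvP => X /HU [].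
- apply/HU; split=> [|Z gZ]; first exact: (ca_sub CA).
  have gYX := ca_sub CA gX gY.
  rewrite bra_anti -scaleN1r (linear_hypZ (trf_linl Z)) kilZl trf_inv // (kil_inv (ca_sub CA)) // EX ?(ca_sub CA) //.
  by rewrite /GRing.scale /=; ring.
- have : X0 \in U.
    apply/HU; split=> // Y gY; rewrite (ebas_span CA gY) kil_sumr mulr_sumr.
    elim/big_rec2: _ => [|j a b _ <-]; first exact: linear_hyp0 (trf_linr X0).
    rewrite (linear_hypD (trf_linr X0)) (linear_hypZ (trf_linr X0)) EX0 kilZr.
    by rewrite /GRing.scale /= mulrCA.
  rewrite E memv0 => /eqP X00; case/negP: v0; apply/eqP/(can_inj (mulmxK egram_unit)).
  rewrite mul0mx; apply/matrixP => i j; rewrite (ord1 i) !mxE -[RHS](_ : kil X0 (e j) = 0); last first.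
    by rewrite X00 kil0l.
  by rewrite /X0 kil_suml; apply: eq_bigr => k _; rewrite kilZl [egram _ _]mxE.
move=> X Y gX gY; have : X \in U by rewrite E.
by move=> /HU [_]; apply.
Qed.

Definition Cas := \sum_i dPi (e i) *m dPi (edual i).

Lemma dPi_sum (I : Type) (s : seq I) (F : I -> 'M[C]_n) : dPi (\sum_(i <- s) F i) = \sum_(i <- s) dPi (F i).
Proof.
elim/big_rec2: _ => [|i x y _ <-]; first exact: linear_hyp0 dPi_linear.
exact: linear_hypD dPi_linear _ _.
Qed.

Lemma Cas_comm X : X \in g -> dPi X *m Cas = Cas *m dPi X.
Proof.
move=> gX; apply/eqP; rewrite -subr_eq0 mulmx_sumr mulmx_suml -sumrB.
have E i : dPi X *m (dPi (e i) *m dPi (edual i)) - dPi (e i) *m dPi (edual i) *m dPi X =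
   dPi (bra X (e i)) *m dPi (edual i) + dPi (e i) *m dPi (bra X (edual i)).
  by rewrite !dPi_bra // mulmxBl mulmxBr !mulmxA addrA subrK.
under eq_bigr do rewrite E; rewrite big_split /=.
have E1 i : dPi (bra X (e i)) *m dPi (edual i) =
    \sum_j kil (edual j) (bra X (e i)) *: (dPi (e j) *m dPi (edual i)).
  rewrite {1}(expand_e (ca_sub CA gX (ge i))) dPi_sum mulmx_suml; apply: eq_bigr => j _.
  by rewrite (linear_hypZ dPi_linear) scalemxAl.
have E2 i : dPi (e i) *m dPi (bra X (edual i)) =
    \sum_j kil (bra X (edual i)) (e j) *: (dPi (e i) *m dPi (edual j)).
  have -> : dPi (bra X (edual i)) = \sum_j kil (bra X (edual i)) (e j) *: dPi (edual j).
    rewrite {1}(expand_edual (ca_sub CA gX (edual_g i))) dPi_sum; apply: eq_bigr => j _.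
    exact: linear_hypZ dPi_linear _ _.
  by rewrite mulmx_sumr; apply: eq_bigr => j _; rewrite scalemxAr.
under eq_bigr do rewrite E1; under [X in _ + X]eq_bigr do rewrite E2.
rewrite exchange_big -big_split big1 //= => i _; rewrite -big_split big1 //= => j _.
rewrite -scalerDl.
rewrite [bra X (edual i)]bra_anti -scaleN1r kilZl (kil_inv (ca_sub CA)) //.
by rewrite mulN1r addrN scale0r.
Qed.

Lemma Cas_trace c : (forall X Y, X \in g -> Y \in g -> trf X Y = c * kil X Y) -> \tr Cas = c * d%:R.
Proof.
move=> tc; rewrite /Cas raddf_sum /= (eq_bigr (fun=> c)).
  by rewrite sumr_const card_ord mulr_natr.
by move=> i _; rewrite -/(trf _ _) tc // kil_sym kil_edual eqxx mulr1.
Qed.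

Hypothesis irr : forall U : {vspace 'cV[C]_m}, (forall x v, G x -> v \in U -> Pi x *m v \in U) ->
  U = 0%VS \/ U = fullv.

(** The eigenspace is stable under g, hence under G, and is therefore everything. *)
Lemma Cas_scalar (v : 'cV[C]_m) (om : C) : v != 0 -> Cas *m v = om *: v -> Cas = om%:M.
Proof.
move=> v0 Ev; have [|a x y Ex Ey|U HU] := @pred_vspace C _ (fun v : 'cV[C]_m => Cas *m v = om *: v).
- by rewrite mulmx0 scaler0.
- by rewrite mulmxDr -scalemxAr Ex Ey scalerDr !scalerA mulrC.
have [|U0|UT] := irr (U := U).
- apply: stable_group => X u gX /HU Eu; apply/HU.
  by rewrite mulmxA -Cas_comm // -mulmxA Eu -scalemxAr.
- by have := (HU v).2 Ev; rewrite U0 memv0 (negbTE v0).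
apply/matrixP => i j; have /HU : delta_mx j 0 \in U by rewrite UT memvf.
by rewrite -colE -mul_scalar_mx -colE => /matrixP /(_ i 0); rewrite !mxE.
Qed.

Variables (Qp : 'M[C]_m) (wp : 'I_m -> 'I_r -> int).
Hypothesis Qpu : Qp \in unitmx.
Hypothesis HQp : forall j, dPi (H j) *m Qp = Qp *m diag_mx (\row_i (wp i j)%:~R).

Variables (P : 'cV[C]_r -> Prop) (k0 : 'I_m).
Hypothesis P_root : forall a, P a -> rootw g H a.
Hypothesis P_sign : forall a, rootw g H a -> P a \/ P (- a).
Hypothesis hw : forall k a, P a -> wt C (wp k) != wt C (wp k0) + a.

Let la := wt C (wp k0).
Let v0 := col k0 Qp.

Lemma dPi_hh x : dPi (hh x) *m Qp = Qp *m diag_mx (\row_i dotc (wt C (wp i)) x).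
Proof. exact: hh_diag dPi_linear HQp x. Qed.

Lemma v0_weight x : dPi (hh x) *m v0 = dotc la x *: v0.
Proof.
rewrite /v0 {1}colE mulmxA dPi_hh -mulmxA -colE; apply/matrixP => k l.
rewrite !mxE (bigD1 k0) //= big1 ?addr0 => [|j /negbTE ji]; last by rewrite !mxE ji mulr0n mulr0.
by rewrite !mxE eqxx mulr1n mulrC.
Qed.

Lemma weight_vector (mu : 'cV[C]_r) (u : 'cV[C]_m) : u != 0 -> (forall x, dPi (hh x) *m u = dotc mu x *: u) ->
  exists k, mu = wt C (wp k).
Proof.
move=> u0 Eu; have [k nk] : exists k, (invmx Qp *m u) k 0 != 0.
  apply/existsP; apply: contraR u0; rewrite negb_exists => /forallP E.
  have -> : u = Qp *m (invmx Qp *m u) by rewrite mulKVmx.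
  apply/eqP; rewrite (_ : invmx Qp *m u = 0) ?mulmx0 //; apply/matrixP => i j.
  by rewrite (ord1 j) [RHS]mxE; have := E i; rewrite negbK => /eqP.
exists k; apply/eqP; rewrite -subr_eq0; apply/eqP/dotc_inj => x; apply/(mulIf nk).
rewrite mul0r -scaleN1r dotcDl dotcZl.
have : diag_mx (\row_i dotc (wt C (wp i)) x) *m (invmx Qp *m u) = dotc mu x *: (invmx Qp *m u).
  rewrite scalemxAr -Eu !mulmxA; congr (_ *m _); apply: (can_inj (mulmxK Qpu)).
  by rewrite mulmxKV // -mulmxA dPi_hh mulKmx.
by rewrite mul_diag_mx => /matrixP /(_ k 0); rewrite !mxE => E; rewrite mulrDl mulN1r mulNr E subrr.
Qed.

Lemma raise_v0 a X : P a -> wsp a X -> dPi X *m v0 = 0.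
Proof.
move=> Pa wX; apply/eqP; apply/negPn/negP => nz.
have [|k /eqP] := @weight_vector (la + a) _ nz; last by rewrite eq_sym (negbTE (hw k Pa)).
move=> x; have gx : hh x \in g by apply: (t_in_g CA); apply: (ca_hht CA).
have /(congr1 (fun A => A *m v0)) := dPi_bra gx wX.1; rewrite (wX.2 x) (linear_hypZ dPi_linear) mulmxBl.
rewrite -!mulmxA v0_weight -scalemxAr -scalemxAl => /esym/eqP; rewrite subr_eq => /eqP ->.
by rewrite dotcDl scalerDl addrC.
Qed.

Lemma rootw_uniq a : rootw g H a -> exists2 i, wt C (al i) = a & forall j, wt C (al j) = a -> j = i.
Proof.
move=> [a0 [X wX X0]]; have [i Ei] := wsp_al CA wX X0; exists i => // j Ej.
have wi := ebas_wsp CA i; have wj := ebas_wsp CA j; rewrite -Ei in wi; rewrite Ej in wj.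
have ei0 : e i != 0.
  apply: contra_eq_neq (kil_edual i i) => ->.
  by rewrite kil0r eqxx eq_sym oner_eq0.
have [c Ec] := wsp_dim1 CA a0 wi ei0 wj.
have := kil_edual j j; rewrite eqxx Ec kilZr kil_edual; case: eqP => // _.
by rewrite mulr0 => /esym/eqP; rewrite oner_eq0.
Qed.

(** On the highest weight vector, the terms of weight 0 add up to the square of la. A positive root
    contributes through the commutator of [e i] with its dual, as [e i] kills the vector; for a
    negative root the dual vector kills it. *)
Lemma Cas_v0 : Cas *m v0 = (form la la + \sum_(i | `[< P (wt C (al i)) >]) form (wt C (al i)) la) *: v0.
Proof.
have /choice [x Hx] : forall i, exists x, wt C (al i) = 0 -> e i = hh x.
  move=> i; have [a0|a0] := eqVneq (wt C (al i)) 0; last by exists 0 => E; rewrite E eqxx in a0.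
  have : e i \in t by apply: (wsp0 CA); have := ebas_wsp CA i; rewrite a0.
  by move=> /(ca_thh CA) [x ->]; exists x.
have /choice [y Hy] : forall i, exists y, wt C (al i) = 0 -> edual i = hh y.
  move=> i; have [a0|a0] := eqVneq (wt C (al i)) 0; last by exists 0 => E; rewrite E eqxx in a0.
  have : edual i \in t by apply: (wsp0 CA); have := edual_wsp i; rewrite a0 oppr0.
  by move=> /(ca_thh CA) [y ->]; exists y.
have Ei i : dPi (e i) *m dPi (edual i) *m v0 =
    ((if wt C (al i) == 0 then dotc la (x i) * dotc la (y i) else 0) +
     (if `[< P (wt C (al i)) >] then form (wt C (al i)) la else 0)) *: v0.
  case: eqP => [a0|/eqP a0].
    case: asboolP => [/P_root []|_]; first by rewrite a0 eqxx.
    by rewrite addr0 -mulmxA (Hx _ a0) (Hy _ a0) v0_weight -scalemxAr v0_weight scalerA mulrC.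
  rewrite add0r; case: asboolP => Pi'.
    have := dPi_bra (ge i) (edual_g i).
    rewrite (bra_wsp_opp CA (ebas_wsp CA i) (edual_wsp i)) kil_sym kil_edual eqxx scale1r.
    move/eqP; rewrite eq_sym subr_eq => /eqP ->; rewrite mulmxDl -(mulmxA _ (dPi (e i))).
    by rewrite (raise_v0 Pi' (ebas_wsp CA i)) mulmx0 addr0 v0_weight.
  have rw : rootw g H (wt C (al i)).
    split=> //; exists (e i); first exact: (ebas_wsp CA i).
    apply: contra_eq_neq (kil_edual i i) => ->.
    by rewrite kil0r eqxx eq_sym oner_eq0.
  case: (P_sign rw) => // Pi2.
  by rewrite -mulmxA (raise_v0 Pi2 (edual_wsp i)) mulmx0 scale0r.
rewrite /Cas mulmx_suml; under eq_bigr => i _ do rewrite Ei.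
rewrite -scaler_suml big_split /= -!big_mkcond /=; congr ((_ + _) *: _).
pose tl := tv g H la.
have tlt : tl \in t by apply: (ca_hht CA).
have gtl : tl \in g by apply: (t_in_g CA).
have Etl : tl = hh (\sum_(i | wt C (al i) == 0) dotc la (x i) *: y i).
  have -> : hh (\sum_(i | wt C (al i) == 0) dotc la (x i) *: y i) = \sum_(i | wt C (al i) == 0) dotc la (x i) *: edual i.
    elim/big_rec2: _ => [|i a b /eqP a0 <-]; first exact: linear_hyp0 (hh_linear H).
    by rewrite (linear_hypD (hh_linear H)) (linear_hypZ (hh_linear H)) Hy.
  rewrite {1}(expand_edual gtl) (bigID (fun i => wt C (al i) == 0)) /= [X in _ + X]big1 ?addr0.
    by apply: eq_bigr => i /eqP a0; rewrite (Hx _ a0) (kil_tv CA).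
  move=> i a0; rewrite (kil_wsp CA (mu := 0) (nu := wt C (al i))) ?scale0r ?add0r //; last exact: (ebas_wsp CA i).
  split=> // z; have [u ->] := ca_thh CA tlt.
  by rewrite /bra (hh_comm CA) subrr /dotc big1 ?scale0r // => j _; rewrite mxE mul0r.
have E : invmx (gram g H) *m la = \sum_(i | wt C (al i) == 0) dotc la (x i) *: y i.
  apply/eqP; rewrite -subr_eq0 -scaleN1r addrC; apply/eqP/(ca_inj CA).
  by rewrite (hh_linear H) -Etl scaleN1r addNr.
rewrite /form E; elim/big_rec2: _ => [|i a b _ Eab].
  by rewrite /dotc big1 // => j _; rewrite [X in _ * X]mxE mulr0.
by rewrite dotcDr dotcZr; congr (_ + _).
Qed.

Theorem casimir_identity c : (forall X Y, X \in g -> Y \in g -> trf X Y = c * kil X Y) ->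
  m%:R * (form la la + \sum_(i | `[< P (wt C (al i)) >]) form (wt C (al i)) la) = c * d%:R.
Proof.
move=> tc; rewrite -(Cas_trace tc) (@Cas_scalar v0 _ _ Cas_v0) ?mxtrace_scalar ?mulr_natl //.
apply/negP => /eqP v00; have /matrixP /(_ k0 0) : invmx Qp *m v0 = delta_mx k0 0.
  by rewrite /v0 colE mulmxA mulVmx // mul1mx.
by rewrite v00 mulmx0 !mxE !eqxx => /eqP; rewrite eq_sym oner_eq0.
Qed.

End Casimir.
End Representation.

(** * Clifford algebras *)

Section CliffordSign.
Variable m : nat.
Local Notation I := {ffun 'I_m -> bool}.

Definition xadd (s u : I) : I := [ffun i => s i (+) u i].
Definition xnul : I := [ffun=> false].

Lemma xaddA : associative xadd. Proof. by move=> s u v; apply/ffunP => i; rewrite !ffunE addbA. Qed.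
Lemma xaddC : commutative xadd. Proof. by move=> s u; apply/ffunP => i; rewrite !ffunE addbC. Qed.
Lemma xadd0 s : xadd s xnul = s. Proof. by apply/ffunP => i; rewrite !ffunE addbF. Qed.
Lemma xadd0l s : xadd xnul s = s. Proof. by rewrite xaddC xadd0. Qed.
Lemma xaddss s : xadd s s = xnul. Proof. by apply/ffunP => i; rewrite !ffunE addbb. Qed.
Lemma xaddK s u : xadd s (xadd s u) = u. Proof. by rewrite xaddA xaddss xadd0l. Qed.
Lemma xadd_eq s u v : (xadd s u == v) = (u == xadd s v).
Proof. by apply/eqP/eqP => [<-|->]; rewrite xaddK. Qed.

Lemma xaddI s : injective (xadd s). Proof. by move=> u v E; rewrite -(xaddK s u) E xaddK. Qed.

(* The number, modulo 2, of transpositions sorting the concatenation of two ordered monomials. *)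
Definition inv2 (s u : I) : bool := \big[addb/false]_(i < m) \big[addb/false]_(j < m | (j < i)%N) (s i && u j).

Lemma inv2Dl s s' u : inv2 (xadd s s') u = inv2 s u (+) inv2 s' u.
Proof.
rewrite -big_split; apply: eq_bigr => i _; rewrite -big_split; apply: eq_bigr => j _.
by rewrite ffunE andb_addl.
Qed.

Lemma inv2Dr s u u' : inv2 s (xadd u u') = inv2 s u (+) inv2 s u'.
Proof.
rewrite -big_split; apply: eq_bigr => i _; rewrite -big_split; apply: eq_bigr => j _.
by rewrite ffunE andb_addr.
Qed.

Lemma inv20l u : inv2 xnul u = false.
Proof. by rewrite /inv2 big1 // => i _; rewrite big1 // => j _; rewrite ffunE. Qed.

Lemma inv20r u : inv2 u xnul = false.
Proof. by rewrite /inv2 big1 // => i _; rewrite big1 // => j _; rewrite ffunE andbF. Qed.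

Definition xone (i : 'I_m) : I := [ffun j => j == i].
Definition par (s : I) : bool := \big[addb/false]_i s i.

Lemma parD s u : par (xadd s u) = par s (+) par u.
Proof. by rewrite -big_split; apply: eq_bigr => i _; rewrite ffunE. Qed.

Lemma inv2_1l i u : inv2 (xone i) u = \big[addb/false]_(j < m | (j < i)%N) u j.
Proof.
rewrite /inv2 (bigD1 i) //= [X in _ (+) X]big1 ?addbF => [|k ki].
  by apply: eq_bigr => j _; rewrite ffunE eqxx.
by rewrite big1 // => j _; rewrite ffunE (negbTE ki).
Qed.

Lemma inv2_1r i u : inv2 u (xone i) = \big[addb/false]_(j < m | (i < j)%N) u j.
Proof.
rewrite /inv2 (exchange_big_dep predT) //= [in RHS]big_mkcond /=.
rewrite (bigD1 i) //= [X in _ (+) X]big1 ?addbF => [|k ki].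
  by rewrite big_mkcond; apply: eq_bigr => j _; rewrite ffunE eqxx andbT.
by rewrite big1 // => j _; rewrite ffunE (negbTE ki) andbF.
Qed.

Lemma inv2_comm i u : inv2 (xone i) u (+) inv2 u (xone i) = par u (+) u i.
Proof.
rewrite inv2_1l inv2_1r /par [in RHS](bigD1 i) //= addbAC addbb addFb.
rewrite [in RHS](bigID (fun j : 'I_m => (j < i)%N)) /=; congr (_ (+) _); apply: eq_bigl => j.
  by rewrite andbC ltn_neqAle -(inj_eq val_inj); case: ltngtP.
by rewrite -leqNgt -(inj_eq val_inj) ltn_neqAle eq_sym.
Qed.

End CliffordSign.

(** The Clifford algebra of the standard form, as the group algebra of the subsets of m under
    symmetric difference, twisted by the sign cocycle [inv2]. Ordered monomials then form a basis by
    construction. *)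
Definition cliff (C : numClosedFieldType) (m : nat) := {ffun {ffun 'I_m -> bool} -> C^o}.

Section Clifford.
Variables (C : numClosedFieldType) (m : nat).
Local Notation I := {ffun 'I_m -> bool}.
Local Notation A := (cliff C m).
HB.instance Definition _ := Vector.on A.

Definition sgn (b : bool) : C := (-1) ^+ b.

Lemma sgnD b c : sgn (b (+) c) = sgn b * sgn c. Proof. by rewrite /sgn signr_addb. Qed.
Lemma sgnK b : sgn b * sgn b = 1. Proof. by rewrite -sgnD addbb. Qed.

Definition cmul (a b : A) : A := [ffun u => \sum_s sgn (inv2 s (xadd u s)) * a s * b (xadd u s)].
Definition cone : A := [ffun u => (u == xnul m)%:R].

Lemma cmulA : associative cmul.
Proof.
move=> a b c; apply/ffunP => u; rewrite !ffunE.
under eq_bigr => s _ do rewrite ffunE mulr_sumr.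
under [RHS]eq_bigr => s _ do rewrite ffunE mulr_sumr mulr_suml.
rewrite [RHS]exchange_big; apply: eq_bigr => t _ /=.
rewrite [RHS](reindex_inj (@xaddI m t)) /=; apply: eq_bigr => s _.
have -> : xadd (xadd t s) t = s by rewrite xaddC xaddK.
have -> : xadd u (xadd t s) = xadd (xadd u t) s by rewrite xaddA.
have Es : sgn (inv2 t (xadd u t)) * sgn (inv2 s (xadd (xadd u t) s)) =
    sgn (inv2 (xadd t s) (xadd (xadd u t) s)) * sgn (inv2 t s).
  rewrite -!sgnD; congr sgn; rewrite !(inv2Dl, inv2Dr).
  by do ![case: (inv2 _ _)].
transitivity (sgn (inv2 t (xadd u t)) * sgn (inv2 s (xadd (xadd u t) s)) *
    (a t * b s * c (xadd (xadd u t) s)) : C); first by ring.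
by rewrite Es; ring.
Qed.

Lemma cmul1 : left_id cone cmul.
Proof.
move=> a; apply/ffunP => u; rewrite ffunE (bigD1 (xnul m)) //= big1 => [|s /negbTE s0].
  by rewrite xadd0 inv20l ffunE eqxx /sgn expr0 !mul1r addr0.
by rewrite ffunE s0 mulr0 mul0r.
Qed.

Lemma cmulr1 : right_id cone cmul.
Proof.
move=> a; apply/ffunP => u; rewrite ffunE (bigD1 u) //= big1 => [|s /negbTE s0].
  by rewrite xaddss inv20r ffunE eqxx /sgn expr0 mul1r mulr1 addr0.
by rewrite ffunE xadd_eq xadd0 s0 mulr0.
Qed.

Lemma cmulDl : left_distributive cmul +%R.
Proof.
move=> a b c; apply/ffunP => u; rewrite !ffunE -big_split; apply: eq_bigr => s _ /=.
by rewrite ffunE mulrDr mulrDl.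
Qed.

Lemma cmulDr : right_distributive cmul +%R.
Proof.
move=> a b c; apply/ffunP => u; rewrite !ffunE -big_split; apply: eq_bigr => s _ /=.
by rewrite ffunE mulrDr.
Qed.

Lemma cone_neq0 : cone != 0.
Proof. by apply/eqP => /ffunP /(_ (xnul m)); rewrite !ffunE eqxx => /eqP; rewrite oner_eq0. Qed.

HB.instance Definition _ := GRing.Zmodule_isNzRing.Build A cmulA cmul1 cmulr1 cmulDl cmulDr cone_neq0.

Lemma cmulZl (k : C) (a b : A) : k *: (a * b) = (k *: a) * b.
Proof.
apply/ffunP => u; rewrite !ffunE /GRing.scale /= mulr_sumr; apply: eq_bigr => s _.
by rewrite ffunE /GRing.scale /=; ring.
Qed.

HB.instance Definition _ := GRing.Lmodule_isLalgebra.Build C A cmulZl.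

Lemma cmulZr (k : C) (a b : A) : k *: (a * b) = a * (k *: b).
Proof.
apply/ffunP => u; rewrite !ffunE /GRing.scale /= mulr_sumr; apply: eq_bigr => s _.
by rewrite ffunE /GRing.scale /=; ring.
Qed.

HB.instance Definition _ := GRing.Lalgebra_isAlgebra.Build C A cmulZr.
HB.instance Definition _ := Algebra_isFalgebra.Build C A.

Definition mon (s : I) : A := [ffun u => (u == s)%:R].

Lemma mon_mul s t : mon s * mon t = sgn (inv2 s t) *: mon (xadd s t).
Proof.
apply/ffunP => u; rewrite !ffunE (bigD1 s) //= big1 => [|v /negbTE vs]; last by rewrite ffunE vs mulr0 mul0r.
rewrite !ffunE eqxx mulr1 addr0 /GRing.scale /= xaddC xadd_eq.
by case: eqP => [->|_]; rewrite ?mulr0 // xaddK.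
Qed.

Lemma mon0 : mon (xnul m) = 1. Proof. by []. Qed.

Lemma mon_span (a : A) : a = \sum_s a s *: mon s.
Proof.
apply/ffunP => u; rewrite sum_ffunE (bigD1 u) //= !ffunE eqxx big1 ?addr0 => [|s su].
  by rewrite /GRing.scale /= mulr1.
by rewrite !ffunE eq_sym (negbTE su) /GRing.scale /= mulr0.
Qed.

Lemma cliff_ind (P : A -> Prop) : P 0 -> (forall a b, P a -> P b -> P (a + b)) ->
  (forall k s, P (k *: mon s)) -> forall a, P a.
Proof. by move=> P0 PD PM a; rewrite (mon_span a); apply: (big_ind P) => // s _; apply: PM. Qed.

Lemma linear_ext (W : lmodType C) (f h : A -> W) : linear f -> linear h ->
  (forall s, f (mon s) = h (mon s)) -> f =1 h.
Proof.
move=> lf lh E; have f0 (F : A -> W) : linear F -> F 0 = 0.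
  by move=> lF; have := lF (-1) 0 0; rewrite scaler0 addr0 scaleN1r addNr.
have fD (F : A -> W) : linear F -> forall a b, F (a + b) = F a + F b.
  by move=> lF a b; have := lF 1 a b; rewrite !scale1r.
have fZ (F : A -> W) : linear F -> forall k a, F (k *: a) = k *: F a.
  by move=> lF k a; have := lF k a 0; rewrite !addr0 (f0 _ lF) addr0.
elim/cliff_ind => [|a b Ea Eb|k s]; first by rewrite !f0.
  by rewrite !fD // Ea Eb.
by rewrite !fZ // E.
Qed.

(** The coefficient of 1, which is a normalised trace. *)
Definition ctr (a : A) : C := a (xnul m).

Lemma ctr1 : ctr 1 = 1. Proof. by rewrite /ctr ffunE eqxx. Qed.

Lemma ctrC a b : ctr (a * b) = ctr (b * a).
Proof.
rewrite /ctr !ffunE; apply: eq_bigr => s _; rewrite !xadd0l; ring.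
Qed.

Lemma ctrD a b : ctr (a + b) = ctr a + ctr b. Proof. by rewrite /ctr ffunE. Qed.
Lemma ctrZ k a : ctr (k *: a) = k * ctr a. Proof. by rewrite /ctr ffunE. Qed.

(** [alpha] is the parity automorphism, whose fixed points are the even elements; [crev] is the
    anti-automorphism that reverses products of vectors, and gives the inverse on products of unit
    vectors. *)
Definition alpha (a : A) : A := [ffun s => sgn (par s) * a s].
Definition crev (a : A) : A := [ffun s => sgn (inv2 s s) * a s].

Lemma alpha_linear : linear alpha.
Proof. by move=> k a b; apply/ffunP => s; rewrite !ffunE /GRing.scale /=; ring. Qed.

Lemma crev_linear : linear crev.
Proof. by move=> k a b; apply/ffunP => s; rewrite !ffunE /GRing.scale /=; ring. Qed.

Lemma alpha_mon s : alpha (mon s) = sgn (par s) *: mon s.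
Proof. by apply/ffunP => u; rewrite !ffunE /GRing.scale /=; case: eqP => [->|_]; rewrite ?mulr0. Qed.

Lemma crev_mon s : crev (mon s) = sgn (inv2 s s) *: mon s.
Proof. by apply/ffunP => u; rewrite !ffunE /GRing.scale /=; case: eqP => [->|_]; rewrite ?mulr0. Qed.

Lemma bilinear_ext (W : lmodType C) (f h : A -> A -> W) :
  (forall a, linear (f a)) -> (forall a, linear (f^~ a)) ->
  (forall a, linear (h a)) -> (forall a, linear (h^~ a)) ->
  (forall s t, f (mon s) (mon t) = h (mon s) (mon t)) -> forall a b, f a b = h a b.
Proof.
move=> fl fr hl hr E a b; have := @linear_ext W (f^~ b) (h^~ b) (fr b) (hr b); apply=> s.
by apply: (@linear_ext W (f (mon s)) (h (mon s))).
Qed.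

Lemma mul_linr (a : A) : linear (fun b => a * b).
Proof. by move=> k b c; rewrite mulrDr scalerAr. Qed.

Lemma mul_linl (a : A) : linear (fun b => b * a).
Proof. by move=> k b c; rewrite mulrDl scalerAl. Qed.

Lemma alphaM a b : alpha (a * b) = alpha a * alpha b.
Proof.
apply: (@bilinear_ext _ (fun a b => alpha (a * b)) (fun a b => alpha a * alpha b)).
- by move=> c k u v; rewrite mul_linr alpha_linear.
- by move=> c k u v; rewrite mul_linl alpha_linear.
- by move=> c k u v; rewrite alpha_linear mul_linr.
- by move=> c k u v; rewrite alpha_linear mul_linl.
move=> s t; have lZ k u : alpha (k *: u) = k *: alpha u.
  by apply/ffunP => v; rewrite !ffunE /GRing.scale /=; ring.
rewrite mon_mul lZ !alpha_mon parD -scalerAl -scalerAr mon_mul !scalerA sgnD; congr (_ *: _); ring.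
Qed.

Lemma crevZ k u : crev (k *: u) = k *: crev u.
Proof. by apply/ffunP => v; rewrite !ffunE /GRing.scale /=; ring. Qed.

Lemma crevM a b : crev (a * b) = crev b * crev a.
Proof.
apply: (@bilinear_ext _ (fun a b => crev (a * b)) (fun a b => crev b * crev a)).
- by move=> c k u v; rewrite mul_linr crev_linear.
- by move=> c k u v; rewrite mul_linl crev_linear.
- by move=> c k u v; rewrite crev_linear mul_linl.
- by move=> c k u v; rewrite crev_linear mul_linr.
move=> s t.
rewrite mon_mul crevZ !crev_mon -scalerAl -scalerAr mon_mul !scalerA (xaddC t s) -!sgnD.
by congr (sgn _ *: _); rewrite !(inv2Dl, inv2Dr); do ![case: (inv2 _ _)].
Qed.

Lemma crev1 : crev 1 = 1. Proof. by rewrite -mon0 crev_mon inv20l /sgn expr0 scale1r. Qed.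
Lemma ctr_crev a : ctr (crev a) = ctr a.
Proof. by rewrite /ctr ffunE inv20l /sgn expr0 mul1r. Qed.
Lemma alpha1 : alpha 1 = 1.
Proof. by rewrite -mon0 alpha_mon /par big1 /sgn ?expr0 ?scale1r // => i _; rewrite ffunE. Qed.

Definition cinv (s : I) : A := sgn (inv2 s s) *: mon s.

Lemma mon_cinv s : mon s * cinv s = 1.
Proof. by rewrite /cinv -scalerAr mon_mul scalerA sgnK xaddss scale1r. Qed.

Lemma sum_sgn (f : I -> bool) s0 : f s0 -> (forall s, f (xadd s0 s) = ~~ f s) -> \sum_s sgn (f s) = 0.
Proof.
move=> fs0 E; set S := \sum_s _; suff : S = - S.
  by move/eqP; rewrite -subr_eq0 opprK -mulr2n mulrn_eq0 => /eqP.
rewrite {1}/S (reindex_inj (@xaddI m s0)) /= -sumrN; apply: eq_bigr => s _.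
by rewrite E /sgn; case: (f s); rewrite /= ?expr0 ?expr1 ?opprK.
Qed.

(** For a nonempty even monomial t and i in t, adding i to s changes the sign with which e_s and e_t
    commute, so the conjugates of e_t cancel in pairs. *)
Lemma average_even a : alpha a = a -> \sum_s mon s * a * cinv s = (2 ^+ m * ctr a) *: 1.
Proof.
move=> ea.
have E s t : mon s * mon t * cinv s = sgn (inv2 s t (+) inv2 t s) *: mon t.
  rewrite /cinv -scalerAr mon_mul -scalerAl mon_mul !scalerA -!sgnD.
  rewrite (xaddC s t) -xaddA xaddss xadd0; congr (sgn _ *: _).
  by rewrite inv2Dl; do ![case: (inv2 _ _)].
have E' s t k : mon s * (k *: mon t) * cinv s = k *: (sgn (inv2 s t (+) inv2 t s) *: mon t).
  by rewrite -[mon s * _]scalerAr -[_ *: _ * _]scalerAl E.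
have as0 t : par t -> a t = 0.
  move=> pt; move/ffunP: ea => /(_ t); rewrite ffunE pt /sgn expr1 mulN1r => /eqP.
  by rewrite eq_sym -subr_eq0 opprK -mulr2n mulrn_eq0 => /eqP.
rewrite {1}[a]mon_span; under eq_bigr => s _ do rewrite mulr_sumr mulr_suml.
rewrite exchange_big /= (bigD1 (xnul m)) //= [X in _ + X]big1 ?addr0.
  under eq_bigr => s _ do rewrite E' inv20l inv20r /sgn expr0 scale1r.
  by rewrite sumr_const card_ffun card_bool card_ord -scaler_nat scalerA natrX.
move=> t t0; under eq_bigr => s _ do rewrite E'.
rewrite -scaler_sumr -scaler_suml; have [pt|pt] := boolP (par t); first by rewrite as0 // scale0r.
have [i ti] : exists i, t i.
  apply/existsP; apply: contraR t0; rewrite negb_exists => /forallP H; apply/eqP/ffunP => i.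
  by rewrite ffunE; apply/negbTE/H.
rewrite (@sum_sgn (fun s => inv2 s t (+) inv2 t s) (xone i)) ?scale0r ?scaler0 //.
  by rewrite inv2_comm (negbTE pt) ti.
move=> s; rewrite inv2Dl inv2Dr; have := inv2_comm i t; rewrite (negbTE pt) ti.
by do ![case: (inv2 _ _)].
Qed.

(** The tensor formed by the sum of all pairs e_s, e_s^-1 is the same after multiplying its first
    factor by x on the left or its second one by x on the right. *)
Lemma pair_shift (W : lmodType C) (F : A -> A -> W) : (forall a, linear (F a)) -> (forall a, linear (F^~ a)) ->
  forall x, \sum_s F (x * mon s) (cinv s) = \sum_s F (mon s) (cinv s * x).
Proof.
move=> Fl Fr x.
have fZ (f : A -> W) : linear f -> forall k a, f (k *: a) = k *: f a.
  move=> lF k a; have := lF k a 0; have f0 : f 0 = 0.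
    by have := lF (-1) 0 0; rewrite scaler0 addr0 scaleN1r addNr.
  by rewrite !addr0 f0 addr0.
apply: (@linear_ext _ (fun x => \sum_s F (x * mon s) (cinv s)) (fun x => \sum_s F (mon s) (cinv s * x))).
- move=> k u v; rewrite scaler_sumr -big_split; apply: eq_bigr => s _ /=.
  by rewrite mul_linl Fr.
- move=> k u v; rewrite scaler_sumr -big_split; apply: eq_bigr => s _ /=.
  by rewrite mul_linr Fl.
move=> u; rewrite [RHS](reindex_inj (@xaddI m u)) /=; apply: eq_bigr => s _.
rewrite mon_mul (fZ _ (Fr _)) /cinv -!scalerAl mon_mul scalerA [in RHS](xaddC u s) -xaddA xaddss xadd0.
rewrite !(fZ _ (Fl _)) !scalerA (xaddC s u); congr (_ *: _); rewrite -!sgnD; congr sgn.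
by rewrite !(inv2Dl, inv2Dr); do ![case: (inv2 _ _)].
Qed.

End Clifford.

Section OrderedMonomials.
Variables (C : numClosedFieldType) (B : algType C).

Section NatIndexed.
Variables (x : nat -> B).
Definition nmon (s : nat -> bool) k : B := \prod_(i < k) (if s i then x i else 1).
Definition ninv (s u : nat -> bool) k := \big[addb/false]_(i < k) (s i && \big[addb/false]_(j < i) u j).

Lemma nmonS s k : nmon s k.+1 = nmon s k * (if s k then x k else 1).
Proof. by rewrite /nmon big_ord_recr. Qed.

Variable K : nat.
Hypothesis x_sq : forall i, (i < K)%N -> x i * x i = 1.
Hypothesis x_anti : forall i j, (i < j < K)%N -> x j * x i = - (x i * x j).

Lemma nmon_anti s k l : (l <= k < K)%N ->
  x k * nmon s l = (sgn C (\big[addb/false]_(j < l) s j)) *: (nmon s l * x k).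
Proof.
move=> /andP[+ kK]; elim: l => [|l IH] lk; first by rewrite /nmon !big_ord0 /sgn expr0 scale1r mul1r mulr1.
rewrite nmonS big_ord_recr /= mulrA IH ?(ltnW lk) // sgnD -scalerAl -!mulrA -[RHS]scalerA; congr (_ *: _).
case: (s l); rewrite /sgn ?mulr1 ?expr0 ?scale1r ?mul1r // expr1 scaleN1r (@x_anti l k) ?lk //.
by rewrite mulrN.
Qed.

Lemma nmon_mul s u k : (k <= K)%N ->
  nmon s k * nmon u k = sgn C (ninv s u k) *: nmon (fun i => s i (+) u i) k.
Proof.
elim: k => [|k IH] kK; first by rewrite /nmon /ninv !big_ord0 mulr1 /sgn expr0 scale1r.
rewrite !nmonS /ninv big_ord_recr /= -/(ninv s u k) sgnD.
have -> : nmon s k * (if s k then x k else 1) * (nmon u k * (if u k then x k else 1)) =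
    nmon s k * ((if s k then x k else 1) * nmon u k) * (if u k then x k else 1) by rewrite !mulrA.
have -> : (if s k then x k else 1) * nmon u k =
    sgn C (s k && \big[addb/false]_(j < k) u j) *: (nmon u k * (if s k then x k else 1)).
  case: (s k) => /=; first by rewrite nmon_anti // leqnn.
  by rewrite /sgn expr0 scale1r mul1r mulr1.
rewrite -scalerAr -scalerAl !mulrA IH ?(ltnW kK) // -!scalerAl scalerA -mulrA mulrC.
congr (_ *: (_ * _)).
by case: (s k); case: (u k); rewrite /= ?mulr1 ?mul1r // x_sq.
Qed.

End NatIndexed.

Variables (m : nat) (x : 'I_m -> B).
Hypothesis x_sq : forall i, x i * x i = 1.
Hypothesis x_anti : forall i j, i != j -> x i * x j = - (x j * x i).
Local Notation I := {ffun 'I_m -> bool}.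

Definition omon (s : I) : B := \prod_(i < m) (if s i then x i else 1).

Let xn (i : nat) := oapp x 1 (insub i).
Let sn (s : I) (i : nat) := oapp s false (insub i).

Lemma omon_nat s : omon s = nmon xn (sn s) m.
Proof. by apply: eq_bigr => i _; rewrite /xn /sn valK. Qed.

Lemma ninv_inv2 (s u : I) : ninv (sn s) (sn u) m = inv2 s u.
Proof.
apply: eq_bigr => i _; rewrite /sn valK /=; case: (s i) => /=; last by rewrite big1.
rewrite (big_ord_widen m (fun j => oapp u false (insub j))) 1?ltnW //.
by apply: eq_bigr => j _; rewrite valK.
Qed.

Lemma omon_mul s u : omon s * omon u = sgn C (inv2 s u) *: omon (xadd s u).
Proof.
rewrite !omon_nat (@nmon_mul xn m) // ?ninv_inv2.
- congr (_ *: _); apply: eq_bigr => i _; rewrite /sn !valK /= ffunE.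
  by [].
- by move=> i im; rewrite /xn insubT /= x_sq.
move=> i j /andP[ij jm]; rewrite /xn !insubT ?(ltn_trans ij) // => im /=.
by rewrite x_anti // -val_eqE /= gtn_eqF.
Qed.

Lemma omon0 : omon (xnul m) = 1.
Proof. by rewrite /omon big1 // => i _; rewrite ffunE. Qed.

End OrderedMonomials.

Section Vectors.
Variables (C : numClosedFieldType) (m : nat).
Local Notation A := (cliff C m).
Local Notation V := 'cV[C]_m.
Local Notation mon := (@mon C m).

Definition gen (i : 'I_m) : A := mon (xone i).
Definition cvec (v : V) : A := \sum_i v i 0 *: gen i.

Lemma cvec_linear : linear cvec.
Proof.
move=> a u v; rewrite /cvec scaler_sumr -big_split; apply: eq_bigr => i _ /=.
by rewrite !mxE scalerDl scalerA.
Qed.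

Lemma cvecD u v : cvec (u + v) = cvec u + cvec v.
Proof. by have := cvec_linear 1 u v; rewrite !scale1r. Qed.
Lemma cvec0 : cvec 0 = 0. Proof. by rewrite /cvec big1 // => i _; rewrite mxE scale0r. Qed.
Lemma cvecZ a u : cvec (a *: u) = a *: cvec u.
Proof. by have := cvec_linear a u 0; rewrite cvec0 !addr0. Qed.
Lemma cvecN u : cvec (- u) = - cvec u. Proof. by rewrite -scaleN1r cvecZ scaleN1r. Qed.
Lemma cvec_sum (J : Type) (r : seq J) (F : J -> V) : cvec (\sum_(i <- r) F i) = \sum_(i <- r) cvec (F i).
Proof. by elim/big_rec2: _ => [|i a b _ <-]; rewrite ?cvec0 ?cvecD. Qed.

Lemma cvec_delta i : cvec (delta_mx i 0) = gen i.
Proof.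
rewrite /cvec (bigD1 i) //= mxE !eqxx scale1r big1 ?addr0 // => j /negbTE ji.
by rewrite mxE ji scale0r.
Qed.

Lemma inv2_xone (i : 'I_m) : inv2 (xone i) (xone i) = false.
Proof. by rewrite inv2_1l big1 // => j ji; rewrite ffunE -val_eqE /= ltn_eqF. Qed.

Lemma par_xone (i : 'I_m) : par (xone i) = true.
Proof.
by rewrite /par (bigD1 i) //= big1 ?ffunE ?eqxx // => j /negbTE ji; rewrite ffunE.
Qed.

Lemma gen_sq i : gen i * gen i = 1.
Proof. by rewrite mon_mul inv2_xone /sgn expr0 scale1r xaddss. Qed.

Lemma gen_anti i j : i != j -> gen i * gen j = - (gen j * gen i).
Proof.
move=> ij; rewrite !mon_mul (xaddC (xone j)) -scaleNr; congr (_ *: _).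
have := inv2_comm i (xone j); rewrite par_xone ffunE (negbTE ij).
by do ![case: (inv2 _ _)]; rewrite // /sgn ?expr0 ?expr1 ?opprK.
Qed.

Lemma cvec_anti u v : cvec u * cvec v + cvec v * cvec u = (2 * dotc u v) *: 1.
Proof.
rewrite /cvec !mulr_suml.
under eq_bigr do rewrite mulr_sumr; under [X in _ + X]eq_bigr do rewrite mulr_sumr.
rewrite [X in _ + X]exchange_big -big_split /= /dotc mulr_sumr scaler_suml; apply: eq_bigr => i _.
rewrite -big_split (bigD1 i) //= big1 ?addr0 => [|j ji].
  by rewrite -!scalerAr -!scalerAl gen_sq !scalerA -scalerDl; congr (_ *: _); ring.
rewrite -!scalerAr -!scalerAl gen_anti 1?eq_sym // !scalerN !scalerA mulrC.
by rewrite addNr.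
Qed.

Lemma cvec_sq v : cvec v * cvec v = dotc v v *: 1.
Proof.
apply/(@scalerI _ _ (2 : C)); first by rewrite pnatr_eq0.
by rewrite scalerA -cvec_anti scaler_nat mulr2n.
Qed.

Lemma alpha_cvec v : alpha (cvec v) = - cvec v.
Proof.
apply/ffunP => s; rewrite !ffunE !sum_ffunE mulr_sumr -sumrN; apply: eq_bigr => i _.
rewrite !ffunE /GRing.scale /=; case: eqP => [->|_]; last by rewrite !mulr0 oppr0.
by rewrite par_xone /sgn expr1 mulN1r.
Qed.

Lemma crev_cvec v : crev (cvec v) = cvec v.
Proof.
apply/ffunP => s; rewrite !ffunE !sum_ffunE mulr_sumr; apply: eq_bigr => i _.
rewrite !ffunE /GRing.scale /=; case: eqP => [->|_]; last by rewrite !mulr0.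
by rewrite inv2_xone /sgn expr0 mul1r.
Qed.

Lemma mon_omon s : mon s = omon gen s.
Proof.
pose rs k : {ffun 'I_m -> bool} := [ffun i : 'I_m => (i < k)%N && s i].
pose sn (i : nat) := oapp s false (insub i).
pose xn (i : nat) := oapp gen 1 (insub i).
have E k : (k <= m)%N -> nmon xn sn k = mon (rs k).
  elim: k => [|k IH] km.
    by rewrite /nmon big_ord0 -mon0; congr mon; apply/ffunP => i; rewrite !ffunE.
  rewrite nmonS IH ?(ltnW km) // /sn /xn insubT /=.
  case sk: (s (Ordinal km)); last first.
    rewrite mulr1; congr mon; apply/ffunP => i; rewrite !ffunE ltnS [in RHS]leq_eqVlt.
    case: eqP => //= ik; have -> : i = Ordinal km by apply: val_inj.
    by rewrite sk /= ltnn.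
  rewrite /gen mon_mul inv2_1r big1 => [|j /= kj]; last by rewrite ffunE ltnNge ltnW.
  rewrite /sgn expr0 scale1r; congr mon; apply/ffunP => i; rewrite !ffunE ltnS [in RHS]leq_eqVlt.
  rewrite -(inj_eq val_inj) /=; case: eqP => [ik|_] /=; last by rewrite addbF.
  have -> : i = Ordinal km by apply: val_inj.
  by rewrite sk /= ltnn.
rewrite (_ : omon gen s = nmon xn sn m).
  by rewrite E //; congr mon; apply/ffunP => i; rewrite ffunE ltn_ord.
by apply: eq_bigr => i _; rewrite /xn /sn valK.
Qed.

Lemma comm_mon (a : A) : (forall v, a * cvec v = cvec v * a) -> forall s, a * mon s = mon s * a.
Proof.
move=> ca s; rewrite mon_omon /omon; elim/big_rec: _ => [|i b _ IH]; first by rewrite mulr1 mul1r.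
rewrite mulrA; case: (s i); rewrite ?mulr1 ?mul1r //.
by rewrite -cvec_delta ca -!mulrA IH.
Qed.

Lemma even_central (a : A) : alpha a = a -> (forall v, a * cvec v = cvec v * a) -> a = ctr a *: 1.
Proof.
move=> ea ca; apply/(@scalerI _ _ (2 ^+ m : C)); first by rewrite expf_neq0 // pnatr_eq0.
rewrite scalerA -average_even // (eq_bigr (fun=> a)).
  by rewrite sumr_const card_ffun card_bool card_ord -scaler_nat natrX.
by move=> s _; rewrite -(comm_mon ca) -mulrA mon_cinv mulr1.
Qed.

Definition comm (a b : A) := a * b - b * a.

(** The difference is even and commutes with all vectors, hence is a scalar, which the trace
    detects. Identities between elements of spin type are thus checked on vectors. *)
Lemma even_eq (a b : A) : alpha a = a -> alpha b = b -> ctr a = ctr b ->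
  (forall v, comm a (cvec v) = comm b (cvec v)) -> a = b.
Proof.
move=> ea eb tab cab; apply/eqP; rewrite -subr_eq0 (@even_central (a - b)).
- by rewrite -scaleN1r ctrD ctrZ tab mulN1r subrr scale0r.
- by rewrite -scaleN1r addrC alpha_linear ea eb.
move=> v; rewrite mulrBl mulrBr; have /eqP := cab v; rewrite /comm subr_eq => /eqP ->.
move: (b * cvec v) (cvec v * b) (cvec v * a) => x y z.
by rewrite addrAC (addrAC x) subrr add0r addrC.
Qed.

Lemma alphaB (a b : A) : alpha (a - b) = alpha a - alpha b.
Proof. by rewrite -scaleN1r addrC alpha_linear scaleN1r addrC. Qed.
Lemma alphaZ k (a : A) : alpha (k *: a) = k *: alpha a.
Proof. by apply/ffunP => v; rewrite !ffunE /GRing.scale /=; ring. Qed.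
Lemma crevD (a b : A) : crev (a + b) = crev a + crev b.
Proof. by have := crev_linear 1 a b; rewrite !scale1r. Qed.
Lemma crevN (a : A) : crev (- a) = - crev a.
Proof. by rewrite -scaleN1r crevZ scaleN1r. Qed.
Lemma alpha_sum (J : Type) (r : seq J) (F : J -> A) : alpha (\sum_(i <- r) F i) = \sum_(i <- r) alpha (F i).
Proof.
elim/big_rec2: _ => [|i a b _ <-]; first by apply/ffunP => s; rewrite !ffunE mulr0.
by have := alpha_linear 1 (F i) b; rewrite !scale1r.
Qed.
Lemma ctr_sum (J : Type) (r : seq J) (F : J -> A) : ctr (\sum_(i <- r) F i) = \sum_(i <- r) ctr (F i).
Proof. by elim/big_rec2: _ => [|i a b _ <-]; rewrite ?ctrD // /ctr ffunE. Qed.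
Lemma ctrN (a : A) : ctr (- a) = - ctr a. Proof. by rewrite -scaleN1r ctrZ mulN1r. Qed.

Lemma comm_jacobi a b c : comm (comm a b) c = comm a (comm b c) - comm b (comm a c).
Proof.
rewrite /comm !mulrBl !mulrBr !mulrA.
move: (a * b * c) (b * a * c) (c * a * b) (c * b * a) (a * c * b) (b * c * a) => x1 x2 x3 x4 x5 x6.
apply/ffunP => i; rewrite !ffunE; ring.
Qed.

(* The differential of the spin cover, from skew matrices to the Clifford algebra. *)
Definition Phi (D : 'M[C]_m) : A := 4^-1 *: \sum_i \sum_j D i j *: (gen i * gen j).

Lemma Phi_dual (U W : 'M[C]_m) :
  \sum_k cvec (col k U) * cvec (col k W) = \sum_i \sum_j (U *m W^T) i j *: (gen i * gen j).
Proof.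
under eq_bigr => k _ do rewrite /cvec mulr_suml.
rewrite exchange_big; apply: eq_bigr => i _ /=.
under eq_bigr => k _ do rewrite mulr_sumr.
rewrite exchange_big; apply: eq_bigr => j _ /=.
rewrite mxE scaler_suml; apply: eq_bigr => k _.
by rewrite -scalerAr -scalerAl scalerA !mxE mulrC.
Qed.

(** The defining sum may be taken over any pair of dual bases; weight bases will be used. *)
Lemma PhiE (U W D : 'M[C]_m) : U *m W^T = 1%:M ->
  Phi D = 4^-1 *: \sum_k cvec (col k (D *m U)) * cvec (col k W).
Proof. by move=> UW; rewrite Phi_dual -mulmxA UW mulmx1. Qed.

Lemma Phi_linear : linear Phi.
Proof.
move=> k D E; rewrite /Phi scalerA mulrC -scalerA -scalerDr; congr (_ *: _).
rewrite scaler_sumr -big_split; apply: eq_bigr => i _; rewrite scaler_sumr -big_split.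
by apply: eq_bigr => j _; rewrite /= !mxE scalerDl scalerA.
Qed.

Lemma alpha_Phi D : alpha (Phi D) = Phi D.
Proof.
rewrite alphaZ alpha_sum; congr (_ *: _); apply: eq_bigr => i _; rewrite alpha_sum.
by apply: eq_bigr => j _; rewrite alphaZ alphaM -!cvec_delta !alpha_cvec mulrNN.
Qed.

Lemma ctr_gen i j : ctr (gen i * gen j) = (i == j)%:R.
Proof.
have [<-|ij] := eqVneq i j; first by rewrite gen_sq ctr1.
have := ctrC (gen i) (gen j); rewrite [in LHS](gen_anti ij) ctrN => /eqP.
rewrite -subr_eq0 -opprD oppr_eq0 -mulr2n mulrn_eq0 /= => /eqP E.
by rewrite (gen_anti ij) ctrN E oppr0.
Qed.

Lemma ctr_Phi D : ctr (Phi D) = 4^-1 * \tr D.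
Proof.
rewrite ctrZ ctr_sum; congr (_ * _); apply: eq_bigr => i _; rewrite ctr_sum (bigD1 i) //=.
rewrite ctrZ ctr_gen eqxx mulr1 big1 ?addr0 // => j ji.
by rewrite ctrZ ctr_gen eq_sym (negbTE ji) mulr0.
Qed.

Lemma dotc_trmx (D : 'M[C]_m) u v : dotc (D *m u) v = dotc u (D^T *m v).
Proof. by rewrite !dotc_mx trmx_mul mulmxA. Qed.

Lemma dotc_delta i (v : V) : dotc (delta_mx i 0) v = v i 0.
Proof.
rewrite /dotc (bigD1 i) //= mxE !eqxx mul1r big1 ?addr0 // => j /negbTE ji.
by rewrite mxE ji mul0r.
Qed.

Lemma comm_Phi D v : D^T = - D -> comm (Phi D) (cvec v) = cvec (D *m v).
Proof.
move=> skD; have id1 : (1%:M : 'M[C]_m) *m 1%:M^T = 1%:M by rewrite trmx1 mulmx1.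
rewrite (PhiE D id1) mulmx1 /comm -scalerAl -scalerAr -scalerBr mulr_suml mulr_sumr -sumrB.
have E k : cvec (col k D) * cvec (col k 1%:M) * cvec v - cvec v * (cvec (col k D) * cvec (col k 1%:M)) =
    (2 * v k 0) *: cvec (col k D) + (2 * (D *m v) k 0) *: gen k.
  have c1 : col k 1%:M = delta_mx k 0 :> V by rewrite colE mul1mx.
  rewrite c1 cvec_delta.
  have E1 : gen k * cvec v = (2 * v k 0) *: 1 - cvec v * gen k.
    by rewrite -[gen k]cvec_delta -[v k 0]dotc_delta -cvec_anti addrK.
  have E2 : cvec v * cvec (col k D) = (- (2 * (D *m v) k 0)) *: 1 - cvec (col k D) * cvec v.
    have <- : 2 * dotc v (col k D) = - (2 * (D *m v) k 0).
      rewrite colE dotcC dotc_trmx skD mulNmx -scaleN1r dotcZr dotc_delta; ring.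
    by rewrite -cvec_anti addrK.
  rewrite -mulrA E1 mulrA E2 mulrBr mulrBl -scalerAr mulr1 -scalerAl mul1r scaleNr -!mulrA.
  by rewrite opprB opprK addrA subrK.
under eq_bigr do rewrite E; rewrite big_split /=.
have -> : \sum_k (2 * v k 0) *: cvec (col k D) = 2 *: cvec (D *m v).
  under eq_bigr => k _ do rewrite -scalerA -cvecZ.
  rewrite -scaler_sumr -cvec_sum; congr (_ *: cvec _); apply/matrixP => i j.
  by rewrite summxE mxE; apply: eq_bigr => k _; rewrite !mxE mulrC (ord1 j).
have -> : \sum_k (2 * (D *m v) k 0) *: gen k = 2 *: cvec (D *m v).
  by rewrite /cvec scaler_sumr; apply: eq_bigr => k _; rewrite scalerA.
by rewrite -scalerDl scalerA (_ : 4^-1 * _ = 1) ?scale1r //; field.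
Qed.

Lemma skew_trace (D : 'M[C]_m) : D^T = - D -> \tr D = 0.
Proof.
move=> skD; have := mxtrace_tr D; rewrite skD linearN /= => /eqP.
by rewrite eq_sym -subr_eq0 opprK -mulr2n mulrn_eq0 => /eqP.
Qed.

Lemma Phi_bra D E : D^T = - D -> E^T = - E -> Phi (D *m E - E *m D) = comm (Phi D) (Phi E).
Proof.
move=> skD skE; have skDE : (D *m E - E *m D)^T = - (D *m E - E *m D).
  by rewrite linearB /= !trmx_mul skD skE !mulmxN !mulNmx !opprK opprB.
apply: even_eq.
- exact: alpha_Phi.
- by rewrite /comm alphaB !alphaM !alpha_Phi.
- by rewrite ctr_Phi skew_trace // mulr0 /comm ctrD ctrN (ctrC (Phi E)) subrr.
move=> v; rewrite comm_Phi // comm_jacobi !comm_Phi // -cvecN -cvecD.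
by rewrite mulmxBl !mulmxA.
Qed.

Lemma crev_Phi D : D^T = - D -> crev (Phi D) = - Phi D.
Proof.
move=> skD; apply: even_eq.
- apply/ffunP => s; have /ffunP /(_ s) := alpha_Phi D; rewrite !ffunE => E.
  by rewrite mulrCA E.
- by rewrite -scaleN1r alphaZ alpha_Phi.
- by rewrite ctr_crev ctrN ctr_Phi skew_trace // mulr0 oppr0.
move=> v; have := congr1 (@crev C m) (comm_Phi v skD); rewrite crev_cvec -(comm_Phi v skD) /comm.
rewrite crevD crevN !crevM crev_cvec => E; rewrite mulNr mulrN opprK.
by rewrite -[LHS]opprB E opprB addrC.
Qed.

End Vectors.

Section Universal.
Variables (C : numClosedFieldType) (m : nat).
Local Notation A := (cliff C m).

Lemma cliff_universal (B : algType C) (x : 'I_m -> B) : (forall i, x i * x i = 1) ->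
  (forall i j, i != j -> x i * x j = - (x j * x i)) ->
  exists F : {lrmorphism A -> B}, forall s, F (mon C s) = omon x s.
Proof.
move=> xsq xanti; pose F (a : A) : B := \sum_s (a s : C) *: omon x s.
have lF : linear F.
  move=> k a b; rewrite /F scaler_sumr -big_split; apply: eq_bigr => s _ /=.
  by rewrite !ffunE scalerDl scalerA.
have Fm s : F (mon C s) = omon x s.
  rewrite /F (bigD1 s) //= ffunE eqxx scale1r big1 ?addr0 // => u /negbTE us.
  by rewrite ffunE us scale0r.
have FM : {morph F : a b / a * b}.
  apply: (@bilinear_ext _ _ B (fun a b => F (a * b)) (fun a b => F a * F b)).
  - by move=> c k u v; rewrite mul_linr lF.
  - by move=> c k u v; rewrite mul_linl lF.
  - by move=> c k u v; rewrite lF mulrDr scalerAr.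
  - by move=> c k u v; rewrite lF mulrDl scalerAl.
  move=> s u; rewrite mon_mul !Fm omon_mul //.
  by have := lF (sgn C (inv2 s u)) (mon C (xadd s u)) 0; rewrite !addr0 Fm /F [X in _ + X]big1 ?addr0 // => i _; rewrite ffunE scale0r.
have F1 : F 1 = 1 by rewrite -mon0 Fm omon0.
pose F' : {lrmorphism A -> B} := HB.pack F (GRing.isLinear.Build C A B *:%R F lF)
  (GRing.isMonoidMorphism.Build A B F (F1, FM)).
by exists F'.
Qed.

Lemma clifford_gens (B : algType C) (f : 'cV[C]_m -> B) : linear f ->
  (forall v, f v * f v = dotc v v *: 1) ->
  (forall i, f (delta_mx i 0) * f (delta_mx i 0) = 1) /\
  (forall i j, i != j -> f (delta_mx i 0) * f (delta_mx j 0) = - (f (delta_mx j 0) * f (delta_mx i 0))).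
Proof.
move=> lf fq; split=> [i|i j ij]; first by rewrite fq dotc_delta mxE !eqxx scale1r.
have fD u v : f (u + v) = f u + f v by have := lf 1 u v; rewrite !scale1r.
have := fq (delta_mx i 0 + delta_mx j 0); rewrite fD mulrDl !mulrDr !fq.
rewrite dotcDl !dotcDr !dotc_delta !mxE !eqxx (negbTE ij) (eq_sym j) (negbTE ij) /= addr0 add0r scalerDl.
rewrite addrA -[X in X + _ = _]addrA -[RHS]addr0 addrAC => /addrI /eqP.
by rewrite addr_eq0 => /eqP.
Qed.

Lemma cvec_morph (B : algType C) (F : {lrmorphism A -> B}) (f : 'cV[C]_m -> B) : linear f ->
  (forall i, F (gen C i) = f (delta_mx i 0)) -> forall v, F (cvec v) = f v.
Proof.
move=> lf E v; have fD u w : f (u + w) = f u + f w by have := lf 1 u w; rewrite !scale1r.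
have f0 : f 0 = 0 by have := lf (-1) 0 0; rewrite scaler0 addr0 scaleN1r addNr.
have fZ k w : f (k *: w) = k *: f w by have := lf k w 0; rewrite f0 !addr0.
have -> : f v = \sum_i v i 0 *: f (delta_mx i 0).
  rewrite {1}(_ : v = \sum_i v i 0 *: delta_mx i 0).
    by elim/big_rec2: _ => [|i a b _ <-]; rewrite ?f0 // fD fZ.
  apply/matrixP => i j; rewrite summxE (bigD1 i) //= !mxE !eqxx (ord1 j) mulr1 big1 ?addr0 // => k /negbTE ki.
  by rewrite !mxE eq_sym ki mulr0.
by rewrite /cvec linear_sum; apply: eq_bigr => i _; rewrite linearZZ; congr (_ *: _); apply: E.
Qed.

Lemma cliff_morph_eq (B : algType C) (F F' : {lrmorphism A -> B}) :
  (forall v, F (cvec v) = F' (cvec v)) -> F =1 F'.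
Proof.
move=> E; apply: (@linear_ext _ _ B F F'); [exact: linearP|exact: linearP|move=> s].
by rewrite mon_omon /omon !rmorph_prod; apply: eq_bigr => i _; case: (s i); rewrite ?rmorph1 // -cvec_delta; apply: E.
Qed.

End Universal.

Section SymmetricForms.
Variable C : numClosedFieldType.

Lemma sym_form_zero m (B : 'M[C]_m) : B^T = B -> (forall v : 'cV[C]_m, (v^T *m B *m v) 0 0 = 0) -> B = 0.
Proof.
move=> sB q0; have E (u v : 'cV[C]_m) : (u^T *m B *m v) 0 0 = 0.
  have := q0 (u + v).
  have -> : (u + v)^T = u^T + v^T by apply/matrixP => i j; rewrite !mxE.
  rewrite !mulmxDl !mulmxDr [X in X = 0]mxE [X in X + _]mxE [X in _ + X]mxE !q0 add0r addr0.
  have -> : (v^T *m B *m u) 0 0 = (u^T *m B *m v) 0 0.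
    by rewrite -[v^T *m B *m u]trmxK mxE !trmx_mul trmxK sB mulmxA.
  by move/eqP; rewrite -mulr2n mulrn_eq0 => /eqP.
apply/matrixP => i j; have := E (delta_mx i 0) (delta_mx j 0).
by rewrite trmx_delta -rowE -colE !mxE.
Qed.

(** A vector on which the form is nonzero is made the first basis vector; completing the square
    leaves a form in one variable less. *)
Lemma sym_square m (B : 'M[C]_m) : B^T = B -> exists O : 'M[C]_m, B = O^T *m O.
Proof.
elim: m B => [|m IH] B sB; first by exists B; apply/matrixP => -[].
have [B0|] := pselect (forall v : 'cV[C]_m.+1, (v^T *m B *m v) 0 0 = 0).
  by exists 0; rewrite trmx0 mulmx0; apply: sym_form_zero.
move/existsNP => [v /eqP qv].
(* As v has rank 1, the first column of this invertible matrix is proportional to v. *)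
pose S := col_ebase v; have Su : S \in unitmx by apply: col_ebase_unit.
suff [O EO] : exists O : 'M[C]_(1 + m), S^T *m B *m S = O^T *m O.
  exists (O *m invmx S); rewrite trmx_mul -!mulmxA (mulmxA O^T) -EO !mulmxA.
  rewrite mulmxK // -trmx_mul mulmxV // trmx1 mul1mx.
  by [].
have rv : \rank v = 1%N.
  apply/eqP; rewrite eqn_leq rank_leq_col lt0n mxrank_eq0; apply: contra qv => /eqP ->.
  by rewrite mulmx0 mxE.
pose W : 'M[C]_(1 + m) := S^T *m B *m S.
have sW : W^T = W by rewrite /W !trmx_mul trmxK sB mulmxA.
have {qv} a0 : W 0 0 != 0.
  have Ev : v = row_ebase v 0 0 *: (S *m delta_mx 0 0).
    rewrite -{1}[v]mulmx_ebase rv -/S {1}[row_ebase v]mx11_scalar mul_mx_scalar; congr (_ *: (_ *m _)).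
    by apply/matrixP => i j; rewrite !mxE (ord1 j) -val_eqE /= andbT; case: (i : nat).
  apply: contra qv => /eqP q0; have {Ev} [c Ev] : exists c, v = c *: (S *m delta_mx 0 0).
    by exists (row_ebase v 0 0).
  have -> : v^T = c *: (S *m delta_mx 0 0)^T by rewrite {1}Ev; apply/matrixP => i j; rewrite !mxE.
  rewrite {1}Ev -!scalemxAl -scalemxAr scalerA mxE.
  rewrite trmx_mul !mulmxA -(mulmxA _ S^T) -(mulmxA _ _ S) -/W trmx_delta.
  rewrite -rowE -colE; move: q0; move: (W) => W' q0.
  by rewrite !mxE q0 mulr0.
rewrite -/W; move: W a0 sW => W a0 sW; pose a := W 0 0; pose ra := sqrtC a.
have ra0 : ra != 0 by rewrite sqrtC_eq0.
have raa : ra * ra = a by rewrite -expr2 sqrtCK.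
pose b := ursubmx W; pose D := drsubmx W.
have EW : W = block_mx a%:M b b^T D.
  rewrite -[LHS]submxK; congr (block_mx _ _ _ _); last by rewrite /b trmx_ursub sW.
  rewrite [LHS]mx11_scalar; congr (_%:M); rewrite !mxE; congr (W _ _); exact: val_inj.
have sD : D^T = D by rewrite /D trmx_drsub sW.
have [|O' EO'] := IH (D - a^-1 *: (b^T *m b)).
  by rewrite linearB /= sD linearZ /= trmx_mul trmxK.
exists (block_mx ra%:M (ra^-1 *: b) 0 O').
rewrite EW tr_block_mx mulmx_block !(trmx0, mulmx0, mul0mx, addr0) tr_scalar_mx -EO'.
have -> : (ra^-1 *: b)^T = ra^-1 *: b^T by apply/matrixP => i j; rewrite !mxE.
rewrite -scalar_mxM raa mul_scalar_mx scalerA divff // scale1r mul_mx_scalar scalerA divff // scale1r.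
by rewrite -scalemxAl -scalemxAr scalerA -invfM raa addrC subrK.
Qed.

End SymmetricForms.

(** * Products of reflections and their Clifford lifts *)

Section Reflections.
Variables (C : numClosedFieldType) (m : nat).
Local Notation V := 'cV[C]_m.

Definition rfl (u : V) : 'M[C]_m := 1%:M - 2 *: (u *m u^T).

Lemma rfl_act u v : rfl u *m v = v - (2 * dotc u v) *: u.
Proof.
rewrite mulmxBl mul1mx -scalemxAl -mulmxA; congr (_ - _).
by rewrite [u^T *m v]mx11_scalar -dotc_mx mul_mx_scalar scalerA.
Qed.

Lemma rfl_sq u : dotc u u = 1 -> rfl u *m rfl u = 1%:M.
Proof.
move=> u1; have E (v : V) : rfl u *m (rfl u *m v) = v.
  rewrite !rfl_act -scaleN1r dotcDr !dotcZr u1 scaleN1r -addrA -opprD -scalerDl.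
  by rewrite [X in X *: u](_ : _ = 0) ?scale0r ?subr0 //; ring.
apply/matrixP => i j; have := E (delta_mx j 0).
by rewrite mulmxA -colE => /matrixP /(_ i 0); rewrite !mxE /= andbT.
Qed.

(** A block matrix is factored in two ways, which exchanges the determinants of 1 - 2 u u^T and of
    the scalar 1 - 2 u^T u. *)
Lemma det_rfl u : dotc u u = 1 -> \det (rfl u) = -1.
Proof.
move=> u1; have E1 : block_mx 1%:M u^T (2 *: u) 1%:M =
    block_mx 1%:M 0 (2 *: u) 1%:M *m block_mx 1%:M u^T 0 (rfl u) :> 'M[C]_(1 + m).
  rewrite mulmx_block !(mul1mx, mulmx1, mul0mx, mulmx0, addr0) -scalemxAl /rfl addrC subrK.
  by [].
have E2 : block_mx 1%:M u^T (2 *: u) 1%:M =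
    block_mx (1%:M - u^T *m (2 *: u)) u^T 0 1%:M *m block_mx 1%:M 0 (2 *: u) 1%:M :> 'M[C]_(1 + m).
  by rewrite mulmx_block !(mul1mx, mulmx1, mul0mx, mulmx0, add0r) subrK.
have := congr1 determinant E1; rewrite E2 !det_mulmx !det_ublock !det_lblock !det1 !mul1r !mulr1 => <-.
rewrite det_mx11; have -> : (1%:M - u^T *m (2 *: u)) 0 0 = 1 - 2 * dotc u u.
  by rewrite dotc_mx -scalemxAr !mxE.
rewrite u1; ring.
Qed.

(** The sign is there because conjugation by a unit vector is minus the reflection in it. *)
Definition clift (M : 'M[C]_m) (s : seq V) := [/\ forall u, u \in s -> dotc u u = 1,
  \det M = (-1) ^+ size s &
  forall v, \prod_(u <- s) cvec u * cvec v = (-1) ^+ size s *: (cvec (M *m v) * \prod_(u <- s) cvec u)].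

Lemma clift_cons M s u : dotc u u = 1 -> clift M s -> clift (rfl u *m M) (u :: s).
Proof.
move=> u1 [us dM lM]; split=> [w|/=|v].
- by rewrite inE => /orP[/eqP -> //|]; apply: us.
- by rewrite det_mulmx det_rfl // dM exprS.
rewrite !big_cons /= -mulrA lM -scalerAr mulrA -mulmxA rfl_act exprS mulN1r scaleNr -scalerN; congr (_ *: _).
move: (M *m v) => w; rewrite mulrA -mulNr; congr (_ * _).
rewrite cvecD cvecN cvecZ mulrBl -scalerAl cvec_sq u1 scale1r opprB.
by rewrite -cvec_anti addrK.
Qed.

(** Induction on the number l of basis vectors not yet fixed. The next basis vector w has an image
    u; a reflection in u - w brings u back to w unless this vector is isotropic. The vectors used
    are orthogonal to those already fixed. *)
Lemma fix_orthogonal (M : 'M[C]_m) l : M^T *m M = 1%:M -> (l <= m)%N ->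
  (forall j : 'I_m, (j < m - l)%N -> M *m delta_mx j 0 = delta_mx j 0 :> V) -> exists s, clift M s.
Proof.
elim: l M => [|l IH] M oM lm fM.
  exists [::]; have -> : M = 1%:M.
    apply/matrixP => i j; have := fM j; rewrite subn0 => /(_ (ltn_ord j)).
    by rewrite -colE => /matrixP /(_ i 0); rewrite !mxE /= andbT.
  by split=> // [|v]; rewrite ?det1 // !big_nil mul1mx mul1r mulr1 scale1r.
have iso (N : 'M[C]_m) u v : N^T *m N = 1%:M -> dotc (N *m u) (N *m v) = dotc u v.
  by move=> oN; rewrite !dotc_mx trmx_mul -mulmxA (mulmxA N^T) oN mul1mx.
have rfl_orth u : dotc u u = 1 -> (rfl u)^T *m rfl u = 1%:M.
  move=> u1; rewrite -(rfl_sq u1); congr (_ *m _).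
  by rewrite /rfl linearB /= trmx1 linearZ /= trmx_mul trmxK.
have mulO (N N' : 'M[C]_m) : N^T *m N = 1%:M -> N'^T *m N' = 1%:M -> (N *m N')^T *m (N *m N') = 1%:M.
  by move=> oN oN'; rewrite trmx_mul -mulmxA (mulmxA N^T) oN mul1mx.
have km : (m - l.+1 < m)%N by lia.
pose k := Ordinal km; pose w : V := delta_mx k 0; pose u := M *m w.
have w1 : dotc w w = 1 by rewrite dotc_delta mxE !eqxx.
have u1 : dotc u u = 1 by rewrite iso.
have wj (j : 'I_m) : (j < k)%N -> dotc w (delta_mx j 0) = 0.
  by move=> jk; rewrite dotc_delta mxE -val_eqE /= gtn_eqF.
have uj (j : 'I_m) : (j < k)%N -> dotc u (delta_mx j 0) = 0.
  by move=> jk; rewrite -(fM j) // iso // wj.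
have rfl0 (a v : V) : dotc a v = 0 -> rfl a *m v = v.
  by move=> av; rewrite rfl_act av mulr0 scale0r subr0.
have step (N : 'M[C]_m) : N^T *m N = 1%:M -> N *m u = w ->
    (forall j : 'I_m, (j < k)%N -> N *m delta_mx j 0 = delta_mx j 0 :> V) -> exists s, clift (N *m M) s.
  move=> oN Nu Nj; apply: IH => //; [exact: mulO|lia|] => j jl.
  rewrite -mulmxA; have [jk|kj|jk] := ltngtP j k.
  - by rewrite fM // Nj.
  - by move: kj jl => /=; lia.
  - by have -> : j = k by [apply: val_inj]; exact: Nu.
pose s := dotc (u - w) (u - w).
have [s0|s0] := eqVneq s 0; last first.
  pose a := (sqrtC s)^-1 *: (u - w).
  have a1 : dotc a a = 1.
    rewrite /a dotcZl dotcZr -/s mulrA -invfM -expr2 sqrtCK mulVf //.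
  have au : rfl a *m u = w.
    have e : 2 * dotc (u - w) u = s.
      rewrite /s -scaleN1r !dotcDl !dotcDr !dotcZl !dotcZr w1 u1 (dotcC w u); ring.
    have s0' : sqrtC s != 0 by rewrite sqrtC_eq0.
    rewrite rfl_act /a scalerA dotcZl.
    have -> : 2 * ((sqrtC s)^-1 * dotc (u - w) u) / sqrtC s = 1.
      have -> : 2 * ((sqrtC s)^-1 * dotc (u - w) u) / sqrtC s = (2 * dotc (u - w) u) / (sqrtC s ^+ 2).
        by field.
      by rewrite e sqrtCK divff.
    by rewrite scale1r opprB addrC subrK.
  have [j jk|t ct] := step (rfl a) (rfl_orth _ a1) au.
    apply: rfl0; rewrite /a dotcZl -scaleN1r dotcDl dotcZl uj // wj //; ring.
  exists (a :: t); rewrite -[M]mul1mx -(rfl_sq a1) -mulmxA; exact: clift_cons.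
(* If u - w is isotropic, then u and w have product 1 and this is a unit vector; its reflection
   sends u to -w, and the one in w corrects the sign. *)
pose a := 2^-1 *: (u + w).
have uw : dotc u w = 1.
  have : s = 2 - 2 * dotc u w.
    rewrite /s -scaleN1r !dotcDl !dotcDr !dotcZl !dotcZr w1 u1 (dotcC w u); ring.
  by rewrite s0 => /esym/eqP; rewrite subr_eq0 => /eqP E; apply: (@mulfI _ (2 : C)); rewrite ?pnatr_eq0 // -E mulr1.
have a1 : dotc a a = 1.
  rewrite /a dotcZl dotcZr dotcDl !dotcDr w1 u1 (dotcC w) uw; by field.
have au : rfl a *m u = - w.
  rewrite rfl_act /a dotcZl dotcDl u1 (dotcC w) uw scalerA.
  rewrite (_ : 2 * _ * _ = 1); last by field.
  by rewrite scale1r opprD addrA subrr sub0r.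
have ww : rfl w *m rfl a *m u = w.
  rewrite -mulmxA au mulmxN rfl_act w1 mulr1 scaler_nat mulr2n opprB addrK.
  by [].
have [|j jk|t ct] := step (rfl w *m rfl a) _ ww.
- by apply: mulO; [apply: rfl_orth w1|apply: rfl_orth a1].
- rewrite -mulmxA (rfl0 a) ?rfl0 ?wj // /a dotcZl dotcDl uj // wj //; ring.
exists (a :: w :: t); rewrite -[M]mul1mx -(rfl_sq a1) -mulmxA; apply: clift_cons => //.
rewrite -[rfl a *m M]mul1mx -(rfl_sq w1) -!mulmxA; apply: clift_cons => //.
by rewrite mulmxA.
Qed.

Lemma cartan_dieudonne (M : 'M[C]_m) : M^T *m M = 1%:M -> exists s, clift M s.
Proof. by move=> oM; apply: (@fix_orthogonal M m) => // j; rewrite subnn. Qed.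

End Reflections.

(** * The spin lift *)

Section Extremal.
Variables (C : numClosedFieldType) (m : nat).
Local Notation A := (cliff C m).
Variables (U : 'M[C]_m) (kap : 'I_m -> int).
Hypothesis Uu : U \in unitmx.
Let W := (invmx U)^T.
Hypothesis U_iso : forall k l, (U^T *m U) k l != 0 -> kap k = - kap l.
Hypothesis W_iso : forall k l, (W^T *m W) k l != 0 -> kap k = - kap l.

Definition evc k : A := cvec (col k U).
Definition fvc k : A := cvec (col k W).

Lemma UW : U *m W^T = 1%:M. Proof. by rewrite /W trmxK mulmxV. Qed.
Lemma WU : W *m U^T = 1%:M. Proof. by rewrite -[W]trmxK -trmx_mul UW trmx1. Qed.

Lemma dotc_col (X Y : 'M[C]_m) k l : dotc (col k X) (col l Y) = (X^T *m Y) k l.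
Proof. by rewrite mxE; apply: eq_bigr => i _; rewrite !mxE. Qed.

Lemma evc_anti k l : kap k + kap l != 0 -> evc k * evc l = - (evc l * evc k).
Proof.
move=> kl; apply/eqP; rewrite -addr_eq0 /evc cvec_anti dotc_col.
have [->|/U_iso E] := eqVneq ((U^T *m U) k l) 0; first by rewrite mulr0 scale0r.
by rewrite E addNr eqxx in kl.
Qed.

Lemma fvc_anti k l : kap k + kap l != 0 -> fvc k * fvc l = - (fvc l * fvc k).
Proof.
move=> kl; apply/eqP; rewrite -addr_eq0 /fvc cvec_anti dotc_col.
have [->|/W_iso E] := eqVneq ((W^T *m W) k l) 0; first by rewrite mulr0 scale0r.
by rewrite E addNr eqxx in kl.
Qed.

Lemma ef_anti k l : evc k * fvc l + fvc l * evc k = (2 * (k == l)%:R) *: 1.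
Proof.
by rewrite /evc /fvc cvec_anti dotc_col -[U^T *m W]trmxK trmx_mul trmxK /W trmxK mulVmx // trmx1 mxE.
Qed.

Lemma evc_sq k : kap k != 0 -> evc k * evc k = 0.
Proof.
move=> k0; have /evc_anti : kap k + kap k != 0 by rewrite -mulr2n mulrn_eq0.
by move/eqP; rewrite -addr_eq0 -mulr2n -scaler_nat scaler_eq0 pnatr_eq0 => /eqP.
Qed.

Lemma fvc_sq k : kap k != 0 -> fvc k * fvc k = 0.
Proof.
move=> k0; have /fvc_anti : kap k + kap k != 0 by rewrite -mulr2n mulrn_eq0.
by move/eqP; rewrite -addr_eq0 -mulr2n -scaler_nat scaler_eq0 pnatr_eq0 => /eqP.
Qed.

(** For nonzero [kap k] the two vectors square to 0 and have anticommutator 2, so each factor is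
    twice an idempotent, killed by [fvc k] on the left and by [evc k] on the right. With this
    scaling the trace is 1. *)
Definition extr (s : seq 'I_m) : A := \prod_(k <- s) (fvc k * evc k).

Lemma extr_comm s l : 0 < kap l -> {in s, forall k, 0 < kap k} -> l \notin s ->
  evc l * extr s = extr s * evc l /\ fvc l * extr s = extr s * fvc l.
Proof.
move=> l0; elim: s => [|k s IH] ps; first by rewrite /extr big_nil !mul1r !mulr1.
rewrite inE negb_or => /andP[lk ls]; rewrite /extr big_cons -/(extr s).
have [|E1 E2] := IH _ ls; first by move=> j js; apply: ps; rewrite inE js orbT.
have k0 : 0 < kap k by apply: ps; rewrite mem_head.
have kl : kap l + kap k != 0 by rewrite gt_eqF // addr_gt0.
have ef i j : i != j -> evc i * fvc j = - (fvc j * evc i).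
  by move=> /negbTE ij; apply/eqP; rewrite -addr_eq0 ef_anti ij mulr0 scale0r.
have ee := evc_anti kl; have ff := fvc_anti kl.
split.
  rewrite -[RHS]mulrA -E1 !mulrA; congr (_ * _).
  by rewrite ef // mulNr -!mulrA ee mulrN opprK.
rewrite -[RHS]mulrA -E2 !mulrA; congr (_ * _).
have fe : evc k * fvc l = - (fvc l * evc k) by rewrite ef // eq_sym.
by rewrite ff mulNr -!mulrA fe mulrN.
Qed.

Lemma extr_evc s k : uniq s -> {in s, forall k, 0 < kap k} -> k \in s -> extr s * evc k = 0.
Proof.
elim: s => // a s IH /= /andP[as0 us] ps; rewrite inE /extr big_cons -/(extr s).
have ps' : {in s, forall k, 0 < kap k} by move=> j js; apply: ps; rewrite inE js orbT.
have a0 : 0 < kap a by apply: ps; rewrite mem_head.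
case: eqP => [->|_] /= ks; last by rewrite -mulrA IH // mulr0.
by rewrite -!mulrA -(extr_comm a0 ps' as0).1 (mulrA (evc a)) evc_sq ?gt_eqF // mul0r mulr0.
Qed.

Lemma fvc_extr s k : uniq s -> {in s, forall k, 0 < kap k} -> k \in s -> fvc k * extr s = 0.
Proof.
elim: s => // a s IH /= /andP[as0 us] ps ks; rewrite /extr big_cons -/(extr s).
have ps' : {in s, forall k, 0 < kap k} by move=> j js; apply: ps; rewrite inE js orbT.
have a0 : 0 < kap a by apply: ps; rewrite mem_head.
have k0 : 0 < kap k by apply: ps.
have [ka|ka] := eqVneq k a; first by rewrite ka !mulrA fvc_sq ?gt_eqF // !mul0r.
have ks' : k \in s by move: ks; rewrite inE (negbTE ka).
have pa : {in [:: a], forall k, 0 < kap k} by move=> j; rewrite inE => /eqP ->.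
have na : k \notin [:: a] by rewrite inE.
have [_ E] := extr_comm k0 pa na.
move: E; rewrite /extr big_seq1 => E.
by rewrite mulrA E -!mulrA -/(extr s) IH // !mulr0.
Qed.

Lemma ctr_extr s : uniq s -> {in s, forall k, 0 < kap k} -> ctr (extr s) = 1.
Proof.
elim: s => [|a s IH] /=; first by rewrite /extr big_nil ctr1.
move=> /andP[as0 us] ps; rewrite /extr big_cons -/(extr s).
have ps' : {in s, forall k, 0 < kap k} by move=> j js; apply: ps; rewrite inE js orbT.
have a0 : 0 < kap a by apply: ps; rewrite mem_head.
have [E1 E2] := extr_comm a0 ps' as0.
have H : ctr (fvc a * evc a * extr s) = ctr (evc a * fvc a * extr s).
  by rewrite -!mulrA ctrC -mulrA -E2.
have : ctr ((evc a * fvc a + fvc a * evc a) * extr s) = 2.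
  by rewrite ef_anti eqxx mulr1 -scalerAl mul1r ctrZ IH // mulr1.
rewrite mulrDl ctrD -H -mulr2n => E.
apply: (@mulfI _ (2 : C)); first by rewrite pnatr_eq0.
by rewrite mulr1 mulr_natl.
Qed.

Lemma alpha_extr s : alpha (extr s) = extr s.
Proof.
rewrite /extr; elim/big_rec: _ => [|k a _ IH]; first exact: alpha1.
by rewrite !alphaM !alpha_cvec mulrNN IH.
Qed.

Definition possel := [seq k <- enum 'I_m | 0 < kap k].
(* Up to a scalar, the projector on the lowest weight line of the spin module. *)
Definition Ext : A := extr possel.

Lemma possel_uniq : uniq possel. Proof. by rewrite filter_uniq // enum_uniq. Qed.
Lemma possel_pos : {in possel, forall k, 0 < kap k}.
Proof. by move=> k; rewrite mem_filter => /andP[]. Qed.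

Lemma Ext_e k : 0 < kap k -> Ext * evc k = 0.
Proof.
move=> k0; apply: extr_evc; [exact: possel_uniq|exact: possel_pos|].
by rewrite mem_filter k0 mem_enum.
Qed.

Lemma f_Ext k : 0 < kap k -> fvc k * Ext = 0.
Proof.
move=> k0; apply: fvc_extr; [exact: possel_uniq|exact: possel_pos|].
by rewrite mem_filter k0 mem_enum.
Qed.

Lemma cvec_col_mul (X Y : 'M[C]_m) k : cvec (col k (X *m Y)) = \sum_i Y i k *: cvec (col i X).
Proof.
rewrite -[RHS](_ : cvec (\sum_i Y i k *: col i X) = _); last first.
  by rewrite cvec_sum; apply: eq_bigr => i _; rewrite cvecZ.
congr cvec; apply/matrixP => i j; rewrite !mxE summxE; apply: eq_bigr => l _.
by rewrite !mxE mulrC.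
Qed.

Lemma Ext_f k : kap k < 0 -> Ext * fvc k = 0.
Proof.
move=> k0; rewrite /fvc -[W in col _ W]mul1mx -UW -mulmxA cvec_col_mul mulr_sumr big1 // => l _.
rewrite -scalerAr; have [->|/W_iso E] := eqVneq ((W^T *m W) l k) 0; first by rewrite scale0r.
by rewrite -/(evc l) Ext_e ?scaler0 // E oppr_gt0.
Qed.

Lemma e_Ext k : kap k < 0 -> evc k * Ext = 0.
Proof.
move=> k0; rewrite /evc -[U in col _ U]mul1mx -WU -mulmxA cvec_col_mul mulr_suml big1 // => l _.
rewrite -scalerAl; have [->|/U_iso E] := eqVneq ((U^T *m U) l k) 0; first by rewrite scale0r.
by rewrite -/(fvc l) f_Ext ?scaler0 // E oppr_gt0.
Qed.

Lemma Phi_ef (D X : 'M[C]_m) : D *m U = U *m X ->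
  Phi D = 4^-1 *: \sum_k \sum_i X i k *: (evc i * fvc k).
Proof.
move=> DU; rewrite (PhiE D UW) DU; congr (_ *: _); apply: eq_bigr => k _.
by rewrite cvec_col_mul mulr_suml; apply: eq_bigr => i _; rewrite -scalerAl.
Qed.

(** For a matrix that raises heights, every off-diagonal term has a factor that [Ext] kills,
    possibly after exchanging the two vectors. A diagonal term survives only for negative [kap k],
    where [evc k * fvc k] acts as 2. *)
Lemma Ext_Phi (D X : 'M[C]_m) : D *m U = U *m X ->
  (forall i k, X i k != 0 -> kap k < kap i \/ i = k) -> (forall k, kap k = 0 -> X k k = 0) ->
  Ext * Phi D = (2^-1 * \sum_(k | kap k < 0) X k k) *: Ext.
Proof.
move=> DU up d0; rewrite (Phi_ef DU) -scalerAr mulr_sumr.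
have E k : Ext * (\sum_i X i k *: (evc i * fvc k)) = (if kap k < 0 then 2 * X k k else 0) *: Ext.
  rewrite mulr_sumr (bigD1 k) //= [X in _ + X]big1 ?addr0.
    rewrite -scalerAr mulrA; case: ltgtP => k0.
    - have -> : Ext * evc k * fvc k = 2 *: Ext.
        have := ef_anti k k; rewrite eqxx mulr1 => /eqP; rewrite eq_sym -subr_eq => /eqP E.
        by rewrite -mulrA -E mulrBr mulrA Ext_f // mul0r subr0 -scalerAr mulr1.
      by rewrite scalerA mulrC.
    - by rewrite Ext_e // mul0r scaler0 scale0r.
    - by rewrite d0 // !scale0r.
  move=> i ik; have [->|/up [ki|E]] := eqVneq (X i k) 0; [by rewrite scale0r mulr0| |by rewrite E eqxx in ik].
  rewrite -scalerAr; have [i0|i0] := ltP 0 (kap i); first by rewrite mulrA Ext_e // mul0r scaler0.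
  have k0 : kap k < 0 by apply: lt_le_trans i0.
  have -> : evc i * fvc k = - (fvc k * evc i).
    by apply/eqP; rewrite -addr_eq0 ef_anti (negbTE ik) mulr0 scale0r.
  by rewrite mulrN mulrA Ext_f // mul0r oppr0 scaler0.
under eq_bigr do rewrite E.
rewrite -scaler_suml scalerA -big_mkcond -mulr_sumr mulrA; congr (_ * _ *: _).
by field.
Qed.

Lemma Phi_Ext (D X : 'M[C]_m) : D *m U = U *m X -> (forall i k, X i k != 0 -> kap i < kap k) ->
  Phi D * Ext = 0.
Proof.
move=> DU lo; rewrite (Phi_ef DU) -scalerAl mulr_suml big1 ?scaler0 // => k _.
rewrite mulr_suml big1 // => i _; have [->|/lo ik] := eqVneq (X i k) 0; first by rewrite scale0r mul0r.
rewrite -scalerAl -mulrA; have [k0|k0] := ltP 0 (kap k); first by rewrite f_Ext // mulr0 scaler0.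
have i0 : kap i < 0 by apply: lt_le_trans k0.
have -> : evc i * (fvc k * Ext) = - (fvc k * (evc i * Ext)).
  have ne : (i == k) = false by apply/eqP => E; rewrite E ltxx in ik.
  by rewrite !mulrA -mulNr; congr (_ * _); apply/eqP; rewrite -addr_eq0 ef_anti ne mulr0 scale0r.
by rewrite e_Ext // mulr0 oppr0 scaler0.
Qed.

End Extremal.

Section DetDerivative.
Variables (C : numClosedFieldType).

(** The determinant of 1 + e X is the characteristic polynomial of -X with its coefficients
    reversed. *)
Lemma det_add1_coef k (X : 'M[C]_k) (p : {poly C}) : (forall e, \det (1%:M + e *: X) = p.[e]) -> p`_1 = \tr X.
Proof.
case: k X => [|k] X Hp.
  have -> : p = 1.
    by apply: poly_eq_nz => e _; rewrite -Hp hornerC det_mx00.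
  by rewrite coef1 /mxtrace big_ord0.
pose q := char_poly (- X).
have sq : size q = k.+2 by rewrite size_char_poly.
pose p' := \poly_(l < k.+2) q`_(k.+1 - l).
have -> : p = p'.
  apply: poly_eq_nz => e e0; rewrite -Hp horner_poly.
  have -> : 1%:M + e *: X = e *: (e^-1%:M - - X).
    by rewrite opprK scalerDr scale_scalar_mx divff.
  rewrite detZ.
  have -> : \det (e^-1%:M - - X) = q.[e^-1].
    rewrite /q /char_poly -[RHS]/(horner_eval e^-1 _) -det_map_mx; congr (\det _).
    apply/matrixP => i j; rewrite !mxE /= /horner_eval hornerD hornerN hornerC.
    by case: eqP => _; rewrite ?mulr1n ?mulr0n ?hornerX ?horner0.
  rewrite horner_coef sq mulr_sumr [RHS](reindex_inj rev_ord_inj) /=; apply: eq_bigr => l _.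
  have lk : (l <= k.+1)%N by rewrite -ltnS.
  rewrite subSS subKn // mulrCA; congr (_ * _).
  by rewrite -{1}(subnK lk) exprD -mulrA exprVn divff ?mulr1 // expf_neq0.
rewrite coef_poly /= subn1 /=; have := @char_poly_trace C k.+1 (- X) isT; rewrite /= -/q => ->.
by rewrite linearN /= opprK.
Qed.

Lemma der_det_mulr n k (F : 'M[C]_n -> 'M[C]_k) x v (X : 'M[C]_k) :
  (forall e : C, F (x + e *: v) = F x *m (1%:M + e *: X)) ->
  der (fun y => \det (F y) : C^o) x v = \tr X * \det (F x).
Proof.
move=> H; have [p Hp] := det_line 1%:M X; rewrite -(det_add1_coef Hp).
rewrite (@der_poly _ _ _ _ _ (\det (F x) *: p)) => [|e]; first by rewrite coefZ mulrC.
by rewrite H det_mulmx Hp hornerZ.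
Qed.

Lemma der_det_mull n k (F : 'M[C]_n -> 'M[C]_k) x v (X : 'M[C]_k) :
  (forall e : C, F (x + e *: v) = (1%:M + e *: X) *m F x) ->
  der (fun y => \det (F y) : C^o) x v = \tr X * \det (F x).
Proof.
move=> H; have [p Hp] := det_line 1%:M X; rewrite -(det_add1_coef Hp).
rewrite (@der_poly _ _ _ _ _ (\det (F x) *: p)) => [|e]; first by rewrite coefZ mulrC.
by rewrite H det_mulmx Hp hornerZ mulrC.
Qed.

End DetDerivative.

(** If Z preserves the range of P, the corner of a product with Z is the product of the corners;
    hence derivatives of minors reduce to traces. *)
Lemma compress_r (C : numClosedFieldType) n (P x Z : 'M[C]_n) : P *m P = P -> Z *m P = P *m Z *m P ->
  (P *m x *m P + (1%:M - P)) *m (P *m Z *m P) = P *m (x *m Z) *m P.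
Proof.
move=> PP HZ; have PZ : P *m (Z *m P) = Z *m P by rewrite mulmxA -HZ.
by rewrite -HZ mulmxDl mulmxBl mul1mx PZ subrr addr0 -!mulmxA PZ.
Qed.

Lemma compress_l (C : numClosedFieldType) n (P x Y : 'M[C]_n) : P *m P = P -> P *m Y = P *m Y *m P ->
  (P *m Y *m P) *m (P *m x *m P + (1%:M - P)) = P *m (Y *m x) *m P.
Proof.
move=> PP HY; rewrite mulmxDr mulmxBr mulmx1 -(mulmxA (P *m Y) P P) PP subrr addr0.
by rewrite !mulmxA -(mulmxA (P *m Y) P P) PP -HY.
Qed.

(** * Semi-invariant functions from principal minors *)

Section Semi.
Variables (C : numClosedFieldType) (n : nat) (g t : {vspace 'M[C]_n}) (r : nat) (H : 'I_r -> 'M[C]_n).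
Local Notation d := (\dim g).
Variables (Q : 'M[C]_n) (w : 'I_n -> 'I_r -> int) (A : 'M[C]_d) (al : 'I_d -> 'I_r -> int).
Hypothesis CA : cartan t H Q w A al.
Hypothesis w_gen : forall j, exists m : 'I_n -> nat, forall l, \sum_i (m i)%:Z * w i l = (l == j)%:R.
Variable nu : 'I_r -> int.
Local Notation ht u := (dot u nu).

(* [nu] fixes the signs of the roots.  On the big cell N^- T N^+ such a function
   is the character [u] of T. *)
Definition semi (a : 'M[C]_n -> C^o) (u : 'I_r -> int) :=
  [/\ polymap a, a 1%:M = 1, forall x z, DX (hh H x) a z = dotc (wt C u) x * a z,
      forall i, 0 < ht (al i) -> forall z, DX (ebas A i) a z = 0
    & forall i, ht (al i) < 0 -> forall z, LX (ebas A i) a z = 0].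

Lemma wtD u v : wt C (fun j => u j + v j) = wt C u + wt C v :> 'cV[C]_r.
Proof. by apply/matrixP => i j; rewrite !mxE rmorphD. Qed.

Lemma semi_mul a b u v : semi a u -> semi b v -> semi (fun x => a x * b x) (fun j => u j + v j).
Proof.
move=> [pa a1 aH ap an] [pb b1 bH bp bn]; split.
- exact: polymap_mul.
- by rewrite a1 b1 mulr1.
- move=> x z; rewrite /DX der_mul // -/(DX _ a z) -/(DX _ b z) aH bH wtD dotcDl; ring.
- by move=> i hi z; rewrite /DX der_mul // -/(DX _ a z) -/(DX _ b z) ap // bp // mul0r mulr0 addr0.
- by move=> i hi z; rewrite /LX der_mul // -/(LX _ a z) -/(LX _ b z) an // bn // mul0r mulr0 addr0.
Qed.

Lemma semi1 : semi (fun=> 1) (fun=> 0).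
Proof.
split; rewrite /DX /LX => *; rewrite ?der_cst //; first exact: PolyCst.
by rewrite /dotc big1 ?mul0r // => j _; rewrite mxE mul0r.
Qed.

Section Minor.
Variable U : pred 'I_n.
Hypothesis U_up : forall k l, U k -> ht (w k) < ht (w l) -> U l.
Let Dg : 'M[C]_n := diag_mx (\row_i (U i)%:R).
Let cj (x : 'M[C]_n) := invmx Q *m x *m Q.
Let F (x : 'M[C]_n) := Dg *m cj x *m Dg + (1%:M - Dg).
(** The principal minor on the weight vectors indexed by [U]; the added complementary projector lets
    it be written as a full determinant. *)
Definition minor (x : 'M[C]_n) : C^o := \det (F x).

Let Dg2 : Dg *m Dg = Dg.
Proof.
rewrite mulmx_diag; congr diag_mx; apply/matrixP => i j; rewrite !mxE.
by case: (U j); rewrite ?mulr1 ?mulr0.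
Qed.

Let Qu := ca_Qu CA.

Let cjM x y : cj (x *m y) = cj x *m cj y.
Proof. by rewrite /cj !mulmxA mulmxK. Qed.

Let cj_lin : linear cj.
Proof. by move=> a u v; rewrite /cj mulmxDr mulmxDl -!(scalemxAr, scalemxAl). Qed.

Lemma minor_poly : polymap minor.
Proof.
apply: polymap_det; apply: PolyAdd; last exact: PolyCst.
by apply: polymap_of_linear => a u v; rewrite cj_lin mulmxDr mulmxDl -!(scalemxAr, scalemxAl).
Qed.

Lemma F_line x v e : F (x + e *: v) = F x + e *: (Dg *m cj v *m Dg).
Proof.
rewrite /F; have -> : cj (x + e *: v) = cj x + e *: cj v by rewrite addrC cj_lin addrC.
by rewrite mulmxDr mulmxDl -!(scalemxAr, scalemxAl) addrAC.
Qed.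

Lemma minor_DX Z x : cj Z *m Dg = Dg *m cj Z *m Dg -> DX Z minor x = \tr (Dg *m cj Z *m Dg) * minor x.
Proof.
move=> HZ; apply: der_det_mulr => e; rewrite F_line mulmxDr mulmx1; congr (_ + _).
by rewrite -scalemxAr cjM /F compress_r.
Qed.

Lemma minor_LX Y x : Dg *m cj Y = Dg *m cj Y *m Dg -> LX Y minor x = \tr (Dg *m cj Y *m Dg) * minor x.
Proof.
move=> HY; apply: der_det_mull => e; rewrite F_line mulmxDl mul1mx; congr (_ + _).
by rewrite -scalemxAl cjM /F compress_l.
Qed.

Let cj_weight i k l : cj (ebas A i) k l != 0 -> ht (w k) = ht (w l) + ht (al i).
Proof.
move=> nz.
have E j : w k j = w l j + al i j.
  have := (ebas_wsp CA i).2 (delta_mx j 0); rewrite hh_delta dotcC dotc_delta mxE => Eb.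
  have cjH : cj (H j) = diag_mx (\row_i (w i j)%:~R) by rewrite /cj -mulmxA (ca_HQ CA) mulKmx.
  have cjB X Y : cj (X - Y) = cj X - cj Y by rewrite -scaleN1r addrC cj_lin scaleN1r addrC.
  have cjZ c X : cj (c *: X) = c *: cj X.
    by have := cj_lin c X 0; rewrite !addr0 => ->; rewrite [cj 0](_ : _ = 0) ?addr0 // /cj mulmx0 mul0mx.
  have := congr1 cj Eb; rewrite cjB cjZ !cjM cjH => /matrixP /(_ k l).
  move: nz; move: (cj (ebas A i)) => Y nz.
  rewrite mul_diag_mx mul_mx_diag !mxE [Y k l * _]mulrC -mulrBl => /(mulIf nz) /eqP.
  by rewrite -rmorphB /= eqr_int subr_eq addrC => /eqP.
by rewrite /dot -big_split; apply: eq_bigr => j _; rewrite E mulrDl.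
Qed.

(** As [U] is closed under passing to greater heights, raising root vectors preserve its span and
    lowering ones preserve the complementary span. Their corners have zero diagonal, hence zero
    trace, while t contributes the sum of the weights in [U]. *)
Lemma minor_semi : semi minor (fun j => \sum_(i | U i) w i j).
Proof.
have cjH x : cj (hh H x) = diag_mx (\row_i dotc (wt C (w i)) x).
  by rewrite (hh_Q CA) /cj !mulmxA mulVmx // mul1mx mulmxKV.
split.
- exact: minor_poly.
- rewrite /minor /F /cj mulmx1 mulVmx // mulmx1 Dg2 addrC subrK det1.
  by [].
- move=> x z; rewrite minor_DX cjH; last by rewrite diag_mxC -!mulmxA [diag_mx _ *m Dg]diag_mxC mulmxA Dg2 diag_mxC.
  congr (_ * _); rewrite !mulmx_diag mxtrace_diag /dotc.
  under [RHS]eq_bigr => j _ do rewrite mxE rmorph_sum mulr_suml.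
  rewrite exchange_big /= [RHS]big_mkcond; apply: eq_bigr => i _; rewrite !mxE.
  case: (U i); last by rewrite mulr0.
  by rewrite mul1r mulr1; apply: eq_bigr => j _; rewrite mxE.
- move=> i hi z; rewrite minor_DX; last first.
    apply/matrixP => k l; move: (@cj_weight i k l); move: (cj (ebas A i)) => Y cjw; rewrite mul_mx_diag mul_diag_mx mul_mx_diag !mxE.
    have [->|/cjw E] := eqVneq (Y k l) 0; first by rewrite mulr0 !mul0r.
    case Ul: (U l); last by rewrite !mulr0.
    by rewrite (U_up Ul) ?mul1r // E ltrDl.
  rewrite (_ : \tr _ = 0) ?mul0r //; apply: big1 => k _; move: (@cj_weight i k k); move: (cj (ebas A i)) => Y cjw; rewrite mul_mx_diag mul_diag_mx !mxE.
  have [->|/cjw E] := eqVneq (Y k k) 0; first by rewrite mulr0 mul0r.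
  by move: hi; rewrite -(ltrDl (ht (w k))) -E ltxx.
move=> i hi z; rewrite minor_LX; last first.
  apply/matrixP => k l; move: (@cj_weight i k l); move: (cj (ebas A i)) => Y cjw; rewrite mul_mx_diag !mul_diag_mx !mxE.
  have [->|/cjw E] := eqVneq (Y k l) 0; first by rewrite mulr0 !mul0r.
  case Uk: (U k); last by rewrite !mul0r.
  by rewrite (U_up Uk) ?mulr1 // E gtrDl.
rewrite (_ : \tr _ = 0) ?mul0r //; apply: big1 => k _; move: (@cj_weight i k k); move: (cj (ebas A i)) => Y cjw; rewrite mul_mx_diag mul_diag_mx !mxE.
have [->|/cjw E] := eqVneq (Y k k) 0; first by rewrite mulr0 mul0r.
by move: hi; rewrite -(gtrDl (ht (w k))) -E ltxx.
Qed.

End Minor.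

(* The character [u] of T extends to a rational function on the big cell. *)
Definition virtual (u : 'I_r -> int) := exists a b va vb, [/\ semi a va, semi b vb & forall j, va j = vb j + u j].

Lemma virtualD u v : virtual u -> virtual v -> virtual (fun j => u j + v j).
Proof.
move=> [a [b [va [vb [sa sb E]]]]] [a' [b' [va' [vb' [sa' sb' E']]]]].
do 4 eexists; split; [exact: semi_mul sa sa'|exact: semi_mul sb sb'|].
by move=> j; rewrite /= E E'; ring.
Qed.

Lemma virtual0 : virtual (fun=> 0).
Proof. by do 4 eexists; split; [exact: semi1|exact: semi1|move=> j]; rewrite addr0. Qed.

Lemma virtualN u : virtual u -> virtual (fun j => - u j).
Proof.
move=> [a [b [va [vb [sa sb E]]]]]; do 4 eexists; split; [exact: sb|exact: sa|].
by move=> j; rewrite /= E; ring.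
Qed.

Lemma virtual_ext u v : u =1 v -> virtual u -> virtual v.
Proof. by move=> /funext ->. Qed.

Lemma virtual_sum (I : Type) (s : seq I) (u : I -> 'I_r -> int) : (forall i, virtual (u i)) ->
  virtual (fun j => \sum_(i <- s) u i j).
Proof.
move=> vu; elim: s => [|i s IH].
  by apply: virtual_ext virtual0 => j; rewrite big_nil.
by apply: virtual_ext (virtualD (vu i) IH) => j; rewrite big_cons.
Qed.

Lemma virtualM (k : int) u : virtual u -> virtual (fun j => k * u j).
Proof.
have nat_case l v : virtual v -> virtual (fun j => l%:Z * v j).
  move=> vv; have := virtual_sum (iota 0 l) (fun _ : nat => vv); apply: virtual_ext => j.
  by rewrite big_const_seq count_predT size_iota iter_addr_0 mulrC -mulr_natr natz.
move=> vu; case: k => l; first exact: nat_case.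
by apply: virtual_ext (virtualN (nat_case l.+1 _ vu)) => j; rewrite NegzE mulNr.
Qed.

(** The quotient of two minors whose index sets differ by the single index i. *)
Lemma virtual_w i : virtual (w i).
Proof.
pose U1 := [pred k | (ht (w i) < ht (w k)) || (k == i)]; pose U2 := [pred k | ht (w i) < ht (w k)].
have [sa sb] : (forall k l, U1 k -> ht (w k) < ht (w l) -> U1 l) /\ (forall k l, U2 k -> ht (w k) < ht (w l) -> U2 l).
  split=> k l /=; last by move=> ik kl; apply: lt_trans kl.
  by move=> /orP[ik kl|/eqP -> -> //]; rewrite (lt_trans ik kl).
do 4 eexists; split; [exact: minor_semi sa|exact: minor_semi sb|move=> j /=].
by rewrite (bigD1 i) ?eqxx ?orbT //= addrC; congr (_ + _); apply: eq_bigl => k; case: eqP => [->|]; rewrite ?ltxx ?andbF ?orbF ?andbT.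
Qed.

Theorem virtual_all u : virtual u.
Proof.
have vd j : virtual (fun l => (l == j)%:R).
  have [m Hm] := w_gen j; apply: virtual_ext (virtual_sum (index_enum 'I_n) (fun i => virtualM (m i)%:Z (virtual_w i))) => l.
  exact: Hm.
apply: virtual_ext (virtual_sum (index_enum 'I_r) (fun j => virtualM (u j) (vd j))) => l /=.
by rewrite (bigD1 l) //= eqxx mulr1 big1 ?addr0 // => j /negbTE jl; rewrite eq_sym jl mulr0.
Qed.

End Semi.

Section SpinLift.
Variables (C : numClosedFieldType) (m : nat).
Local Notation A := (cliff C m).

Definition spin_of (M : 'M[C]_m) (S : A) :=
  [/\ alpha S = S, S * crev S = 1, crev S * S = 1 & forall v, S * cvec v = cvec (M *m v) * S].

Lemma prod_cvec (s : seq 'cV[C]_m) : (forall u, u \in s -> dotc u u = 1) -> ~~ odd (size s) ->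
  [/\ alpha (\prod_(u <- s) cvec u) = \prod_(u <- s) cvec u :> A,
      \prod_(u <- s) cvec u * crev (\prod_(u <- s) cvec u) = 1 :> A
    & crev (\prod_(u <- s) cvec u) * \prod_(u <- s) cvec u = 1 :> A].
Proof.
move=> us ev; split.
- have -> : forall s' : seq 'cV[C]_m, alpha (\prod_(u <- s') cvec u) = (-1) ^+ size s' *: \prod_(u <- s') cvec u.
    elim=> [|u s' IH]; first by rewrite big_nil alpha1 scale1r.
    by rewrite big_cons alphaM IH alpha_cvec /= exprS mulN1r scaleNr mulNr -scalerAr.
  by rewrite -signr_odd (negbTE ev) scale1r.
- elim: s us {ev} => [|u s IH] us; first by rewrite big_nil crev1 mulr1.
  rewrite big_cons crevM crev_cvec mulrA -[_ * _ * crev _]mulrA IH.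
    by rewrite mulr1 cvec_sq us ?mem_head // scale1r.
  by move=> w ws; apply: us; rewrite inE ws orbT.
elim: s us {ev} => [|u s IH] us; first by rewrite big_nil crev1 mulr1.
rewrite big_cons crevM crev_cvec mulrA -[_ * cvec u * cvec u]mulrA cvec_sq us ?mem_head // scale1r mulr1 IH //.
by move=> w ws; apply: us; rewrite inE ws orbT.
Qed.

Lemma clift_spin (M : 'M[C]_m) s : clift M s -> \det M = 1 ->
  ~~ odd (size s) /\ spin_of M (\prod_(u <- s) cvec u).
Proof.
move=> [us dM lM] d1; have ev : ~~ odd (size s).
  move: dM; rewrite d1 -signr_odd; case: (odd _) => // /eqP.
  by rewrite expr1 -subr_eq0 opprK -mulr2n pnatr_eq0.
split=> //; have [aS Sc cS] := prod_cvec us ev; split=> // v.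
by rewrite lM -signr_odd (negbTE ev) scale1r.
Qed.

Lemma alpha_crev (a : A) : alpha (crev a) = crev (alpha a).
Proof. by apply/ffunP => s; rewrite !ffunE mulrCA. Qed.

End SpinLift.

(** * Automorphisms of the Clifford algebra induced by the representation *)

Section Theta.
Variables (C : numClosedFieldType) (n : nat) (G : set 'M[C]_n) (g : {vspace 'M[C]_n}).
Hypothesis AG : algebraic_lie G g.
Variables (m : nat) (Pi : 'M[C]_n -> 'M[C]_m).
Hypothesis Pi_poly : polymap Pi.
Hypothesis Pi_1 : Pi 1%:M = 1%:M.
Hypothesis Pi_M : forall x y, G x -> G y -> Pi (x *m y) = Pi x *m Pi y.
Hypothesis Pi_orth : forall x, G x -> (Pi x)^T *m Pi x = 1%:M.
Hypothesis Pi_det : forall x, G x -> \det (Pi x) = 1.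
Local Notation A := (cliff C m).
Local Notation dPi := (dPi Pi).
Local Notation PhiL X := (Phi (dPi X)).

Lemma Pi_skew X : X \in g -> (dPi X)^T = - dPi X.
Proof.
move=> gX; apply/eqP; rewrite -addr_eq0; apply/eqP.
have := @dPi_skew _ _ _ _ AG _ _ Pi_poly Pi_1 1%:M X; rewrite mulmx1 mul1mx; apply=> // x Gx.
by rewrite mulmx1 Pi_orth.
Qed.

Lemma LX_Pi Y x : Y \in g -> G x -> LX Y Pi x = dPi Y *m Pi x.
Proof.
move=> gY Gx; have pl : polymap (fun y => Pi (y *m x)) by apply: polymap_mulr.
have lin : linear (fun B : 'M[C]_m => B *m Pi x) by move=> a u v; rewrite mulmxDl -scalemxAl.
have pr : polymap (fun y => Pi y *m Pi x) := polymap_linear lin Pi_poly.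
have := LX_eq (al_M AG) (al_lie AG) pl pr (fun y Gy => Pi_M Gy Gx) gY (al_1 AG).
by rewrite LX_mulr // mul1mx => ->; rewrite /LX mulmx1 (der_linear _ _ lin Pi_poly).
Qed.

Lemma spin_lift x : G x -> exists S, spin_of (Pi x) S.
Proof.
move=> Gx; have [s cs] := cartan_dieudonne (Pi_orth Gx).
by exists (\prod_(u <- s) cvec u); case: (clift_spin cs (Pi_det Gx)).
Qed.

(** Conjugation by any S above Pi(x), written through the images of the generators: this form is
    polynomial in x and involves no choice of S. *)
Definition theta (x : 'M[C]_n) (a : A) : A := \sum_u (a u : C) *: omon (fun i => cvec (col i (Pi x))) u.

Lemma theta_linear x : linear (theta x).
Proof.
move=> k a b; rewrite /theta scaler_sumr -big_split; apply: eq_bigr => u _ /=.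
by rewrite !ffunE scalerDl scalerA.
Qed.

Lemma thetaD x a b : theta x (a + b) = theta x a + theta x b.
Proof. by have := theta_linear x 1 a b; rewrite !scale1r. Qed.
Lemma theta0 x : theta x 0 = 0.
Proof. by rewrite /theta big1 // => u _; rewrite ffunE scale0r. Qed.
Lemma thetaZ x k a : theta x (k *: a) = k *: theta x a.
Proof. by have := theta_linear x k a 0; rewrite theta0 !addr0. Qed.
Lemma thetaB x a b : theta x (a - b) = theta x a - theta x b.
Proof. by rewrite -scaleN1r thetaD thetaZ scaleN1r. Qed.

Lemma theta_mon x s : theta x (mon C s) = omon (fun i => cvec (col i (Pi x))) s.
Proof.
rewrite /theta (bigD1 s) //= ffunE eqxx scale1r big1 ?addr0 // => u /negbTE us.
by rewrite ffunE us scale0r.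
Qed.

Lemma cvec_col_linear i : linear (fun M : 'M[C]_m => cvec (col i M) : A).
Proof.
move=> k M N; rewrite -cvecZ -cvecD; congr cvec; apply/matrixP => a b; rewrite !mxE.
by [].
Qed.

Lemma polymap_theta a : polymap (fun x => theta x a).
Proof.
apply: polymap_sum => u; apply: polymap_scalec; rewrite /omon; elim: (index_enum _) => [|i s IH].
  by apply: polymap_ext (PolyCst _ (1 : A)) => x; rewrite big_nil.
have H : polymap (fun x => if u i then cvec (col i (Pi x)) else 1 : A).
  by case: (u i); [apply: polymap_linear (cvec_col_linear i) Pi_poly|apply: PolyCst].
by apply: polymap_ext (polymap_mulA H IH) => x; rewrite big_cons.
Qed.

Lemma theta_spin x S a : spin_of (Pi x) S -> theta x a * S = S * a.
Proof.
move=> [_ _ _ lS]; apply: (@linear_ext _ _ A (fun a => theta x a * S) (fun a => S * a)).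
- by move=> k u v; rewrite theta_linear mulrDl scalerAl.
- exact: mul_linr.
move=> s; rewrite theta_mon mon_omon /omon; elim: (index_enum _) => [|i l IH]; first by rewrite !big_nil mul1r mulr1.
rewrite !big_cons -mulrA IH !mulrA; congr (_ * _); case: (s i); rewrite ?mulr1 ?mul1r //.
by rewrite -cvec_delta lS colE.
Qed.

Lemma theta_conj x S a : spin_of (Pi x) S -> theta x a = S * a * crev S.
Proof. by move=> lS; rewrite -(theta_spin a lS) -mulrA; case: lS => _ -> _ _; rewrite mulr1. Qed.

Lemma thetaM x a b : G x -> theta x (a * b) = theta x a * theta x b.
Proof.
move=> Gx; have [S lS] := spin_lift Gx; rewrite !(theta_conj _ lS).
by case: lS => _ _ cS _; rewrite !mulrA -[_ * crev S * S]mulrA cS mulr1.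
Qed.

Lemma theta1 x : G x -> theta x 1 = 1.
Proof. by move=> Gx; have [S lS] := spin_lift Gx; rewrite (theta_conj _ lS) mulr1; case: lS. Qed.

Lemma theta_cvec x v : G x -> theta x (cvec v) = cvec (Pi x *m v).
Proof.
move=> Gx; have [S lS] := spin_lift Gx; rewrite (theta_conj _ lS).
by case: lS => _ cS _ lS; rewrite lS -mulrA cS mulr1.
Qed.

Lemma comm_M (p a b : A) : comm p (a * b) = comm p a * b + a * comm p b.
Proof. by rewrite /comm mulrBl mulrBr !mulrA addrA subrK. Qed.

Lemma DX_theta X a x : X \in g -> G x -> DX X (theta^~ a) x = theta x (comm (PhiL X) a).
Proof.
move=> gX; have skX := Pi_skew gX.
have P1 y : G y -> DX X (theta^~ 1) y = theta y (comm (PhiL X) 1).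
  move=> Gy; rewrite (DX_eq (al_M AG) (al_lie AG) (polymap_theta 1) (PolyCst _ (1 : A)) theta1 gX Gy).
  by rewrite /DX der_cst /comm mulr1 mul1r subrr theta0.
have Pg i y : G y -> DX X (theta^~ (gen C i)) y = theta y (comm (PhiL X) (gen C i)).
  move=> Gy; have pc := polymap_linear (cvec_col_linear i) Pi_poly.
  have E z : G z -> theta z (gen C i) = cvec (col i (Pi z)).
    by move=> Gz; rewrite -cvec_delta theta_cvec // colE.
  rewrite (DX_eq (al_M AG) (al_lie AG) (polymap_theta _) pc E gX Gy).
  rewrite /DX (der_linear _ _ (cvec_col_linear i) Pi_poly) -/(DX X Pi y) (DX_Pi AG) //.
  by rewrite -cvec_delta comm_Phi // theta_cvec // colE mulmxA.
have PM b c : (forall y, G y -> DX X (theta^~ b) y = theta y (comm (PhiL X) b)) ->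
    (forall y, G y -> DX X (theta^~ c) y = theta y (comm (PhiL X) c)) ->
    forall y, G y -> DX X (theta^~ (b * c)) y = theta y (comm (PhiL X) (b * c)).
  move=> Pb Pc y Gy; have pbc := polymap_mulA (polymap_theta b) (polymap_theta c).
  rewrite (DX_eq (al_M AG) (al_lie AG) (polymap_theta _) pbc (fun z => @thetaM z b c) gX Gy).
  rewrite /DX (der_mulA _ _ (polymap_theta b) (polymap_theta c)) -/(DX X (theta^~ b) y) -/(DX X (theta^~ c) y).
  by rewrite Pb // Pc // comm_M [RHS]thetaD !thetaM.
move: x; elim/cliff_ind: a => [|a b Pa Pb|k s] x Gx.
- rewrite /comm mulr0 mul0r subrr theta0 /DX (@der_ext _ _ _ _ (fun=> 0)) ?der_cst // => y.
  exact: theta0.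
- rewrite /DX (@der_ext _ _ _ _ (fun y => theta y a + theta y b)) => [|y]; last exact: thetaD.
  rewrite (der_add _ _ (polymap_theta a) (polymap_theta b)) -/(DX X (theta^~ a) x) -/(DX X (theta^~ b) x).
  by rewrite Pa // Pb // -thetaD; congr theta; rewrite /comm mulrDl mulrDr opprD addrACA.
rewrite /DX (@der_ext _ _ _ _ (fun y => k *: theta y (mon C s))) => [|y]; last exact: thetaZ.
rewrite (der_scalec _ _ _ (polymap_theta _)) -/(DX X (theta^~ (mon C s)) x).
have -> : comm (PhiL X) (k *: mon C s) = k *: comm (PhiL X) (mon C s).
  by move: (PhiL X) => p; rewrite /comm -scalerAr -scalerAl scalerBr.
rewrite thetaZ; congr (_ *: _); move: x Gx; rewrite mon_omon /omon.
elim: (index_enum _) => [|i l IH]; first by rewrite big_nil; exact: P1.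
rewrite big_cons; apply: PM => //; case: (s i); [exact: Pg|exact: P1].
Qed.

(* For [S] above [Pi x] this is [2 ^ m * ctr (b * crev S)] times [S]; being
   quadratic in [S], it is independent of the choice of its sign. *)
Definition Rb (b : A) (x : 'M[C]_n) : A := \sum_s theta x (mon C s * b) * cinv C s.

Lemma polymap_Rb b : polymap (Rb b).
Proof. by apply: polymap_sum => s; apply: polymap_linear (mul_linl _) (polymap_theta _). Qed.

(** Writing theta as conjugation, S factors out on the left and the average of the even element b
    S^-1 remains. *)
Lemma Rb_spin b x S : alpha b = b -> spin_of (Pi x) S -> Rb b x = (2 ^+ m * ctr (b * crev S)) *: S.
Proof.
move=> eb lS; have [eS cS Sc _] := lS.
rewrite -[RHS]mulr1 -scalerAl scalerAr -average_even; last by rewrite alphaM alpha_crev eb eS.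
rewrite mulr_sumr; apply: eq_bigr => s _.
by rewrite (theta_conj _ lS) !mulrA.
Qed.

Lemma DX_Rb b X x : X \in g -> G x -> DX X (Rb b) x = Rb b x * PhiL X - Rb (b * PhiL X) x.
Proof.
move=> gX Gx; rewrite /DX (der_sum _ _ _ (fun s => polymap_linear (mul_linl (cinv C s)) (polymap_theta (mon C s * b)))).
have E s : der (fun y => theta y (mon C s * b) * cinv C s) x (x *m X) =
    theta x (PhiL X * mon C s * b) * cinv C s - theta x (mon C s * (b * PhiL X)) * cinv C s.
  rewrite (der_linear _ _ (mul_linl (cinv C s)) (polymap_theta _)) -/(DX X (theta^~ (mon C s * b)) x).
  by rewrite DX_theta // /comm thetaB mulrBl !mulrA.
under eq_bigr do rewrite E; rewrite sumrB; congr (_ - _).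
rewrite (@pair_shift _ _ A (fun p q => theta x (p * b) * q)).
- by rewrite /Rb mulr_suml; apply: eq_bigr => s _; rewrite mulrA.
- by move=> a; apply: mul_linr.
- by move=> a k u v; rewrite mul_linl theta_linear mulrDl scalerAl.
Qed.

(** At x, the right-invariant derivative along Y is the left-invariant one along x^-1 Y x, and S
    carries the image of the latter under the spin differential to that of Y. *)
Lemma LX_Rb b Y x : alpha b = b -> Y \in g -> G x -> LX Y (Rb b) x = PhiL Y * Rb b x - Rb (PhiL Y * b) x.
Proof.
move=> eb gY Gx; have Vx := al_V AG Gx; have ux := al_unit AG Gx.
pose Y' := invmx x *m Y *m x.
have gY' : Y' \in g by have := Ad_stable AG Vx gY; rewrite invmxK.
have EY : x *m Y' = Y *m x by rewrite /Y' !mulmxA mulmxV // mul1mx.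
have -> : LX Y (Rb b) x = DX Y' (Rb b) x by rewrite /LX /DX EY.
have EP : Pi x *m dPi Y' = dPi Y *m Pi x.
  by rewrite -(DX_Pi AG Pi_poly Pi_M gY' Gx) -(LX_Pi gY Gx) /LX /DX EY.
have [S lS] := spin_lift Gx; have [eS cS Sc SV] := lS.
have ES : S * PhiL Y' = PhiL Y * S.
  suff E : S * PhiL Y' * crev S = PhiL Y by rewrite -E -!mulrA Sc mulr1.
  apply: even_eq.
  - by rewrite !alphaM alpha_crev eS alpha_Phi.
  - exact: alpha_Phi.
  - by rewrite -mulrA ctrC -mulrA Sc mulr1 !ctr_Phi !skew_trace ?Pi_skew.
  move=> v; rewrite comm_Phi ?Pi_skew //.
  have Ev : cvec v = S * cvec ((Pi x)^T *m v) * crev S.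
    rewrite SV -mulrA cS mulr1 mulmxA; congr cvec.
    by rewrite (mulmx1C (Pi_orth Gx)) mul1mx.
  have -> : comm (S * PhiL Y' * crev S) (cvec v) = S * comm (PhiL Y') (cvec ((Pi x)^T *m v)) * crev S.
    rewrite Ev /comm mulrBr mulrBl !mulrA; congr (_ - _).
      by rewrite -[_ * crev S * S]mulrA Sc mulr1.
    by rewrite -[_ * crev S * S]mulrA Sc mulr1.
  rewrite comm_Phi ?Pi_skew // SV -mulrA cS mulr1; congr cvec.
  by rewrite !mulmxA EP -(mulmxA (dPi Y)) (mulmx1C (Pi_orth Gx)) mulmx1.
rewrite DX_Rb // !(Rb_spin _ lS) ?alphaM ?eb ?alpha_Phi //.
have E2 : PhiL Y' * crev S = crev S * PhiL Y.
  by rewrite -[LHS]mul1r -Sc -!mulrA (mulrA S) ES -mulrA cS mulr1.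
congr (_ - _ *: _); first by rewrite -[LHS]scalerAl -[RHS]scalerAr ES.
by rewrite -mulrA E2 mulrA ctrC mulrA.
Qed.

End Theta.

(** * Division and existence of the lift *)

Section Existence.
Variables (C : numClosedFieldType) (n : nat) (G : set 'M[C]_n) (g t : {vspace 'M[C]_n}).
Hypothesis AG : algebraic_lie G g.
Hypothesis G_perfect : forall U : {vspace 'M[C]_n},
  (forall X Y, X \in g -> Y \in g -> bra X Y \in U) -> (g <= U)%VS.
Variables (r : nat) (H : 'I_r -> 'M[C]_n).
Local Notation d := (\dim g).
Variables (Q : 'M[C]_n) (w : 'I_n -> 'I_r -> int) (Ad : 'M[C]_d) (al : 'I_d -> 'I_r -> int).
Hypothesis CA : cartan t H Q w Ad al.
Hypothesis w_gen : forall j, exists k : 'I_n -> nat, forall l, \sum_i (k i)%:Z * w i l = (l == j)%:R.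
Variable nu : 'I_r -> int.
Local Notation ht u := (dot u nu).
Hypothesis nu_gen : forall i, ht (al i) = 0 -> wt C (al i) = 0.

Variables (m : nat) (Pi : 'M[C]_n -> 'M[C]_m).
Hypothesis Pi_poly : polymap Pi.
Hypothesis Pi_1 : Pi 1%:M = 1%:M.
Hypothesis Pi_M : forall x y, G x -> G y -> Pi (x *m y) = Pi x *m Pi y.
Hypothesis Pi_orth : forall x, G x -> (Pi x)^T *m Pi x = 1%:M.
Hypothesis Pi_det : forall x, G x -> \det (Pi x) = 1.
Local Notation A := (cliff C m).
Local Notation PhiL X := (Phi (dPi Pi X)).

Variables (E : A) (u0 : 'I_r -> int).
Hypothesis E_even : alpha E = E.
Hypothesis E_tr : ctr E = 1.
Hypothesis E_H : forall x, E * PhiL (hh H x) = (- dotc (wt C u0) x) *: E.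
Hypothesis E_pos : forall i, 0 < ht (al i) -> E * PhiL (ebas Ad i) = 0.
Hypothesis E_neg : forall i, ht (al i) < 0 -> PhiL (ebas Ad i) * E = 0.

Lemma RbZ b k x : Rb Pi (k *: b) x = k *: Rb Pi b x.
Proof. by rewrite /Rb scaler_sumr; apply: eq_bigr => s _; rewrite -[mon C s * _]scalerAr thetaZ scalerAl. Qed.

Lemma Rb0 x : Rb Pi 0 x = 0.
Proof. by rewrite -[X in Rb Pi X](scale0r (0 : A)) RbZ scale0r. Qed.

Variables (a b : 'M[C]_n -> C^o) (va vb : 'I_r -> int).
Hypothesis sa : semi H Ad al nu a va.
Hypothesis sb : semi H Ad al nu b vb.
Hypothesis vab : forall j, va j = vb j + u0 j.

Let pa : polymap a. Proof. by case: sa. Qed.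
Let pb : polymap b. Proof. by case: sb. Qed.
Let a1 : a 1%:M = 1. Proof. by case: sa. Qed.
Let pRE : polymap (Rb Pi E). Proof. exact: polymap_Rb. Qed.

(** The scalar factor of [Rb Pi E] has the same weight and invariance as a / b, so this function
    should be [a] times the lift. *)
Definition RR x : A := (2 ^+ m)^-1 *: ((b x : C) *: Rb Pi E x).

Let pR0 : polymap (fun x => (b x : C) *: Rb Pi E x). Proof. exact: polymap_scale. Qed.

Lemma RR_poly : polymap RR. Proof. exact: polymap_scalec. Qed.

Hint Resolve RR_poly : core.

Lemma spin_of1 : spin_of (Pi 1%:M) (1 : A).
Proof. by split; rewrite ?alpha1 ?crev1 ?mulr1 // => v; rewrite mul1r mulr1 Pi_1 mul1mx. Qed.

Lemma RR1 : RR 1%:M = 1.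
Proof.
rewrite /RR; have [_ -> _ _ _] := sb; rewrite (Rb_spin E_even spin_of1) crev1 mulr1 E_tr mulr1 scale1r scalerA.
by rewrite mulVf ?scale1r // expf_neq0 // pnatr_eq0.
Qed.

Let derR X x : der RR x X = (2 ^+ m)^-1 *: ((der b x X : C) *: Rb Pi E x + (b x : C) *: der (Rb Pi E) x X).
Proof. by rewrite (der_scalec _ _ _ pR0) (der_scale _ _ pb pRE). Qed.

(** The directions along which RR / a visibly satisfies the equation of the lift: [a] and [RR] are
    scaled by the same c. Lowering root vectors are treated by right-invariant fields in [nilneg]
    instead. *)
Definition borel X := X \in g /\ exists c : C, forall x, G x ->
  DX X a x = c * a x /\ DX X RR x = RR x * PhiL X + c *: RR x.

Definition nilneg Y := Y \in g /\ forall x, G x -> LX Y a x = 0 /\ LX Y RR x = PhiL Y * RR x.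

Let dPiZ k X : dPi Pi (k *: X) = k *: dPi Pi X. Proof. exact: linear_hypZ (dPi_linear Pi_poly) _ _. Qed.
Let dPiD X Y : dPi Pi (X + Y) = dPi Pi X + dPi Pi Y. Proof. exact: linear_hypD (dPi_linear Pi_poly) _ _. Qed.
Let PhiD (X Y : 'M[C]_m) : Phi (X + Y) = Phi X + Phi Y :> A.
Proof. by have := Phi_linear 1 X Y; rewrite !scale1r. Qed.
Let Phi0 : Phi 0 = 0 :> A.
Proof. by have := Phi_linear (-1) (0 : 'M[C]_m) 0; rewrite scaler0 addr0 scaleN1r addNr. Qed.
Let PhiZ k (X : 'M[C]_m) : Phi (k *: X) = k *: Phi X :> A.
Proof. by have := Phi_linear k X 0; rewrite Phi0 !addr0. Qed.

Let DXl (W : vectType C) (f : 'M[C]_n -> W) k X Y x : polymap f -> DX (k *: X + Y) f x = k *: DX X f x + DX Y f x.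
Proof. by move=> pf; rewrite /DX mulmxDr -scalemxAr der_dirD // der_dirZ. Qed.
Let LXl (W : vectType C) (f : 'M[C]_n -> W) k X Y x : polymap f -> LX (k *: X + Y) f x = k *: LX X f x + LX Y f x.
Proof. by move=> pf; rewrite /LX mulmxDl -scalemxAl der_dirD // der_dirZ. Qed.

Lemma borel_lin k X Y : borel X -> borel Y -> borel (k *: X + Y).
Proof.
move=> [gX [c Hc]] [gY [c' Hc']]; split; first by rewrite memvD ?memvZ.
exists (k * c + c') => x Gx; have [ca cR] := Hc x Gx; have [ca' cR'] := Hc' x Gx.
rewrite !DXl ?RR_poly // ca ca' cR cR' dPiD dPiZ PhiD PhiZ; split.
  by rewrite /GRing.scale /= mulrDl mulrA.
move: (RR x) (PhiL X) (PhiL Y) => R0 p q.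
by rewrite mulrDr -scalerAr scalerDr scalerDl scalerA addrACA.
Qed.

Lemma nilneg_lin k X Y : nilneg X -> nilneg Y -> nilneg (k *: X + Y).
Proof.
move=> [gX Hc] [gY Hc']; split=> [|x Gx]; first by rewrite memvD ?memvZ.
have [ca cR] := Hc x Gx; have [ca' cR'] := Hc' x Gx.
rewrite !LXl ?RR_poly // ca ca' cR cR' dPiD dPiZ PhiD PhiZ scaler0 addr0; split=> //.
by move: (RR x) (PhiL X) (PhiL Y) => R0 p q; rewrite mulrDl -scalerAl.
Qed.

Let gH x : hh H x \in g. Proof. by apply: (t_in_g CA); apply: (ca_hht CA). Qed.
Let ge i : ebas Ad i \in g. Proof. exact: vc_mem. Qed.

Lemma borel_H x : borel (hh H x).
Proof.
split=> //; exists (dotc (wt C va) x) => z Gz; have [_ _ aH _ _] := sa; have [_ _ bH _ _] := sb.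
split=> //; rewrite /DX derR -/(DX _ b z) -/(DX _ (Rb Pi E) z) bH.
rewrite (DX_Rb AG) // E_H RbZ.
have -> : wt C va = wt C vb + wt C u0.
  by rewrite -wtD; congr wt; apply/funext => j; rewrite vab.
rewrite dotcDl /RR.
move: (dotc _ _) (dotc _ _) => c1 c2; move: (PhiL _) => P; rewrite -!scalerAl.
move: (b z : C) (Rb Pi E z * P) (Rb Pi E z) => bz x1 x2.
apply/ffunP => i; rewrite !ffunE /GRing.scale /=; ring.
Qed.

Lemma borel_pos i : 0 < ht (al i) -> borel (ebas Ad i).
Proof.
move=> hi; split=> //; exists 0 => z Gz; have [_ _ _ ap _] := sa; have [_ _ _ bp _] := sb.
rewrite ap // mul0r; split=> //; rewrite /DX derR -/(DX _ b z) -/(DX _ (Rb Pi E) z) bp // scale0r add0r.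
by rewrite (DX_Rb AG) // E_pos // Rb0 subr0 scale0r addr0 /RR -!scalerAl.
Qed.

Lemma nilneg_neg i : ht (al i) < 0 -> nilneg (ebas Ad i).
Proof.
move=> hi; split=> // z Gz; have [_ _ _ _ an] := sa; have [_ _ _ _ bn] := sb.
rewrite an //; split=> //; rewrite /LX derR -/(LX _ b z) -/(LX _ (Rb Pi E) z) bn // scale0r add0r.
by rewrite (LX_Rb AG) // E_neg // Rb0 subr0 /RR -!scalerAr.
Qed.

Lemma borel0 : borel 0. Proof. by have := borel_H 0; rewrite /hh big1 // => j _; rewrite mxE scale0r. Qed.
Lemma nilneg0 : nilneg 0.
Proof.
split=> [|x Gx]; first exact: mem0v.
rewrite /LX mul0mx !der_dir0 ?RR_poly //; split=> //.
by rewrite (linear_hyp0 (dPi_linear Pi_poly)) Phi0 mul0r.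
Qed.

Lemma triangular_decomposition X : X \in g -> exists B Y, [/\ borel B, nilneg Y & X = B + Y].
Proof.
move=> /(ebas_span CA) ->; elim/big_rec: _ => [|i X' _ [B [Y [bB nY ->]]]].
  by exists 0, 0; rewrite addr0; split; [exact: borel0|exact: nilneg0|].
move: (_ i 0) => k; have [hi|hi] := leP 0 (ht (al i)); last first.
  exists B, (k *: ebas Ad i + Y); split=> //; last by rewrite addrCA.
  by apply: nilneg_lin => //; apply: nilneg_neg.
exists (k *: ebas Ad i + B), Y; split=> //; last by rewrite addrA.
apply: borel_lin => //; have [h0|h0] := eqVneq (ht (al i)) 0; last by apply: borel_pos; rewrite lt_def h0.
have : ebas Ad i \in t by apply: (wsp0 CA); have := ebas_wsp CA i; rewrite nu_gen.
by move=> /(ca_thh CA) [x ->]; apply: borel_H.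
Qed.

(** Up to the factor a^2, the defect of RR / a as a solution of the equation rho' = rho Phi(X), with
    denominators cleared. *)
Definition ZX X x : A := (a x : C) *: DX X RR x - (DX X a x : C) *: RR x - (a x : C) *: (RR x * PhiL X).

Let pDR X : polymap (DX X RR). Proof. exact/polymap_DX/RR_poly. Qed.
Let pRP (P : A) : polymap (fun x => RR x * P). Proof. exact: polymap_linear (mul_linl P) RR_poly. Qed.
Let pPR (P : A) : polymap (fun x => P * RR x). Proof. exact: polymap_linear (mul_linr P) RR_poly. Qed.
Let p1 X : polymap (fun x => (a x : C) *: DX X RR x). Proof. exact: polymap_scale. Qed.
Let p2 X : polymap (fun x => (DX X a x : C) *: RR x).
Proof. by apply: polymap_scale; [apply: polymap_DX|apply: RR_poly]. Qed.
Let p3 (P : A) : polymap (fun x => (a x : C) *: (RR x * P)). Proof. exact: polymap_scale. Qed.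

Lemma ZX_poly X : polymap (ZX X).
Proof. by apply: polymap_sub; first apply: polymap_sub. Qed.

Let derZ X x v : der (ZX X) x v =
  ((der a x v : C) *: DX X RR x + (a x : C) *: der (DX X RR) x v)
  - ((der (DX X a) x v : C) *: RR x + (DX X a x : C) *: der RR x v)
  - ((der a x v : C) *: (RR x * PhiL X) + (a x : C) *: (der RR x v * PhiL X)).
Proof.
rewrite /ZX (der_sub _ _ (polymap_sub (p1 X) (p2 X)) (p3 (PhiL X))) (der_sub _ _ (p1 X) (p2 X)).
rewrite (der_scale _ _ pa (pDR X)) (der_scale _ _ (polymap_DX X pa) RR_poly) (der_scale _ _ pa (pRP (PhiL X))).
by rewrite (der_linear _ _ (mul_linl (PhiL X)) RR_poly).
Qed.

Lemma ZX_lin k X Y x : ZX (k *: X + Y) x = k *: ZX X x + ZX Y x.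
Proof.
rewrite /ZX !DXl ?RR_poly // dPiD dPiZ PhiD PhiZ.
move: (a x : C) (DX X a x : C) (DX Y a x : C) (DX X RR x) (DX Y RR x) (RR x) (PhiL X) (PhiL Y).
move=> a0 c1 c2 R1 R2 R0 p q; rewrite mulrDr -scalerAr; move: (R0 * p) (R0 * q) => x1 x2.
apply/ffunP => i; rewrite !ffunE /GRing.scale /=; ring.
Qed.

Lemma ZX_borel Z X : borel Z -> X \in g -> exists c : C, forall x, G x ->
  DX Z (ZX X) x = (2 * c) *: ZX X x + ZX (bra Z X) x + ZX X x * PhiL Z.
Proof.
move=> [gZ [c Hc]] gX; exists c => x Gx.
have EaZ y : G y -> DX Z a y = c * a y by move=> /Hc [].
have ERZ y : G y -> DX Z RR y = RR y * PhiL Z + c *: RR y by move=> /Hc [].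
have pca : polymap (fun y => c * (a y : C) : C^o) by apply: polymap_mulc.
have pRZ : polymap (fun y => RR y * PhiL Z + c *: RR y) by apply: PolyAdd => //; apply/polymap_scalec/RR_poly.
rewrite {1}/DX derZ -/(DX Z a x) -/(DX Z (DX X RR) x) -/(DX Z (DX X a) x) -/(DX Z RR x).
rewrite !(DX_comm Z X) ?RR_poly // -!/(bra Z X) -/(DX (bra Z X) RR x) -/(DX (bra Z X) a x).
rewrite (DX_eq (al_M AG) (al_lie AG) (polymap_DX Z RR_poly) pRZ ERZ gX Gx).
rewrite (DX_eq (al_M AG) (al_lie AG) (polymap_DX Z pa) pca EaZ gX Gx) EaZ // ERZ //.
have -> : DX X (fun y => RR y * PhiL Z + c *: RR y) x = DX X RR x * PhiL Z + c *: DX X RR x.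
  rewrite /DX (der_add _ _ (pRP (PhiL Z)) (polymap_scalec c RR_poly)).
  by rewrite (der_linear _ _ (mul_linl (PhiL Z)) RR_poly) (der_scalec _ _ _ RR_poly).
have -> : DX X (fun y => c * (a y : C) : C^o) x = c * (DX X a x : C).
  by rewrite /DX (der_scalec c x _ pa).
rewrite /ZX (dPi_bra AG Pi_poly Pi_M) // Phi_bra ?(Pi_skew AG Pi_poly Pi_1 Pi_orth) // /comm.
move: (a x : C) (DX X a x : C) (DX (bra Z X) a x : C) (RR x) (DX X RR x) (DX (bra Z X) RR x) (PhiL X) (PhiL Z).
move=> {x Gx} al' de de' R0 R1 R2 P Zp.
rewrite !(mulrDl, mulrDr, mulNr, mulrN) -!scalerAl !mulrA.
move: (R1 * Zp) (R0 * Zp) (R0 * P) (R0 * Zp * P) (R0 * P * Zp) => x1 x2 x3 x4 x5.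
apply/ffunP => i; rewrite !ffunE /GRing.scale /=; ring.
Qed.

Lemma ZX_nilneg Y X : nilneg Y -> X \in g -> forall x, G x -> LX Y (ZX X) x = PhiL Y * ZX X x.
Proof.
move=> [gY Hc] gX x Gx.
have EaY y : G y -> LX Y a y = 0 by move=> /Hc [].
have ERY y : G y -> LX Y RR y = PhiL Y * RR y by move=> /Hc [].
rewrite {1}/LX derZ -/(LX Y a x) -/(LX Y (DX X RR) x) -/(LX Y (DX X a) x) -/(LX Y RR x).
rewrite -!DX_LX ?RR_poly //.
rewrite (DX_eq (al_M AG) (al_lie AG) (polymap_LX Y RR_poly) (pPR (PhiL Y)) ERY gX Gx).
rewrite (DX_eq (al_M AG) (al_lie AG) (polymap_LX Y pa) (PolyCst _ (0 : C^o)) EaY gX Gx) EaY // ERY //.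
have -> : DX X (fun=> 0 : C^o) x = 0 by rewrite /DX der_cst.
have -> : DX X (fun y => PhiL Y * RR y) x = PhiL Y * DX X RR x.
  by rewrite /DX (der_linear _ _ (mul_linr (PhiL Y)) RR_poly).
rewrite /ZX.
move: (a x : C) (DX X a x : C) (RR x) (DX X RR x) (PhiL X) (PhiL Y).
move=> {x Gx} al' de R0 R1 P Yp.
rewrite !scale0r !add0r !mulrBr -!scalerAr !mulrA.
by [].
Qed.

(** The span of the defects under multiplication by constants on both sides, which is closed under
    the derivations computed in [ZX_borel] and [ZX_nilneg]. *)
Inductive ZF : ('M[C]_n -> A) -> Prop :=
| ZFgen X : X \in g -> ZF (ZX X)
| ZFadd f h : ZF f -> ZF h -> ZF (fun x => f x + h x)
| ZFscale k f : ZF f -> ZF (fun x => k *: f x)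
| ZFr P f : ZF f -> ZF (fun x => f x * P)
| ZFl P f : ZF f -> ZF (fun x => P * f x).

Lemma ZF_poly f : ZF f -> polymap f.
Proof.
elim=> [X _|f1 f2 _ p1' _ p2'|k f1 _ p1'|P f1 _ p1'|P f1 _ p1'].
- exact: ZX_poly.
- exact: PolyAdd.
- exact: polymap_scalec.
- exact: polymap_linear (mul_linl P) p1'.
- exact: polymap_linear (mul_linr P) p1'.
Qed.

Lemma ZX1 X : X \in g -> ZX X 1%:M = 0.
Proof.
move=> /triangular_decomposition [B [Y [[gB [c Hc]] [gY Hn] ->]]].
rewrite -[B]scale1r ZX_lin scale1r; have [aB RB] := Hc _ (al_1 AG); have [aY RY] := Hn _ (al_1 AG).
rewrite /ZX aB RB a1 RR1 !scale1r mulr1 !mul1r; have -> : DX Y a 1%:M = 0 by rewrite -aY /LX /DX mulmx1 mul1mx.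
have -> : DX Y RR 1%:M = PhiL Y by rewrite -[RHS]mulr1 -RR1 -RY /LX /DX mulmx1 mul1mx.
by rewrite scale0r subr0 subrr addr0 addrK subrr.
Qed.

Lemma RR_equation X x : X \in g -> G x ->
  (a x : C) *: DX X RR x = (DX X a x : C) *: RR x + (a x : C) *: (RR x * PhiL X).
Proof.
move=> gX Gx; suff : ZX X x = 0.
  by rewrite /ZX -addrA -opprD => /eqP; rewrite subr_eq0 => /eqP.
apply: (@ode_vanish2 _ _ _ _ AG A borel nilneg ZF) => //; last exact: ZFgen.
- by move=> Z [].
- by move=> Y [].
- exact: triangular_decomposition.
- move=> f Zf; split; first exact: ZF_poly.
  by elim: Zf => [Y|f1 f2 _ -> _ ->|k f1 _ ->|P f1 _ ->|P f1 _ ->]; rewrite ?addr0 ?scaler0 ?mul0r ?mulr0 //; apply: ZX1.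
- move=> f Z Zf bZ; elim: Zf => [Y gY|f1 f2 z1 [h1 H1 E1] z2 [h2 H2 E2]|k f1 z1 [h1 H1 E1]|P f1 z1 [h1 H1 E1]|P f1 z1 [h1 H1 E1]].
  + have [c Hc] := ZX_borel bZ gY; eexists; last exact: Hc.
    apply: ZFadd; last by apply/ZFr/ZFgen.
    by apply: ZFadd; [apply/ZFscale/ZFgen|apply: ZFgen; apply: (ca_sub CA) => //; case: bZ].
  + exists (fun x => h1 x + h2 x); first exact: ZFadd.
    by move=> y Gy; rewrite /DX (der_add _ _ (ZF_poly z1) (ZF_poly z2)) -E1 // -E2.
  + exists (fun x => k *: h1 x); first exact: ZFscale.
    by move=> y Gy; rewrite /DX (der_scalec _ _ _ (ZF_poly z1)) -E1.
  + exists (fun x => h1 x * P); first exact: ZFr.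
    by move=> y Gy; rewrite /DX (der_linear _ _ (mul_linl P) (ZF_poly z1)) -E1.
  + exists (fun x => P * h1 x); first exact: ZFl.
    by move=> y Gy; rewrite /DX (der_linear _ _ (mul_linr P) (ZF_poly z1)) -E1.
move=> f Z Zf nZ; elim: Zf => [Y gY|f1 f2 z1 [h1 H1 E1] z2 [h2 H2 E2]|k f1 z1 [h1 H1 E1]|P f1 z1 [h1 H1 E1]|P f1 z1 [h1 H1 E1]].
+ by eexists; last exact: (ZX_nilneg nZ gY); apply/ZFl/ZFgen.
+ exists (fun x => h1 x + h2 x); first exact: ZFadd.
  by move=> y Gy; rewrite /LX (der_add _ _ (ZF_poly z1) (ZF_poly z2)) -E1 // -E2.
+ exists (fun x => k *: h1 x); first exact: ZFscale.
  by move=> y Gy; rewrite /LX (der_scalec _ _ _ (ZF_poly z1)) -E1.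
+ exists (fun x => h1 x * P); first exact: ZFr.
  by move=> y Gy; rewrite /LX (der_linear _ _ (mul_linl P) (ZF_poly z1)) -E1.
exists (fun x => P * h1 x); first exact: ZFl.
by move=> y Gy; rewrite /LX (der_linear _ _ (mul_linr P) (ZF_poly z1)) -E1.
Qed.

(** A connected group is irreducible, so q is not a zero divisor. In terms of derivatives: q h = 0
    implies q^2 h' = 0, so the functions killed by some such q form a class stable under
    derivations, and they vanish at 1. *)
Lemma cancel_unit (W : vectType C) (q : 'M[C]_n -> C^o) (h : 'M[C]_n -> W) : polymap q -> q 1%:M = 1 -> polymap h ->
  (forall x, G x -> (q x : C) *: h x = 0) -> forall x, G x -> h x = 0.
Proof.
move=> pq q1 ph E0.
pose Z (f : 'M[C]_n -> W) := polymap f /\ exists q : 'M[C]_n -> C^o,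
  [/\ polymap q, q 1%:M = 1 & forall x, G x -> (q x : C) *: f x = 0].
apply: (@ode_vanish _ _ _ _ AG W Z) => //; last by split=> //; exists q.
- move=> f [pf [q' [_ q'1 Hf]]]; split=> //.
  by have := Hf _ (al_1 AG); rewrite q'1 scale1r.
move=> f X [pf [q' [pq' q'1 Hf]]] gX; exists (DX X f) => //; split; first exact: polymap_DX.
exists (fun x => q' x * q' x); split; [exact: polymap_mul|by rewrite q'1 mulr1|move=> x Gx].
have := DX_vanish (al_M AG) (al_lie AG) (polymap_scale pq' pf) Hf gX Gx.
rewrite /DX (der_scale _ _ pq' pf) => /(congr1 (fun v => (q' x : C) *: v)).
by rewrite scalerDr scaler0 scalerA mulrC -scalerA Hf // scaler0 add0r scalerA.
Qed.

(** The functions q such that q RR is divisible by [a] form an ideal stable under [g]. It contains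
    [a], which is 1 at the identity, hence a function equal to 1 on G. *)
Theorem lift_quotient : exists Q0 : 'M[C]_n -> A, polymap Q0 /\ forall x, G x -> RR x = (a x : C) *: Q0 x.
Proof.
pose D (q : 'M[C]_n -> C^o) := polymap q /\ exists2 Q0 : 'M[C]_n -> A, polymap Q0 &
  forall x, G x -> (q x : C) *: RR x = (a x : C) *: Q0 x.
have [||f h|f h|f X gX||//|q [pq [Q0 pQ0 HQ0]] q1] := @stable_ideal_unit _ _ G g AG G_perfect D a.
- by move=> f [].
- split; first exact: PolyCst.
  by exists (fun=> 0) => [|x _]; [exact: PolyCst|rewrite scale0r scaler0].
- move=> [pf [Qf pQf Hf]] [ph [Qh pQh Hh]]; split; first exact: PolyAdd.
  exists (fun x => Qf x + Qh x); first exact: PolyAdd.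
  by move=> x Gx; rewrite scalerDl scalerDr Hf // Hh.
- move=> ph [pf [Qf pQf Hf]]; split; first exact: polymap_mul.
  exists (fun x => (h x : C) *: Qf x); first exact: polymap_scale.
  by move=> x Gx; rewrite -scalerA Hf // !scalerA mulrC.
- move=> [pf [Qf pQf Hf]]; split; first exact: polymap_DX.
  (* If rho denotes RR / a, then Qf is f rho, and the product rule with rho' = rho Phi(X) gives this
     quotient for f'. *)
  exists (fun x => DX X Qf x - Qf x * PhiL X).
    by apply: polymap_sub; [apply: polymap_DX|apply: polymap_linear (mul_linl _) pQf].
  move=> x Gx; apply/eqP; rewrite -subr_eq0; apply/eqP; move: x Gx.
  have pl : polymap (fun x => (DX X f x : C) *: RR x - (a x : C) *: (DX X Qf x - Qf x * PhiL X)).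
    apply: polymap_sub; apply: polymap_scale => //; first exact: polymap_DX.
    by apply: polymap_sub; [apply: polymap_DX|apply: polymap_linear (mul_linl _) pQf].
  apply: (cancel_unit pa a1 pl) => x Gx.
  have := DX_eq (al_M AG) (al_lie AG) (polymap_scale pf RR_poly) (polymap_scale pa pQf) Hf gX Gx.
  rewrite /DX (der_scale _ _ pf RR_poly) (der_scale _ _ pa pQf) -!/(DX _ _ _) => ED.
  have EX := RR_equation gX Gx; have Ef := Hf x Gx.
  have E1 : (a x : C) *: ((f x : C) *: DX X RR x) = (DX X a x : C) *: ((a x : C) *: Qf x) + (a x : C) *: ((a x : C) *: (Qf x * PhiL X)).
    rewrite scalerA mulrC -scalerA EX scalerDr; congr (_ + _).
      by rewrite [LHS]scalerA [_ * _]mulrC -scalerA Ef.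
    rewrite [LHS]scalerA (mulrC (f x)) -[LHS]scalerA; congr (_ *: _).
    by rewrite [LHS]scalerAl [RHS]scalerAl Ef.
  have := congr1 (fun v => (a x : C) *: v) ED; rewrite /= !scalerDr E1.
  move: (a x : C) (DX X a x : C) (DX X f x : C) (RR x) (DX X Qf x) (Qf x) (Qf x * PhiL X).
  move=> al' de df R0 Q1 Q2 Q3 => /ffunP EE; apply/ffunP => i; have := EE i; rewrite !ffunE /GRing.scale /=.
  by move/eqP; rewrite -subr_eq0 => /eqP EE'; rewrite -[RHS]EE'; ring.
- by split=> //; exists RR => //; exact: RR_poly.
exists Q0; split=> // x Gx; rewrite -HQ0 // q1 // scale1r.
by [].
Qed.

(** The quotient satisfies rho' = rho Phi(X) and rho(1) = 1; each required identity compares two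
    solutions of a linear system with the same value at 1. *)
Theorem spin_lift_of_semi : exists rho : 'M[C]_n -> A, [/\ polymap rho,
  forall x y, G x -> G y -> rho (x *m y) = rho x * rho y,
  forall x, G x -> alpha (rho x) = rho x,
  forall x, G x -> rho x * crev (rho x) = 1 &
  forall x v, G x -> rho x * cvec v = cvec (Pi x *m v) * rho x].
Proof.
have [Q0 [pQ HQ]] := lift_quotient; exists Q0.
have Q01 : Q0 1%:M = 1 by have := HQ _ (al_1 AG); rewrite RR1 a1 scale1r.
have pQr P : polymap (fun x => Q0 x * P) := polymap_linear (mul_linl P) pQ.
have DQ X x : X \in g -> G x -> DX X Q0 x = Q0 x * PhiL X.
  move=> gX Gx; apply/eqP; rewrite -subr_eq0; apply/eqP; move: x Gx.
  have pd : polymap (fun x => DX X Q0 x - Q0 x * PhiL X) by apply: polymap_sub => //; apply: polymap_DX.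
  apply: (cancel_unit pa a1 pd); apply: (cancel_unit pa a1 (polymap_scale pa pd)) => x Gx.
  have := RR_equation gX Gx; rewrite HQ //.
  have -> : DX X RR x = (DX X a x : C) *: Q0 x + (a x : C) *: DX X Q0 x.
    by rewrite (DX_eq (al_M AG) (al_lie AG) RR_poly (polymap_scale pa pQ) HQ gX Gx) /DX (der_scale _ _ pa pQ).
  rewrite -scalerAl; move: (a x : C) (DX X a x : C) (Q0 x) (DX X Q0 x) (Q0 x * PhiL X) => c1 c2 v1 v2 v3.
  move=> /ffunP EE; apply/ffunP => i; have := EE i; rewrite !ffunE /GRing.scale /=.
  by move/eqP; rewrite -subr_eq0 => /eqP EE'; rewrite -[RHS]EE'; ring.
have uniq0 F : polymap F -> F 1%:M = 0 -> (forall X x, X \in g -> G x -> DX X F x = F x * PhiL X) ->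
    forall x, G x -> F x = 0.
  move=> pF F1 DF; pose Z (f : 'M[C]_n -> A) := exists P, f = fun x => F x * P.
  apply: (@ode_vanish _ _ _ _ AG A Z) => //; last by exists 1; apply/funext => x; rewrite mulr1.
  - move=> _ [P ->]; split; first exact: polymap_linear (mul_linl P) pF.
    by rewrite F1 mul0r.
  move=> _ X [P ->] gX; exists (fun x => F x * (PhiL X * P)); first by exists (PhiL X * P).
  by move=> x Gx; rewrite /DX (der_linear _ _ (mul_linl P) pF) -/(DX X F x) DF // mulrA.
split=> //.
- move=> y x Gy Gx; apply/eqP; rewrite -subr_eq0; apply/eqP; move: x Gx.
  have p1' : polymap (fun x => Q0 (y *m x)) by apply: polymap_mull.
  have p2' : polymap (fun x => Q0 y * Q0 x) := polymap_linear (mul_linr (Q0 y)) pQ.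
  apply: (uniq0 (fun x => Q0 (y *m x) - Q0 y * Q0 x)); first exact: polymap_sub.
    by rewrite mulmx1 Q01 mulr1 subrr.
  move=> X x gX Gx; rewrite /DX (der_sub _ _ p1' p2') -/(DX X (fun x => Q0 (y *m x)) x) DX_mull //.
  rewrite (der_linear _ _ (mul_linr (Q0 y)) pQ) -/(DX X Q0 x) !DQ //; last exact: (al_M AG).
  by rewrite mulrBl mulrA.
- move=> x Gx; apply/eqP; rewrite -subr_eq0; apply/eqP; move: x Gx.
  have lal : linear (@alpha C m) by exact: alpha_linear.
  apply: (uniq0 (fun x => alpha (Q0 x) - Q0 x)); first by apply: polymap_sub => //; apply: polymap_linear lal pQ.
    by rewrite Q01 alpha1 subrr.
  move=> X x gX Gx; rewrite /DX (der_sub _ _ (polymap_linear lal pQ) pQ) (der_linear _ _ lal pQ).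
  by rewrite -/(DX X Q0 x) DQ // alphaM alpha_Phi mulrBl.
- move=> x Gx; apply/eqP; rewrite -subr_eq0; apply/eqP; move: x Gx.
  have lcr : linear (@crev C m) by exact: crev_linear.
  have pcr := polymap_linear lcr pQ; have pp := polymap_mulA pQ pcr.
  pose Z (f : 'M[C]_n -> A) := f = (fun x => Q0 x * crev (Q0 x) - 1) \/ f = fun=> 0.
  apply: (@ode_vanish _ _ _ _ AG A Z); last by left.
    move=> _ [] ->; last by split=> //; apply: PolyCst.
    by split; [apply: polymap_sub => //; apply: PolyCst|rewrite Q01 crev1 mulr1 subrr].
  move=> _ X [] -> gX; exists (fun=> 0); try by right.
    move=> x Gx; rewrite /DX (der_sub _ _ pp (PolyCst _ (1 : A))) der_cst subr0 (der_mulA _ _ pQ pcr).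
    rewrite (der_linear _ _ lcr pQ) -/(DX X Q0 x) DQ // crevM crev_Phi ?(Pi_skew AG Pi_poly Pi_1 Pi_orth) //.
    by rewrite mulNr mulrN mulrA subrr.
  by move=> x Gx; rewrite /DX der_cst.
move=> x v Gx; apply/eqP; rewrite -subr_eq0; apply/eqP; move: x Gx.
(* The constant right factor P is carried along because differentiating the defect for v gives the
   defect for v times Phi(X), and the defect for the vector dPi(X) v. *)
pose FF v P x := (Q0 x * cvec v - cvec (Pi x *m v) * Q0 x) * P.
have lPv u : linear (fun M : 'M[C]_m => cvec (M *m u) : A).
  by move=> k M N; rewrite mulmxDl -scalemxAl cvec_linear.
have pPv u := polymap_linear (lPv u) Pi_poly.
have pd u : polymap (fun x => Q0 x * cvec u - cvec (Pi x *m u) * Q0 x).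
  by apply: polymap_sub => //; apply: polymap_mulA.
have pFF u P : polymap (FF u P) := polymap_linear (mul_linl P) (pd u).
pose Z (f : 'M[C]_n -> A) := exists s : seq ('cV[C]_m * A), f = fun x => \sum_(c <- s) FF c.1 c.2 x.
have := @ode_vanish _ _ _ _ AG A Z; move/(_ _ _ (FF v 1)) => HZ.
suff H0 : forall x, G x -> FF v 1 x = 0 by move=> x Gx; have := H0 x Gx; rewrite /FF mulr1.
apply: HZ; last first.
- by exists [:: (v, 1)]; apply/funext => x; rewrite big_seq1.
- move=> _ X [s ->] gX; exists (fun x => \sum_(c <- s) FF c.1 (PhiL X * c.2) x + \sum_(c <- s) FF (dPi Pi X *m c.1) c.2 x).
    exists ([seq (c.1, PhiL X * c.2) | c <- s] ++ [seq (dPi Pi X *m c.1, c.2) | c <- s]).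
    by apply/funext => x; rewrite big_cat !big_map.
  move=> x Gx; rewrite /DX (der_sum _ _ _ (fun c => pFF c.1 c.2)) -big_split; apply: eq_bigr => -[u P] _ /=.
  rewrite /FF (der_linear _ _ (mul_linl P) (pd u)) (der_sub _ _ (pQr (cvec u)) (polymap_mulA (pPv u) pQ)).
  rewrite (der_linear _ _ (mul_linl (cvec u)) pQ) (der_mulA _ _ (pPv u) pQ) (der_linear _ _ (lPv u) Pi_poly).
  rewrite -/(DX X Q0 x) -/(DX X Pi x) DQ // (DX_Pi AG Pi_poly Pi_M gX Gx).
  have := comm_Phi u (Pi_skew AG Pi_poly Pi_1 Pi_orth gX); rewrite /comm => <-; rewrite -!mulmxA.
  move: (Q0 x) (PhiL X) (cvec u) (cvec (Pi x *m (dPi Pi X *m u))) (cvec (Pi x *m u)) => q p c e f.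
  rewrite mulrA -mulrDl; congr (_ * _).
  rewrite !(mulrBl, mulrBr) !mulrA opprD addrA addrC; move: (q * p * c) (q * c * p) (e * q) (f * q * p) => y1 y2 y3 y4.
  by apply/ffunP => i; rewrite !ffunE; ring.
- move=> _ [s ->]; split; first by apply: polymap_sum => c.
  by rewrite big1 // => c _; rewrite /FF Q01 Pi_1 mul1mx mul1r mulr1 subrr mul0r.
Qed.

End Existence.

(** * Integrality criteria for the existence of a lift *)

Section Criterion.
Variables (C : numClosedFieldType) (n : nat) (G : set 'M[C]_n) (g t : {vspace 'M[C]_n}).
Hypothesis AG : algebraic_lie G g.
Hypothesis G_perfect : forall U : {vspace 'M[C]_n},
  (forall X Y, X \in g -> Y \in g -> bra X Y \in U) -> (g <= U)%VS.
Variables (T : set 'M[C]_n) (r : nat) (tor : ('I_r -> C) -> 'M[C]_n) (p pv : 'I_r -> 'M[C]_n -> C^o).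
Hypothesis TC : torus_chart T tor p pv.
Hypothesis TG : forall x, T x -> G x.
Variables (H : 'I_r -> 'M[C]_n).
Hypothesis H_lder : forall j a b, lder (fun y => tor (evec j y) a b) (H j a b).
Local Notation d := (\dim g).
Variables (Q : 'M[C]_n) (w : 'I_n -> 'I_r -> int) (Ad : 'M[C]_d) (al : 'I_d -> 'I_r -> int).
Hypothesis CA : cartan t H Q w Ad al.
Hypothesis torQ : forall z, nzv z -> tor z *m Q = Q *m diag_mx (\row_i mono (w i) z).
Variables (m : nat) (Pi : 'M[C]_n -> 'M[C]_m).
Hypothesis Pi_poly : polymap Pi.
Hypothesis Pi_1 : Pi 1%:M = 1%:M.
Hypothesis Pi_M : forall x y, G x -> G y -> Pi (x *m y) = Pi x *m Pi y.
Hypothesis Pi_orth : forall x, G x -> (Pi x)^T *m Pi x = 1%:M.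
Hypothesis Pi_det : forall x, G x -> \det (Pi x) = 1.
Variables (Qp : 'M[C]_m) (wp : 'I_m -> 'I_r -> int).
Hypothesis Qpu : Qp \in unitmx.
Hypothesis HQp : forall j, dPi Pi (H j) *m Qp = Qp *m diag_mx (\row_i (wp i j)%:~R).
Local Notation A := (cliff C m).
Local Notation PhiL X := (Phi (dPi Pi X)).

Definition has_lift := exists rho : 'M[C]_n -> A, [/\ polymap rho,
  forall x y, G x -> G y -> rho (x *m y) = rho x * rho y,
  forall x, G x -> alpha (rho x) = rho x,
  forall x, G x -> rho x * crev (rho x) = 1 &
  forall x v, G x -> rho x * cvec v = cvec (Pi x *m v) * rho x].

Variable nu : 'I_r -> int.
Local Notation ht u := (dot u nu).
Hypothesis nu_al : forall i, ht (al i) = 0 -> wt C (al i) = 0.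
Hypothesis nu_wp : forall k, ht (wp k) = 0 -> wt C (wp k) = 0.
Let kap k : int := ht (wp k).

Let gH x : hh H x \in g. Proof. by apply: (t_in_g CA); apply: (ca_hht CA). Qed.
Let ge i : ebas Ad i \in g. Proof. exact: vc_mem. Qed.
Let gHj j : H j \in g. Proof. by rewrite -hh_delta; apply: gH. Qed.
Let sk X (gX : X \in g) := Pi_skew AG Pi_poly Pi_1 Pi_orth gX.

Let W := (invmx Qp)^T.

Let HW j : dPi Pi (H j) *m W = - (W *m diag_mx (\row_i (wp i j)%:~R)).
Proof.
have E : invmx Qp *m dPi Pi (H j) = diag_mx (\row_i (wp i j)%:~R) *m invmx Qp.
  by apply: (can_inj (mulmxK Qpu)); rewrite mulmxKV // -mulmxA HQp mulKmx.
have := congr1 trmx E; rewrite !trmx_mul sk // tr_diag_mx -/W => <-.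
by rewrite mulNmx opprK.
Qed.

(** The operators of t are skew, so two weight vectors with nonzero product have opposite weights.
    The sign s treats the weight basis and its dual basis together. *)
Let iso_gen (U : 'M[C]_m) (s : int) : (s = 1 \/ s = -1) ->
  (forall j, dPi Pi (H j) *m U = s%:~R *: (U *m diag_mx (\row_i (wp i j)%:~R))) ->
  forall k l, (U^T *m U) k l != 0 -> forall j, wp k j = - wp l j.
Proof.
move=> s1 HU k l nz j.
have s0 : s%:~R != 0 :> C by case: s1 => ->; rewrite ?oner_eq0 // rmorphN oppr_eq0 oner_eq0.
have E1 : U^T *m dPi Pi (H j) *m U = s%:~R *: (U^T *m U *m diag_mx (\row_i (wp i j)%:~R)).
  by rewrite -mulmxA HU -scalemxAr mulmxA.
have E2 : U^T *m dPi Pi (H j) *m U = - s%:~R *: (diag_mx (\row_i (wp i j)%:~R) *m (U^T *m U)).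
  have := congr1 trmx (HU j); rewrite trmx_mul sk // linearZ /= trmx_mul tr_diag_mx mulmxN => /eqP.
  by rewrite eqr_oppLR => /eqP ->; rewrite -scaleNr -scalemxAl mulmxA.
have := E1; rewrite E2 => /matrixP /(_ k l); move: nz; move: (U^T *m U) => M nz.
rewrite mxE [RHS]mxE mul_diag_mx mul_mx_diag !mxE mulNr -mulrN => /(mulfI s0).
rewrite [M k l * _]mulrC -mulNr => /(mulIf nz) /eqP.
by rewrite -rmorphN /= eqr_int eqr_oppLR => /eqP.
Qed.

Lemma gram_opp k l : (Qp^T *m Qp) k l != 0 -> forall j, wp k j = - wp l j.
Proof. by apply: (iso_gen (s := 1)); [left|move=> j; rewrite scale1r HQp]. Qed.

Let kap_opp k l : (forall j, wp k j = - wp l j) -> kap k = - kap l.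
Proof. by move=> E; rewrite /kap /dot -sumrN; apply: eq_bigr => j _; rewrite E mulNr. Qed.

Let U_iso k l : (Qp^T *m Qp) k l != 0 -> kap k = - kap l.
Proof. by move=> nz; apply: kap_opp; apply: gram_opp. Qed.

Let W_iso k l : (W^T *m W) k l != 0 -> kap k = - kap l.
Proof.
move=> nz; apply: kap_opp; apply: (iso_gen (s := -1) (U := W)) => //; first by right.
by move=> j; rewrite rmorphN scaleN1r HW.
Qed.

Local Notation EE := (Ext Qp kap).

(* Also the half sum of the positive weights, as the weights of an orthogonal
   representation are symmetric; [EE] has the opposite weight. *)
Definition halfw j : C := - (2^-1 * \sum_(k | kap k < 0) (wp k j)%:~R).

Let pHH x : dPi Pi (hh H x) *m Qp = Qp *m diag_mx (\row_i dotc (wt C (wp i)) x).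
Proof. exact: hh_diag (dPi_linear Pi_poly) HQp x. Qed.

Lemma Ext_H x : EE * PhiL (hh H x) = (- \sum_j halfw j * x j 0) *: EE.
Proof.
rewrite (Ext_Phi Qpu U_iso W_iso (pHH x)).
- congr (_ *: _); rewrite (eq_bigr (fun k => dotc (wt C (wp k)) x)) => [|k _]; last first.
    by rewrite !mxE eqxx mulr1n.
  rewrite /dotc exchange_big mulr_sumr -sumrN; apply: eq_bigr => j _ /=.
  rewrite /halfw mulNr opprK -mulrA mulr_suml; congr (_ * _).
  by apply: eq_bigr => k _; rewrite mxE.
- by move=> i k; rewrite !mxE; case: (i =P k) => [->|_]; [right|rewrite mulr0n eqxx].
- move=> k k0; rewrite !mxE eqxx mulr1n nu_wp // /dotc big1 // => j _.
  by rewrite mxE mul0r.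
Qed.

Let X i := invmx Qp *m dPi Pi (ebas Ad i) *m Qp.
Let DX i : dPi Pi (ebas Ad i) *m Qp = Qp *m X i. Proof. by rewrite /X !mulmxA mulmxV // mul1mx. Qed.

Let X_weight i k l : X i k l != 0 -> kap k = kap l + ht (al i).
Proof.
move=> nz; suff E j : wp k j = wp l j + al i j.
  by rewrite /kap /dot -big_split; apply: eq_bigr => j _; rewrite E mulrDl.
have Eb : bra (H j) (ebas Ad i) = (al i j)%:~R *: ebas Ad i.
  have := (ebas_wsp CA i).2 (delta_mx j 0); rewrite hh_delta dotcC dotc_delta mxE.
  by [].
have := dPi_bra AG Pi_poly Pi_M (gHj j) (ge i); rewrite Eb (linear_hypZ (dPi_linear Pi_poly)) => E.
have E1 : diag_mx (\row_i (wp i j)%:~R) *m X i - X i *m diag_mx (\row_i (wp i j)%:~R) = (al i j)%:~R *: X i.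
  have := DX i; move: (X i) => Y DXi; apply: (can_inj (mulKmx Qpu)); rewrite mulmxBr -scalemxAr !mulmxA -HQp -DXi.
  rewrite -(mulmxA (dPi Pi (H j)) Qp Y) -DXi -(mulmxA (dPi Pi (ebas Ad i)) Qp) -HQp !mulmxA -mulmxBl -E.
  by rewrite -scalemxAl.
have /matrixP /(_ k l) := E1; move: nz; move: (X i) => Y nz.
rewrite mul_diag_mx mul_mx_diag !mxE [Y k l * _]mulrC -mulrBl => /(mulIf nz) /eqP.
by rewrite -rmorphB /= eqr_int subr_eq addrC => /eqP.
Qed.

Lemma Ext_pos i : 0 < ht (al i) -> EE * PhiL (ebas Ad i) = 0.
Proof.
move=> hi; have X0 k : X i k k = 0.
  by apply/eqP; apply/negPn/negP => /X_weight /eqP; rewrite -subr_eq0 opprD addrA subrr add0r oppr_eq0 gt_eqF.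
rewrite (Ext_Phi Qpu U_iso W_iso (DX i)) => [|k l /X_weight ->|k _]; [|by left; rewrite ltrDl|exact: X0].
by rewrite big1 ?mulr0 ?scale0r.
Qed.

Lemma Ext_neg i : ht (al i) < 0 -> PhiL (ebas Ad i) * EE = 0.
Proof.
by move=> hi; apply: (Phi_Ext Qpu U_iso W_iso (DX i)) => k l /X_weight ->; rewrite gtrDl.
Qed.

Let Ext_even : alpha EE = EE := alpha_extr _ _.
Let Ext_tr : ctr EE = 1.
Proof. by apply: (ctr_extr Qpu U_iso W_iso); [apply: possel_uniq|apply: possel_pos]. Qed.

Lemma lift_of_integral : (exists u0 : 'I_r -> int, forall j, halfw j = (u0 j)%:~R) -> has_lift.
Proof.
move=> [u0 Hu]; have w_gen := weights_generate TC (ca_Qu CA) torQ.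
have [a [b [va [vb [sa sb vab]]]]] := virtual_all CA w_gen nu u0.
apply: (@spin_lift_of_semi _ _ G g t AG G_perfect _ _ _ _ _ _ CA nu nu_al _ Pi Pi_poly Pi_1 Pi_M Pi_orth Pi_det EE u0 Ext_even Ext_tr _ Ext_pos Ext_neg a b va vb sa sb vab).
move=> x; rewrite Ext_H; congr (- _ *: _); apply: eq_bigr => j _.
by rewrite mxE Hu.
Qed.

Section OnlyIf.
Variable rho : 'M[C]_n -> A.
Hypothesis rho_poly : polymap rho.
Hypothesis rho_M : forall x y, G x -> G y -> rho (x *m y) = rho x * rho y.
Hypothesis rho_even : forall x, G x -> alpha (rho x) = rho x.
Hypothesis rho_rev : forall x, G x -> rho x * crev (rho x) = 1.
Hypothesis rho_conj : forall x v, G x -> rho x * cvec v = cvec (Pi x *m v) * rho x.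

Lemma rho1 : rho 1%:M = 1.
Proof.
have G1 := al_1 AG; have := rho_M G1 G1; rewrite mulmx1 => /(congr1 (fun a => a * crev (rho 1%:M))).
by rewrite -mulrA rho_rev // mulr1.
Qed.

(** The derivative is even, has trace 0 because it is reversed to its opposite, and acts on vectors
    by dPi; [even_eq] then identifies it. *)
Lemma der_rho Y : Y \in g -> der rho 1%:M Y = PhiL Y.
Proof.
move=> gY; have lal : linear (@alpha C m) := @alpha_linear C m.
have lcr : linear (@crev C m) := @crev_linear C m.
have S0 : der rho 1%:M Y + crev (der rho 1%:M Y) = 0.
  have pcr := polymap_linear lcr rho_poly; have pp := polymap_mulA rho_poly pcr.
  have := @lie_der0 _ _ _ _ (al_lie AG) _ (fun x => rho x * crev (rho x) - 1) Y.
  rewrite (der_sub _ _ pp (PolyCst _ (1 : A))) der_cst subr0 (der_mulA _ _ rho_poly pcr) (der_linear _ _ lcr rho_poly).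
  rewrite rho1 crev1 mulr1 mul1r; apply=> //; first by apply: polymap_sub => //; apply: PolyCst.
  by move=> x Gx; rewrite rho_rev // subrr.
apply: even_eq.
- have := @lie_der0 _ _ _ _ (al_lie AG) _ (fun x => alpha (rho x) - rho x) Y.
  rewrite (der_sub _ _ (polymap_linear lal rho_poly) rho_poly) (der_linear _ _ lal rho_poly) => E0.
  apply/eqP; rewrite -subr_eq0; apply/eqP/E0 => //; first by apply: polymap_sub => //; apply: polymap_linear lal rho_poly.
  by move=> x Gx; rewrite rho_even // subrr.
- exact: alpha_Phi.
- rewrite ctr_Phi skew_trace ?sk // mulr0; have := congr1 (@ctr C m) S0.
  rewrite ctrD ctr_crev -mulr2n [ctr 0](_ : _ = 0); last by rewrite /ctr ffunE.
  by move/eqP; rewrite mulrn_eq0 => /eqP.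
move=> v; rewrite comm_Phi ?sk //.
have lPv : linear (fun M : 'M[C]_m => cvec (M *m v) : A) by move=> k M N; rewrite mulmxDl -scalemxAl cvec_linear.
have pPv := polymap_linear lPv Pi_poly.
have := @lie_der0 _ _ _ _ (al_lie AG) _ (fun x => rho x * cvec v - cvec (Pi x *m v) * rho x) Y.
have pl : polymap (fun x => rho x * cvec v) := polymap_linear (mul_linl (cvec v)) rho_poly.
have pr := polymap_mulA pPv rho_poly.
rewrite (der_sub _ _ pl pr) (der_linear _ _ (mul_linl (cvec v)) rho_poly) (der_mulA _ _ pPv rho_poly).
rewrite (der_linear _ _ lPv Pi_poly) rho1 mulr1 Pi_1 mul1mx -/(dPi Pi Y) => E0.
have {E0} := E0 (polymap_sub pl pr); rewrite /comm opprD addrCA => E0.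
apply/eqP; rewrite -subr_eq0 addrC E0 // => x Gx.
by rewrite rho_conj // subrr.
Qed.

Let b := vbasis {:A}.
Let N := \dim {:A}.
Let ca (a : A) : 'cV[C]_N := \col_i coord b i a.
Let F (x : 'M[C]_n) : 'M[C]_N := \matrix_(i, j) coord b i (b`_j * rho x).

Let ca_lin : linear ca. Proof. by move=> k u v; apply/matrixP => i j; rewrite !mxE linearP. Qed.
Let ca_inj a : ca a = 0 -> a = 0.
Proof.
move=> /matrixP E; rewrite (coord_vbasis (memvf a)) big1 // => i _.
by have := E i 0; rewrite !mxE => ->; rewrite scale0r.
Qed.

Let mat_act (z : A) a : (\matrix_(i, j) coord b i (b`_j * z)) *m ca a = ca (a * z).
Proof.
have ca_sum (I : Type) (s : seq I) (f : I -> A) : ca (\sum_(i <- s) f i) = \sum_(i <- s) ca (f i).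
  elim/big_rec2: _ => [|i u v _ <-]; first exact: linear_hyp0 ca_lin.
  exact: linear_hypD ca_lin _ _.
rewrite [in RHS](coord_vbasis (memvf a)) mulr_suml ca_sum; apply/matrixP => i j.
rewrite mxE summxE; apply: eq_bigr => k _; rewrite !mxE -scalerAl linearZ /= mulrC.
by [].
Qed.

Let mat_ext (P P' : 'M[C]_N) : (forall a, P *m ca a = P' *m ca a) -> P = P'.
Proof.
move=> E; apply/matrixP => i j; have := E b`_j.
have -> : ca b`_j = delta_mx j 0.
  apply/matrixP => k l; rewrite !mxE (ord1 l) coord_free ?(basis_free (vbasisP _)) // eqxx andbT.
  by rewrite eq_sym.
by rewrite -!colE => /matrixP /(_ i 0); rewrite !mxE.
Qed.

Let coordl i j : linear (fun z : A => coord b i (b`_j * z) : C^o).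
Proof. by move=> k u v; rewrite mul_linr linearP. Qed.

Let F_poly : polymap F.
Proof.
apply: polymap_mx => i j; have := polymap_linear (coordl i j) rho_poly.
by apply: polymap_ext => x; rewrite mxE.
Qed.

(** Right multiplication by rho is a polynomial representation of T on the Clifford algebra, whose
    weights are integral; [EE] is an eigenvector of weight opposite to [halfw]. *)
Lemma integral_of_lift : forall j, exists z : int, halfw j = z%:~R.
Proof.
move=> j.
have F1 : F 1%:M = 1%:M by apply: mat_ext => a; rewrite mat_act rho1 mulr1 mul1mx.
(* Right multiplication reverses products, which is harmless on the commutative group T. *)
have FM x y : T x -> T y -> F (x *m y) = F x *m F y.
  move=> Tx Ty; have xy : x *m y = y *m x.
    have [z nz ->] := tc_sur TC Tx; have [z' nz' ->] := tc_sur TC Ty.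
    by rewrite -!(tc_mul TC) //; congr tor; apply/funext => k; rewrite mulrC.
  apply: mat_ext => a; rewrite -mulmxA !mat_act xy rho_M ?mulrA //; exact: TG.
have [Q2 [w2 [Q2u HQ2]]] := chart_weights TC H_lder F_poly F1 FM.
have DF := der_tor_weights TC H_lder F_poly HQ2 j.
have EF : der F 1%:M (H j) *m ca EE = (- halfw j) *: ca EE.
  have -> : der F 1%:M (H j) = \matrix_(i, k) coord b i (b`_k * der rho 1%:M (H j)).
    apply/matrixP => i k; rewrite -der_mxentry; last exact: F_poly.
    rewrite (@der_ext _ _ _ _ (fun x => coord b i (b`_k * rho x) : C^o)) => [|x]; last by rewrite mxE.
    by rewrite (der_linear _ _ (coordl i k) rho_poly) mxE.
  rewrite mat_act der_rho // -(hh_delta H j) Ext_H.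
  have -> : \sum_k halfw k * (delta_mx j 0 : 'cV[C]_r) k 0 = halfw j.
    rewrite (bigD1 j) //= mxE !eqxx mulr1 big1 ?addr0 // => k /negbTE kj.
    by rewrite mxE kj mulr0.
  exact: linear_hypZ ca_lin _ _.
have nz : invmx Q2 *m ca EE != 0.
  apply/eqP => /(congr1 (mulmx Q2)); rewrite mulKVmx // mulmx0 => /ca_inj E0.
  by have := Ext_tr; rewrite E0 /ctr ffunE => /eqP; rewrite eq_sym oner_eq0.
have [k nk] : exists k, (invmx Q2 *m ca EE) k 0 != 0.
  apply/existsP; apply: contraR nz; rewrite negb_exists => /forallP E0.
  by apply/eqP/matrixP => i l; rewrite (ord1 l) [RHS]mxE; have := E0 i; rewrite negbK => /eqP.
exists (- w2 k j); apply/eqP; rewrite rmorphN -eqr_oppLR; apply/eqP/(mulIf nk).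
have : diag_mx (\row_i (w2 i j)%:~R) *m (invmx Q2 *m ca EE) = (- halfw j) *: (invmx Q2 *m ca EE).
  rewrite scalemxAr -EF !mulmxA; congr (_ *m _); apply: (can_inj (mulmxK Q2u)).
  by rewrite mulmxKV // -mulmxA DF mulKmx.
by rewrite mul_diag_mx => /matrixP /(_ k 0) E0; move: E0; rewrite mxE [(\row_i _) 0 k]mxE [RHS]mxE => ->.
Qed.

End OnlyIf.

Theorem lift_iff_integral : has_lift <-> forall j, exists z : int, halfw j = z%:~R.
Proof.
split; first by move=> [rho [? ? ? ? ?]]; apply: (integral_of_lift (rho := rho)).
by move=> /choice [u0 Hu]; apply: lift_of_integral; exists u0.
Qed.

Definition isint (x : C) := exists z : int, x = z%:~R.

Lemma isintD x y : isint x -> isint y -> isint (x + y).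
Proof. by move=> [a ->] [c ->]; exists (a + c); rewrite rmorphD. Qed.
Lemma isintN x : isint x -> isint (- x).
Proof. by move=> [a ->]; exists (- a); rewrite rmorphN. Qed.
Lemma isintM x y : isint x -> isint y -> isint (x * y).
Proof. by move=> [a ->] [c ->]; exists (a * c); rewrite rmorphM. Qed.
Lemma isint_int (z : int) : isint z%:~R. Proof. by exists z. Qed.
Lemma isint_sum (I : Type) (s : seq I) (P : pred I) (f : I -> C) : (forall i, isint (f i)) -> isint (\sum_(i <- s | P i) f i).
Proof. by move=> Hf; elim/big_rec: _ => [|i x _ Hx]; [exists 0|apply: isintD]. Qed.

Lemma half_square (s : int) : isint (2^-1 * (s%:~R * s%:~R - s%:~R)).
Proof.
have [z Ez] : exists z : int, s * s - s = 2 * z.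
  have := divz_eq s 2; set q := (s %/ 2)%Z; have := modz_ge0 s (isT : (2 : int) != 0).
  have := ltz_mod s (isT : (2 : int) != 0); case: (s %% 2)%Z => [[|[|k]]|k] //= _ _ ->.
    by exists (2 * q * q - q); ring.
  by exists (2 * q * q + q); ring.
exists z; rewrite -rmorphM -rmorphB Ez rmorphM mulrA mulVf ?mul1r //.
by rewrite pnatr_eq0.
Qed.

Lemma trace_square (v : 'I_r -> int) : \tr (dPi Pi (hh H (wt C v)) *m dPi Pi (hh H (wt C v))) =
  2 * \sum_(k | kap k < 0) (dot (wp k) v)%:~R * (dot (wp k) v)%:~R.
Proof.
have Ed k : dotc (wt C (wp k)) (wt C v) = (dot (wp k) v)%:~R.
  by rewrite /dot rmorph_sum; apply: eq_bigr => j _; rewrite !mxE rmorphM.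
have -> : dPi Pi (hh H (wt C v)) = Qp *m diag_mx (\row_i (dot (wp i) v)%:~R) *m invmx Qp.
  apply: (can_inj (mulmxK Qpu)); rewrite mulmxKV // pHH; congr (_ *m diag_mx _).
  by apply/matrixP => a c; rewrite !mxE Ed.
rewrite !mulmxA mulmxKV // mxtrace_mulC !mulmxA mulVmx // mul1mx mulmx_diag mxtrace_diag.
under eq_bigr do rewrite !mxE.
pose f k : C := (dot (wp k) v)%:~R * (dot (wp k) v)%:~R.
have Gu : Qp^T *m Qp \in unitmx by rewrite unitmx_mul unitmx_tr Qpu.
(* The Gram matrix of the weight basis is invertible and links only opposite weights, so it
   conjugates one diagonal matrix to the other; this avoids choosing a pairing of the indices. *)
have E1 : \sum_(k | 0 < kap k) f k = \sum_(k | kap k < 0) f k.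
  pose Dp : 'M[C]_m := diag_mx (\row_k (if 0 < kap k then f k else 0)).
  pose Dn : 'M[C]_m := diag_mx (\row_k (if kap k < 0 then f k else 0)).
  have E0 : Dp *m (Qp^T *m Qp) = (Qp^T *m Qp) *m Dn.
    apply/matrixP => k l; have := @gram_opp k l; move: (Qp^T *m Qp) => M Hk.
    rewrite mul_diag_mx mul_mx_diag !mxE.
    have [->|/Hk E] := eqVneq (M k l) 0; first by rewrite mulr0 mul0r.
    rewrite (kap_opp E) oppr_gt0 mulrC; congr (_ * _); case: ifP => // _.
    by rewrite /f (_ : dot (wp k) v = - dot (wp l) v) ?rmorphN ?mulrNN // /dot -sumrN; apply: eq_bigr => j _; rewrite E mulNr.
  have Tp : \tr Dp = \sum_(k | 0 < kap k) f k.
    by rewrite mxtrace_diag [RHS]big_mkcond; apply: eq_bigr => k _; rewrite mxE.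
  have Tn : \tr Dn = \sum_(k | kap k < 0) f k.
    by rewrite mxtrace_diag [RHS]big_mkcond; apply: eq_bigr => k _; rewrite mxE.
  by rewrite -Tp -Tn -[Dp](mulmxK Gu) E0 mxtrace_mulC mulKmx.
rewrite (bigID (fun k => kap k < 0)) /= [2](_ : _ = 1 + 1) // mulrDl mul1r; congr (_ + _).
rewrite -E1 big_mkcond [RHS]big_mkcond; apply: eq_bigr => k _; case: ltgtP => // k0.
rewrite (_ : dot (wp k) v = 0) ?mulr0 // /dot big1 // => j _.
have /matrixP /(_ j 0) := nu_wp k0; rewrite !mxE => /eqP; rewrite intr_eq0 => /eqP ->.
by rewrite mul0r.
Qed.

(** The difference between a quarter of the trace and half the sum of the pairings s, over the
    weights of negative height, is the sum of the integers (s^2 - s) / 2. *)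
Theorem lift_iff_trace : has_lift <-> forall v : 'I_r -> int,
  isint (4^-1 * \tr (dPi Pi (hh H (wt C v)) *m dPi Pi (hh H (wt C v)))).
Proof.
rewrite lift_iff_integral.
have E v : 4^-1 * \tr (dPi Pi (hh H (wt C v)) *m dPi Pi (hh H (wt C v))) =
    \sum_(k | kap k < 0) 2^-1 * ((dot (wp k) v)%:~R * (dot (wp k) v)%:~R - (dot (wp k) v)%:~R)
    - \sum_j (v j)%:~R * halfw j.
  rewrite trace_square mulrA (_ : 4^-1 * 2 = 2^-1); last by field.
  under [in RHS]eq_bigr do rewrite mulrBr; rewrite sumrB -!mulr_sumr -addrA -[LHS]addr0; congr (_ + _).
  have -> : \sum_j (v j)%:~R * halfw j = - (2^-1 * \sum_(k | kap k < 0) (dot (wp k) v)%:~R).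
    under eq_bigr do rewrite /halfw mulrN mulrCA; rewrite sumrN -mulr_sumr; congr (- (_ * _)).
    under eq_bigr do rewrite mulr_sumr; rewrite exchange_big; apply: eq_bigr => k _ /=.
    by rewrite /dot rmorph_sum; apply: eq_bigr => j _; rewrite rmorphM mulrC.
  by rewrite opprK addNr.
have I1 v : isint (\sum_(k | kap k < 0) 2^-1 * ((dot (wp k) v)%:~R * (dot (wp k) v)%:~R - (dot (wp k) v)%:~R)).
  by apply: isint_sum => k; apply: half_square.
split=> [Hj v|Hv j].
  by rewrite E; apply: isintD (I1 v) _; apply/isintN/isint_sum => j; apply: isintM (isint_int _) (Hj j).
have := Hv (fun l => (l == j)%:R); rewrite E => HE.
have := isintD (isintN HE) (I1 (fun l => (l == j)%:R)); rewrite opprB subrK => -[z Ez]; exists z.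
rewrite -Ez (bigD1 j) //= eqxx mul1r big1 ?addr0 // => l /negbTE lj.
by rewrite lj mul0r.
Qed.

End Criterion.

(** * Comparison with the definitions of the statement *)

Section Translate.
Variables (R : realType) (n : nat).
Local Notation C := (R[i]).
Local Notation M := 'M[C]_n.

Lemma mxdiff1_der (p : {mpoly C[n * n]}) (X : M) : mxdiff1 p X = der (fun x => mxeval p x : C^o) 1%:M X.
Proof. by rewrite /mxdiff1 /mxeval der_meval. Qed.

Lemma mxeval_poly (p : {mpoly C[n * n]}) : polymap (fun x => mxeval p x : C^o).
Proof. exact: polymap_meval. Qed.

Lemma poly_mxeval (f : M -> C^o) : polymap f -> exists p : {mpoly C[n * n]}, forall x, f x = mxeval p x.
Proof. exact: meval_polymap. Qed.

Lemma closed_poly (S : set M) : zariski_closed S -> poly_closed S.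
Proof.
move=> [I ->]; exists (fun f => exists2 p, I p & f = fun x => mxeval p x); split.
  by move=> _ [p _ ->]; apply: mxeval_poly.
move=> x; split=> [[Gx Hx]|[ux Hx]]; first by split=> // _ [p Ip ->]; apply: Hx.
by split=> // p Ip; apply: (Hx (fun x => mxeval p x)); exists p.
Qed.

Lemma poly_closed_zariski (S : set M) : poly_closed S -> zariski_closed S.
Proof.
move=> [I [pI HS]]; exists (fun p : {mpoly C[n * n]} => exists2 f, I f & forall x, f x = mxeval p x).
apply/seteqP; split=> x /= => [/HS [ux Hx]|[ux Hx]].
  by split=> // p [f If <-]; apply: Hx.
apply/HS; split=> // f If; have [p Hp] := poly_mxeval (pI f If).
by rewrite Hp; apply: Hx; exists f.
Qed.

Lemma tangent_space (S : set M) (g : {vspace M}) : is_lie_algebra S g -> forall X, X \in g <->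
  forall f : M -> C^o, polymap f -> (forall x, S x -> f x = 0) -> der f 1%:M X = 0.
Proof.
move=> Hg X; rewrite (Hg X); split=> [HX f pf f0|HX p p0].
  have [p Hp] := poly_mxeval pf; have -> : f = fun x => mxeval p x by apply/funext.
  by rewrite -mxdiff1_der; apply: HX => x Sx; rewrite -Hp f0.
by rewrite mxdiff1_der; apply: HX => //; apply: mxeval_poly.
Qed.

Lemma group_lie (G : set M) (g : {vspace M}) : algebraic_group G -> zariski_connected G -> is_lie_algebra G g ->
  algebraic_lie G g.
Proof.
move=> [Gc G1 GM GV] Gconn Hg; split=> //; first exact: closed_poly.
  move=> A B /poly_closed_zariski cA /poly_closed_zariski cB GAB GnAB; apply: Gconn => //.
  by apply/seteqP; split=> x //= [[Gx Ax] Bx]; case: (GnAB x Gx Ax Bx).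
exact: tangent_space.
Qed.

Lemma regular_poly (G : set M) (f : M -> C) : (forall x, G x -> \det x = 1) -> regular G f ->
  exists F : M -> C^o, polymap F /\ forall x, G x -> f x = F x.
Proof.
move=> Gd [p [k Hp]]; exists (fun x => mxeval p x); split; first exact: mxeval_poly.
by move=> x Gx; rewrite Hp // Gd // expr1n divr1.
Qed.

Lemma poly_regular (G : set M) (f : M -> C) (F : M -> C^o) : polymap F -> (forall x, G x -> f x = F x) -> regular G f.
Proof.
move=> pF E; have [p Hp] := poly_mxeval pF; exists p, 0%N => x Gx.
by rewrite expr0 divr1 E.
Qed.

End Translate.

Section Tori.
Variables (R : realType) (n : nat).
Local Notation C := (R[i]).
Local Notation M := 'M[C]_n.

Definition dgm r (z : 'I_r -> C) : 'M[C]_r := diag_mx (\row_j z j).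

Lemma dgm_group r (z : 'I_r -> C) : nzv z -> @diag_group R r (dgm z).
Proof.
move=> nz; split; last exact: diag_mx_is_diag.
rewrite /GL /= unitmxE unitfE det_diag; apply/prodf_neq0 => j _.
by rewrite mxE.
Qed.

Lemma diag_group_dgm r (x : 'M[C]_r) : @diag_group R r x -> nzv (fun j => x j j) /\ x = dgm (fun j => x j j).
Proof.
move=> [ux /is_diag_mxP dx]; have Ex : x = dgm (fun j => x j j).
  apply/matrixP => i j; rewrite !mxE; case: (i =P j) => [->|/eqP ij]; first by rewrite mulr1n.
  by rewrite mulr0n dx.
split=> // j; move: ux; rewrite /GL /= Ex unitmxE unitfE det_diag => /prodf_neq0 /(_ j isT).
by rewrite !mxE eqxx mulr1n.
Qed.

Lemma dgmM r (z z' : 'I_r -> C) : dgm (fun j => z j * z' j) = dgm z *m dgm z'.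
Proof. by rewrite /dgm mulmx_diag; congr diag_mx; apply/matrixP => i j; rewrite !mxE. Qed.

Lemma dgm1 r : dgm (fun _ : 'I_r => 1) = 1%:M.
Proof. by rewrite -diag_const_mx; congr diag_mx; apply/matrixP => i j; rewrite !mxE. Qed.

Lemma torus_has_chart (T : set M) : torus T -> (forall x, T x -> \det x = 1) ->
  exists r (tor : ('I_r -> C) -> M) p pv, torus_chart T tor p pv.
Proof.
move=> [[Tc T1 TM TV] [r [f [h [[fT fM freg] [hD hM hreg] hf fh]]]]] Td.
have uT x : T x -> x \in unitmx by move=> /Td dx; rewrite unitmxE dx unitr1.
have /choice [p Hp] : forall j : 'I_r, exists F : M -> C^o, polymap F /\ forall x, T x -> h x j j = F x.
  by move=> j; apply: regular_poly.
pose pv j : M -> C^o := fun x => p j (\adj x).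
have vadj x : T x -> \adj x = invmx x.
  by move=> Tx; rewrite -[\adj x](mulKmx (uT x Tx)) mul_mx_adj Td // mulmx1.
exists r, (fun z => f (dgm z)), p, pv.
have f1 : f 1%:M = 1%:M.
  have D1 : @diag_group R r 1%:M by rewrite -dgm1; apply: dgm_group => j; apply: oner_neq0.
  have := fM _ _ D1 D1; rewrite mulmx1 => /(congr1 (mulmx (invmx (f 1%:M)))).
  by rewrite mulKmx ?mulVmx ?uT //; apply: fT.
have pf j z : nzv z -> p j (f (dgm z)) = z j.
  move=> nz; have [_ Hj] := Hp j; rewrite -Hj; last by apply/fT/dgm_group.
  by rewrite hf ?mxE ?eqxx ?mulr1n //; apply: dgm_group.
split=> //.
- by move=> z nz; apply/fT/dgm_group.
- move=> x Tx; have [nz Ex] := diag_group_dgm (hD x Tx); exists (fun j => h x j j) => //.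
  by rewrite -Ex fh.
- by move=> z z' nz nz'; rewrite dgmM fM //; apply: dgm_group.
- by rewrite dgm1.
- move=> k i j; have [q [l Hq]] := freg i j.
  have [q' Hq'] := polymap_line 1%:M (delta_mx k k) (mxeval_poly q).
  (* A coordinate subgroup lies on a line through 1, so numerators restrict to polynomials in y -
     1. *)
  have E y : dgm (evec k y) = 1%:M + (y - 1) *: delta_mx k k.
    apply/matrixP => a b; rewrite !mxE /evec; case: (a =P b) => [->|/eqP ab].
      by rewrite mulr1n; case: (b == k); rewrite /= ?mulr1 ?mulr0 ?addr0 // addrC subrK.
    rewrite mulr0n add0r; case: (a =P k) => [Ea|_]; case: (b =P k) => [Eb|_]; rewrite /= ?mulr0 //.
    by rewrite Ea Eb eqxx in ab.
  exists ((q' \Po ('X - 1%:P))^`().[1] - l%:R * (q' \Po ('X - 1%:P)).[1]); exists (q' \Po ('X - 1%:P)), l.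
  split=> // y y0; rewrite Hq; last by apply/dgm_group/nzv_evec.
  congr (_ / _).
    by rewrite E Hq' horner_comp !hornerE.
  congr (_ ^+ _); rewrite det_diag (bigD1 k) //= mxE /evec eqxx big1 ?mulr1 // => a /negbTE ak.
  by rewrite mxE ak.
- by move=> j; have [] := Hp j.
- by move=> j; apply: polymap_comp (polymap_adj (@polymap_id C n)) _; have [] := Hp j.
move=> j z nz; rewrite /pv vadj; last by apply/fT/dgm_group.
have nzi : nzv (fun j => (z j)^-1) by move=> k; rewrite invr_eq0.
have -> : invmx (f (dgm z)) = f (dgm (fun j => (z j)^-1)).
  have uz : f (dgm z) \in unitmx by apply/uT/fT/dgm_group.
  rewrite -[RHS](mulKmx uz) -fM ?dgmM //; [|exact: dgm_group|exact: dgm_group].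
  rewrite -dgmM (_ : (fun j => z j * (z j)^-1) = fun=> 1) ?dgm1 ?f1 ?mulmx1 //.
  by apply/funext => k; rewrite divff.
by rewrite pf.
Qed.

(** Multiplying by a power of the determinant, the product of all coordinates, makes every exponent
    nonnegative. *)
Lemma mono_regular r (u : 'I_r -> int) : exists (F : 'M[C]_r -> C^o) (k : nat), polymap F /\
  forall d, @diag_group R r d -> mono u (fun j => d j j) = F d / \det d ^+ k.
Proof.
pose k := (\sum_j `|u j|)%N; exists (fun d => \prod_j (d j j) ^+ absz (u j + k%:Z)), k.
split.
  apply: polymap_prod => j; elim: (absz _) => [|l IH]; first exact: PolyCst.
  by apply: polymap_ext (polymap_mul (polymap_entry C j j) IH) => x; rewrite exprS.
move=> d Dd; have [nz Ed] := diag_group_dgm Dd.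
have -> : \det d = \prod_j d j j by rewrite {1}Ed /dgm det_diag; apply: eq_bigr => j _; rewrite mxE.
rewrite -prodrXl -prodfV -big_split.
apply: eq_bigr => j _ /=.
have -> : d j j ^+ absz (u j + k%:Z) = d j j ^ (u j + k%:Z).
  have : 0 <= u j + k%:Z.
    have : (`|u j| <= k)%N by rewrite /k (bigD1 j) //= leq_addr.
    by lia.
  by case: (u j + k%:Z).
by rewrite expfzDr // -exprnP mulfK // expf_neq0.
Qed.

(** The converse passage is needed because maximality of T is stated among sets satisfying [torus],
    whereas the tori constructed from replicas come with charts. *)
Lemma chart_torus (T : set M) r (tor : ('I_r -> C) -> M) p pv : torus_chart T tor p pv -> poly_closed T ->
  (forall x, T x -> x \in unitmx) -> torus T.
Proof.
move=> TC Tc uT.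
have T1 : T 1%:M by rewrite -(tc_one TC); apply: (tc_in TC) => j; apply: oner_neq0.
have TM x y : T x -> T y -> T (x *m y).
  move=> /(tc_sur TC) [z nz ->] /(tc_sur TC) [z' nz' ->]; rewrite -(tc_mul TC) //.
  by apply/(tc_in TC)/nzvM.
have TV x : T x -> T (invmx x).
  move=> Tx; have [z nz Ex] := tc_sur TC Tx; have nzi : nzv (fun j => (z j)^-1) by move=> k; rewrite invr_eq0.
  rewrite (_ : invmx x = tor (fun j => (z j)^-1)); first exact: (tc_in TC).
  rewrite -[RHS](mulKmx (uT x Tx)) Ex -(tc_mul TC) //.
  rewrite (_ : (fun j => z j * (z j)^-1) = fun=> 1) ?(tc_one TC) ?mulmx1 //.
  by apply/funext => k; rewrite divff.
split; first by split=> //; apply: poly_closed_zariski.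
have [Q [w [Qu Hw]]] := simultaneous_weights (tc_laurent TC) (tc_mul TC) (tc_one TC).
exists r, (fun d => tor (fun j => d j j)), (fun x => dgm (fun j => p j x)); split.
- split.
  + by move=> d /diag_group_dgm [nz _]; apply: (tc_in TC).
  + move=> d d' Dd Dd'; have [nz Ed] := diag_group_dgm Dd; have [nz' Ed'] := diag_group_dgm Dd'.
    rewrite -(tc_mul TC) //; congr tor; apply/funext => j; rewrite {1}Ed {1}Ed' -dgmM mxE eqxx mulr1n.
    by rewrite mxE.
  move=> i j; have /choice [F HF] := fun l => mono_regular (w l).
  have {HF} /choice [k HF] := HF.
  pose K := (\sum_l k l)%N.
  pose FF (d : 'M[C]_r) : C^o := \sum_l (Q i l * invmx Q l j) * ((F l d : C) * \det d ^+ (K - k l)).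
  have pdet (a : nat) : polymap (fun d : 'M[C]_r => \det d ^+ a : C^o).
    by apply: polymap_expn; apply: polymap_det; apply: polymap_id.
  have pFF : polymap FF.
    apply: polymap_sum => l; apply: polymap_mulc; apply: polymap_mul => //.
    by have [] := HF l.
  have [q Hq] := poly_mxeval pFF; exists q, K => d Dd; rewrite -Hq.
  have [nz Ed] := diag_group_dgm Dd.
  have -> : tor (fun j => d j j) = Q *m diag_mx (\row_l mono (w l) (fun j => d j j)) *m invmx Q.
    by rewrite -Hw // mulmxK.
  rewrite mxE mulr_suml; apply: eq_bigr => l _; rewrite mul_mx_diag !mxE; have [_ ->] := HF l => //.
  have dn : \det d != 0 by case: Dd; rewrite /GL /= unitmxE unitfE.
  have kK : (k l <= K)%N by rewrite /K (bigD1 l) //= leq_addr.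
  have E : \det d ^+ K = \det d ^+ (K - k l) * \det d ^+ k l by rewrite -exprD subnK.
  rewrite E; set D1 := \det d ^+ (K - k l); set D2 := \det d ^+ k l.
  have D1n : D1 != 0 by rewrite expf_neq0.
  have D2n : D2 != 0 by rewrite expf_neq0.
  by field; rewrite D1n D2n.
- split.
  + move=> x /(tc_sur TC) [z nz ->]; apply: dgm_group => j.
    by rewrite (tc_p TC).
  + move=> x y /(tc_sur TC) [z nz ->] /(tc_sur TC) [z' nz' ->]; rewrite -dgmM; congr dgm; apply/funext => j.
    by rewrite -(tc_mul TC) // !(tc_p TC) //; apply: nzvM.
  move=> i j; apply: (@poly_regular _ _ _ _ (fun x => if i == j then p i x else 0)).
    by case: (i == j); [apply: (tc_poly TC)|apply: PolyCst].
  by move=> x _; rewrite !mxE; case: eqP => [->|_]; rewrite ?mulr1n ?mulr0n.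
- move=> d Dd; have [nz Ed] := diag_group_dgm Dd; rewrite [RHS]Ed; congr dgm; apply/funext => j.
  by rewrite (tc_p TC).
- move=> x /(tc_sur TC) [z nz ->]; congr tor; apply/funext => j.
  by rewrite mxE eqxx mulr1n mxE (tc_p TC).
Qed.

End Tori.

(** * Linear forms on t in coordinates *)

Section Duals.
Variables (R : realType) (n : nat).
Local Notation C := (R[i]).
Local Notation M := 'M[C]_n.
Variables (g t : {vspace M}) (r : nat) (H : 'I_r -> M).
Local Notation d := (\dim g).
Variables (Q : M) (w : 'I_n -> 'I_r -> int) (A : 'M[C]_d) (al : 'I_d -> 'I_r -> int).
Hypothesis CA : cartan t H Q w A al.

Lemma killing_kil X Y : X \in g -> Y \in g -> killing g X Y = kil g X Y.
Proof.
move=> gX gY; apply: eq_bigr => i _.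
have gb : (vbasis g)`_i \in g by apply: vbasis_g.
have gYb : bra Y (vbasis g)`_i \in g by apply: (ca_sub CA).
have := adm_act X gYb; rewrite -adm_act // mulmxA => /matrixP /(_ i 0); rewrite [RHS]mxE => <-.
have -> : cv g (vbasis g)`_i = delta_mx i 0.
  apply/matrixP => k l; rewrite !mxE (ord1 l) coord_free ?(basis_free (vbasisP _)) // eqxx andbT.
  by rewrite eq_sym.
by rewrite -colE mxE.
Qed.

Definition tel (x : 'cV[C]_r) : subvs_of t := vsproj t (hh H x).

Lemma val_tel x : vsval (tel x) = hh H x.
Proof. by rewrite vsprojK // (ca_hht CA). Qed.

Lemma tel_sur (nu : subvs_of t) : exists x, nu = tel x.
Proof. by have [x Ex] := ca_thh CA (subvsP nu); exists x; apply: val_inj; rewrite /= val_tel. Qed.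

Definition av (a : dual t) : 'cV[C]_r := \col_j a (tel (delta_mx j 0)).

Lemma tel_linear : linear tel.
Proof. by move=> k x y; rewrite /tel hh_linear linearP. Qed.

Lemma av_val (a : dual t) x : a (tel x) = dotc (av a) x.
Proof.
have -> : tel x = \sum_j x j 0 *: tel (delta_mx j 0).
  have {1}-> : x = \sum_j x j 0 *: delta_mx j 0.
    apply/matrixP => i k; rewrite (ord1 k) summxE (bigD1 i) //= !mxE !eqxx mulr1 big1 ?addr0 // => j ji.
    by rewrite !mxE eq_sym (negPf ji) mulr0.
  have t0 := linear_hyp0 tel_linear.
  elim/big_rec2: _ => [|j y1 y2 _ <-]; first exact: t0.
  by rewrite (tel_linear (x j 0)).
by rewrite linear_sum; apply: eq_bigr => j _; rewrite linearZ /= mxE mulrC.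
Qed.

Lemma av_inj (a b : dual t) : av a = av b -> a = b.
Proof. by move=> E; apply/lfunP => nu; have [x ->] := tel_sur nu; rewrite !av_val E. Qed.

Lemma av_linear : linear av.
Proof. by move=> k a b; apply/matrixP => i j; rewrite !mxE !lfunE /= lfunE. Qed.

Lemma avD a b : av (a + b) = av a + av b.
Proof. exact: linear_hypD av_linear _ _. Qed.
Lemma avZ k a : av (k *: a) = k *: av a.
Proof. exact: linear_hypZ av_linear _ _. Qed.
Lemma av0 : av 0 = 0. Proof. exact: linear_hyp0 av_linear. Qed.
Lemma avN a : av (- a) = - av a. Proof. by rewrite -scaleN1r avZ scaleN1r. Qed.
Lemma av_sum (I : Type) (s : seq I) (F : I -> dual t) : av (\sum_(i <- s) F i) = \sum_(i <- s) av (F i).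
Proof. by elim/big_rec2: _ => [|i a b _ <-]; rewrite ?av0 ?avD. Qed.

Lemma linfunE_hyp (aT rT : vectType C) (f : aT -> rT) : linear f -> forall x, linfun f x = f x.
Proof.
move=> lf x; pose F : {linear aT -> rT} := HB.pack f (GRing.isLinear.Build C aT rT *:%R f lf).
exact: (lfunE F x).
Qed.

(** The linear form with coordinates [mu], expressed by the Killing form so that it is linear
    without inverting [hh]. *)
Definition mu_dual (mu : 'cV[C]_r) : dual t :=
  linfun (fun nu : subvs_of t => kil g (tv g H mu) (vsval nu) : C^o).

Lemma av_mu_dual mu : av (mu_dual mu) = mu.
Proof.
have lf : linear (fun nu : subvs_of t => kil g (tv g H mu) (vsval nu) : C^o).
  by move=> k x y; rewrite linearP kilDr kilZr.
apply/matrixP => j k; rewrite mxE /mu_dual linfunE_hyp // val_tel (kil_tv CA) dotcC dotc_delta.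
by rewrite (ord1 k).
Qed.

Lemma killing_isoE (nu nu' : subvs_of t) : killing_iso g t nu nu' = kil g (vsval nu) (vsval nu').
Proof.
have gt (x : subvs_of t) : vsval x \in g by apply: (t_in_g CA); apply: subvsP.
have l1 (x : subvs_of t) : linear (fun y : subvs_of t => killing g (vsval x) (vsval y) : C^o).
  by move=> k y z; rewrite !killing_kil // linearP kilDr kilZr.
have l2 : linear (fun x : subvs_of t => linfun (fun y : subvs_of t => killing g (vsval x) (vsval y) : C^o) : dual t).
  move=> k x y; apply/lfunP => z; rewrite add_lfunE scale_lfunE.
  have E1 (u : subvs_of t) : linfun (fun y : subvs_of t => killing g (vsval u) (vsval y) : C^o) z = kil g (vsval u) (vsval z).
    by rewrite (linfunE_hyp (l1 u)) killing_kil.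
  by rewrite !E1 linearP kilDl kilZl.
by rewrite /killing_iso (linfunE_hyp l2) (linfunE_hyp (l1 nu)) killing_kil.
Qed.

Lemma killing_iso_inv (a : dual t) : vsval ((killing_iso g t)^-1%VF a) = tv g H (av a).
Proof.
set y := (_^-1%VF a); have Ea : killing_iso g t y = a.
  apply: limg_lfunVK; apply/memv_imgP; exists (tel (invmx (gram g H) *m av a)); first exact: memvf.
  apply/lfunP => nu; have [x ->] := tel_sur nu; rewrite killing_isoE !val_tel av_val.
  by rewrite (kil_tv CA (av a) x).
have [x Ex] := tel_sur y; rewrite Ex val_tel in Ea *; apply/eqP; rewrite -subr_eq0; apply/eqP.
apply: (kil_t_nondeg CA).
  by rewrite memvB // (ca_hht CA).
move=> z; rewrite -scaleN1r kilDl kilZl (kil_tv CA) -av_val -Ea killing_isoE !val_tel.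
by rewrite mulN1r subrr.
Qed.

Lemma killing_dual_form (a b : dual t) : killing_dual g a b = form g H (av a) (av b).
Proof.
rewrite /killing_dual !killing_iso_inv killing_kil ?(form_tv CA) 1?(form_sym CA) //;
  by apply: (t_in_g CA); apply: (ca_hht CA).
Qed.

Lemma is_root_rootw (a : dual t) : is_root g a <-> rootw g H (av a).
Proof.
split=> [[a0 [X [gX X0 HX]]]|[a0 [X [gX HX] X0]]].
  split; first by apply: contra a0 => /eqP; rewrite -av0 => /av_inj ->.
  by exists X => //; split=> // x; have := HX (tel x); rewrite val_tel av_val.
split; first by apply: contra a0 => /eqP ->; rewrite av0.
by exists X; split=> // nu; have [x ->] := tel_sur nu; rewrite val_tel av_val -HX.
Qed.

Variable P : seq (dual t).
Hypothesis P_pos : positive_system g P.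
Definition Pw (mu : 'cV[C]_r) := exists2 a, a \in P & av a = mu.

Lemma Pw_root mu : Pw mu -> rootw g H mu.
Proof. by move=> [a Pa <-]; apply/is_root_rootw; case: P_pos => _ PR _ _; apply: PR. Qed.

Lemma Pw_sign mu : rootw g H mu -> Pw mu \/ Pw (- mu).
Proof.
move=> rmu; have [_ _ Px _] := P_pos; have := Px (mu_dual mu).
rewrite is_root_rootw av_mu_dual => /(_ rmu).
have [Pm _|_ /= Pm] := boolP (mu_dual mu \in P); first by left; exists (mu_dual mu); rewrite ?av_mu_dual.
by right; exists (- mu_dual mu); rewrite ?avN ?av_mu_dual.
Qed.

Lemma Pw_opp mu : Pw mu -> ~ Pw (- mu).
Proof.
move=> [a Pa <-] [b Pb Eb]; have [_ PR Px _] := P_pos; have := Px _ (PR _ Pa).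
by rewrite Pa -(_ : b = - a) ?Pb //; apply: av_inj; rewrite avN.
Qed.

Lemma Pw_closed mu nu : Pw mu -> Pw nu -> rootw g H (mu + nu) -> Pw (mu + nu).
Proof.
move=> [a Pa <-] [b Pb <-]; rewrite -avD -is_root_rootw => rab.
by exists (a + b) => //; case: P_pos => _ _ _; apply.
Qed.

Lemma Pw_sum_nonzero (s : seq (dual t)) : {subset s <= P} -> s != [::] -> \sum_(a <- s) a != 0.
Proof.
move=> sP s0; have := positive_sum CA Pw_root Pw_opp Pw_closed (s := [seq av a | a <- s]).
rewrite big_map -av_sum => H0; apply: contra_neq (H0 _ _) => [->||]; first exact: av0.
- by move=> _ /mapP [a sa ->]; exists a => //; apply: sP.
- by case: (s) s0.
Qed.

(** Root spaces are lines, so each positive root is the weight of exactly one index i. *)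
Lemma sum_positive (f : 'cV[C]_r -> C) :
  \sum_(i | `[< Pw (wt C (al i)) >]) f (wt C (al i)) = \sum_(a <- P) f (av a).
Proof.
have [uP PR _ _] := P_pos.
transitivity (\sum_i \sum_(a <- P | av a == wt C (al i)) f (av a)).
  rewrite big_mkcond; apply: eq_bigr => i _; case: asboolP => [[a Pa Ea]|nP]; last first.
    by rewrite big_seq_cond big1 // => a /andP[Pa /eqP Ea]; case: nP; exists a.
  rewrite -big_filter (_ : [seq b <- P | av b == _] = [:: a]) ?big_seq1 ?Ea //.
  have := filter_uniq (fun b => av b == wt C (al i)) uP.
  have : forall b, b \in [seq b <- P | av b == wt C (al i)] = (b == a).
    move=> b; rewrite mem_filter; apply/andP/eqP => [[/eqP Eb _]|->]; last by rewrite Ea eqxx.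
    by apply: av_inj; rewrite Eb.
  case: [seq _ <- _ | _] => [|x [|y s]] Hs; first by have := Hs a; rewrite inE eqxx.
    by have := Hs x; rewrite mem_head => /esym/eqP ->.
  have := Hs x; rewrite mem_head => /esym/eqP ->; have := Hs y; rewrite !inE eqxx orbT => /esym/eqP ->.
  by rewrite /= mem_head.
rewrite (exchange_big_dep predT) //= big_seq [RHS]big_seq; apply: eq_bigr => a Pa.
have [i Ei Ui] := rootw_uniq CA (Pw_root (ex_intro2 _ _ a Pa (erefl _))).
rewrite (big_pred1 i) // => j /=; apply/eqP/eqP => [/esym/Ui //|->].
by rewrite Ei.
Qed.

End Duals.

(** * The character lattice and the weights of a representation *)

Section Characters.
Variables (R : realType) (n : nat).
Local Notation C := (R[i]).
Local Notation M := 'M[C]_n.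
Variables (G T : set M) (g t : {vspace M}).
Hypothesis AG : algebraic_lie G g.
Hypothesis G_det : forall x, G x -> \det x = 1.
Variables (r : nat) (tor : ('I_r -> C) -> M) (p pv : 'I_r -> M -> C^o).
Hypothesis TC : torus_chart T tor p pv.
Hypothesis t_lie : forall X, X \in t <->
  forall f : M -> C^o, polymap f -> (forall x, T x -> f x = 0) -> der f 1%:M X = 0.
Hypothesis TG : forall x, T x -> G x.
Variable H : 'I_r -> M.
Hypothesis H_lder : forall j a b, lder (fun y => tor (evec j y) a b) (H j a b).
Local Notation d := (\dim g).
Variables (Q : M) (w : 'I_n -> 'I_r -> int) (A : 'M[C]_d) (al : 'I_d -> 'I_r -> int).
Hypothesis CA : cartan t H Q w A al.

(** This removes the term that the denominator det^k contributes to the differential of a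
    character. *)
Lemma trace_H j : \tr (H j) = 0.
Proof.
have gH : H j \in g by rewrite -hh_delta; apply: (t_in_g CA); apply: (ca_hht CA).
have pd : polymap (fun x : M => \det x : C^o) by apply/polymap_det/polymap_id.
have /(al_lie AG) /(_ (fun x => \det x - 1)) := gH.
rewrite der_sub //; last exact: PolyCst.
rewrite der_cst subr0 (der_det_mulr (X := H j)) ?det1 ?mulr1 ?mul1r; last first.
- by move=> e; rewrite mul1mx.
apply; first by apply: polymap_sub => //; apply: PolyCst.
by move=> x Gx; rewrite G_det // subrr.
Qed.

Lemma T_mul x y : T x -> T y -> T (x *m y).
Proof.
move=> /(tc_sur TC) [z nz ->] /(tc_sur TC) [z' nz' ->]; rewrite -(tc_mul TC) //.
by apply/(tc_in TC)/nzvM.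
Qed.

Lemma char_diff_wt chi (mu : dual t) : char_diff T chi mu ->
  exists u : 'I_r -> int, (forall z, nzv z -> chi (tor z) = mono u z) /\ av H mu = wt C u.
Proof.
move=> [nz mulT [q [k [Eq Dq]]]]; have pq := mxeval_poly q.
have EF x : T x -> mxeval q x = chi x by move=> Tx; rewrite Eq // G_det ?expr1n ?divr1 //; apply: TG.
have [||u Hu] := character_mono TC H_lder pq.
- by move=> x Tx; rewrite EF //; apply: nz.
- by move=> x y Tx Ty; rewrite !EF ?mulT //; apply: T_mul.
exists u; split; first by move=> z nzz; rewrite -Hu // EF //; apply: (tc_in TC).
apply/matrixP => j l; rewrite !mxE Dq (val_tel CA) hh_delta trace_H mulr0 subr0 mxdiff1_der.
exact: (der_tor_mono TC H_lder pq Hu).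
Qed.

Lemma wt_char_diff (u : 'I_r -> int) : char_diff T (cmap p pv u) (mu_dual g t H (wt C u)).
Proof.
split.
- by move=> x /(tc_sur TC) [z nz ->]; rewrite (cmap_tor TC) // mono_neq0.
- move=> x y /(tc_sur TC) [z nz ->] /(tc_sur TC) [z' nz' ->]; rewrite -(tc_mul TC) //.
  by rewrite !(cmap_tor TC) ?monoM //; apply: nzvM.
have pc := polymap_cmap TC u; have [q Hq] := poly_mxeval pc; exists q, 0%N; split.
  by move=> x _; rewrite expr0 divr1.
move=> nu; have [x ->] := tel_sur CA nu; rewrite av_val (av_mu_dual CA) mul0r subr0 mxdiff1_der.
rewrite -(_ : (fun x => cmap p pv u x) = fun x => mxeval q x); last exact/funext.
rewrite (val_tel CA) (der_cmap TC t_lie); last exact: (ca_hht CA).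
apply: eq_bigr => j _; rewrite mxE; congr (_ * _); rewrite (der_dir_sum _ _ _ (tc_poly TC j)).
rewrite (bigD1 j) //= (der_dirZ _ _ _ (tc_poly TC j)) (der_p_H TC H_lder) eqxx big1 => [|l /negbTE lj].
  by rewrite addr0 /GRing.scale /= mulr1.
by rewrite (der_dirZ _ _ _ (tc_poly TC j)) (der_p_H TC H_lder) eq_sym lj scaler0.
Qed.

Lemma char_lattice_wt (mu : dual t) : char_lattice T mu <-> exists u : 'I_r -> int, av H mu = wt C u.
Proof.
split=> [[chi /char_diff_wt [u [_ Eu]]]|[u Eu]]; first by exists u.
exists (cmap p pv u); have -> : mu = mu_dual g t H (wt C u) by apply: (av_inj CA); rewrite (av_mu_dual CA).
exact: wt_char_diff.
Qed.

Section Weights.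
Variables (m : nat) (pi Pi : M -> 'M[C]_m).
Hypothesis PiE : forall x, G x -> pi x = Pi x.
Variables (Qp : 'M[C]_m) (wp : 'I_m -> 'I_r -> int).
Hypothesis Qpu : Qp \in unitmx.
Hypothesis torQp : forall z, nzv z -> Pi (tor z) *m Qp = Qp *m diag_mx (\row_i mono (wp i) z).

Lemma is_weight_wp k : is_weight T pi (mu_dual g t H (wt C (wp k))).
Proof.
exists (cmap p pv (wp k)); split; first exact: wt_char_diff.
exists (col k Qp); split.
  apply: contraL Qpu => /eqP E; rewrite unitmxE unitfE negbK (expand_det_col _ k) big1 // => i _.
  by have /matrixP /(_ i 0) := E; rewrite !mxE => ->; rewrite mul0r.
move=> x Tx; rewrite PiE; last exact: TG.
have [z nz ->] := tc_sur TC Tx; rewrite (cmap_tor TC) // colE mulmxA torQp // -mulmxA mul_diag_mx.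
rewrite scalemxAr; congr (_ *m _); apply/matrixP => i j; rewrite !mxE.
by case: (i =P k) => [->|]; rewrite ?mulr0.
Qed.

Lemma weight_is_wp (mu : dual t) : is_weight T pi mu -> exists k, av H mu = wt C (wp k).
Proof.
move=> [chi [/char_diff_wt [u [Hu ->]] [v [v0 Hv]]]].
have [k nk] : exists k, (invmx Qp *m v) k 0 != 0.
  apply/existsP; apply: contraR v0; rewrite negb_exists => /forallP E.
  rewrite -[v](mulKVmx Qpu) (_ : invmx Qp *m v = 0) ?mulmx0 //; apply/matrixP => i j.
  by rewrite (ord1 j) [RHS]mxE; have := E i; rewrite negbK => /eqP.
exists k; apply/matrixP => j l; rewrite !mxE.
apply: lder_uniq (lder_exprz C (u j)) (lder_exprz C (wp k j)) _ => y y0.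
have nz := nzv_evec j y0; have Tz := tc_in TC nz; have := Hv _ Tz; rewrite PiE; last exact: TG.
have Ev : v = Qp *m (invmx Qp *m v) by rewrite mulKVmx.
rewrite Hu // {1 2}Ev; move: (invmx Qp *m v) nk => c nk; rewrite mulmxA torQp // -mulmxA => /(congr1 (mulmx (invmx Qp))).
rewrite -scalemxAr mulKmx // mul_diag_mx => /matrixP /(_ k 0); rewrite [LHS]mxE [RHS]mxE [X in X * _]mxE.
rewrite !mono_evec => E.
by rewrite mulKmx // in E; apply/esym/(mulIf nk).
Qed.

Variables (P : seq (dual t)) (la : dual t).
Hypothesis P_pos : positive_system g P.
Hypothesis la_hw : highest_weight T P pi la.

(** If la + b were a weight for a positive root b, then, la being highest, b plus a sum of positive
    roots would be 0. *)
Lemma highest_wp : exists k0, av H la = wt C (wp k0) /\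
  forall k a, Pw H P a -> wt C (wp k) != wt C (wp k0) + a.
Proof.
have [/weight_is_wp [k0 E0] hw] := la_hw; exists k0; split=> // k a [b Pb <-]; apply/negP => /eqP Ek.
have [c Ec] := hw _ (is_weight_wp k).
have /negP : \sum_(x <- b :: flatten [seq nseq (c a) a | a <- P]) x != 0.
  apply: (Pw_sum_nonzero CA P_pos) => //; move=> x; rewrite inE => /orP [/eqP -> //|/flattenP [s /mapP [y Py ->]]].
  by rewrite mem_nseq => /andP [_ /eqP ->].
apply; apply/eqP; rewrite big_cons big_flatten big_map.
under eq_bigr do rewrite big_nseq iter_addr_0.
rewrite -Ec; apply: (av_inj CA); rewrite av0 !avD avN (av_mu_dual CA) Ek E0.
by rewrite addrCA addrA subrr.
Qed.
End Weights.
End Characters.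

(** * The concrete Clifford algebra and the definition of spinorial *)

Section Spinorial.
Variables (R : realType) (n m : nat).
Local Notation C := (R[i]).
Local Notation M := 'M[C]_n.
Local Notation A := (cliff C m).
Variables (G : set M) (pi : M -> 'M[C]_m) (B O : 'M[C]_m) (Pi : M -> 'M[C]_m).
Hypothesis m_gt0 : (0 < m)%N.
Hypothesis G_det : forall x, G x -> \det x = 1.
Hypothesis BO : B = O^T *m O.
Hypothesis G_mul : forall x y, G x -> G y -> G (x *m y).
Hypothesis Ou : O \in unitmx.
Hypothesis PiE : forall x, G x -> Pi x *m O = O *m pi x.
Hypothesis Pi_orth : forall x, G x -> (Pi x)^T *m Pi x = 1%:M.
Hypothesis Pi_det : forall x, G x -> \det (Pi x) = 1.

Lemma quad_dotc v : quad B v = dotc (O *m v) (O *m v).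
Proof. by rewrite /quad dotc_mx BO trmx_mul !mulmxA. Qed.

Definition iotaO (v : 'cV[C]_m) : A := cvec (O *m v).

Lemma iotaO_linear : linear iotaO.
Proof. by move=> k u v; rewrite /iotaO mulmxDr -scalemxAr cvecD cvecZ. Qed.

Lemma cliff_is_clifford (iota : {linear 'cV[C]_m -> A}) : (forall v, iota v = iotaO v) ->
  is_clifford_algebra B iota.
Proof.
move=> Ei; split=> [v|A' f fq]; first by rewrite Ei cvec_sq quad_dotc.
pose f' v := f (invmx O *m v).
have lf : linear f' by move=> k u v; rewrite /f' mulmxDr -scalemxAr linearP.
have [|sq anti] := clifford_gens lf.
  by move=> v; rewrite /f' fq quad_dotc mulKVmx.
have [F HF] := cliff_universal sq anti.
have Fv : forall v, F (cvec v) = f' v.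
  apply: cvec_morph => // i; rewrite HF /omon -big_mkcond; apply: big_pred1 => j.
  by rewrite ffunE.
exists F; split=> [v|F' HF']; first by rewrite Ei Fv /f' mulKmx.
by apply: cliff_morph_eq => v; rewrite Fv /f' -HF' Ei /iotaO mulKVmx.
Qed.

(** The quotient x S^-1 is even and commutes with all vectors, hence is a scalar; the normalisation
    makes its square 1. *)
Lemma spin_scalar (N : 'M[C]_m) (S x : A) : N \in unitmx -> spin_of N S -> alpha x = x -> x * crev x = 1 ->
  (forall v, x * cvec v = cvec (N *m v) * x) -> x = S \/ x = - S.
Proof.
move=> Nu [aS Sc cS SN] ax xx xN; pose a := x * crev S.
have cN v : crev S * cvec (N *m v) = cvec v * crev S.
  rewrite -[LHS]mulr1 -Sc mulrA -[_ * _ * S]mulrA -SN mulrA cS mul1r.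
  by [].
have Ea : a = ctr a *: 1.
  apply: even_central; first by rewrite alphaM ax alpha_crev aS.
  move=> v; rewrite -[v](mulKVmx Nu); move: (invmx N *m v) => u.
  by rewrite /a -[LHS]mulrA cN [LHS]mulrA xN -mulrA.
have Ex : x = ctr a *: S by rewrite -[x]mulr1 -cS mulrA -/a {1}Ea -scalerAl mul1r.
have : ctr a ^+ 2 == 1.
  move: xx; rewrite {1 2}Ex crevZ -scalerAr -scalerAl Sc scalerA -expr2 => /(congr1 (@ctr _ _)).
  by rewrite ctrZ ctr1 mulr1 => ->.
rewrite sqrf_eq1 => /orP [] /eqP E; [left|right]; by rewrite Ex E ?scale1r // scaleN1r.
Qed.

Lemma lift_spinorial : has_lift G Pi -> spinorial G pi B.
Proof.
move=> [rho [pr rM ra rr rN]].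
pose iota : {linear 'cV[C]_m -> A} := HB.pack iotaO (GRing.isLinear.Build C _ A *:%R iotaO iotaO_linear).
have uO u : quad B (invmx O *m u) = dotc u u by rewrite quad_dotc mulKVmx.
have Hs x : G x -> exists s, [/\ ~~ odd (size s), forall u, u \in s -> dotc u u = 1 & rho x = \prod_(u <- s) cvec u].
  move=> Gx; have Pu : Pi x \in unitmx by rewrite unitmxE Pi_det ?unitr1.
  have [s cs] := cartan_dieudonne (Pi_orth Gx); have [ev sp] := clift_spin cs (Pi_det Gx).
  have us := let: And3 us _ _ := cs in us.
  have [->|->] := spin_scalar Pu sp (ra x Gx) (rr x Gx) (fun v => rN x v Gx); first by exists s.
  (* The opposite of a product of unit vectors is again an even product of unit vectors, as e (-e) =
     -1 for a unit vector e. *)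
  pose e : 'cV[C]_m := delta_mx (Ordinal m_gt0) 0.
  have e1 : dotc e e = 1 by rewrite dotc_delta mxE !eqxx.
  exists (e :: - e :: s); split=> [|u|]; first by rewrite /= negbK.
    rewrite !inE => /or3P [/eqP ->|/eqP ->|/us //] //.
    by rewrite -scaleN1r dotcZl dotcZr mulrA mulrNN !mul1r.
  by rewrite !big_cons cvecN mulNr mulrN mulrA cvec_sq e1 scale1r mul1r.
exists A, iota; split; first exact: cliff_is_clifford.
exists rho; split=> //.
- move=> x /Hs [s [ev us ->]]; exists [seq invmx O *m u | u <- s]; split; first by rewrite size_map.
    by move=> v /mapP [u su ->]; rewrite uO us.
  by rewrite big_map; apply: eq_bigr => u _; rewrite /= /iotaO mulKVmx.
- move=> i; apply: (poly_regular (F := fun x => coord (vbasis {:A}) i (rho x))) => //.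
  by apply: (@polymap_linear _ _ _ _ (coord (vbasis {:A}) i : A -> C^o)) => // k u v; rewrite linearP.
move=> x v Gx; have [s [ev us Es]] := Hs x Gx; have [_ Sc cS] := prod_cvec us ev.
have ru : rho x \is a GRing.unit by apply/unitrP; exists (crev (rho x)); rewrite Es.
by rewrite /= /iotaO rN // (mulmxA (Pi x)) PiE // -(mulmxA O) mulrK.
Qed.

Lemma spinorial_lift : spinorial G pi B -> has_lift G Pi.
Proof.
move=> [A0 [iota [[isq univ] [rho [rs rM rreg rc]]]]].
pose f : {linear 'cV[C]_m -> A} := HB.pack iotaO (GRing.isLinear.Build C _ A *:%R iotaO iotaO_linear).
have [|F [HF _]] := univ A f; first by move=> v; rewrite /= /iotaO cvec_sq quad_dotc.
have /choice [q Hq] : forall i, exists q : M -> C^o, polymap q /\ forall x, G x -> coord (vbasis {:A0}) i (rho x) = q x.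
  by move=> i; apply: regular_poly.
pose rho' x : A := F (\sum_i (q i x : C) *: (vbasis {:A0})`_i).
have Er x : G x -> rho' x = F (rho x).
  move=> Gx; rewrite /rho' (coord_vbasis (memvf (rho x))); congr (F _); apply: eq_bigr => i _.
  by have [_ ->] := Hq i.
have Hs x : G x -> exists s, [/\ ~~ odd (size s), forall u, u \in s -> dotc u u = 1 & rho' x = \prod_(u <- s) cvec u].
  move=> Gx; have [s [ev us Es]] := rs x Gx; exists [seq O *m u | u <- s]; rewrite size_map; split=> //.
    by move=> u /mapP [v sv ->]; rewrite -quad_dotc us.
  by rewrite Er // Es rmorph_prod big_map; apply: eq_bigr => u _; apply: HF.
exists rho'; split.
- apply: (polymap_linear (L := F)); first exact: linearP.
  apply: polymap_sum => i; apply: polymap_scale; first by have [] := Hq i.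
  exact: PolyCst.
- by move=> x y Gx Gy; have Gxy := G_mul Gx Gy; rewrite !Er // rM // rmorphM.
- by move=> x /Hs [s [ev us ->]]; have [] := prod_cvec us ev.
- by move=> x /Hs [s [ev us ->]]; have [] := prod_cvec us ev.
move=> x v Gx.
have ru : rho x \is a GRing.unit.
  have [s [_ us ->]] := rs x Gx; rewrite big_seq; apply: rpred_prod => u su.
  by apply/unitrP; exists (iota u); rewrite isq us // scale1r.
have E : rho x * iota (invmx O *m v) = iota (pi x *m (invmx O *m v)) * rho x by rewrite -rc // mulrVK.
have E1 : F (rho x) * F (iota (invmx O *m v)) = F (iota (pi x *m (invmx O *m v))) * F (rho x).
  by rewrite -[LHS]rmorphM E [LHS]rmorphM.
have H1 : F (iota (invmx O *m v)) = cvec v by rewrite HF /= /iotaO mulKVmx.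
have H2 : F (iota (pi x *m (invmx O *m v))) = cvec (O *m (pi x *m (invmx O *m v))) by rewrite HF.
have H3 : O *m (pi x *m (invmx O *m v)) = Pi x *m v.
  by rewrite mulmxA -(PiE Gx) -mulmxA mulKVmx.
by move: E1; rewrite H1 H2 H3 (Er x Gx).
Qed.
End Spinorial.

(** * Integrality up to the prime 2 *)

Section TwoAdicIntegrality.

(** The odd part of b is coprime to 4, so it already divides a k; only the 2-parts remain to be
    compared. *)
Lemma dvdn_part2 a b k : (0 < a)%N -> (0 < b)%N -> (b %| 4 * (a * k))%N ->
  (b %| a * k)%N = (2 ^ logn 2 b %| 2 ^ logn 2 a * k)%N.
Proof.
move=> a0 b0 bd; rewrite -!p_part.
have co x : coprime 2 x`_(2^')%N by have := coprime_partC (2%N : nat_pred) 2 x; rewrite part_pnat_id ?pnat_id.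
have bo : (b`_(2^') %| a * k)%N.
  rewrite -(@Gauss_dvdr _ 4%N); first by apply: dvdn_trans bd; apply: dvdn_part.
  by rewrite coprime_sym (_ : 4 = 2 ^ 2)%N // coprimeXl.
rewrite -{1}(partnC 2%N b0) Gauss_dvd ?coprime_partC // bo andbT -{1}(partnC 2%N a0) -mulnA mulnCA.
by rewrite Gauss_dvdr // p_part; case: (logn 2 b) => [|l]; rewrite ?expn0 ?coprime1n ?coprimeXl.
Qed.

Variable R : realType.
Local Notation C := (R[i]).

Lemma isint_div (a b : int) : b != 0 -> isint (a%:~R / b%:~R : C) <-> (b %| a)%Z.
Proof.
move=> b0; have b0' : b%:~R != 0 :> C by rewrite intr_eq0.
split=> [[z /(congr1 ( *%R^~ b%:~R)) /=]|/dvdzP [z ->]]; last by exists z; rewrite rmorphM mulfK.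
by rewrite divfK // -rmorphM => /intr_inj ->; apply: dvdz_mull.
Qed.

Lemma isint_ord2 (q : rat) (k : int) : isint (4 * (ratr q * k%:~R) : C) ->
  isint (ratr q * k%:~R : C) <-> isint (2 ^ ord2_rat q * k%:~R : C).
Proof.
(* Here the convention that the valuation of 0 is 0 makes both sides integers. *)
have [->|q0] := eqVneq q 0.
  rewrite rmorph0 mul0r (_ : ord2_rat 0 = 0) ?expr0z ?mul1r // => _.
  by split=> _; [exists k|exists 0].
have d0 := denq_neq0 q; have n0 : numq q != 0 by rewrite numq_eq0.
have -> : ratr q * k%:~R = (numq q * k)%:~R / (denq q)%:~R :> C by rewrite /ratr rmorphM mulrAC.
have -> : 2 ^ ord2_rat q * k%:~R = ((2 ^+ logn 2 `|numq q|) * k)%:~R / (2 ^+ logn 2 `|denq q|)%:~R :> C.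
  rewrite /ord2_rat expfzDr ?pnatr_eq0 // -exprnP -exprnN rmorphM !rmorphXn /= mulrAC.
  by [].
rewrite mulrA -[4]/(4%:~R) -rmorphM !isint_div ?expf_neq0 //.
rewrite !dvdzE !abszM !abszX => bd; rewrite dvdn_part2 ?absz_gt0 //.
Qed.

Lemma ord2_ratr (q : rat) : ord2 (ratr q : C) = ord2_rat q.
Proof.
rewrite /ord2; case: xgetP => [q' -> /= /fmorph_inj -> //|/(_ q) []].
by [].
Qed.
End TwoAdicIntegrality.

(** The coefficients above the diagonal collect both mixed terms: for an integral quadratic form
    these sums are integers, while the separate terms may be half-integers. *)
Lemma triangular_sum (C : pzRingType) r (a : 'I_r -> 'I_r -> C) (x : 'I_r -> 'I_r -> C) : (forall j k, x j k = x k j) ->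
  \sum_(j < r) \sum_(k < r) a j k * x j k =
  \sum_(j < r) \sum_(k < r) (if (j < k)%N then a j k + a k j else if j == k then a j k else 0) * x j k.
Proof.
move=> xC.
have E (j k : 'I_r) : (if (j < k)%N then a j k + a k j else if j == k then a j k else 0) * x j k =
    (if (j <= k)%N then a j k * x j k else 0) + (if (j < k)%N then a k j * x j k else 0).
  rewrite -(inj_eq val_inj) /=; case: ltngtP => _; rewrite ?mul0r ?addr0 // mulrDl.
  by [].
under [RHS]eq_bigr do (under eq_bigr do rewrite E; rewrite big_split /=).
rewrite big_split /= [X in _ = _ + X]exchange_big -big_split; apply: eq_bigr => j _ /=.
rewrite -big_split; apply: eq_bigr => k _ /=.
by rewrite (xC k) ltnNge; case: leqP; rewrite ?addr0 ?add0r.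
Qed.

(** * Integral quadratic forms and the symmetric square of the lattice *)

Section SymmetricSquare.
Variables (R : realType) (n : nat).
Local Notation C := (R[i]).
Local Notation M := 'M[C]_n.
Variables (G T : set M) (g t : {vspace M}).
Hypothesis AG : algebraic_lie G g.
Hypothesis G_det : forall x, G x -> \det x = 1.
Variables (r : nat) (tor : ('I_r -> C) -> M) (p pv : 'I_r -> M -> C^o).
Hypothesis TC : torus_chart T tor p pv.
Hypothesis t_lie : forall X, X \in t <->
  forall f : M -> C^o, polymap f -> (forall x, T x -> f x = 0) -> der f 1%:M X = 0.
Hypothesis TG : forall x, T x -> G x.
Variable H : 'I_r -> M.
Hypothesis H_lder : forall j a b, lder (fun y => tor (evec j y) a b) (H j a b).
Local Notation d := (\dim g).
Variables (Q : M) (w : 'I_n -> 'I_r -> int) (A : 'M[C]_d) (al : 'I_d -> 'I_r -> int).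
Hypothesis CA : cartan t H Q w A al.
Local Notation hh := (hh H).
Local Notation kq v := (kil g (hh (wt C v)) (hh (wt C v))).
Let clw := char_lattice_wt AG G_det TC t_lie TG H_lder CA.

Lemma dotc_wt (u v : 'I_r -> int) : dotc (wt C u) (wt C v) = (dot u v)%:~R.
Proof. by rewrite /dot rmorph_sum; apply: eq_bigr => j _; rewrite !mxE rmorphM. Qed.

Lemma kq_int v : isint (kq v).
Proof.
rewrite (kil_hh CA); apply: isint_sum => i; rewrite dotc_wt.
by apply: isintM; apply: isint_int.
Qed.

Lemma sym2_integral (e : C) : in_sym2_lattice T (fun nu : subvs_of t => e * killing_quadratic g nu) <->
  forall v : 'I_r -> int, isint (e * kq v).
Proof.
have KE x : killing_quadratic g (tel t H x) = kil g (hh x) (hh x).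
  have gx : hh x \in g by apply: (t_in_g CA); apply: (ca_hht CA).
  by rewrite /killing_quadratic (val_tel CA) (killing_kil CA).
split=> [[s [Hs Es]] v|Hv].
  rewrite -KE Es big_seq; elim/big_rec: _ => [|ab y /Hs [/clw [a Ea] /clw [b Eb]] Hy]; first by exists 0.
  apply: isintD Hy; rewrite !av_val Ea Eb !dotc_wt.
  by apply: isintM; apply: isint_int.
pose a j k := e * kil g (H j) (H k).
have Kx x : e * kil g (hh x) (hh x) = \sum_j \sum_k a j k * (x j 0 * x k 0).
  rewrite kil_suml mulr_sumr; apply: eq_bigr => j _; rewrite kilZl kil_sumr !mulr_sumr.
  by apply: eq_bigr => k _; rewrite kilZr /a; ring.
(* Diagonal coefficients are values at basis cocharacters; the mixed ones come from values at sums
   of two of them. *)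
have aint (j k : 'I_r) : isint (if (j < k)%N then a j k + a k j else if j == k then a j k else 0).
  have E1 l : isint (a l l).
    have := Hv (fun i => (i == l)%:R); rewrite (_ : wt C _ = delta_mx l 0) ?hh_delta //.
    by apply/matrixP => i h; rewrite !mxE (ord1 h) eqxx andbT; case: (i == l).
  case: ifP => _; last by case: eqP => [<-|_]; [apply: E1|exists 0].
  have := Hv (fun i => (i == j)%:R + (i == k)%:R).
  rewrite (_ : wt C _ = delta_mx j 0 + delta_mx k 0); last first.
    by apply/matrixP => i h; rewrite !mxE (ord1 h) eqxx !andbT rmorphD; case: (i == j); case: (i == k).
  rewrite (linear_hypD (hh_linear H)) !hh_delta kilDl !kilDr => E2.
  have := isintD E2 (isintN (isintD (E1 j) (E1 k))).
  rewrite /a; move: (kil g (H j) (H j)) (kil g (H j) (H k)) (kil g (H k) (H j)) (kil g (H k) (H k)) => y1 y2 y3 y4.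
  by rewrite (_ : _ - _ = e * y2 + e * y3) //; ring.
have /choice [b Hb] : forall jk : 'I_r * 'I_r, exists z : int,
    (if (jk.1 < jk.2)%N then a jk.1 jk.2 + a jk.2 jk.1 else if jk.1 == jk.2 then a jk.1 jk.2 else 0) = z%:~R.
  by move=> [j k]; apply: aint.
pose pd j : dual t := mu_dual g t H (delta_mx j 0).
have pdE j x : pd j (tel t H x) = x j 0 by rewrite av_val (av_mu_dual CA) dotc_delta.
exists [seq ((b jk)%:~R *: pd jk.1, pd jk.2) | jk <- enum {: 'I_r * 'I_r}]; split=> [ab|nu].
  move=> /mapP [[j k] _ ->] /=; split; apply/clw.
    exists (fun i => if i == j then b (j, k) else 0); rewrite avZ (av_mu_dual CA).
    by apply/matrixP => i h; rewrite !mxE (ord1 h) eqxx andbT; case: (i == j); rewrite ?mulr1 ?mulr0.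
  exists (fun i => (i == k)%:R); rewrite (av_mu_dual CA).
  by apply/matrixP => i h; rewrite !mxE (ord1 h) eqxx andbT; case: (i == k).
have [x ->] := tel_sur CA nu; rewrite KE Kx (@triangular_sum _ r a (fun j k => x j 0 * x k 0)); last by move=> j k; apply: mulrC.
rewrite big_map big_enum pair_big /=; apply: eq_big => [jk|jk _] //=.
have E1 : ((b jk)%:~R *: pd jk.1) (tel t H x) = (b jk)%:~R * x jk.1 0 by rewrite scale_lfunE pdE.
have E2 := pdE jk.2 x; have E3 := Hb jk.
by transitivity ((b jk)%:~R * (x jk.1 0 * x jk.2 0)); [rewrite -E3|rewrite mulrA -E1 -E2].
Qed.
End SymmetricSquare.

(** * Determinant, trace and conjugation of a representation *)

Section Representation.
Variables (C : numClosedFieldType) (n : nat) (G : set 'M[C]_n) (g : {vspace 'M[C]_n}).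
Hypothesis AG : algebraic_lie G g.
Hypothesis G_perfect : forall U : {vspace 'M[C]_n},
  (forall X Y, X \in g -> Y \in g -> bra X Y \in U) -> (g <= U)%VS.
Variables (m : nat) (Pi : 'M[C]_n -> 'M[C]_m).
Hypothesis Pi_poly : polymap Pi.
Hypothesis Pi_1 : Pi 1%:M = 1%:M.
Hypothesis Pi_M : forall x y, G x -> G y -> Pi (x *m y) = Pi x *m Pi y.

(** The determinant of the representation is an eigenfunction of every derivation, hence trivial as
    g is perfect. *)
Lemma rep_det x : G x -> \det (Pi x) = 1.
Proof.
move=> Gx; have pd : polymap (fun y : 'M[C]_m => \det y : C^o) by apply/polymap_det/polymap_id.
have pP := polymap_det Pi_poly; rewrite -(det1 C m) -Pi_1.
apply: (character_trivial AG G_perfect pP) Gx => X gX; exists (\tr (dPi Pi X)) => y Gy.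
rewrite /DX (der_comp y (y *m X) Pi_poly pd).
have -> : der Pi y (y *m X) = Pi y *m dPi Pi X by apply: (DX_Pi AG Pi_poly Pi_M gX Gy).
by apply: (der_det_mulr (F := fun y => y)) => e; rewrite mulmxDr mulmx1 -scalemxAr.
Qed.

Variables (r : nat) (H : 'I_r -> 'M[C]_n) (Qp : 'M[C]_m) (wp : 'I_m -> 'I_r -> int).
Hypothesis Qpu : Qp \in unitmx.
Hypothesis HQp : forall j, dPi Pi (H j) *m Qp = Qp *m diag_mx (\row_i (wp i j)%:~R).

Lemma trace_weights x : \tr (dPi Pi (hh H x) *m dPi Pi (hh H x)) =
  \sum_i dotc (wt C (wp i)) x * dotc (wt C (wp i)) x.
Proof.
have -> : dPi Pi (hh H x) = Qp *m diag_mx (\row_i dotc (wt C (wp i)) x) *m invmx Qp.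
  by apply: (can_inj (mulmxK Qpu)); rewrite mulmxKV // (dPi_hh Pi_poly HQp).
rewrite !mulmxA mulmxKV // mxtrace_mulC !mulmxA mulVmx // mul1mx mulmx_diag mxtrace_diag.
by apply: eq_bigr => i _; rewrite !mxE.
Qed.

Variable O : 'M[C]_m.
Hypothesis Ou : O \in unitmx.
(* With [B = O^T *m O], conjugation by [O] makes [B] the standard form. *)
Definition conj_rep x := O *m Pi x *m invmx O.

Let conj_linear : linear (fun Y : 'M[C]_m => O *m Y *m invmx O).
Proof. by move=> k x y; rewrite mulmxDr mulmxDl -scalemxAr -scalemxAl. Qed.

Lemma polymap_conj_rep : polymap conj_rep.
Proof. exact: polymap_linear conj_linear Pi_poly. Qed.

Lemma dPi_conj_rep X : dPi conj_rep X = O *m dPi Pi X *m invmx O.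
Proof. exact: (der_linear 1%:M X conj_linear Pi_poly). Qed.

Lemma trace_conj_rep X : \tr (dPi conj_rep X *m dPi conj_rep X) = \tr (dPi Pi X *m dPi Pi X).
Proof.
rewrite !dPi_conj_rep; move: (dPi Pi X) => D.
by rewrite !mulmxA mulmxKV // mxtrace_mulC !mulmxA mulVmx // mul1mx.
Qed.
End Representation.

(** * The criterion for simple Lie algebras *)

Theorem corollary4 (R : realType) (n : nat)
    (G T : set 'M[R[i]]_n) (g t : {vspace 'M[R[i]]_n})
    (G_connected : zariski_connected G) (G_reductive : reductive G)
    (T_maximal : maximal_torus G T)
    (g_lie : is_lie_algebra G g) (t_lie : is_lie_algebra T t)
    (g_simple : simple_lie_algebra g)
    (P : seq (dual t)) (P_positive : positive_system g P)
    (la : dual t) (la_char : char_lattice T la)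
    (la_dominant : dominant g P la)
    (m : nat) (pi : 'M[R[i]]_n -> 'M[R[i]]_m)
    (pi_repr : representation G pi) (pi_irr : irreducible G pi)
    (pi_la : highest_weight T P pi la)
    (B : 'M[R[i]]_m) (pi_orthogonal : invariant_form G pi B) :
  spinorial G pi B <->
  in_sym2_lattice T
    (fun nu : subvs_of t =>
       2 ^ (- spin_exponent g P m la) * killing_quadratic g nu).
Proof.
have AG := group_lie G_reductive.1 G_connected g_lie; have t_lie' := tangent_space t_lie.
have [g_nab g_id] := g_simple; have Perf := G_perfect AG g_id g_nab.
have Gd := al_det AG Perf; have [Ttor TG Tmax] := T_maximal.
have Gu x : G x -> x \in unitmx by move=> Gx; rewrite unitmxE Gd // unitr1.
have [r [tor [p [pv TC]]]] := torus_has_chart Ttor (fun x Tx => Gd x (TG x Tx)).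
have Tmax' (T' : set 'M[R[i]]_n) r' (tor' : ('I_r' -> R[i]) -> 'M[R[i]]_n) p' pv' :
    torus_chart T' tor' p' pv' -> poly_closed T' -> (forall x, T' x -> G x) ->
    (forall x, T x -> T' x) -> forall x, T' x -> T x.
  move=> TC' cT' TG' TT'; have uT' x (Tx : T' x) := Gu x (TG' x Tx).
  by rewrite (Tmax T' (chart_torus TC' cT' uT') TG' TT').
have [H [Q [w [A [al [Hl torQ CA]]]]]] := cartan_setup AG g_id g_nab TC t_lie' TG Tmax'.
have [piGL piM preg] := pi_repr; have [m_gt0 pi_irr'] := pi_irr; have [Bsym Bu Binv] := pi_orthogonal.
have /choice [F HF] : forall ij : 'I_m * 'I_m, exists F : 'M[R[i]]_n -> (R[i])^o,
    polymap F /\ forall x, G x -> pi x ij.1 ij.2 = F x.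
  by move=> ij; apply: regular_poly (preg _ _).
pose Pi x : 'M[R[i]]_m := \matrix_(i, j) F (i, j) x.
have PiE x : G x -> pi x = Pi x by move=> Gx; apply/matrixP => i j; rewrite mxE; case: (HF (i, j)) => _ ->.
have Pi_poly : polymap Pi.
  by apply: polymap_mx => i j; apply: polymap_ext (HF (i, j)).1 => x; rewrite mxE.
have Pi_M x y : G x -> G y -> Pi (x *m y) = Pi x *m Pi y.
  by move=> Gx Gy; rewrite -!PiE ?piM //; apply: (al_M AG).
have Pi_1 : Pi 1%:M = 1%:M.
  have G1 := al_1 AG; have u1 := piGL _ G1; rewrite PiE // in u1.
  by rewrite -[LHS](mulKmx u1) -Pi_M // mulmx1 mulVmx.
have [O BO] := sym_square Bsym; have Ou : O \in unitmx by move: Bu; rewrite BO unitmx_mul => /andP [].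
pose Po := conj_rep Pi O; have Po_poly : polymap Po := polymap_conj_rep Pi_poly O.
have Po_1 : Po 1%:M = 1%:M by rewrite /Po /conj_rep Pi_1 mulmx1 mulmxV.
have Po_M x y : G x -> G y -> Po (x *m y) = Po x *m Po y.
  by move=> Gx Gy; rewrite /Po /conj_rep Pi_M // !mulmxA mulmxKV.
have PoE x : G x -> Po x *m O = O *m pi x by move=> Gx; rewrite /Po /conj_rep mulmxKV // PiE.
have Po_orth x : G x -> (Po x)^T *m Po x = 1%:M.
  move=> Gx; have := Binv x Gx; rewrite BO !mulmxA -trmx_mul -mulmxA -PoE // trmx_mul => E.
  have OTu : O^T \in unitmx by rewrite unitmx_tr.
  apply: (can_inj (mulKmx OTu)); apply: (can_inj (mulmxK Ou)).
  by rewrite mulmx1 -[RHS]E !mulmxA.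
have Po_det := rep_det AG Perf Po_poly Po_1 Po_M.
have [Qp [wp [Qpu torQp]]] := chart_weights TC Hl Pi_poly Pi_1 (fun x y Tx Ty => Pi_M x y (TG x Tx) (TG y Ty)).
have HQp := der_tor_weights TC Hl Pi_poly torQp.
have [c trc] := trf_kil AG Pi_poly Pi_M CA.
have gh x : hh H x \in g by apply: (t_in_g CA); apply: (ca_hht CA).
have d0 : (\dim g)%:R != 0 :> R[i].
  rewrite pnatr_eq0 dimv_eq0; apply: contraTneq isT => g0; have [X [Y [gX _]]] := g_nab.
  by move: gX; rewrite g0 memv0 => /eqP ->; rewrite /bracket mul0mx mulmx0 subrr eqxx.
(* Twice the half sum is the sum of the positive roots, which is the second term of the Casimir
   scalar. *)
have Ez : m%:R * killing_dual g (la + 2 *: half_sum P) la / (4 * (\dim g)%:R) = 4^-1 * c.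
  have [k0 [E0 hw]] := highest_wp AG Gd TC t_lie' TG Hl CA PiE Qpu torQp P_positive pi_la.
  have irr (U : {vspace 'cV[R[i]]_m}) : (forall x v, G x -> v \in U -> Pi x *m v \in U) -> U = 0%VS \/ U = fullv.
    by move=> HU; apply: pi_irr' => x v Gx; rewrite PiE //; apply: HU.
  have := casimir_identity AG Pi_poly Pi_1 Pi_M CA irr Qpu HQp (Pw_root CA P_positive)
    (Pw_sign CA P_positive) hw trc.
  rewrite (sum_positive CA P_positive (fun x => form g H x (wt R[i] (wp k0)))) -E0 => E.
  rewrite (killing_dual_form CA) avD avZ avZ scalerA divff ?pnatr_eq0 // scale1r av_sum formDl.
  have -> : form g H (\sum_(a <- P) av H a) (av H la) = \sum_(a <- P) form g H (av H a) (av H la).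
    elim/big_rec2: _ => [|a x y _ <-]; last by rewrite formDl.
    by rewrite -(scale0r (0 : 'cV_r)) formZl mul0r.
  by rewrite E; field; rewrite ?d0.
have trK v : \tr (dPi Po (hh H (wt R[i] v)) *m dPi Po (hh H (wt R[i] v))) = c * kil g (hh H (wt R[i] v)) (hh H (wt R[i] v)).
  by rewrite (trace_conj_rep Pi_poly Ou); apply: trc.
have tr_int v : isint (c * kil g (hh H (wt R[i] v)) (hh H (wt R[i] v))).
  rewrite -trK (trace_conj_rep Pi_poly Ou) (trace_weights Pi_poly Qpu HQp); apply: isint_sum => i.
  by rewrite dotc_wt; apply: isintM; apply: isint_int.
(* At a cocharacter with nonzero derivative both c K(v, v) and K(v, v) are integers, the latter
   positive. So c is rational, and [ord2] does not fall back on its default. *)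
have [q Eq] : exists q : rat, 4^-1 * c = ratr q.
  have [j Hj] := t_nonzero CA; pose v l : int := (l == j)%:R.
  have Ev : wt R[i] v = delta_mx j 0.
    by apply/matrixP => a b; rewrite !mxE (ord1 b) eqxx andbT /v; case: (a == j).
  have [[z Hz] [k Hk]] := (tr_int v, kq_int CA v); exists (z%:~R / (4 * k%:~R)).
  have k0 : k%:~R != 0 :> R[i].
    rewrite -Hk gt_eqF //; apply: (kil_pos CA) => [l|]; last by rewrite Ev hh_delta.
    by rewrite mxE realz.
  rewrite fmorph_div rmorphM !rmorph_int /= rmorph_nat -Hz Hk.
  by field; rewrite ?k0.
(* One cocharacter must separate from 0 both the roots and the weights of the representation, since
   the same heights order them. *)
have [nu Hnu] := generic_vector R[i] (fun x : 'I_(\dim g) + 'I_m => match x with inl i => al i | inr k => wp k end).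
have nu0 (u : 'I_r -> int) : ((exists l, u l != 0) -> dot u nu != 0) -> dot u nu = 0 -> wt R[i] u = 0.
  move=> Hu u0; apply/matrixP => l b; rewrite !mxE; apply/eqP; rewrite intr_eq0.
  by apply/negPn/negP => ul; move: Hu; rewrite u0 eqxx => /(_ (ex_intro _ l ul)).
have HQo j : dPi Po (H j) *m (O *m Qp) = (O *m Qp) *m diag_mx (\row_i (wp i j)%:~R).
  by rewrite (dPi_conj_rep Pi_poly O) !mulmxA mulmxKV // -[O *m _ *m Qp]mulmxA HQp mulmxA.
have Qou : O *m Qp \in unitmx by rewrite unitmx_mul Ou.
have lift := lift_iff_trace AG Perf TC TG Hl CA torQ Po_poly Po_1 Po_M Po_orth Po_det Qou HQo
  (fun i => nu0 _ (Hnu (inl i))) (fun k => nu0 _ (Hnu (inr k))).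
have spin : spinorial G pi B <-> has_lift G Po.
  by split; [apply: (spinorial_lift Gd BO (al_M AG) Ou PoE)|apply: (lift_spinorial m_gt0 BO Ou PoE Po_orth Po_det)].
rewrite spin lift (sym2_integral AG Gd TC t_lie' TG Hl CA) /spin_exponent opprK Ez Eq ord2_ratr.
(* Four times the left number is the trace, an integer, so only powers of 2 can obstruct
   integrality. *)
have key v : isint (4^-1 * \tr (dPi Po (hh H (wt R[i] v)) *m dPi Po (hh H (wt R[i] v)))) <->
    isint (2 ^ ord2_rat q * kil g (hh H (wt R[i] v)) (hh H (wt R[i] v))).
  have [k Hk] := kq_int CA v; have := tr_int v; rewrite trK mulrA Eq Hk => Hi.
  apply: isint_ord2; rewrite -Eq.
  by rewrite !mulrA divff ?pnatr_eq0 // mul1r.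
by split=> Hv v; apply/key.
Qed.
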